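(* Consider the discrete-time Rayleigh fading MIMO channel (no channel state information) with $N_T$ transmit and $N_R$ receive antennas described in the context. If the channel is nonephemeral and no average power constraint is imposed (i.e. $\beta=1$), then, writing $C_{mimo-i}(\rho)=C_{mimo-i}(\rho,1)$, $$\limsup_{\rho\to0}\frac{C_{mimo-i}(\rho)}{\rho^2}\le N_T\sum_{k=0}^{N_T-1}\sum_{l=0}^{N_R-1}\phi_{k,l}$$ and $$\liminf_{\rho\to0}\frac{C_{mimo-i}(\rho)}{\rho^2}\ge\sum_{l=0}^{N_R-1}\sum_{n=1}^{\infty}\left|\sum_{k=0}^{N_T-1}R_{k,l}(n)\right|^2 .$$
   Context: Channel model. For $n\in\mathbb{N}$ the input is $\sqrt{\rho}\,\underline{Z}(n)$ ($\rho>0$) with $\underline{Z}(n)=(Z_0(n),\dots,Z_{N_T-1}(n))\in\mathbb{C}^{N_T}$, and the output $\underline{Y}(n)\in\mathbb{C}^{N_R}$ is $$Y_l(n)=\sqrt{\rho}\sum_{k=0}^{N_T-1}H_{k,l}(n)Z_k(n)+W_l(n),\qquad 0\le l\le N_R-1 .$$ The fading processes $H_{k,l}=(H_{k,l}(n):n\in\mathbb{Z})$ are zero-mean, stationary and ergodic, jointly proper complex normal (i.e. jointly circularly symmetric complex Gaussian), and mutually independent for distinct pairs $(k,l)$. $H_{k,l}$ has autocorrelation function $R_{k,l}(n)=E[H_{k,l}(n)H_{k,l}^*(0)]$ and a spectral density. The $W_l(n)$ are iid (over $l$ and $n$) proper complex normal with zero mean and unit variance. Fading, additive noise and input are mutually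 independent (neither transmitter nor receiver observes the fading). Information is measured in nats. Define $\phi_{k,l}=\sum_{n=1}^\infty|R_{k,l}(n)|^2$ (assumed finite for all $k,l$). A fading process $H_{k,l}$ is ephemeral if $2\phi_{k,l}\le R_{k,l}^2(0)$ and nonephemeral otherwise; the MIMO channel is nonephemeral if all processes $H_{k,l}$ are nonephemeral. Individual power constraints: $|Z_k(n)|^2\le1$ and $E[|Z_k(n)|^2]\le1/\beta$ for all $k\in[0,N_T-1]$ and all $n$, where $\beta\ge1$. $C_{mimo-i}(\rho,\beta)$ denotes the information theoretic capacity under these constraints, i.e. $\lim_{N\to\infty}\frac1N\sup I(\underline{Z}(1),\dots,\underline{Z}(N);\underline{Y}(1),\dots,\underline{Y}(N))$, the supremum being over joint distributions of $(\underline{Z}(1),\dots,\underline{Z}(N))$ satisfying the constraints for $1\le n\le N$. *)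

(* Defs.v *)
From HB Require Import structures.
From mathcomp Require Import all_boot all_order all_algebra.
From mathcomp Require Import complex.
From mathcomp Require Import all_classical all_reals all_analysis.
From mathcomp Require Import measurable_realfun.

Set Implicit Arguments.
Unset Strict Implicit.
Unset Printing Implicit Defensive.

Import Order.TTheory GRing.Theory Num.Theory.
Import numFieldNormedType.Exports.

Local Open Scope classical_set_scope.
Local Open Scope ring_scope.
Local Open Scope complex_scope.

(* R[i] carries the Borel sigma-algebra of R * R, that is, the one generated
   by the real and imaginary parts. *)
Definition complex_display : measure_display.
Proof. exact: default_measure_display. Qed.

Section complex_measurable.
Variable R : realType.

Let re : R[i] -> R := @complex.Re R.
Let im : R[i] -> R := @complex.Im R.

HB.instance Definition _ := isPointed.Build R[i] 0.

Let complex_set0 : g_sigma_preimageU re im set0.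
Proof. exact: sigma_algebra0. Qed.

Let complex_setC A : g_sigma_preimageU re im A -> g_sigma_preimageU re im (~` A).
Proof. exact: sigma_algebraC. Qed.

Let complex_bigcup (F : (set R[i])^nat) :
  (forall i, g_sigma_preimageU re im (F i)) ->
  g_sigma_preimageU re im (\bigcup_i (F i)).
Proof. exact: sigma_algebra_bigcup. Qed.

HB.instance Definition _ := @isMeasurable.Build complex_display
  R[i] (g_sigma_preimageU re im) complex_set0 complex_setC complex_bigcup.

Lemma measurable_Re : measurable_fun setT re.
Proof.
by move=> _ A mA; apply: sub_sigma_algebra; left; exists A.
Qed.

Lemma measurable_Im : measurable_fun setT im.
Proof.
by move=> _ A mA; apply: sub_sigma_algebra; right; exists A.
Qed.

Lemma measurable_fun_complexP d (T : measurableType d) (f : T -> R[i]) :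
  measurable_fun setT f <->
  measurable_fun setT (re \o f) /\ measurable_fun setT (im \o f).
Proof.
split=> [mf|[mre mim]].
  by split; apply: measurableT_comp => //;
    [exact: measurable_Re|exact: measurable_Im].
move=> _ A mA; rewrite setTI.
suff: g_sigma_preimageU re im `<=` image_set_system setT f measurable.
  by move=> /(_ A mA); rewrite /image_set_system/= setTI.
apply: smallest_sub.
  exact/sigma_algebra_image/sigma_algebra_measurable.
move=> B [] [C mC <-]; rewrite /image_set_system/= !setTI.
- by rewrite -comp_preimage -[X in measurable X]setTI; exact: mre.
- by rewrite -comp_preimage -[X in measurable X]setTI; exact: mim.
Qed.

Lemma measurable_complexD d (T : measurableType d) (f g : T -> R[i]) :
  measurable_fun setT f -> measurable_fun setT g ->
  measurable_fun setT (fun x => f x + g x).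
Proof.
move=> /measurable_fun_complexP[fr fi] /measurable_fun_complexP[gr gi].
apply/measurable_fun_complexP; split.
  rewrite (_ : _ \o _ = (re \o f) \+ (re \o g)); first exact: measurable_funD.
  by apply/funext => x /=; case: (f x) (g x) => [? ?] [].
rewrite (_ : _ \o _ = (im \o f) \+ (im \o g)); first exact: measurable_funD.
by apply/funext => x /=; case: (f x) (g x) => [? ?] [].
Qed.

Lemma measurable_complexM d (T : measurableType d) (f g : T -> R[i]) :
  measurable_fun setT f -> measurable_fun setT g ->
  measurable_fun setT (fun x => f x * g x).
Proof.
move=> /measurable_fun_complexP[fr fi] /measurable_fun_complexP[gr gi].
apply/measurable_fun_complexP; split.
  rewrite (_ : _ \o _ = ((re \o f) \* (re \o g)) \- ((im \o f) \* (im \o g))).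
    by apply: measurable_funB; exact: measurable_funM.
  by apply/funext => x /=; case: (f x) (g x) => [? ?] [].
rewrite (_ : _ \o _ = ((re \o f) \* (im \o g)) \+ ((im \o f) \* (re \o g))).
  by apply: measurable_funD; exact: measurable_funM.
by apply/funext => x /=; case: (f x) (g x) => [? ?] [].
Qed.

Lemma measurable_complex_sum d (T : measurableType d) (I : Type) (s : seq I)
    (f : I -> T -> R[i]) :
  (forall i, measurable_fun setT (f i)) ->
  measurable_fun setT (fun x => \sum_(i <- s) f i x).
Proof.
move=> mf; elim: s => [|i s ih].
  by under eq_fun do rewrite big_nil; exact: measurable_cst.
by under eq_fun do rewrite big_cons; exact: measurable_complexD.
Qed.

End complex_measurable.

Notation normc := ComplexField.Normc.normc.

Section mutual_information.
Local Open Scope ereal_scope.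
Local Open Scope charge_scope.

Definition kl_divergence d (T : measurableType d) (R : realType)
    (P Q : probability T R) : \bar R :=
  if `[< P `<< Q >]
  then \int[P]_x lne (('d (charge_of_finite_measure P) '/d Q) x)
  else +oo.

Section joint.
Context d d1 d2 (T : measurableType d) (T1 : measurableType d1)
  (T2 : measurableType d2) (R : realType) (P : probability T R).
Variables (X : {RV P >-> T1}) (Y : {RV P >-> T2}).

Definition joint_rv (w : T) : T1 * T2 := (X w, Y w).

Lemma measurable_joint_rv : measurable_fun setT joint_rv.
Proof. exact: measurable_fun_pair. Qed.

HB.instance Definition _ := isMeasurableFun.Build _ _ _ _ joint_rv
  measurable_joint_rv.

Definition mutual_information : \bar R :=
  kl_divergence (distribution P joint_rv)
    (distribution P X \x distribution P Y).
End joint.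
End mutual_information.

Section processes.
Local Open Scope ereal_scope.
Context d (T : measurableType d) (R : realType) (P : probability T R).

Definition complex_expectation (X : T -> R[i]) : R[i] :=
  fine 'E_P[fun w => complex.Re (X w)] +i* fine 'E_P[fun w => complex.Im (X w)].

(* Variance 0 is allowed; it needs a separate clause because normal_prob m 0 is
   a uniform law, not a Dirac mass. *)
Definition has_normal_law (Y : T -> R) : Prop :=
  (exists m : R, forall A, measurable A -> P (Y @^-1` A) = \d_m A) \/
  (exists m s : R, (0 < s)%R /\
     forall A, measurable A -> P (Y @^-1` A) = normal_prob m s A).

(* The first clause says that the real and imaginary parts are jointly normal
   (every real linear combination of them is the real part of a complex one);
   the second that the pseudo-covariances vanish. *)
Definition jointly_proper_normal (J : Type) (X : J -> T -> R[i]) : Prop :=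
  (forall (s : seq J) (c : J -> R[i]),
     has_normal_law (fun w => complex.Re (\sum_(j <- s) c j * X j w)%R)) /\
  (forall i j : J,
     complex_expectation (fun w =>
       (X i w - complex_expectation (X i)) *
       (X j w - complex_expectation (X j)))%R = 0%R).

Definition sigma_of (S J : Type) (X : J -> S -> R[i]) : set (set S) :=
  <<s \bigcup_j preimage_set_system setT (X j) measurable >>.

Definition independent (F G : set (set T)) : Prop :=
  forall A B, F A -> G B -> P (A `&` B) = P A * P B.

Definition mutually_independent (I : eqType) (F : I -> set (set T)) : Prop :=
  forall (s : seq I) (A : I -> set T), uniq s ->
    (forall i, i \in s -> F i (A i)) ->
    P (\big[setI/setT]_(i <- s) A i) = \prod_(i <- s) P (A i).

(* product sigma-algebra on sequences *)
Definition sequence_event (A : set (int -> R[i])) : Prop :=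
  sigma_of (fun (n : int) (x : int -> R[i]) => x n) A.

Definition stationary (X : int -> T -> R[i]) : Prop :=
  forall (m : int) A, sequence_event A ->
    P [set w | A (fun n => X (n + m)%R w)] = P [set w | A (fun n => X n w)].

Definition ergodic (X : int -> T -> R[i]) : Prop :=
  forall A, sequence_event A ->
    (forall x, A (fun n => x (n + 1)%R) <-> A x) ->
    P [set w | A (fun n => X n w)] = 0 \/ P [set w | A (fun n => X n w)] = 1.

Definition autocorrelation (X : int -> T -> R[i]) (n : int) : R[i] :=
  complex_expectation (fun w => X n w * (X 0 w)^*)%R.

Definition has_spectral_density (X : int -> T -> R[i]) : Prop :=
  exists S : R -> R, [/\ (forall t, 0 <= S t)%R,
    (@lebesgue_measure R).-integrable `[(- pi)%R, pi]%classic (EFin \o S) &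
    forall n : int, autocorrelation X n =
      (((2 * pi)^-1 *
          \int[@lebesgue_measure R]_(t in `[- pi, pi]) (S t * cos (n%:~R * t)))
       +i* ((2 * pi)^-1 *
          \int[@lebesgue_measure R]_(t in `[- pi, pi]) (S t * sin (n%:~R * t))))%R].

Definition phi (X : int -> T -> R[i]) : \bar R :=
  \sum_(1 <= n <oo) (normc (autocorrelation X n%:Z) ^+ 2)%:E.

(* the autocorrelation at 0 is E|X(0)|^2, hence equal to its real part *)
Definition ephemeral (X : int -> T -> R[i]) : Prop :=
  2%:E * phi X <= (complex.Re (autocorrelation X 0) ^+ 2)%:E.

End processes.

Section channel.
Context d (T : measurableType d) (R : realType) (P : probability T R).
Variables (NT NR : nat).
Variables (H : 'I_NT -> 'I_NR -> int -> {RV P >-> R[i]}).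
Variables (W : 'I_NR -> nat -> {RV P >-> R[i]}).

Record fading_model : Prop := FadingModel {
  fading_mean0 : forall k l n, complex_expectation P (H k l n) = 0 ;
  fading_stationary : forall k l, stationary P (H k l) ;
  fading_ergodic : forall k l, ergodic P (H k l) ;
  fading_normal : jointly_proper_normal P
    (fun i : 'I_NT * 'I_NR * int => H i.1.1 i.1.2 i.2) ;
  fading_indep : mutually_independent P
    (fun kl : 'I_NT * 'I_NR => sigma_of (H kl.1 kl.2)) ;
  fading_spectral : forall k l, has_spectral_density P (H k l) }.

(* Mean, variance and properness determine the law, so the W l n are
   identically distributed. *)
Record noise_model : Prop := NoiseModel {
  noise_mean0 : forall l n, complex_expectation P (W l n) = 0 ;
  noise_variance1 : forall l n, ('E_P[fun w => (normc (W l n w) ^+ 2)%R] = 1)%E ;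
  noise_normal : forall l n,
    jointly_proper_normal P (fun _ : unit => W l n) ;
  noise_indep : mutually_independent P
    (fun i : 'I_NR * nat => sigma_of (fun _ : unit => W i.1 i.2)) }.

Definition fading_noise_independent : Prop := independent P
  (sigma_of (fun i : 'I_NT * 'I_NR * int => H i.1.1 i.1.2 i.2))
  (sigma_of (fun i : 'I_NR * nat => W i.1 i.2)).

(* Component i of a block stands for time i + 1, so that a block of length N
   covers the times 1, ..., N. *)
Local Notation block N n := (N.-tuple (n.-tuple R[i])).

Section block.
Variables (rho : R) (N : nat).

(* The input and the pair (fading, noise) live on the two factors of a product
   space: under a product measure they are independent. *)
Definition channel_input (zw : block N NT * T) : block N NT := zw.1.

Definition channel_output (zw : block N NT * T) : block N NR :=
  [tuple [tuple (Num.sqrt rho)%:C *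
      (\sum_(k < NT) H k l i.+1%:Z zw.2 * tnth (tnth zw.1 i) k)
      + W l i.+1 zw.2 | l < NR] | i < N].

Lemma measurable_channel_input : measurable_fun setT channel_input.
Proof. exact: measurable_fst. Qed.

Lemma measurable_channel_output : measurable_fun setT channel_output.
Proof.
apply/measurable_fun_tnthP => i; apply/measurable_fun_tnthP => l.
under [X in measurable_fun _ X]eq_fun do rewrite /= !tnth_mktuple.
apply: measurable_complexD; last exact: measurableT_comp.
apply: measurable_complexM; first exact: measurable_cst.
apply: measurable_complex_sum => k; apply: measurable_complexM.
  exact: measurableT_comp.
apply: (measurableT_comp (measurable_tnth k)).
exact: (measurableT_comp (measurable_tnth i)).
Qed.

HB.instance Definition _ := isMeasurableFun.Build _ _ _ _ channel_input
  measurable_channel_input.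
HB.instance Definition _ := isMeasurableFun.Build _ _ _ _ channel_output
  measurable_channel_output.

Definition block_information (mu : probability (block N NT) R) : \bar R :=
  @mutual_information _ _ _ _ _ _ R (mu \x P)%E channel_input channel_output.

Definition individual_power_constraint (beta : R)
    (mu : probability (block N NT) R) : Prop :=
  forall (i : 'I_N) (k : 'I_NT),
    {ae mu, forall z : block N NT, normc (tnth (tnth z i) k) ^+ 2 <= 1} /\
    ('E_mu[fun z : block N NT => (normc (tnth (tnth z i) k) ^+ 2)%R]
       <= (beta^-1)%:E)%E.

End block.

Definition capacity_mimo_i (rho beta : R) : \bar R :=
  limn (fun N : nat => ((N%:R : R)^-1%:E *
    ereal_sup [set block_information rho mu |
                 mu in @individual_power_constraint N beta])%E).

End channel.

(* Main.v *)
Require Import Defs.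
From HB Require Import structures.
From mathcomp Require Import all_boot all_order all_algebra.
From mathcomp Require Import complex.
From mathcomp Require Import all_classical all_reals all_analysis.
From mathcomp Require Import measurable_realfun.
From mathcomp Require Import ring lra.

Set Implicit Arguments.
Unset Strict Implicit.
Unset Printing Implicit Defensive.

Import Order.TTheory GRing.Theory Num.Theory.
Import numFieldNormedType.Exports.

Local Open Scope classical_set_scope.
Local Open Scope ring_scope.

Local Open Scope complex_scope.

(* Conditionally on the input block z, the output block is a proper Gaussian
   vector with covariance 1 + rho S(z).

   Upper bound.  The information is at most the mean relative entropy of this
   law from the product Gaussian law with the averaged variances 1 + rho m_a.
   The concavity terms ln (1 + rho m_a) - rho m_a contribute -(rho m_a)^2 / 2 up
   to order rho^3, and the log-determinant contributes at most
   rho^2 / 2 E|S(z)|^2.  If p <= 1 is the mean power of a symbol and r the power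
   of a fading process, the diagonal of S costs r^2 (p - p^2) and the off-diagonal
   part at most 2 phi p.  Nonephemerality is r^2 <= 2 phi, and the total
   2 phi (2 p - p^2) is largest at full power p = 1.

   Lower bound.  All antennas send the same iid signs s_n.  The quadratic form
   X = Re \sum_(m < n) 2 s_n s_m conj(R_l(n - m)) y_l(n) conj(y_l(m)), with
   R_l = \sum_k R_(k,l), has mean rho kappa under the joint law, and mean 0 and
   second moment kappa + O(sqrt rho) under the product of the marginals.  The
   variational formula for the relative entropy with the test function
   exp (clip (rho X)) gives rho^2 kappa / 2 + o(rho^2), and kappa / (2 N) tends to
   the required series as the block length N grows.

   Block capacities are superadditive, so their normalized limit exists and
   dominates every block; this transfers both bounds to the capacity. *)

(** * Densities and laws *)

(** Densities are taken with respect to the law of scaled noise on the given probability space. With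
    a scale whose square dominates all covariance eigenvalues, every Gaussian density involved is
    bounded, which settles integrability. The hypotheses describe laws only through normality of
    real linear forms, hence through integrals of cosines; the output law therefore rests on a
    uniqueness theorem for the functions [cos (real_form g y + th)], where the phase [th] takes over
    the role of complex exponentials.

    Both entropy bounds come from [ln x <= x - 1]. A positive function of integral at most 1 under
    the product of the marginals yields a lower bound, and a subprobability density in place of the
    output marginal an upper bound. Superadditivity uses the former, with the product of the density
    ratios of the two blocks as test function, so the memory of the channel across blocks needs no
    analysis. Time shifts are harmless because the conditional output law depends on time only
    through lags. In the lower bound rho tends to 0 at a fixed block length, since the error
    constants depend on that length. *)

Section density.
Context d (T : measurableType d) (R : realType).
Variables (M : {sigma_finite_measure set T -> \bar R})
  (nu : {finite_measure set T -> \bar R}) (f : T -> R).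
Hypotheses (mf : measurable_fun setT f) (f0 : forall x, 0 <= f x).
Hypothesis nuE : forall A, measurable A ->
  nu A = (\int[M]_(x in A) (f x)%:E)%E.

Lemma density_dominates : nu `<< M.
Proof.
apply/null_content_dominatesP => A mA MA0; rewrite nuE//.
apply: null_set_integral => //; exact/measurable_EFinP/measurable_funTS.
Qed.

Lemma density_RN : ae_eq M setT
  (Radon_Nikodym (charge_of_finite_measure nu) M) (EFin \o f).
Proof.
apply: integral_ae_eq => //.
- exact/Radon_Nikodym_integrable/density_dominates.
- exact/measurable_EFinP.
- move=> E _ mE; rewrite -Radon_Nikodym_integral//; last exact: density_dominates.
  exact: nuE.
Qed.

Lemma ge0_integral_density (g : T -> \bar R) :
  measurable_fun setT g -> (forall x, 0 <= g x)%E ->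
  (\int[nu]_x g x = \int[M]_x (g x * (f x)%:E))%E.
Proof.
move=> mg g0.
rewrite -(Radon_Nikodym_SigmaFinite.change_of_variables density_dominates)//.
have h := ae_eq_Radon_Nikodym_SigmaFinite density_dominates measurableT.
apply: ae_eq_integral => //.
- apply: emeasurable_funM => //; apply: measurable_int.
  exact: Radon_Nikodym_SigmaFinite.f_integrable density_dominates.
- by apply: emeasurable_funM => //; exact/measurable_EFinP.
- apply: ae_eqe_mul2l.
  by apply: ae_eq_trans h density_RN.
Qed.

Lemma Rintegral_density (g : T -> R) : measurable_fun setT g ->
  M.-integrable setT (fun x => (g x * f x)%:E) ->
  \int[nu]_x g x = \int[M]_x (g x * f x).
Proof.
move=> mg ig; rewrite /Rintegral; congr fine.
rewrite integralE [in RHS]integralE; congr (_ - _)%E; rewrite ge0_integral_density//.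
- apply: eq_integral => x _; rewrite !funeposE.
  by rewrite maxe_pMl ?lee_fin// -EFinM mul0e.
- by apply: measurable_funepos; exact/measurable_EFinP.
- apply: eq_integral => x _; rewrite !funenegE.
  by rewrite maxe_pMl ?lee_fin// mul0e mulNe.
- by apply: measurable_funeneg; exact/measurable_EFinP.
Qed.

End density.

Section probability_tools.
Context d (T : measurableType d) (R : realType).

Lemma le_integrableR (P : {measure set T -> \bar R}) (f g : T -> R) :
  measurable_fun setT f -> (forall x, `|f x| <= g x) ->
  P.-integrable setT (fun x => (g x)%:E) -> P.-integrable setT (fun x => (f x)%:E).
Proof.
move=> mf fg; apply: le_integrable => //; first exact/measurable_EFinP.
by move=> x _ /=; rewrite lee_fin (le_trans (fg x))// ler_norm.
Qed.

Section integrableR.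
Variable P : {measure set T -> \bar R}.
Implicit Types f g : T -> R.

Lemma integrableDR f g : P.-integrable setT (fun x => (f x)%:E) ->
  P.-integrable setT (fun x => (g x)%:E) ->
  P.-integrable setT (fun x => (f x + g x)%:E).
Proof. by move=> fi gi; under eq_fun do rewrite EFinD; exact: integrableD. Qed.

Lemma integrableBR f g : P.-integrable setT (fun x => (f x)%:E) ->
  P.-integrable setT (fun x => (g x)%:E) ->
  P.-integrable setT (fun x => (f x - g x)%:E).
Proof. by move=> fi gi; under eq_fun do rewrite EFinB; exact: integrableB. Qed.

Lemma integrableZR (c : R) f : P.-integrable setT (fun x => (f x)%:E) ->
  P.-integrable setT (fun x => (c * f x)%:E).
Proof. by move=> fi; under eq_fun do rewrite EFinM; exact: integrableZl. Qed.

Lemma integrable_sumR (I : Type) (r : seq I) (p : pred I) (f : I -> T -> R) :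
  (forall i, p i -> P.-integrable setT (fun x => (f i x)%:E)) ->
  P.-integrable setT (fun x => (\sum_(i <- r | p i) f i x)%:E).
Proof.
move=> fi; elim: r => [|i r ih].
  by under eq_fun do rewrite big_nil; exact: integrable0.
have [pi|pi] := boolP (p i).
  under eq_fun do rewrite big_cons pi.
  by apply: integrableDR => //; exact: fi.
by under eq_fun do rewrite big_cons (negbTE pi).
Qed.

Lemma Rintegral_sum (I : Type) (r : seq I) (p : pred I) (f : I -> T -> R) :
  (forall i, p i -> P.-integrable setT (fun x => (f i x)%:E)) ->
  \int[P]_x (\sum_(i <- r | p i) f i x) = \sum_(i <- r | p i) \int[P]_x f i x.
Proof.
move=> fi; elim: r => [|i r ih].
  rewrite big_nil -[RHS](mul0r (\int[P]_x (0 : R))) -RintegralZl ?integrable0//.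
  by apply: eq_Rintegral => x _; rewrite big_nil mul0r.
rewrite big_cons; case: ifPn => pi.
  rewrite -ih -RintegralD//; last 2 first.
  - exact: fi.
  - exact: integrable_sumR.
  by apply: eq_Rintegral => x _; rewrite big_cons pi.
by rewrite -ih; apply: eq_Rintegral => x _; rewrite big_cons (negbTE pi).
Qed.

End integrableR.

Lemma bounded_integrable (P : {finite_measure set T -> \bar R}) (f : T -> R) (M : R) :
  measurable_fun setT f -> (forall x, `|f x| <= M) ->
  P.-integrable setT (EFin \o f).
Proof.
move=> mf fM; apply: (@le_integrable _ _ _ _ _ _ _ (cst M%:E)) => //.
- exact/measurable_EFinP.
- by move=> x _ /=; rewrite lee_fin (le_trans (fM x))// ler_norm.
- exact: finite_measure_integrable_cst.
Qed.

Lemma Rintegral_cst1 (P : probability T R) (c : R) : \int[P]_x c = c.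
Proof. by rewrite Rintegral_cst// [X in fine X](_ : _ = 1%E) ?mulr1//; exact: probability_setT. Qed.

Lemma Rintegral_EFin (P : {measure set T -> \bar R}) (f : T -> R) :
  P.-integrable setT (EFin \o f) ->
  (\int[P]_x (f x)%:E = (\int[P]_x f x)%:E)%E.
Proof. by move=> fi; rewrite fineK//; exact: integrable_fin_num fi. Qed.

End probability_tools.

Section law.
Context d1 d2 (T1 : measurableType d1) (T2 : measurableType d2) (R : realType).
Variables (P1 : {finite_measure set T1 -> \bar R})
  (P2 : {finite_measure set T2 -> \bar R}).
Context d (E : measurableType d) (X1 : T1 -> E) (X2 : T2 -> E).
Hypotheses (mX1 : measurable_fun setT X1) (mX2 : measurable_fun setT X2).
Hypothesis same_law : forall A, measurable A -> P1 (X1 @^-1` A) = P2 (X2 @^-1` A).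

Lemma same_law_ge0_integral (g : E -> \bar R) : measurable_fun setT g ->
  (forall x, 0 <= g x)%E -> (\int[P1]_x g (X1 x) = \int[P2]_x g (X2 x))%E.
Proof.
move=> mg g0.
have := @ge0_integral_pushforward _ _ _ _ _ _ mX1 P1 _ g measurableT.
rewrite preimage_setT => <- //.
have := @ge0_integral_pushforward _ _ _ _ _ _ mX2 P2 _ g measurableT.
rewrite preimage_setT => <- //.
by apply: eq_measure_integral => A mA _; exact: same_law.
Qed.

Lemma same_law_integrable (g : E -> R) : measurable_fun setT g ->
  P1.-integrable setT (fun x => (g (X1 x))%:E) ->
  P2.-integrable setT (fun x => (g (X2 x))%:E).
Proof.
move=> mg /integrableP[_ h]; apply/integrableP; split.
  by apply/measurable_EFinP; exact: measurableT_comp.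
rewrite -(same_law_ge0_integral (g := fun x => `|(g x)%:E|%E))//.
by apply: measurableT_comp => //; exact/measurable_EFinP.
Qed.

Lemma same_law_Rintegral (g : E -> R) : measurable_fun setT g ->
  \int[P1]_x g (X1 x) = \int[P2]_x g (X2 x).
Proof.
move=> mg; rewrite /Rintegral; congr fine.
have mg' : measurable_fun setT (EFin \o g) by exact/measurable_EFinP.
rewrite integralE [in RHS]integralE; congr (_ - _)%E.
- under eq_integral do rewrite funeposE.
  under [RHS]eq_integral do rewrite funeposE.
  apply: (@same_law_ge0_integral (fun y => maxe (g y)%:E 0)).
    exact: measurable_maxe.
  by move=> x; rewrite le_max lexx orbT.
- under eq_integral do rewrite funenegE.
  under [RHS]eq_integral do rewrite funenegE.
  apply: (@same_law_ge0_integral (fun y => maxe (- (g y)%:E)%E 0)).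
    by apply: measurable_maxe => //; exact: measurableT_comp.
  by move=> x; rewrite le_max lexx orbT.
Qed.

End law.

(** * Characteristic function of the normal law *)

Lemma measurable_cos (R : realType) : measurable_fun setT (@cos R).
Proof. by apply: continuous_measurable_fun; exact: continuous_cos. Qed.

Lemma measurable_sin (R : realType) : measurable_fun setT (@sin R).
Proof. by apply: continuous_measurable_fun; exact: continuous_sin. Qed.

Lemma continuous_mul (R : realType) (f g : R -> R) :
  continuous f -> continuous g -> continuous (fun x => f x * g x).
Proof. by move=> cf cg x; exact: (continuousM (cf x) (cg x)). Qed.

Section normal_law.
Context (R : realType) (s : R).
Hypothesis s_gt0 : 0 < s.
Let s_neq0 : s != 0. Proof. by rewrite gt_eqF. Qed.
Local Notation nu := (normal_prob (0 : R) s).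
Local Notation p := (normal_pdf (0 : R) s).

Lemma ge0_integral_translation (G : R -> R) (c : R) : continuous G ->
  (forall x, 0 <= G x) ->
  (\int[lebesgue_measure]_x (G x)%:E = \int[lebesgue_measure]_x (G (x + c))%:E)%E.
Proof.
move=> cG G0.
have D : (fun x : R => x + c)^`()%classic = cst 1.
  apply/funext => x; rewrite derive1E deriveD// derive_cst addr0.
  by rewrite derive_id.
rewrite (@increasing_ge0_integration_by_substitutionT _ (fun x => x + c) G)//.
- by apply: eq_integral => x _; rewrite D /= /GRing.mul/= mulr1.
- by move=> x y xy; rewrite ltrD2r.
- by rewrite D => x; exact: cvg_cst.
- by rewrite D; exact: is_cvg_cst.
- by rewrite D; exact: is_cvg_cst.
- exact: cvg_addrr_Ny.
- exact: cvg_addrr.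
Qed.

Lemma ge0_normal_integral (g : R -> R) : measurable_fun setT g ->
  (forall x, 0 <= g x) ->
  (\int[nu]_x (g x)%:E = \int[lebesgue_measure]_x (g x * p x)%:E)%E.
Proof.
move=> mg g0.
rewrite (@ge0_integral_density _ _ _ lebesgue_measure nu p)//.
- exact: measurable_normal_pdf.
- exact/measurable_EFinP.
Qed.

(** Completing the square: an exponential weight moves the mean by [a * s ^+ 2]. *)
Lemma normal_pdf_tilt (a x : R) :
  expR (a * (x + a * s ^+ 2)) * p (x + a * s ^+ 2) =
  expR (a ^+ 2 * s ^+ 2 / 2) * p x.
Proof.
rewrite normal_pdfE// /normal_fun mulrCA [RHS]mulrCA; congr (_ * _).
rewrite -!expRD; congr expR; rewrite !subr0 -[s ^+ 2 *+ 2]mulr_natr.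
by field.
Qed.

Lemma ge0_normal_tilt (a : R) (G : R -> R) : continuous G ->
  (forall x, 0 <= G x) ->
  (\int[nu]_x (expR (a * x) * G x)%:E =
   (expR (a ^+ 2 * s ^+ 2 / 2))%:E * \int[nu]_x (G (x + a * s ^+ 2))%:E)%E.
Proof.
move=> cG G0.
have ca : continuous (fun x : R => expR (a * x)).
  by move=> x; apply: continuous_comp; [exact: mulrl_continuous|exact: continuous_expR].
have cG' : continuous (fun x : R => G (x + a * s ^+ 2)).
  move=> x; apply: continuous_comp; last exact: cG.
  by apply: cvgD; [exact: cvg_id|exact: cvg_cst].
rewrite (@ge0_normal_integral (fun x => expR (a * x) * G x)); last 2 first.
- by apply: continuous_measurable_fun; exact: continuous_mul.
- by move=> x; rewrite mulr_ge0// expR_ge0.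
rewrite (@ge0_integral_translation (fun x => expR (a * x) * G x * p x)
  (a * s ^+ 2)); last 2 first.
- by apply: continuous_mul; [exact: continuous_mul|exact: continuous_normal_pdf].
- by move=> x; rewrite !mulr_ge0 ?expR_ge0// normal_pdf_ge0.
rewrite ge0_normal_integral//; last exact: continuous_measurable_fun.
rewrite -ge0_integralZl//; last 2 first.
- apply/measurable_EFinP/measurable_funM; first exact: continuous_measurable_fun.
  exact: measurable_normal_pdf.
- by move=> x _; rewrite lee_fin mulr_ge0// normal_pdf_ge0.
apply: eq_integral => x _; rewrite -EFinM; congr EFin.
by rewrite mulrAC normal_pdf_tilt -!mulrA; congr (_ * _); rewrite mulrC.
Qed.

Lemma normal_expR (a : R) :
  (\int[nu]_x (expR (a * x))%:E = (expR (a ^+ 2 * s ^+ 2 / 2))%:E)%E.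
Proof.
have := @ge0_normal_tilt a (cst 1) (fun=> cvg_cst _) (fun=> ler01).
under eq_integral do rewrite mulr1.
move=> ->; rewrite [X in (_ * X)%E](_ : _ = 1%E) ?mule1//.
transitivity (\int[nu]_x (cst 1%E x))%E; first by [].
by rewrite integral_cst// mul1e; exact: probability_setT.
Qed.

Lemma normal_integrable_expR (a : R) :
  nu.-integrable setT (fun x => (expR (a * x))%:E).
Proof.
apply/integrableP; split.
  apply/measurable_EFinP/measurableT_comp => //.
under eq_integral do rewrite /= ger0_norm ?expR_ge0//.
by rewrite normal_expR ltry.
Qed.

Lemma expR_abs_le (a x : R) : expR (`|a * x|) <= expR (a * x) + expR (- a * x).
Proof.
case: (ger0P (a * x)) => _; first by rewrite lerDl expR_ge0.
by rewrite mulNr lerDr expR_ge0.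
Qed.

Lemma normal_integrable_expR_abs (a : R) :
  nu.-integrable setT (fun x => (expR (`|a * x|))%:E).
Proof.
apply: (@le_integrableR _ _ _ nu _ (fun x => expR (a * x) + expR (- a * x))).
- by do 2 apply: measurableT_comp => //.
- by move=> x; rewrite ger0_norm ?expR_ge0//; exact: expR_abs_le.
- under eq_fun do rewrite EFinD.
  by apply: integrableD => //; exact: normal_integrable_expR.
Qed.

Lemma normal_integrable_expR_bounded (a b M : R) (g : R -> R) :
  measurable_fun setT g -> (forall x, `|g x| <= M * expR (`|b * x|)) ->
  nu.-integrable setT (fun x => (g x)%:E).
Proof.
move=> mg gM.
apply: (@le_integrableR _ _ _ nu _ (fun x => M * expR (`|b * x|))) => //.
under eq_fun do rewrite EFinM; apply: integrableZl => //.
exact: normal_integrable_expR_abs.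
Qed.

Lemma normal_tilt_cos (a t th : R) :
  \int[nu]_x (expR (a * x) * cos (t * x + th)) =
  expR (a ^+ 2 * s ^+ 2 / 2) * \int[nu]_x cos (t * x + (t * a * s ^+ 2 + th)).
Proof.
(* The tilt identity is available for nonnegative functions. Adding 1 makes the cosine such a
   function; the extra term is the moment generating function and is cancelled by [addrI] at the
   end. *)
pose G := fun x : R => 1 + cos (t * x + th).
have cG : continuous G.
  move=> x; apply: cvgD; first exact: cvg_cst.
  apply: continuous_comp; last exact: continuous_cos.
  by apply: cvgD; [exact: mulrl_continuous|exact: cvg_cst].
have G0 x : 0 <= G x by rewrite /G -lerBlDl sub0r cos_geN1.
have mc (u v : R) : measurable_fun setT (fun x : R => cos (u * x + v)).
  apply: measurableT_comp; first exact: measurable_cos.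
  by apply: measurable_funD => //; exact: measurable_funM.
have bc (u v : R) : nu.-integrable setT (fun x : R => (cos (u * x + v))%:E).
  by apply: (@bounded_integrable _ _ _ nu _ 1); [exact: mc|move=> x; exact: cos_max].
have bec : nu.-integrable setT (fun x : R => (expR (a * x) * cos (t * x + th))%:E).
  apply: (@normal_integrable_expR_bounded 0 a 1).
    by apply: measurable_funM => //; apply: measurableT_comp.
  move=> x; rewrite mul1r normrM ger0_norm ?expR_ge0//.
  rewrite (le_trans (ler_piMr _ _)) ?expR_ge0 ?cos_max//.
  by rewrite ler_expR ler_norm.
have := congr1 fine (ge0_normal_tilt a cG G0).
rewrite [X in X = _ -> _](_ : _ = \int[nu]_x (expR (a * x) + expR (a * x) * cos (t * x + th))); last first.
  by apply: eq_Rintegral => x _; rewrite /G mulrDr mulr1.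
rewrite RintegralD//; last exact: normal_integrable_expR.
have -> : \int[nu]_x expR (a * x) = expR (a ^+ 2 * s ^+ 2 / 2).
  by rewrite /Rintegral normal_expR.
have -> : (\int[nu]_x (G (x + a * s ^+ 2))%:E =
    (1 + \int[nu]_x cos (t * x + (t * a * s ^+ 2 + th)))%:E)%E.
  transitivity (\int[nu]_x (1 + cos (t * x + (t * a * s ^+ 2 + th)))%:E)%E.
    by apply: eq_integral => x _; rewrite /G mulrDr addrA mulrA.
  rewrite Rintegral_EFin//; last first.
    apply: (@bounded_integrable _ _ _ nu _ 2) => [|x].
      by apply: measurable_funD => //; exact: mc.
    by rewrite (le_trans (ler_normD _ _))// normr1 (_ : 2 = 1 + 1)// lerD2l cos_max.
  rewrite RintegralD ?Rintegral_cst1//; last exact: bc.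
  exact: finite_measure_integrable_cst.
by rewrite /= mulrDr mulr1 => /addrI.
Qed.

End normal_law.

Lemma is_derive_under_integral d (T : measurableType d) (R : realType)
    (mu : {measure set T -> \bar R}) (f df : R -> T -> R) (G : T -> R) (a u v : R) :
  u < a < v ->
  (forall x, u < x < v -> mu.-integrable setT (EFin \o f x)) ->
  (forall (x : R) (y : T), is_derive x 1 (f ^~ y) (df x y)) ->
  (forall y, 0 <= G y) -> mu.-integrable setT (EFin \o G) ->
  (forall x y, u < x < v -> `|df x y| <= G y) ->
  is_derive a 1 (fun x => \int[mu]_y f x y) (\int[mu]_y df a y).
Proof.
move=> auv intf derf G0 intG dfG.
have Ia : `]u, v[%classic a by rewrite /= in_itv.
have E (x : R) (y : T) : (f ^~ y)^`()%classic x = df x y.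
  by rewrite derive1E; have [_ ->] := derf x y.
have intf' (x : R) : `]u, v[%classic x -> mu.-integrable setT (EFin \o f x).
  by rewrite /= in_itv/=; exact: intf.
have derf1 (x : R) (y : T) : `]u, v[%classic x -> setT y -> derivable (f ^~ y) x 1.
  by move=> _ _; have [] := derf x y.
have Gub (x : R) (y : T) : `]u, v[%classic x -> setT y -> `|(f ^~ y)^`()%classic x| <= G y.
  by rewrite /= in_itv/= => xuv _; rewrite E dfG.
have D := @derivable_under_integral _ _ _ mu f _ measurableT _ _ _ Ia intf' derf1 _ G0 intG Gub.
have := @differentiation_under_integral _ _ _ mu f _ measurableT _ _ _ Ia intf' derf1 _ G0 intG Gub.
rewrite derive1E => h; apply: DeriveDef => //; rewrite h.
by apply: eq_Rintegral => y _; exact: E.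
Qed.

Section normal_charfun.
Context (R : realType) (s : R).
Hypothesis s_gt0 : 0 < s.
Local Notation nu := (normal_prob (0 : R) s).

Lemma ler_abs_expR (x : R) : `|x| <= expR (`|x|).
Proof. by rewrite (le_trans _ (expR_ge1Dx _))// lerDr. Qed.

Let mct (u v : R) : measurable_fun setT (fun x : R => cos (u * x + v)).
Proof.
apply: measurableT_comp; first exact: measurable_cos.
by apply: measurable_funD => //; exact: measurable_funM.
Qed.

Let mst (u v : R) : measurable_fun setT (fun x : R => sin (u * x + v)).
Proof.
apply: measurableT_comp; first exact: measurable_sin.
by apply: measurable_funD => //; exact: measurable_funM.
Qed.

Lemma normal_integrable_cos (t th : R) :
  nu.-integrable setT (fun x : R => (cos (t * x + th))%:E).
Proof.
by apply: (@bounded_integrable _ _ _ nu _ 1); [exact: mct|move=> x; exact: cos_max].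
Qed.

Lemma is_derive_normal_cos (t th : R) :
  is_derive t 1 (fun t => \int[nu]_x cos (t * x + th))
    (\int[nu]_x (- (x * sin (t * x + th)))).
Proof.
apply: (@is_derive_under_integral _ _ _ nu (fun t x => cos (t * x + th))
  (fun t x => - (x * sin (t * x + th))) (fun x => expR (`|x|)) t (t - 1) (t + 1)).
- by rewrite ltrBlDr !ltrDl ltr01.
- by move=> x _; exact: normal_integrable_cos.
- move=> u y; apply: is_derive_eq.
  rewrite /GRing.scale/=; ring.
- by move=> y; exact: expR_ge0.
- have := normal_integrable_expR_abs s_gt0 1.
  by under eq_fun do rewrite mul1r.
- move=> u y _; rewrite normrN normrM (le_trans _ (ler_abs_expR _))//.
  by rewrite ler_piMr ?normr_ge0// sin_max.
Qed.

Lemma is_derive_normal_tilt (t th : R) :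
  is_derive (0 : R) 1 (fun a => \int[nu]_x (expR (a * x) * cos (t * x + th)))
    (\int[nu]_x (x * cos (t * x + th))).
Proof.
have -> : \int[nu]_x (x * cos (t * x + th)) =
    \int[nu]_x (x * expR (0 * x) * cos (t * x + th)).
  by apply: eq_Rintegral => x _; rewrite mul0r expR0 mulr1.
apply: (@is_derive_under_integral _ _ _ nu (fun a x => expR (a * x) * cos (t * x + th))
  (fun a x => x * expR (a * x) * cos (t * x + th)) (fun x => expR (`|2 * x|)) 0 (-1) 1).
- by rewrite ltr01 andbT ltrN10.
- move=> a _; apply: (@normal_integrable_expR_bounded _ _ s_gt0 0 a 1).
    by apply: measurable_funM => //; exact: measurableT_comp.
  move=> x; rewrite mul1r normrM ger0_norm ?expR_ge0//.
  rewrite (le_trans (ler_piMr _ _)) ?expR_ge0 ?cos_max//.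
  by rewrite ler_expR ler_norm.
- move=> a y; apply: is_derive_eq.
  rewrite /GRing.scale/=; ring.
- by move=> y; exact: expR_ge0.
- exact: normal_integrable_expR_abs.
- move=> a y /andP[a1 a2]; rewrite !normrM (le_trans (ler_piMr _ (cos_max _)))//.
  rewrite (_ : `|2| * `|y| = `|y| + `|y|) ?expRD; last by rewrite ger0_norm//; ring.
  rewrite ler_pM//; first exact: ler_abs_expR.
  rewrite ger0_norm ?expR_ge0// ler_expR (le_trans (ler_norm _))// normrM ler_piMl//.
  by rewrite ler_norml (ltW a1) (ltW a2).
Qed.

(** Gaussian integration by parts, obtained by differentiating [normal_tilt_cos] in [a] at 0: one
    side under the integral, the other in closed form. *)
Lemma normal_mulx_cos (t th : R) :
  \int[nu]_x (x * cos (t * x + th)) = - (t * s ^+ 2 * \int[nu]_x (sin (t * x + th))).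
Proof.
have [_ <-] := is_derive_normal_tilt t th.
have msin : nu.-integrable setT (fun x : R => (sin (t * x + th))%:E).
  by apply: (@bounded_integrable _ _ _ nu _ 1); [exact: mst|move=> x; exact: sin_max].
rewrite (_ : (fun a => _) = (fun a : R => expR (a ^+ 2 * s ^+ 2 / 2) *
  (cos (t * a * s ^+ 2) * \int[nu]_x cos (t * x + th) -
   sin (t * a * s ^+ 2) * \int[nu]_x sin (t * x + th)))); last first.
  apply/funext => a; rewrite normal_tilt_cos//; congr (_ * _).
  rewrite -!RintegralZl//; last exact: normal_integrable_cos.
  rewrite -RintegralB//; last 2 first.
  - by apply: integrableZR; exact: normal_integrable_cos.
  - exact: integrableZR.
  by apply: eq_Rintegral => x _; rewrite -cosD; congr cos; ring.
set c := \int[nu]_x cos _; set c' := \int[nu]_x sin _.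
have D : is_derive (0 : R) 1 (fun a : R => expR (a ^+ 2 * s ^+ 2 / 2) *
  (cos (t * a * s ^+ 2) * c - sin (t * a * s ^+ 2) * c')) (- (t * s ^+ 2 * c')).
  apply: is_derive_eq.
  rewrite /GRing.scale/= !mulr0 !mul0r expr0n/= !mul0r expR0 sin0 cos0.
  ring.
by have [_ ->] := D.
Qed.

(** As a function of t the integral satisfies F' = - t s^2 F, so its product with
    [expR (t ^+ 2 * s ^+ 2 / 2)] is constant; at 0 the value is [cos th]. *)
Lemma normal_cos (t th : R) :
  \int[nu]_x cos (t * x + th) = expR (- (t ^+ 2 * s ^+ 2 / 2)) * cos th.
Proof.
pose F t := \int[nu]_x cos (t * x + th).
have dF (u : R) : is_derive u 1 F (- (u * s ^+ 2 * F u)).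
  apply: (is_derive_eq (is_derive_normal_cos u th)).
  have E (x : R) : cos (x + pi / 2) = - sin x :> R by rewrite cosDpihalf.
  have E' (x : R) : sin (x + pi / 2) = cos x :> R by rewrite sinDpihalf.
  (* A phase shift by pi / 2 writes the sine as a cosine, so that [normal_mulx_cos] applies; the
     sine which that lemma returns becomes the original cosine. *)
  transitivity (\int[nu]_x (x * cos (u * x + (th + pi / 2)))).
    by apply: eq_Rintegral => x _; rewrite addrA E mulrN.
  rewrite normal_mulx_cos; congr (- (_ * _)).
  by apply: eq_Rintegral => x _; rewrite addrA E'.
have dH (u : R) : is_derive u 1 (fun u => expR (u ^+ 2 * s ^+ 2 / 2) * F u) 0.
  by apply: is_derive_eq; rewrite /GRing.scale/=; field.
have := is_derive_0_is_cst t 0 dH.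
rewrite expr0n/= !mul0r expR0 mul1r {2}/F.
have -> : \int[nu]_x cos (0 * x + th) = cos th.
  rewrite -[RHS](@Rintegral_cst1 _ _ _ nu).
  by apply: eq_Rintegral => x _; rewrite mul0r add0r.
by move=> <-; rewrite mulrA -expRD addNr expR0 mul1r.
Qed.

End normal_charfun.

Section normal_law_facts.
Context (R : realType).

Lemma integral_normal_shift (m s : R) (g : R -> R) : 0 < s -> continuous g ->
  (\int[normal_prob m s]_x (g x)%:E = \int[normal_prob 0 s]_x (g (x + m))%:E)%E.
Proof.
move=> s0 cg.
have dens (m' : R) (h : R -> R) : continuous h -> (forall x, 0 <= h x) ->
    (\int[normal_prob m' s]_x (h x)%:E = \int[lebesgue_measure]_x (h x * normal_pdf m' s x)%:E)%E.
  move=> ch h0.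
  rewrite (@ge0_integral_density _ _ _ lebesgue_measure (normal_prob m' s) (normal_pdf m' s))//.
  - exact: measurable_normal_pdf.
  - by apply/measurable_EFinP; exact: continuous_measurable_fun.
have ge0 (h : R -> R) : continuous h -> (forall x, 0 <= h x) ->
    (\int[normal_prob m s]_x (h x)%:E = \int[normal_prob 0 s]_x (h (x + m))%:E)%E.
  move=> ch h0.
  have ch' : continuous (fun x : R => h (x + m)).
    move=> x; apply: continuous_comp; last exact: ch.
    by apply: cvgD; [exact: cvg_id|exact: cvg_cst].
  apply: (etrans (dens m h ch h0)).
  apply: (etrans _ (esym (dens 0 _ ch' (fun x => h0 (x + m))))).
  rewrite (@ge0_integral_translation _ (fun x => h x * normal_pdf m s x) m); last 2 first.
  - by apply: continuous_mul => //; apply: continuous_normal_pdf; rewrite gt_eqF.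
  - by move=> x; rewrite mulr_ge0// normal_pdf_ge0.
  apply: eq_integral => x _; congr ((_ * _)%:E).
  by rewrite !normal_pdfE ?gt_eqF// /normal_fun subr0 addrK.
have cmax (h : R -> R) : continuous h -> continuous (fun x => Num.max (h x) 0).
  move=> ch x; apply: (@continuous_max _ _ h (cst 0) x); first exact: ch.
  exact: cvg_cst.
have hp (h : R -> R) : continuous h ->
    (\int[normal_prob m s]_x ((fun x => (h x)%:E)^\+ x) =
    \int[normal_prob 0 s]_x ((fun x => (h (x + m))%:E)^\+ x))%E.
  move=> ch; under eq_integral do rewrite funeposE -EFin_max.
  have h0 x : 0 <= Num.max (h x) 0 by rewrite le_max lexx orbT.
  apply: (etrans (ge0 _ (cmax _ ch) h0)).
  by apply: eq_integral => x _; rewrite funeposE EFin_max.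
have hn : (\int[normal_prob m s]_x ((fun x => (g x)%:E)^\- x) =
    \int[normal_prob 0 s]_x ((fun x => (g (x + m))%:E)^\- x))%E.
  have cN : continuous (fun x => - g x).
    by move=> x; apply: (@cvgN _ R^o); exact: cg.
  have e (f : R -> R) : ((fun x => (f x)%:E)^\- = (fun x => (- f x)%:E)^\+)%E.
    by apply/funext => x; rewrite funenegE funeposE EFinN.
  by rewrite !e; exact: (hp _ cN).
have {}hp := hp _ cg.
have e1 := integralE (normal_prob m s) setT (fun x => (g x)%:E).
have e2 := integralE (normal_prob 0 s) setT (fun x => (g (x + m))%:E).
exact: (etrans e1 (etrans (congr2 (fun x y => (x - y)%E) hp hn) (esym e2))).
Qed.

(** The derivative at 0 of t -> E[x sin(t x)] is computed twice: under the integral it is the second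
    moment, and by [normal_mulx_cos] it is the derivative of t s^2 exp(- t^2 s^2 / 2). *)
Lemma normal_second_moment (s : R) : 0 < s -> \int[normal_prob 0 s]_x (x ^+ 2) = s ^+ 2.
Proof.
move=> s0.
have D1 : is_derive (0 : R) 1 (fun t => \int[normal_prob 0 s]_x (x * sin (t * x)))
    (\int[normal_prob 0 s]_x (x * (x * cos (0 * x)))).
  apply: (@is_derive_under_integral _ _ _ (normal_prob 0 s) (fun t x => x * sin (t * x))
    (fun t x => x * (x * cos (t * x))) (fun x => expR (`|2 * x|)) 0 (-1) 1).
  - by rewrite ltr01 andbT ltrN10.
  - move=> t _; apply: (@normal_integrable_expR_bounded _ _ s0 1 1 1).
      apply: measurable_funM => //; apply: measurableT_comp; first exact: measurable_sin.
      exact: measurable_funM.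
    move=> x; rewrite !mul1r normrM (le_trans (ler_piMr _ (sin_max _)))//.
    exact: ler_abs_expR.
  - move=> t x; apply: is_derive_eq; rewrite /GRing.scale/=; ring.
  - by move=> x; exact: expR_ge0.
  - exact: normal_integrable_expR_abs.
  - move=> t x _; rewrite mulrA normrM (le_trans (ler_piMr _ (cos_max _)))// normrM.
    rewrite (_ : `|2 * x| = `|x| + `|x|) ?expRD; last by rewrite normrM ger0_norm//; ring.
    by rewrite ler_pM//; exact: ler_abs_expR.
have D2 : is_derive (0 : R) 1 (fun t => \int[normal_prob 0 s]_x (x * sin (t * x))) (s ^+ 2).
  rewrite (_ : (fun t => _) = (fun t => t * s ^+ 2 * expR (- (t ^+ 2 * s ^+ 2 / 2)))).
    apply: is_derive_eq; rewrite /GRing.scale/= !mul0r expr0n/= !mul0r oppr0 expR0; ring.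
  apply/funext => t.
  transitivity (\int[normal_prob 0 s]_x (x * cos (t * x + - (pi / 2)))).
    by apply: eq_Rintegral => x _; rewrite cosBpihalf.
  rewrite normal_mulx_cos// -mulrN; congr (_ * _).
  have := normal_cos s0 t 0; rewrite cos0 mulr1 => <-.
  rewrite -[LHS]mulN1r -RintegralZl//.
    by apply: eq_Rintegral => x _; rewrite sinBpihalf mulrN mulN1r opprK addr0.
  apply: (@bounded_integrable _ _ _ (normal_prob 0 s) _ 1).
    apply: measurableT_comp; first exact: measurable_sin.
    by apply: measurable_funD => //; exact: measurable_funM.
  by move=> x; exact: sin_max.
have [_ <-] := D2; have [_ ->] := D1.
by apply: eq_Rintegral => x _; rewrite mul0r cos0 mulr1 expr2.
Qed.

End normal_law_facts.

Section has_normal_law_facts.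
Context d (T : measurableType d) (R : realType) (P : probability T R).
Variable Y : T -> R.
Hypothesis mY : measurable_fun setT Y.
Hypothesis nY : has_normal_law P Y.

Lemma has_normal_law_integrable_expR (a : R) :
  P.-integrable setT (fun w => (expR (a * `|Y w|))%:E).
Proof.
have ce : continuous (fun x : R => expR (a * `|x|)).
  move=> x; apply: continuous_comp; last exact: continuous_expR.
  apply: (@continuous_comp _ _ _ (fun x : R => `|x|) (fun y => a * y)).
    exact: norm_continuous.
  exact: mulrl_continuous.
have me := continuous_measurable_fun ce.
case: nY => [[m PE]|[m [s [s0 PE]]]].
- apply: (@same_law_integrable _ _ _ _ _ (\d_m : probability _ R) P _ _ id Y _ _ _
    (fun x => expR (a * `|x|))) => //.
    by move=> A mA; exact: (esym (PE A mA)).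
  apply/integrableP; split; first exact/measurable_EFinP.
  rewrite integral_dirac//=; last first.
    by apply/measurable_EFinP; exact: measurableT_comp.
  by rewrite diracT mul1e ltry.
- apply: (@same_law_integrable _ _ _ _ _ (normal_prob m s) P _ _ id Y _ _ _
    (fun x => expR (a * `|x|))) => //.
    by move=> A mA; exact: (esym (PE A mA)).
  apply/integrableP; split; first exact/measurable_EFinP.
  under eq_integral do rewrite /= ger0_norm ?expR_ge0//.
  rewrite (@integral_normal_shift _ m s (fun x => expR (a * `|x|)) s0 ce).
  have : (normal_prob 0 s).-integrable setT (fun x : R => (expR (a * `|x + m|))%:E).
    apply: (@normal_integrable_expR_bounded _ _ s0 0 a (expR (`|a| * `|m|))).
      apply: measurableT_comp => //; apply: measurable_funM => //.
      by apply: measurableT_comp => //; exact: measurable_funD.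
    move=> x; rewrite ger0_norm ?expR_ge0// -expRD ler_expR.
    rewrite normrM -mulrDr (le_trans (ler_wpM2r _ (ler_norm a)))//.
    by rewrite ler_wpM2l// addrC ler_normD.
  move=> /integrableP[_]; apply: le_lt_trans; rewrite le_eqVlt; apply/orP; left.
  by apply/eqP; apply: eq_integral => x _ /=; rewrite (ger0_norm (expR_ge0 _)).
Qed.

(** Writing the variance as an integral gives the Dirac and the nondegenerate case one common
    formula; the zero mean forces the parameter [m] to be 0 in both. *)
Lemma has_normal_law_cos : \int[P]_w Y w = 0 -> forall th,
  \int[P]_w cos (Y w + th) = expR (- (2^-1 * \int[P]_w (Y w ^+ 2))) * cos th.
Proof.
move=> Y0 th.
have mc : measurable_fun setT (fun x : R => cos (x + th)).
  by apply: measurableT_comp; [exact: measurable_cos|exact: measurable_funD].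
case: nY => [[m PE]|[m [s [s0 PE]]]].
- have law A : measurable A -> P (Y @^-1` A) = (\d_m : probability _ R) (id @^-1` A).
    by move=> mA; exact: PE.
  have tr (g : R -> R) : measurable_fun setT g -> \int[P]_w g (Y w) = g m.
    move=> mg; rewrite (same_law_Rintegral mY _ law mg)//.
    by rewrite /Rintegral integral_dirac ?diracT ?mul1e//; exact/measurable_EFinP.
  have m0 : m = 0 by rewrite -Y0 (tr id).
  have h := tr _ mc; rewrite {}h.
  rewrite (_ : \int[P]_w (Y w ^+ 2) = m ^+ 2); last first.
    by apply: (tr (fun x => x ^+ 2)); exact: measurable_funX.
  by rewrite m0 expr0n/= mulr0 oppr0 expR0 mul1r add0r.
- have law A : measurable A -> P (Y @^-1` A) = normal_prob m s (id @^-1` A).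
    by move=> mA; exact: PE.
  have tr (g : R -> R) : measurable_fun setT g -> \int[P]_w g (Y w) = \int[normal_prob m s]_x g x.
    by move=> mg; rewrite (same_law_Rintegral mY _ law mg).
  have m0 : m = 0.
    have e0 : \int[normal_prob 0 s]_x (fun x : R => x) x = 0.
      transitivity (\int[normal_prob 0 s]_x (x * cos (0 * x + 0))).
        by apply: eq_Rintegral => x _; rewrite mul0r addr0 cos0 mulr1.
      by rewrite normal_mulx_cos// !mul0r oppr0.
    rewrite -Y0 (tr id)//= /Rintegral (@integral_normal_shift _ _ _ id)//.
    rewrite -/(Rintegral _ _ _) RintegralD//.
    - by rewrite Rintegral_cst1 e0 add0r.
    - apply: (@normal_integrable_expR_bounded _ _ s0 0 1 1) => // x.
      by rewrite !mul1r; exact: ler_abs_expR.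
    - exact: finite_measure_integrable_cst.
    - by move=> x; exact: cvg_id.
  have h := tr _ mc; rewrite {}h.
  rewrite (_ : \int[P]_w (Y w ^+ 2) = s ^+ 2); last first.
    rewrite -normal_second_moment// -m0.
    by apply: (tr (fun x => x ^+ 2)); exact: measurable_funX.
  rewrite m0.
  have := normal_cos s0 1 th; rewrite expr1n mul1r [s ^+ 2 / 2]mulrC => <-.
  by apply: eq_Rintegral => x _; rewrite mul1r.
Qed.

End has_normal_law_facts.

(** * Laws on complex vectors determined by their characteristic functions *)

Section complex_parts.
Context (R : realType).
Implicit Types x y : R[i].

Lemma ReD x y : complex.Re (x + y) = complex.Re x + complex.Re y.
Proof. by case: x y => a b [c e]. Qed.

Lemma ImD x y : complex.Im (x + y) = complex.Im x + complex.Im y.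
Proof. by case: x y => a b [c e]. Qed.

Lemma complex_ReM x y : complex.Re (x * y) =
  complex.Re x * complex.Re y - complex.Im x * complex.Im y.
Proof. by case: x y => a b [c e]. Qed.

Lemma complex_ImM x y : complex.Im (x * y) =
  complex.Re x * complex.Im y + complex.Im x * complex.Re y.
Proof. by case: x y => a b [c e]. Qed.

Lemma Re_sum (I : Type) (r : seq I) (p : pred I) (f : I -> R[i]) :
  complex.Re (\sum_(i <- r | p i) f i) = \sum_(i <- r | p i) complex.Re (f i).
Proof. by apply: (big_morph (@complex.Re R)) => //; exact: ReD. Qed.

Lemma Im_sum (I : Type) (r : seq I) (p : pred I) (f : I -> R[i]) :
  complex.Im (\sum_(i <- r | p i) f i) = \sum_(i <- r | p i) complex.Im (f i).
Proof. by apply: (big_morph (@complex.Im R)) => //; exact: ImD. Qed.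

Lemma ReZ (t : R) x : complex.Re (t%:C * x) = t * complex.Re x.
Proof. by case: x => a b; rewrite complex_ReM/= mul0r subr0. Qed.

Lemma complex_ext x y : complex.Re x = complex.Re y ->
  complex.Im x = complex.Im y -> x = y.
Proof. by case: x y => a b [c e] /= -> ->. Qed.

Lemma sqr_normcE x : normc x ^+ 2 = complex.Re x ^+ 2 + complex.Im x ^+ 2.
Proof. by case: x => a b /=; rewrite sqr_sqrtr// addr_ge0// sqr_ge0. Qed.

Lemma normc_ge0 x : 0 <= normc x.
Proof. by case: x => a b /=; exact: sqrtr_ge0. Qed.

End complex_parts.

Section linear_form.
Context (R : realType) (n : nat).
Implicit Types (g h : 'I_n -> R[i]) (y : n.-tuple R[i]).

(** Every real linear functional of a complex vector has this form, so these are all the frequencies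
    of a characteristic function. *)
Definition real_form g y : R := complex.Re (\sum_(i < n) g i * tnth y i).

Lemma real_formD g h y :
  real_form (fun i => g i + h i) y = real_form g y + real_form h y.
Proof.
by rewrite /real_form -ReD -big_split; congr complex.Re; apply: eq_bigr => i _;
  rewrite mulrDl.
Qed.

Lemma real_formZ (t : R) g y :
  real_form (fun i => t%:C * g i) y = t * real_form g y.
Proof.
rewrite /real_form -ReZ mulr_sumr; congr complex.Re; apply: eq_bigr => i _.
by rewrite mulrA.
Qed.

Lemma real_formB g h y :
  real_form (fun i => g i - h i) y = real_form g y - real_form h y.
Proof.
rewrite -[- real_form h y]mulN1r -real_formZ -real_formD.
by congr real_form; apply/funext => i; rewrite rmorphN rmorph1 mulN1r.
Qed.

Lemma real_form0 y : real_form (fun=> 0) y = 0.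
Proof. by rewrite /real_form big1// => i _; rewrite mul0r. Qed.

Lemma real_form_Re (i : 'I_n) y :
  real_form (fun j => (j == i)%:R) y = complex.Re (tnth y i).
Proof.
rewrite /real_form (bigD1 i)//= eqxx mul1r big1 ?addr0// => j /negbTE ->.
by rewrite mul0r.
Qed.

Lemma real_form_Im (i : 'I_n) y :
  real_form (fun j => if j == i then - 'i%C else 0) y = complex.Im (tnth y i).
Proof.
rewrite /real_form (bigD1 i)//= eqxx big1 ?addr0; last first.
  by move=> j /negbTE ->; rewrite mul0r.
by case: (tnth y i) => a b; rewrite complex_ReM/= oppr0 mul0r mulN1r sub0r opprK.
Qed.

Lemma measurable_real_form g : measurable_fun setT (real_form g).
Proof.
have : measurable_fun setT (fun y : n.-tuple R[i] => \sum_(i < n) g i * tnth y i).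
  apply: measurable_complex_sum => i; apply: measurable_complexM.
    exact: measurable_cst.
  exact: measurable_tnth.
by move=> /measurable_fun_complexP[].
Qed.

End linear_form.

(** * Polynomials converging to the indicator of an interval *)

Section step_polynomial.
Context (R : realType).

(** With q = exp(- a), the quadratic Taylor term of exp(a n) dominates n and leaves a multiple of 1
    / n. *)
Lemma cvg_natmul_expr (q : R) : 0 <= q < 1 -> n%:R * q ^+ n @[n --> \oo] --> 0.
Proof.
move=> /andP[q0 q1].
have [->|qn0] := eqVneq q 0.
  apply: (@cvg_trans _ ((fun=> 0) @ \oo)); last exact: cvg_cst.
  apply: near_eq_cvg; near=> n; rewrite expr0n.
  have -> : (n == 0)%N = false by apply/negbTE; rewrite -lt0n; near: n; exact: nbhs_infty_gt.
  by rewrite mulr0.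
have qgt : 0 < q by rewrite lt_neqAle eq_sym qn0.
pose a := - ln q; have a0 : 0 < a by rewrite oppr_gt0 ln_lt0// qgt.
have bound n : n.+1%:R * q ^+ n.+1 <= 2 / a ^+ 2 * n.+1%:R^-1.
  have -> : q = expR (- a) by rewrite opprK lnK.
  rewrite -expRM_natr mulNr expRN.
  have h := @expR_ge1Dxn R (a * n.+1%:R) 1 (mulr_ge0 (ltW a0) (ler0n _ _)).
  have h2 : (a * n.+1%:R) ^+ 2 / 2 <= expR (a * n.+1%:R).
    by rewrite (le_trans _ h)// lerDr.
  have p2 : 0 < (a * n.+1%:R) ^+ 2 / 2 by rewrite divr_gt0// exprn_gt0// mulr_gt0.
  rewrite (@le_trans _ _ (n.+1%:R / ((a * n.+1%:R) ^+ 2 / 2)))//.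
    by rewrite ler_pM// ?invr_ge0 ?expR_ge0// lef_pV2 ?posrE ?expR_gt0.
  rewrite le_eqVlt; apply/orP; left; apply/eqP.
  have aux (m b : R) : m != 0 -> b != 0 -> m / ((b * m) ^+ 2 / 2) = 2 / b ^+ 2 / m.
    by move=> m0 b0; field; rewrite m0 b0.
  by apply: aux => //; rewrite gt_eqF.
rewrite -cvg_shiftS.
apply: (@squeeze_cvgr _ _ _ _ (fun=> 0) (fun n => 2 / a ^+ 2 * n.+1%:R^-1)); last 2 first.
- exact: cvg_cst.
- rewrite -[X in _ --> X](mulr0 (2 / a ^+ 2)).
  by apply: cvgM; [exact: cvg_cst|exact: cvg_harmonic].
by near=> n; rewrite mulr_ge0 ?exprn_ge0//=.
Unshelve. all: by end_near. Qed.

Lemma bernoulli_le (x : R) (n : nat) : 0 <= x <= 1 -> 1 - n%:R * x <= (1 - x) ^+ n.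
Proof.
move=> /andP[x0 x1]; elim: n => [|n ih]; first by rewrite mul0r subr0 expr0.
rewrite exprS; apply: (@le_trans _ _ ((1 - x) * (1 - n%:R * x))); last first.
  by rewrite ler_wpM2l// subr_ge0.
rewrite -natr1; have : 0 <= n%:R * x * x by rewrite !mulr_ge0.
lra.
Qed.

(* The exponents are chosen so that (1 - x^n)^(step_exponent h n) tends to the
   indicator of x < h; composed with cos^2 it turns trigonometric functions into
   indicators of slabs. *)
Definition step_exponent (h : R) (n : nat) : nat := (n * (Num.truncn (h^-1 ^+ n)).+1)%N.

Definition step_poly (h x : R) (n : nat) : R := (1 - x ^+ n) ^+ step_exponent h n.

Lemma step_poly_bound (h x : R) (n : nat) : 0 <= x <= 1 -> 0 <= step_poly h x n <= 1.
Proof.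
move=> /andP[x0 x1]; have xn : 0 <= 1 - x ^+ n <= 1.
  by rewrite subr_ge0 exprn_ile1//= lerBlDr lerDl exprn_ge0.
by move: xn => /andP[y0 y1]; rewrite /step_poly exprn_ge0//= exprn_ile1.
Qed.

(** Below [h], Bernoulli's inequality applies: the exponent times x^n is at most n (x / h)^n + n
    x^n, which tends to 0. From [h] on, 1 - y <= exp(- y) applies: the exponent times x^n is at
    least n, so the power is at most exp(- n). *)
Lemma cvg_step_poly (h x : R) : 0 < h <= 1 -> 0 <= x <= 1 ->
  step_poly h x n @[n --> \oo] --> ((x < h)%R%:R : R).
Proof.
move=> /andP[h0 h1] /andP[x0 x1]; case: ltP => [xh|hx].
- have b n : 1 - (n%:R * (x / h) ^+ n + n%:R * x ^+ n) <= step_poly h x n.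
    rewrite /step_poly (le_trans _ (bernoulli_le _ _))//; last first.
      by rewrite exprn_ge0//= exprn_ile1.
    rewrite lerD2l lerN2 /step_exponent natrM -mulrA -mulrDr ler_wpM2l//.
    rewrite exprMn exprVn [x ^+ n * _]mulrC -[X in _ <= _ + X]mul1r -mulrDl.
    rewrite ler_wpM2r ?exprn_ge0// -natr1 lerD2r -exprVn.
    by rewrite truncn_le// exprn_ge0// invr_ge0 ltW.
  apply: (@squeeze_cvgr _ _ _ _
    (fun n => 1 - (n%:R * (x / h) ^+ n + n%:R * x ^+ n)) (fun=> 1)); last 2 first.
  + rewrite -[X in _ --> X]subr0 -[X in _ - X]addr0.
    apply: (@cvgB _ R^o); first exact: cvg_cst.
    apply: (@cvgD _ R^o); apply: cvg_natmul_expr.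
      by rewrite divr_ge0 ?(ltW h0)//= ltr_pdivrMr// mul1r.
    by rewrite x0/= (lt_le_trans xh).
  + exact: cvg_cst.
  near=> n; rewrite b/=.
  by have /andP[] : 0 <= step_poly h x n <= 1 by apply: step_poly_bound; rewrite x0.
- have b n : step_poly h x n <= expR (- n%:R).
    rewrite /step_poly (@le_trans _ _ (expR (- x ^+ n) ^+ step_exponent h n))//.
      apply: lerXn2r; rewrite ?nnegrE ?expR_ge0//.
        by rewrite subr_ge0 exprn_ile1.
      exact: expR_ge1Dx.
    rewrite -expRM_natr ler_expR mulNr lerN2 /step_exponent natrM mulrCA.
    rewrite -[leLHS]mulr1 ler_wpM2l//.
    have hn : 0 < h ^+ n by rewrite exprn_gt0.
    rewrite (@le_trans _ _ (h ^+ n * h^-1 ^+ n))//.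
      by rewrite -exprMn divff ?expr1n// gt_eqF.
    rewrite ler_pM ?exprn_ge0 ?invr_ge0 ?(ltW h0)//; first by rewrite lerXn2r ?nnegrE ?(ltW h0).
    by rewrite ltW// truncnS_gt.
  apply: (@squeeze_cvgr _ _ _ _ (fun=> 0) (fun n => expR (- n%:R))); last 2 first.
  + exact: cvg_cst.
  + exact: cvgn_expR.
  near=> n; rewrite b andbT.
  by have /andP[] : 0 <= step_poly h x n <= 1 by apply: step_poly_bound; rewrite x0.
Unshelve. all: by end_near. Qed.

End step_polynomial.

(** * Equal cosine transforms imply equal laws *)

Section trig_class.
Context (R : realType) (n : nat).
Context d1 d2 (T1 : measurableType d1) (T2 : measurableType d2).
Variables (P1 : probability T1 R) (P2 : probability T2 R).
Variables (X1 : T1 -> n.-tuple R[i]) (X2 : T2 -> n.-tuple R[i]).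
Hypotheses (mX1 : measurable_fun setT X1) (mX2 : measurable_fun setT X2).
Local Notation E := (n.-tuple R[i]).
Local Notation trig g th y := (cos (real_form g y + th)).

Definition same_trig (F : E -> R) : Prop := forall g th,
  \int[P1]_w (F (X1 w) * trig g th (X1 w)) = \int[P2]_w (F (X2 w) * trig g th (X2 w)).

(* A class closed under multiplication by cosines and under bounded pointwise
   limits; it reaches the indicators of boxes, which generate the sigma-algebra. *)
Definition trig_test (F : E -> R) : Prop :=
  [/\ measurable_fun setT F, exists M, forall y, `|F y| <= M & same_trig F].

Hypothesis same_charfun : forall g th,
  \int[P1]_w trig g th (X1 w) = \int[P2]_w trig g th (X2 w).

Lemma measurable_trig g th : measurable_fun setT (fun y : E => trig g th y).
Proof.
apply: measurableT_comp; first exact: measurable_cos.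
by apply: measurable_funD => //; exact: measurable_real_form.
Qed.

Lemma trig_integrable d (T : measurableType d) (P : probability T R) (X : T -> E)
    (F : E -> R) g th : measurable_fun setT X -> measurable_fun setT F ->
  (exists M, forall y, `|F y| <= M) ->
  P.-integrable setT (fun w => (F (X w) * trig g th (X w))%:E).
Proof.
move=> mX mF [M FM]; apply: (@bounded_integrable _ _ _ P _ M).
  apply: measurable_funM; first exact: measurableT_comp.
  by apply: (measurableT_comp (measurable_trig g th)).
by move=> w; rewrite normrM (le_trans _ (FM (X w)))// ler_piMr// cos_max.
Qed.

Lemma trig_test1 : trig_test (cst 1).
Proof.
split => //; first by exists 1 => y; rewrite normr1.
move=> g th; have := same_charfun g th.
by under eq_Rintegral do rewrite -[cos _]mul1r;
   under [RHS]eq_Rintegral do rewrite -[cos _]mul1r.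
Qed.

Lemma trig_testD F G : trig_test F -> trig_test G -> trig_test (fun y => F y + G y).
Proof.
move=> [mF [M FM] sF] [mG [N GN] sG]; split; first exact: measurable_funD.
  by exists (M + N) => y; rewrite (le_trans (ler_normD _ _))// lerD.
move=> g th; under eq_Rintegral do rewrite mulrDl.
under [RHS]eq_Rintegral do rewrite mulrDl.
by rewrite !RintegralD ?sF ?sG//; apply: trig_integrable => //; [exists M|exists N|exists M|exists N].
Qed.

Lemma trig_testZ (c : R) F : trig_test F -> trig_test (fun y => c * F y).
Proof.
move=> [mF [M FM] sF]; split; first exact: measurable_funM.
  by exists (`|c| * M) => y; rewrite normrM ler_wpM2l.
move=> g th; under eq_Rintegral do rewrite -mulrA.
under [RHS]eq_Rintegral do rewrite -mulrA.
by rewrite !RintegralZl ?sF//; apply: trig_integrable => //; exists M.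
Qed.

(** The product-to-sum formula absorbs the new cosine into the frequency and phase over which
    [same_trig] quantifies. *)
Lemma trig_testM_cos F h eta : trig_test F ->
  trig_test (fun y => F y * trig h eta y).
Proof.
move=> [mF [M FM] sF]; split.
- by apply: measurable_funM => //; exact: measurable_trig.
- by exists M => y; rewrite normrM (le_trans _ (FM y))// ler_piMr// cos_max.
move=> g th.
have E y : F y * trig h eta y * trig g th y =
    2^-1 * (F y * trig (fun i => h i + g i) (eta + th) y) +
    2^-1 * (F y * trig (fun i => h i - g i) (eta - th) y).
  rewrite -mulrDr -mulrDr [RHS]mulrCA -mulrA; congr (_ * _).
  rewrite real_formD real_formB.
  have -> : real_form h y + real_form g y + (eta + th) =
    (real_form h y + eta) + (real_form g y + th) by ring.
  have -> : real_form h y - real_form g y + (eta - th) =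
    (real_form h y + eta) - (real_form g y + th) by ring.
  by rewrite [cos (_ + _ + _)]cosD cosB; field.
under eq_Rintegral do rewrite E.
under [RHS]eq_Rintegral do rewrite E.
have eM : exists M, forall y, `|F y| <= M by exists M.
rewrite !RintegralD//; try by apply: integrableZR; exact: trig_integrable.
by rewrite !RintegralZl// ?sF//; exact: trig_integrable.
Qed.

Lemma trig_test_cvg (F : nat -> E -> R) (G : E -> R) (M : R) :
  (forall k, trig_test (F k)) -> (forall k y, `|F k y| <= M) ->
  (forall y, F k y @[k --> \oo] --> G y) -> trig_test G.
Proof.
move=> tF FM FG.
have mF k : measurable_fun setT (F k) by have [] := tF k.
have mG : measurable_fun setT G.
  by apply: (@measurable_fun_cvg _ _ _ setT F) => // y _; exact: FG.
have GM y : `|G y| <= M.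
  have h : `|F k y| @[k --> \oo] --> `|G y| by apply: cvg_norm; exact: FG.
  rewrite -(cvg_lim _ h)//; apply: limr_le; first by apply/cvg_ex; eexists; exact: h.
  by near=> k; exact: FM.
split => //; first by exists M.
move=> g th.
have dc d (T : measurableType d) (P : probability T R) (X : T -> E) :
    measurable_fun setT X ->
    \int[P]_w (F k (X w) * trig g th (X w)) @[k --> \oo] -->
    \int[P]_w (G (X w) * trig g th (X w)).
  move=> mX; apply: fine_cvg; rewrite fineK; last first.
    apply: (@integrable_fin_num _ _ _ P) => //.
    by apply: trig_integrable => //; exists M.
  have mXt : measurable_fun setT (fun w => trig g th (X w)).
    exact: (measurableT_comp (measurable_trig g th)).
  have := @dominated_convergence _ _ _ P setT measurableT
    (fun k w => (F k (X w) * trig g th (X w))%:E)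
    (fun w => (G (X w) * trig g th (X w))%:E) (cst M%:E).
  case => //.
  - by move=> k; apply/measurable_EFinP; apply: measurable_funM => //; exact: measurableT_comp.
  - by apply/measurable_EFinP; apply: measurable_funM => //; exact: measurableT_comp.
  - apply: aeW => w _; apply: cvg_EFin; first exact: nearW.
    by apply: cvgM; [exact: FG|exact: cvg_cst].
  - exact: finite_measure_integrable_cst.
  - apply: aeW => w k _ /=; rewrite lee_fin normrM (le_trans _ (FM k (X w)))//.
    by rewrite ler_piMr// cos_max.
have h1 := dc _ _ P1 X1 mX1; have h2 := dc _ _ P2 X2 mX2.
have e : (fun k => \int[P1]_w (F k (X1 w) * trig g th (X1 w))) =
    (fun k => \int[P2]_w (F k (X2 w) * trig g th (X2 w))).
  by apply/funext => k; have [_ _] := tF k; apply.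
by rewrite -(cvg_lim _ h1)// -(cvg_lim _ h2)// e.
Unshelve. all: by end_near. Qed.

End trig_class.
Section trig_uniqueness.
Context (R : realType) (n : nat).
Context d1 d2 (T1 : measurableType d1) (T2 : measurableType d2).
Variables (P1 : probability T1 R) (P2 : probability T2 R).
Variables (X1 : T1 -> n.-tuple R[i]) (X2 : T2 -> n.-tuple R[i]).
Hypotheses (mX1 : measurable_fun setT X1) (mX2 : measurable_fun setT X2).
Local Notation E := (n.-tuple R[i]).
Local Notation test := (trig_test P1 P2 X1 X2).

Lemma trig_testM_cos2 (F : E -> R) h a (L : R) : test F ->
  test (fun y => F y * cos ((real_form h y - a) / L) ^+ 2).
Proof.
move=> tF; pose t := L^-1.
have E y : F y * cos ((real_form h y - a) / L) ^+ 2 =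
    2^-1 * F y + 2^-1 * (F y * cos (real_form (fun i => (2 * t)%:C * h i) y + - (2 * t * a))).
  rewrite real_formZ -mulrDr.
  have -> : 2 * t * real_form h y + - (2 * t * a) =
    (real_form h y - a) / L + (real_form h y - a) / L by rewrite /t; ring.
  by rewrite cosD -!expr2 sin2cos2; field.
rewrite (funext E).
apply: trig_testD => //; first exact: trig_testZ.
by apply: trig_testZ => //; exact: trig_testM_cos.
Qed.

Lemma trig_testM_expr (F H : E -> R) : (forall G, test G -> test (fun y => G y * H y)) ->
  test F -> forall k, test (fun y => F y * H y ^+ k).
Proof.
move=> tH tF; elim=> [|k ih].
  by rewrite (_ : (fun y => _) = F)//; apply/funext => y; rewrite expr0 mulr1.
rewrite (_ : (fun y => _) = fun y => F y * H y ^+ k * H y); first exact: tH.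
by apply/funext => y; rewrite exprSr mulrA.
Qed.

(** Polynomials in the squared cosine stay in the class, and [1 - step_poly] tends to the indicator
    of cos^2 >= cos^2(r / L). In terms of the linear form this is a union of slabs of half-width [r]
    around [a], repeated with period pi L. *)
Lemma trig_testM_step (F : E -> R) h a (L r : R) : 0 < L -> 0 <= r < L ->
  test F -> test (fun y => F y * (~~ (cos ((real_form h y - a) / L) ^+ 2 < cos (r / L) ^+ 2))%:R).
Proof.
move=> L0 /andP[r0 rL] tF.
have rL1 : 0 <= r / L < 1 by rewrite (divr_ge0 r0 (ltW L0))/= ltr_pdivrMr// mul1r.
have c0 : 0 < cos (r / L) ^+ 2 <= 1.
  rewrite exprn_gt0/=; last first.
    apply: cos_gt0_pihalf; move/andP: rL1 => [a0 a1].
    rewrite (lt_le_trans _ a0) ?oppr_lt0 ?divr_gt0 ?pi_gt0//= (lt_le_trans a1)//.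
    by rewrite ler_pdivlMr// mul1r pi_ge2.
  by rewrite -real_normK ?num_real// exprn_ile1// cos_max.
have [mF [M FM] _] := tF.
pose H y := cos ((real_form h y - a) / L) ^+ 2.
have H01 y : 0 <= H y <= 1.
  by rewrite /H sqr_ge0/= -real_normK ?num_real// exprn_ile1// cos_max.
have tG k : test (fun y => F y * (1 - step_poly (cos (r / L) ^+ 2) (H y) k)).
  rewrite (_ : (fun y => _) = fun y => F y + -1 * (F y * step_poly (cos (r / L) ^+ 2) (H y) k)); last first.
    by apply/funext => y; rewrite mulrBr mulr1 mulN1r.
  apply: trig_testD => //; apply: trig_testZ => //.
  apply: (@trig_testM_expr F (fun y => 1 - H y ^+ k)) => // G tG.
  rewrite (_ : (fun y => _) = fun y => G y + -1 * (G y * H y ^+ k)); last first.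
    by apply/funext => y; rewrite mulrBr mulr1 mulN1r.
  apply: trig_testD => //; apply: trig_testZ => //.
  by apply: (@trig_testM_expr G H) => // G' tG'; exact: trig_testM_cos2.
apply: (trig_test_cvg mX1 mX2 (M := M) tG).
- move=> k y; rewrite normrM (le_trans _ (FM y))// ler_piMr//.
  have /andP[s0 s1] := @step_poly_bound R (cos (r / L) ^+ 2) (H y) k (H01 y).
  by rewrite ler_norml; apply/andP; split; lra.
- move=> y; apply: cvgM; first exact: cvg_cst.
  rewrite (_ : (~~ _)%:R = 1 - (H y < cos (r / L) ^+ 2)%R%:R); last first.
    by rewrite /H; case: ltP => _; rewrite ?subrr ?subr0.
  by apply: (@cvgB _ R^o); [exact: cvg_cst|exact: cvg_step_poly].
Qed.

(** Let the period grow: for a fixed point, [L k] eventually exceeds both [r] and the distance to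
    [a]. Both angles are then below 1 < pi / 2, where the cosine decreases, and only the central
    slab is left. *)
Lemma trig_testM_ball (F : E -> R) h a (r : R) : 0 <= r ->
  test F -> test (fun y => F y * (`|real_form h y - a| <= r)%R%:R).
Proof.
move=> r0 tF; have [mF [M FM] _] := tF.
pose L k : R := r + k.+1%:R.
have L0 k : 0 < L k by rewrite ltr_wpDl.
have rL k : 0 <= r < L k by rewrite r0/= ltrDl.
apply: (trig_test_cvg mX1 mX2 (M := M) (F := fun k y => F y *
  (~~ (cos ((real_form h y - a) / L k) ^+ 2 < cos (r / L k) ^+ 2))%:R)).
- by move=> k; exact: trig_testM_step.
- move=> k y; rewrite normrM (le_trans _ (FM y))// ler_piMr//.
  by case: (~~ _); rewrite ?normr1 ?normr0.
- move=> y; apply: cvgM; first exact: cvg_cst.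
  apply: (@cvg_trans _ ((fun=> (`|real_form h y - a| <= r)%R%:R : R) @ \oo)); last exact: cvg_cst.
  apply: near_eq_cvg; near=> k.
  set x := real_form h y - a.
  have xL : `|x| / L k < 1.
    rewrite ltr_pdivrMr// mul1r /L ltr_wpDl//; near: k.
    exists (Num.truncn `|x|) => // k /= hk; rewrite (lt_le_trans (truncnS_gt _))//.
    by rewrite ler_nat ltnS.
  have rL1 : r / L k < 1 by rewrite ltr_pdivrMr// mul1r /L ltrDl.
  have p2 : 1 <= pi / 2 :> R by rewrite ler_pdivlMr// mul1r pi_ge2.
  have e : cos (x / L k) = cos (`|x| / L k).
    by case: (ger0P x) => // _; rewrite mulNr cosN.
  rewrite e -leNgt; congr (_%:R).
  have cpos (u : R) : 0 <= u < 1 -> 0 <= cos u.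
    move=> /andP[u0 u1]; apply: cos_ge0_pihalf; rewrite (le_trans _ u0) ?oppr_le0 ?divr_ge0 ?pi_ge0//=.
    by rewrite (le_trans (ltW u1)).
  have xx : 0 <= `|x| / L k < 1 by rewrite xL divr_ge0// ltW.
  have rr : 0 <= r / L k < 1 by rewrite rL1 divr_ge0// ltW.
  rewrite ler_pXn2r// ?nnegrE ?cpos//.
  have -> : (cos (r / L k) <= cos (`|x| / L k)) = (`|x| / L k <= r / L k).
    have p1 : 1 <= pi :> R by rewrite (le_trans _ (@pi_ge2 R))// ler1n.
    rewrite !leNgt; congr (~~ _); apply: ltr_cos; rewrite in_itv/=; apply/andP.
      by move/andP: rr => [-> /ltW/le_trans ->].
    by move/andP: xx => [-> /ltW/le_trans ->].
  by rewrite ler_pM2r ?invr_gt0.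
Unshelve. all: by end_near. Qed.

Hypothesis same_charfun : forall g th,
  \int[P1]_w cos (real_form g (X1 w) + th) = \int[P2]_w cos (real_form g (X2 w) + th).

(* The absolute value of the radius makes every list of triples a valid box. *)
Definition box (s : seq (('I_n -> R[i]) * R * R)) : set E :=
  [set y | all (fun c => `|real_form c.1.1 y - c.1.2| <= `|c.2|) s].

Lemma trig_test_box s : test (fun y => (all (fun c : ('I_n -> R[i]) * R * R =>
  `|real_form c.1.1 y - c.1.2| <= `|c.2|) s)%:R).
Proof.
elim: s => [|c s ih].
  by rewrite (_ : (fun y => _) = cst 1)//; exact: trig_test1.
rewrite (_ : (fun y => _) = fun y => (all (fun c : ('I_n -> R[i]) * R * R =>
  `|real_form c.1.1 y - c.1.2| <= `|c.2|) s)%:R * (`|real_form c.1.1 y - c.1.2| <= `|c.2|)%R%:R).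
  exact: trig_testM_ball.
by apply/funext => y /=; rewrite andbC -natrM mulnb.
Qed.

Lemma measurable_box s : measurable (box s).
Proof.
have [mF _ _] := trig_test_box s.
have := mF measurableT [set 1] (measurable_set1 _); rewrite setTI.
congr measurable; apply/seteqP; split => y; rewrite /box /=.
  by case: (all _ _) => // /eqP; rewrite eq_sym oner_eq0.
by move=> ->.
Qed.

Lemma same_law_box s : P1 (X1 @^-1` box s) = P2 (X2 @^-1` box s).
Proof.
(* Zero frequency and zero phase reduce the test to the integral of the indicator. *)
have [_ _ /(_ (fun=> 0) 0)] := trig_test_box s.
have E d (T : measurableType d) (P : probability T R) (X : T -> E) : measurable_fun setT X ->
    \int[P]_w ((all (fun c : ('I_n -> R[i]) * R * R =>
      `|real_form c.1.1 (X w) - c.1.2| <= `|c.2|) s)%:R * cos (real_form (fun=> 0) (X w) + 0)) =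
    fine (P (X @^-1` box s)).
  move=> mX.
  have mXb : measurable (X @^-1` box s) by rewrite -[X in measurable X]setTI; apply: mX => //; exact: measurable_box.
  have -> : fine (P (X @^-1` box s)) = fine (\int[P]_w (\1_(X @^-1` box s) w)%:E).
    by rewrite integral_indic// setIT.
  congr fine; apply: eq_integral => w _.
  rewrite real_form0 addr0 cos0 mulr1 indicE; congr ((nat_of_bool _)%:R%:E).
  by apply/idP/idP => [h|/set_mem//]; apply/mem_set.
have f1 : P1 (X1 @^-1` box s) \is a fin_num.
  apply: fin_num_measure; rewrite -[X in measurable X]setTI.
  by apply: mX1 => //; exact: measurable_box.
have f2 : P2 (X2 @^-1` box s) \is a fin_num.
  apply: fin_num_measure; rewrite -[X in measurable X]setTI.
  by apply: mX2 => //; exact: measurable_box.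
by rewrite !E// => h; rewrite -(fineK f1) -(fineK f2) h.
Qed.

(** Boxes are stable under intersection, by concatenation of the lists, and every real linear form
    is measurable for the sigma-algebra they generate. Among these forms are the real and imaginary
    parts of the coordinates, so the boxes generate all measurable sets. *)
Theorem same_charfun_same_law (A : set E) : measurable A ->
  P1 (X1 @^-1` A) = P2 (X2 @^-1` A).
Proof.
move=> mA.
pose G : set (set E) := range box.
have mG : G `<=` measurable by move=> _ [s _ <-]; exact: measurable_box.
apply: (@g_sigma_algebra_measure_unique _ R _ G mG (fun=> setT) _ _
  (pushforward P1 X1) (pushforward P2 X2)).
- by move=> _; exists [::] => //; apply/seteqP; split.
- by apply/seteqP; split => // y _; exists 0%N.
- move=> _ _ [s _ <-] [t _ <-]; exists (s ++ t) => //.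
  by apply/seteqP; split => y; rewrite /box/= all_cat; [move/andP|move=> [-> ->]].
- by move=> _ [s _ <-]; exact: same_law_box.
- by move=> _; rewrite /= /pushforward preimage_setT probability_setT ltry.
have mid : measurable_fun setT (id : g_sigma_algebraType G -> E).
  have mrf g : measurable_fun setT (real_form g : g_sigma_algebraType G -> R).
    apply: (measurability (@RGenCInfty.G R)) => [|/= _ [_] [x] -> <-].
      exact: RGenCInfty.measurableE.
    (* The half-line from [x] upwards is the union of the intervals [x, x + 2 k], that is, of centre
       x + k and radius k. *)
    rewrite setTI (_ : _ @^-1` _ = \bigcup_k box [:: (g, x + k%:R, k%:R)]).
      by apply: bigcupT_measurable => k; apply: sub_sigma_algebra; exists [:: (g, x + k%:R, k%:R)].
    apply/seteqP; split => y; rewrite /= in_itv/= andbT.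
      move=> xy; exists (Num.truncn (real_form g y - x)).+1 => //.
      rewrite /box/= andbT normr_nat ler_norml; have := truncnS_gt (real_form g y - x).
      by move=> h; apply/andP; split; lra.
    by move=> [k _]; rewrite /box/= andbT normr_nat ler_norml => /andP[h _]; lra.
  apply/measurable_fun_tnthP => i; apply/measurable_fun_complexP; split.
    by apply: eq_measurable_fun (mrf (fun j => (j == i)%:R)) => y _ /=; rewrite real_form_Re.
  by apply: eq_measurable_fun (mrf (fun j => if j == i then - 'i%C else 0)) => y _ /=; rewrite real_form_Im.
by have := mid measurableT A mA; rewrite setTI.
Qed.

End trig_uniqueness.

(** * Independence *)

Section independence.
Context d (T : measurableType d) (R : realType) (P : probability T R).

Lemma integrableM_bounded (G F : T -> R) (M : R) :
  P.-integrable setT (fun w => (G w)%:E) -> measurable_fun setT F ->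
  (forall w, `|F w| <= M) -> P.-integrable setT (fun w => (G w * F w)%:E).
Proof.
move=> iG mF FM.
have mG : measurable_fun setT G by exact/measurable_EFinP/(measurable_int P).
apply: (@le_integrableR _ _ _ P _ (fun w => M * `|G w|)).
- exact: measurable_funM.
- by move=> w; rewrite normrM mulrC ler_wpM2r.
- by apply: integrableZR; exact: (integrable_abse iG).
Qed.

Section one_variable.
Context d' (E : measurableType d') (X : T -> E) (G : T -> R).
Hypotheses (mX : measurable_fun setT X) (iG : P.-integrable setT (fun w => (G w)%:E)).
Hypothesis GX : forall A, measurable A ->
  \int[P]_w (G w * \1_A (X w)) = \int[P]_w G w * fine (P (X @^-1` A)).

Let mG : measurable_fun setT G.
Proof. exact/measurable_EFinP/(measurable_int P). Qed.

Let GX1 A : measurable A ->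
  \int[P]_w (G w * \1_A (X w)) = \int[P]_w G w * \int[P]_w \1_A (X w).
Proof.
move=> mA; rewrite GX//; congr (_ * fine _).
have mXA : measurable (X @^-1` A) by rewrite -[X in measurable X]setTI; exact: mX.
by rewrite -[in LHS](setIT (X @^-1` A)) -integral_indic.
Qed.

(** [GX] gives the product rule for indicators, hence for the staircase [Fk k] of mesh 1 / (k + 1),
    which is uniformly that close to [F]; the resulting error is a constant over k + 1. The strict
    bound on [F] keeps the index of the stair below k + 1. *)
Lemma indep_unit_interval (F : E -> R) : measurable_fun setT F ->
  (forall x, 0 <= F x < 1) ->
  \int[P]_w (G w * F (X w)) = \int[P]_w G w * \int[P]_w F (X w).
Proof.
move=> mF F01.
pose A k j := F @^-1` `[j%:R / k.+1%:R, j.+1%:R / k.+1%:R[%classic.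
have mA k j : measurable (A k j).
  by rewrite -[X in measurable X]setTI; apply: mF => //; exact: measurable_itv.
pose Fk k x : R := \sum_(j < k.+1) (j%:R / k.+1%:R) * \1_(A k j) x.
have FkE k x : Fk k x <= F x < Fk k x + k.+1%:R^-1.
  have kp : 0 < k.+1%:R :> R by [].
  have [F0 F1] := andP (F01 x).
  have kF0 : 0 <= k.+1%:R * F x by rewrite mulr_ge0.
  pose j0 := Num.truncn (k.+1%:R * F x).
  have /andP[j1 j2] : j0%:R <= k.+1%:R * F x < j0.+1%:R by exact: truncn_itv.
  have j0k : (j0 < k.+1)%N.
    by rewrite -(ltr_nat R) (le_lt_trans j1)// gtr_pMr.
  have -> : Fk k x = j0%:R / k.+1%:R.
    rewrite /Fk (bigD1 (Ordinal j0k))//= big1 ?addr0.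
      rewrite indicE mem_set ?mulr1//= /A/= in_itv/=.
      by rewrite ler_pdivrMr// ltr_pdivlMr// mulrC j1 j2.
    move=> j jj0; rewrite indicE memNset ?mulr0// /A/= in_itv/=.
    rewrite ler_pdivrMr// ltr_pdivlMr// [F x * _]mulrC => /andP[a1 a2].
    have l1 : (j < j0.+1)%N by rewrite -(ltr_nat R) (le_lt_trans a1 j2).
    have l2 : (j0 < j.+1)%N by rewrite -(ltr_nat R) (le_lt_trans j1 a2).
    move/eqP: jj0; apply; apply/val_inj => /=; apply/eqP; rewrite eqn_leq.
    by rewrite -ltnS l1 -ltnS l2.
  rewrite ler_pdivrMr// [F x * _]mulrC j1/= -[X in _ + X]mul1r -mulrDl ltr_pdivlMr//.
  by rewrite natr1 mulrC.
have mFk k : measurable_fun setT (Fk k).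
  by apply: measurable_sum => j; apply: measurable_funM.
have mFkX k : measurable_fun setT (fun w => Fk k (X w)) by exact: measurableT_comp.
have mFX : measurable_fun setT (fun w => F (X w)) by exact: measurableT_comp.
have bnd k : `|F (X k)| <= 1 by have /andP[a b] := F01 (X k); rewrite ger0_norm// ltW.
have iGF : P.-integrable setT (fun w => (G w * F (X w))%:E) by exact: (integrableM_bounded (M := 1)).
have iF : P.-integrable setT (fun w => (F (X w))%:E).
  by apply: (@bounded_integrable _ _ _ P _ 1).
have diff k w : `|F (X w) - Fk k (X w)| <= k.+1%:R^-1.
  have /andP[a b] := FkE k (X w); rewrite ger0_norm ?subr_ge0//.
  by rewrite lerBlDl ltW.
have FkM k w : `|Fk k (X w)| <= 2.
  rewrite -[Fk k (X w)](subKr (F (X w))) (le_trans (ler_normB _ _))//.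
  rewrite (_ : 2 = 1 + 1)// lerD//; rewrite (le_trans (diff k w))//.
  by rewrite invf_le1// ler1n.
have iGFk k : P.-integrable setT (fun w => (G w * Fk k (X w))%:E).
  exact: (integrableM_bounded (M := 2)).
have iFk k : P.-integrable setT (fun w => (Fk k (X w))%:E).
  by apply: (@bounded_integrable _ _ _ P _ 2).
have eqk k : \int[P]_w (G w * Fk k (X w)) = \int[P]_w G w * \int[P]_w Fk k (X w).
  have mi j : measurable_fun setT (fun w : T => \1_(A k j) (X w) : R).
    by apply: measurableT_comp.
  have bi j w : `|\1_(A k j) (X w) : R| <= 1.
    by rewrite indicE; case: (_ \in _); rewrite ?normr1 ?normr0.
  under eq_Rintegral do rewrite mulr_sumr.
  rewrite !Rintegral_sum; last 2 first.
  - by move=> j _; apply: integrableZR; apply: (@bounded_integrable _ _ _ P _ 1).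
  - move=> j _; under eq_fun do rewrite mulrCA.
    by apply: integrableZR; exact: (integrableM_bounded (M := 1)).
  rewrite mulr_sumr; apply: eq_bigr => j _.
  under eq_Rintegral do rewrite mulrCA.
  rewrite !RintegralZl//; last 2 first.
  - by apply: (@bounded_integrable _ _ _ P _ 1).
  - exact: (integrableM_bounded (M := 1)).
  by rewrite GX1// mulrCA.
set a := LHS; set b := RHS; set g := \int[P]_w G w.
pose C := \int[P]_w `|G w| + `|g|.
have C0 : 0 <= C by rewrite addr_ge0// Rintegral_ge0.
have key k : `|a - b| <= C * k.+1%:R^-1.
  have -> : a - b = \int[P]_w (G w * (F (X w) - Fk k (X w))) -
      g * \int[P]_w (F (X w) - Fk k (X w)).
    have -> : \int[P]_w (G w * (F (X w) - Fk k (X w))) = a - \int[P]_w (G w * Fk k (X w)).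
      transitivity (\int[P]_w (G w * F (X w) - G w * Fk k (X w))).
        by apply: eq_Rintegral => w _; rewrite mulrBr.
      by rewrite RintegralB//; exact: iGFk.
    rewrite RintegralB//; last exact: iFk.
    by rewrite eqk /b -/g; ring.
  rewrite (le_trans (ler_normB _ _))// /C mulrDl lerD//.
    have iD : P.-integrable setT (fun w => (G w * (F (X w) - Fk k (X w)))%:E).
      apply: (integrableM_bounded (M := k.+1%:R^-1)) => //.
      exact: measurable_funB.
    rewrite (le_trans (le_normr_Rintegral _ _))// -RintegralZr//; last exact: (integrable_abse iG).
    apply: le_Rintegral => //.
    - exact: (integrable_abse iD).
    - under eq_fun do rewrite /= mulrC.
      by apply: integrableZR; exact: (integrable_abse iG).
    - by move=> w _; rewrite normrM ler_wpM2l.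
  rewrite normrM ler_wpM2l// (le_trans (le_normr_Rintegral _ _))//; first exact: integrableBR.
  rewrite -[leRHS](Rintegral_cst1 P); apply: le_Rintegral => //.
  - exact: (integrable_abse (integrableBR iF (iFk k))).
  - exact: finite_measure_integrable_cst.
apply/eqP; rewrite -subr_eq0 -normr_le0; apply/ler_addgt0Pr => e e0.
rewrite add0r (le_trans (key (Num.truncn (C / e))))//.
by rewrite ler_pdivrMr// mulrC -ler_pdivrMr// ltW// truncnS_gt.
Qed.

Lemma indep_bounded (F : E -> R) (M : R) : measurable_fun setT F ->
  (forall x, `|F x| <= M) ->
  \int[P]_w (G w * F (X w)) = \int[P]_w G w * \int[P]_w F (X w).
Proof.
move=> mF FM.
(* A point of [T], which exists because [P] has mass 1, is what yields [0 <= M]. *)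
have [T0|/set0P[w0 _]] := eqVneq [set: T] set0.
  by have := probability_setT P; rewrite T0 measure0 => /esym/eqP; rewrite onee_eq0.
have M0 : 0 <= M by rewrite (le_trans _ (FM (X w0))).
(* The summand 1 keeps [c] positive for M = 0 and [F'] strictly below 1. *)
pose c := 2 * M + 1; have c0 : 0 < c by rewrite ltr_wpDl// mulr_ge0.
pose F' x := (F x + M) / c.
have F'01 x : 0 <= F' x < 1.
  have := FM x; rewrite ler_norml => /andP[a b].
  by rewrite divr_ge0 ?(ltW c0)//= ?ltr_pdivrMr//; rewrite /c; lra.
have mF' : measurable_fun setT F'.
  by apply: measurable_funM => //; exact: measurable_funD.
have FE x : F x = c * F' x - M by rewrite /F' mulrC divfK ?gt_eqF// addrK.
have iF' : P.-integrable setT (fun w => (F' (X w))%:E).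
  apply: (@bounded_integrable _ _ _ P _ 1); first exact: measurableT_comp.
  by move=> w; have /andP[a b] := F'01 (X w); rewrite ger0_norm// ltW.
have iGF' : P.-integrable setT (fun w => (G w * F' (X w))%:E).
  apply: (integrableM_bounded (M := 1)) => //; first exact: measurableT_comp.
  by move=> w; have /andP[a b] := F'01 (X w); rewrite ger0_norm// ltW.
have e1 : \int[P]_w F (X w) = c * \int[P]_w F' (X w) - M.
  under eq_Rintegral do rewrite FE.
  rewrite RintegralB//; last 2 first.
  - exact: integrableZR.
  - exact: finite_measure_integrable_cst.
  by rewrite RintegralZl// Rintegral_cst1.
have e2 : \int[P]_w (G w * F (X w)) = c * \int[P]_w (G w * F' (X w)) - M * \int[P]_w G w.
  transitivity (\int[P]_w (c * (G w * F' (X w)) - M * G w)).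
    by apply: eq_Rintegral => w _; rewrite FE; ring.
  rewrite RintegralB//; last 2 first.
  - exact: integrableZR.
  - exact: integrableZR.
  by rewrite !RintegralZl.
by rewrite e1 e2 indep_unit_interval//; ring.
Qed.

Lemma indep_integrable (F : E -> R) : measurable_fun setT F ->
  P.-integrable setT (fun w => (F (X w))%:E) ->
  P.-integrable setT (fun w => (G w * F (X w))%:E) ->
  \int[P]_w (G w * F (X w)) = \int[P]_w G w * \int[P]_w F (X w).
Proof.
move=> mF iF iGF.
pose Fk k x := if `|F x| <= k%:R then F x else 0.
have mFk k : measurable_fun setT (Fk k).
  apply: measurable_fun_if => //.
  - by apply: (measurable_fun_ler _ _) => //; exact: measurableT_comp.
  - exact: measurable_funTS.
have FkF k x : `|Fk k x| <= `|F x| by rewrite /Fk; case: ifP => // _; rewrite normr0.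
have Fkb k x : `|Fk k x| <= k%:R by rewrite /Fk; case: ifP => // _; rewrite normr0.
have Fkc x : Fk k x @[k --> \oo] --> F x.
  apply: (@cvg_trans _ ((fun=> F x) @ \oo)); last exact: cvg_cst.
  apply: near_eq_cvg; near=> k; rewrite /Fk ifT//; near: k.
  exists (Num.truncn `|F x|).+1 => // k /= hk.
  by rewrite (le_trans (ltW (truncnS_gt _)))// ler_nat.
have dc (U : T -> R) : measurable_fun setT U -> P.-integrable setT (fun w => (U w * F (X w))%:E) ->
    \int[P]_w (U w * Fk k (X w)) @[k --> \oo] --> \int[P]_w (U w * F (X w)).
  move=> mU iU; apply: fine_cvg; rewrite fineK; last exact: integrable_fin_num iU.
  have := @dominated_convergence _ _ _ P setT measurableT
    (fun k w => (U w * Fk k (X w))%:E) (fun w => (U w * F (X w))%:E)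
    (fun w => `|(U w * F (X w))%:E|%E).
  case => //.
  - move=> k; apply/measurable_EFinP; apply: measurable_funM => //; exact: measurableT_comp.
  - exact: (measurable_int P).
  - apply: aeW => w _; apply: cvg_EFin; first exact: nearW.
    by apply: cvgM; [exact: cvg_cst|exact: Fkc].
  - exact: integrable_abse.
  - by apply: aeW => w k _; rewrite lee_fin !normrM ler_wpM2l.
have h1 := dc G mG iGF.
have h2 : \int[P]_w Fk k (X w) @[k --> \oo] --> \int[P]_w F (X w).
  have := dc (cst 1) (@measurable_cst _ _ _ _ _ _).
  under eq_fun do rewrite mul1r; move=> /(_ iF).
  rewrite (_ : (fun k => _) = fun k => \int[P]_w Fk k (X w)); last first.
    by apply/funext => k; apply: eq_Rintegral => w _; rewrite mul1r.
  by rewrite (_ : \int[P]_w (cst 1 w * F (X w)) = \int[P]_w F (X w))//; apply: eq_Rintegral => w _; rewrite mul1r.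
rewrite -(cvg_lim _ h1)//; apply/cvg_lim => //.
rewrite (_ : (fun k => _) = fun k => \int[P]_w G w * \int[P]_w Fk k (X w)).
  by apply: cvgM; [exact: cvg_cst|exact: h2].
by apply/funext => k; apply: (indep_bounded (M := k%:R)).
Unshelve. all: by end_near. Qed.

End one_variable.

(** The one-variable result is used twice: with [f (X w)] as fixed factor and [Y] as variable, and,
    to verify its hypothesis on indicators, with an indicator of [Y] as fixed factor and [X] as
    variable. *)
Lemma indep_pair d1 d2 (E1 : measurableType d1) (E2 : measurableType d2)
    (X : T -> E1) (Y : T -> E2) (f : E1 -> R) (g : E2 -> R) :
  measurable_fun setT X -> measurable_fun setT Y ->
  (forall A B, measurable A -> measurable B ->
    P (X @^-1` A `&` Y @^-1` B) = (P (X @^-1` A) * P (Y @^-1` B))%E) ->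
  measurable_fun setT f -> measurable_fun setT g ->
  P.-integrable setT (fun w => (f (X w))%:E) ->
  P.-integrable setT (fun w => (g (Y w))%:E) ->
  P.-integrable setT (fun w => (f (X w) * g (Y w))%:E) ->
  \int[P]_w (f (X w) * g (Y w)) = \int[P]_w f (X w) * \int[P]_w g (Y w).
Proof.
move=> mX mY XY mf mg iF ig ifg.
apply: indep_integrable => // B mB.
have mXA A : measurable A -> measurable (X @^-1` A).
  by move=> mA; rewrite -[X in measurable X]setTI; exact: mX.
have mYB A : measurable A -> measurable (Y @^-1` A).
  by move=> mA; rewrite -[X in measurable X]setTI; exact: mY.
have iI (C : set T) : measurable C -> \int[P]_w \1_C w = fine (P C).
  by move=> mC; rewrite /Rintegral integral_indic// setIT.
have mi : measurable_fun setT (fun w => \1_B (Y w) : R) by exact: measurableT_comp.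
have bi w : `|\1_B (Y w) : R| <= 1.
  by rewrite indicE; case: (_ \in _); rewrite ?normr1 ?normr0.
have ii : P.-integrable setT (fun w => (\1_B (Y w) : R)%:E).
  by apply: (@bounded_integrable _ _ _ P _ 1).
under eq_Rintegral do rewrite mulrC.
rewrite (@indep_integrable _ _ X (fun w => \1_B (Y w)))//.
- by rewrite mulrC (iI (Y @^-1` B))//; exact: mYB.
- move=> A mA.
  transitivity (\int[P]_w \1_(X @^-1` A `&` Y @^-1` B) w).
    by apply: eq_Rintegral => w _; rewrite mulrC indicI.
  rewrite iI ?XY//; last by apply: measurableI; [exact: mXA|exact: mYB].
  rewrite fineM ?fin_num_measure//; [|exact: mXA|exact: mYB].
  by rewrite mulrC -(iI (Y @^-1` B))//; exact: mYB.
- under eq_fun do rewrite mulrC.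
  exact: (integrableM_bounded (M := 1)).
Qed.

(** Since the one-variable hypothesis holds at every phase, it also says that the weighted sine
    transform vanishes. Hence the sine terms of the addition formula disappear and the cosine
    transforms multiply. *)
Lemma indep_family (I : eqType) (w : I -> T -> R[i]) (f ph : I -> R[i] -> R)
    (kappa : I -> R) (s : seq I) (th : R) :
  (forall i, measurable_fun setT (w i)) ->
  mutually_independent P (fun i => sigma_of (fun _ : unit => w i)) ->
  (forall i, measurable_fun setT (f i)) -> (forall i x, `|f i x| <= 1) ->
  (forall i, measurable_fun setT (ph i)) ->
  (forall i th, \int[P]_t (f i (w i t) * cos (ph i (w i t) + th)) = kappa i * cos th) ->
  uniq s ->
  \int[P]_t (\prod_(i <- s) f i (w i t) * cos (\sum_(i <- s) ph i (w i t) + th)) =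
  \prod_(i <- s) kappa i * cos th.
Proof.
move=> mw iw mf f1 mph fph us.
have mwA i A : measurable A -> measurable (w i @^-1` A).
  by move=> mA; rewrite -[X in measurable X]setTI; exact: mw.
pose U s1 s2 (A : I -> set R[i]) th t := \prod_(i <- s1) f i (w i t) *
  cos (\sum_(i <- s1) ph i (w i t) + th) * \prod_(i <- s2) \1_(A i) (w i t).
have mU s1 s2 A th' : (forall i, measurable (A i)) -> measurable_fun setT (U s1 s2 A th').
  move=> mA; apply: measurable_funM; first apply: measurable_funM.
  - by apply: measurable_prod => i _; exact: measurableT_comp.
  - apply: measurableT_comp; first exact: measurable_cos.
    by apply: measurable_funD => //; apply: measurable_sum => i; exact: measurableT_comp.
  - by apply: measurable_prod => i _; apply: measurableT_comp.
have prod1 (r : seq I) (h : I -> R) : (forall i, `|h i| <= 1) -> `|\prod_(i <- r) h i| <= 1.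
  move=> h1; elim: r => [|i r ih]; first by rewrite big_nil normr1.
  by rewrite big_cons normrM mulr_ile1.
have bU s1 s2 A th' t : `|U s1 s2 A th' t| <= 1.
  rewrite /U normrM mulr_ile1//; last first.
    by apply: prod1 => i; rewrite indicE; case: (_ \in _); rewrite ?normr1 ?normr0.
  by rewrite normrM mulr_ile1// ?cos_max// prod1.
have iU s1 s2 A th' : (forall i, measurable (A i)) ->
    P.-integrable setT (fun t => (U s1 s2 A th' t)%:E).
  by move=> mA; apply: (@bounded_integrable _ _ _ P _ 1); [exact: mU|exact: bU].
(* The induction carries indicators of events of further variables: the claim with one more
   indicator is exactly the factorization that [indep_bounded] demands for the next variable. *)
have claim s1 : forall s2 A th', uniq (s1 ++ s2) -> (forall i, measurable (A i)) ->
    \int[P]_t U s1 s2 A th' t =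
    \prod_(i <- s1) kappa i * cos th' * \prod_(i <- s2) fine (P (w i @^-1` A i)).
  elim: s1 => [|j s1 ih] s2 A th' us12 mA.
    transitivity (\int[P]_t (cos th' * \1_(\big[setI/setT]_(i <- s2) (w i @^-1` A i)) t)).
      apply: eq_Rintegral => t _; rewrite /U !big_nil mul1r add0r; congr (_ * _).
      elim: s2 {us12} => [|i s2 ih]; first by rewrite !big_nil indicT.
      by rewrite !big_cons indicI ih.
    have mI : measurable (\big[setI/setT]_(i <- s2) (w i @^-1` A i)).
      by apply: big_ind => //; [exact: measurableI|move=> i _; exact: mwA].
    rewrite RintegralZl//; last first.
      by apply: (@bounded_integrable _ _ _ P _ 1) => // t; rewrite indicE; case: (_ \in _); rewrite ?normr1 ?normr0.
    rewrite big_nil mul1r; congr (_ * _).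
    transitivity (fine (\prod_(i <- s2) P (w i @^-1` A i))%E).
      rewrite /Rintegral integral_indic// setIT; congr fine; apply: iw => // i _.
      apply: sub_sigma_algebra; exists tt => //.
      by exists (A i) => //; rewrite setTI.
    elim: s2 {us12 mI} => [|i s2 ih]; first by rewrite !big_nil.
    rewrite !big_cons fineM ?ih//; first by apply: fin_num_measure; exact: mwA.
    by apply: prode_fin_num => k _; apply: fin_num_measure; exact: mwA.
  move: us12; rewrite /= mem_cat negb_or => /andP[/andP[js1 js2] us12].
  pose F0 x := f j x * cos (ph j x); pose F1 x := f j x * sin (ph j x).
  have mF0 : measurable_fun setT F0.
    by apply: measurable_funM => //; apply: measurableT_comp => //; exact: measurable_cos.
  have mF1 : measurable_fun setT F1.
    by apply: measurable_funM => //; apply: measurableT_comp => //; exact: measurable_sin.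
  have bF0 x : `|F0 x| <= 1 by rewrite normrM mulr_ile1// cos_max.
  have bF1 x : `|F1 x| <= 1 by rewrite normrM mulr_ile1// sin_max.
  have ind th'' B : measurable B ->
      \int[P]_t (U s1 s2 A th'' t * \1_B (w j t)) =
      \int[P]_t U s1 s2 A th'' t * fine (P (w j @^-1` B)).
    (* As [j] does not occur in [s2], its event can be redefined without changing the other
       indicators. *)
    move=> mB; pose A' i := if i == j then B else A i.
    have mA' i : measurable (A' i) by rewrite /A'; case: ifP.
    have EA i : i \in s2 -> A' i = A i.
      by rewrite /A' => is2; rewrite ifF//; apply: contraNF js2 => /eqP <-.
    have -> : \int[P]_t (U s1 s2 A th'' t * \1_B (w j t)) =
        \int[P]_t U s1 (j :: s2) A' th'' t.
      apply: eq_Rintegral => t _; rewrite /U big_cons {1}/A' eqxx -[LHS]mulrA; congr (_ * _).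
      rewrite mulrC; congr (_ * _); apply: eq_big_seq => i is2; by rewrite EA.
    rewrite ih//; last by rewrite cat_uniq/= negb_or js1 andbA andbC; move: us12; rewrite cat_uniq js2 => /and3P[-> -> ->].
    rewrite ih// big_cons {1}/A' eqxx -[RHS]mulrA; congr (_ * _); rewrite mulrC; congr (_ * _).
    by apply: eq_big_seq => i is2; rewrite EA.
  have E t : U (j :: s1) s2 A th' t =
      U s1 s2 A th' t * F0 (w j t) - U s1 s2 A (th' - pi / 2) t * F1 (w j t).
    rewrite /U !big_cons /F0 /F1 addrA cosBpihalf -addrA cosD; ring.
  under eq_Rintegral do rewrite E.
  rewrite RintegralB//; last 2 first.
  - apply: (integrableM_bounded (M := 1)); [exact: iU|exact: measurableT_comp|by move=> t; exact: bF0].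
  - apply: (integrableM_bounded (M := 1)); [exact: iU|exact: measurableT_comp|by move=> t; exact: bF1].
  rewrite !(@indep_bounded _ _ (w j) _ _ _ _ _ 1)//; try exact: iU; try exact: ind.
  have -> : \int[P]_t F0 (w j t) = kappa j.
    rewrite -[RHS]mulr1 -(@cos0 R) -fph; apply: eq_Rintegral => t _.
    by rewrite addr0.
  have -> : \int[P]_t F1 (w j t) = 0.
    rewrite -[RHS](mulr0 (kappa j)) -(@cos_pihalf R) -cosN -fph; apply: eq_Rintegral => t _.
    by rewrite cosBpihalf.
  by rewrite mulr0 subr0 ih// big_cons; ring.
have := claim s [::] (fun=> setT) th; rewrite cats0 => /(_ us (fun=> measurableT)).
rewrite big_nil mulr1 => <-; apply: eq_Rintegral => t _.
by rewrite /U big_nil mulr1.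
Qed.

End independence.

(** * Gaussian densities *)

Section hermitian_matrices.
Context (R : realType) (n : nat).
Local Notation C := R[i].
Local Notation conj := (@conjc R).
Local Notation ctr V := (map_mx conj V^T).
Implicit Types (V S : 'M[C]_n) (l e : 'I_n -> R).

Lemma conjcM (x y : C) : conj (x * y) = conj x * conj y.
Proof. exact: rmorphM. Qed.

Lemma conjc_sum (I : Type) (r : seq I) (p : pred I) (f : I -> C) :
  conj (\sum_(i <- r | p i) f i) = \sum_(i <- r | p i) conj (f i).
Proof. exact: rmorph_sum. Qed.

Lemma real_complexM (x y : R) : (x * y)%:C = x%:C * y%:C.
Proof. exact: rmorphM. Qed.

Lemma real_complex_sum (I : Type) (r : seq I) (p : pred I) (f : I -> R) :
  (\sum_(i <- r | p i) f i)%:C = \sum_(i <- r | p i) (f i)%:C.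
Proof. exact: (rmorph_sum (real_complex R)). Qed.

Lemma normc_conj (x : C) : normc (conj x) = normc x.
Proof. by case: x => a b /=; rewrite sqrrN. Qed.

Lemma mulc_conj (x : C) : x * conj x = (normc x ^+ 2)%:C.
Proof. by rewrite -complex.sqr_normc -rmorphXn. Qed.

Lemma conj_mulc (x : C) : conj x * x = (normc x ^+ 2)%:C.
Proof. by rewrite mulrC mulc_conj. Qed.

(** The eigenvalues [l] are kept as real numbers, so that they can be compared and have
    logarithms. *)
Definition unitary_conj V l : 'M[C]_n := ctr V *m diag_mx (\row_i (l i)%:C) *m V.

Lemma unitary_conjE V l a b :
  unitary_conj V l a b = \sum_i conj (V i a) * (l i)%:C * V i b.
Proof.
rewrite /unitary_conj mxE; apply: eq_bigr => i _.
by rewrite mul_mx_diag !mxE.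
Qed.

Lemma hermitian_decomposition S : (forall a b, S b a = conj (S a b)) ->
  exists V, exists l,
    [/\ V *m ctr V = 1%:M, ctr V *m V = 1%:M & S = unitary_conj V l].
Proof.
move=> hS.
have hermS : S \is hermsymmx.
  apply/is_hermitianmxP; rewrite expr0 scale1r; apply/matrixP => a b.
  by rewrite !mxE; exact: hS.
have /orthomx_spectralP SE := hermitian_normalmx hermS.
have uV := spectral_unitarymx S.
have realD := hermitian_spectral_diag_real hermS.
exists (spectralmx S), (fun i => complex.Re (spectral_diag S 0 i)).
have e1 : spectralmx S *m ctr (spectralmx S) = 1%:M := unitarymxP uV.
have e2 : invmx (spectralmx S) = ctr (spectralmx S) := invmx_unitary uV.
split; [exact: e1|by rewrite -e2 mulVmx// unitarymx_unit|].
rewrite {1}SE e2 /unitary_conj; congr (_ *m diag_mx _ *m _).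
apply/rowP => i; rewrite !mxE.
by have /mxOverP/(_ 0 i) h := realD; rewrite RRe_real.
Qed.

Section decomposed.
Variable V : 'M[C]_n.
Hypotheses (VV : V *m ctr V = 1%:M) (VV' : ctr V *m V = 1%:M).

Lemma unitary_row i j : \sum_a V i a * conj (V j a) = (i == j)%:R.
Proof.
by have /matrixP/(_ i j) := VV; rewrite !mxE => <-; apply: eq_bigr => a _; rewrite !mxE.
Qed.

Lemma unitary_col a b : \sum_i conj (V i a) * V i b = (a == b)%:R.
Proof.
by have /matrixP/(_ a b) := VV'; rewrite !mxE => <-; apply: eq_bigr => i _; rewrite !mxE.
Qed.

Lemma unitary_conjM l e : unitary_conj V l *m unitary_conj V e =
  unitary_conj V (fun i => l i * e i).
Proof.
rewrite /unitary_conj !mulmxA -(mulmxA _ V) VV mulmx1 -(mulmxA (ctr V)) mulmx_diag.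
by congr (_ *m diag_mx _ *m _); apply/rowP => i; rewrite !mxE rmorphM.
Qed.

Lemma unitary_conj1 : unitary_conj V (fun=> 1) = 1%:M.
Proof.
rewrite /unitary_conj (_ : \row_i _ = const_mx 1); last first.
  by apply/rowP => i; rewrite !mxE rmorph1.
by rewrite diag_const_mx mulmx1 VV'.
Qed.

Lemma unitary_conjB1 l : unitary_conj V l - 1%:M = unitary_conj V (fun i => l i - 1).
Proof.
apply/matrixP => a b; rewrite [LHS]mxE [X in _ + X]mxE -unitary_conj1 !unitary_conjE -sumrB.
by apply: eq_bigr => i _; rewrite -mulrBl -mulrBr -rmorphB.
Qed.

Lemma unitary_conj_trace l : \tr (unitary_conj V l) = (\sum_i l i)%:C.
Proof.
rewrite /unitary_conj mxtrace_mulC mulmxA VV mul1mx mxtrace_diag rmorph_sum.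
by apply: eq_bigr => i _; rewrite mxE.
Qed.

Lemma unitary_conj_det l : \det (unitary_conj V l) = (\prod_i l i)%:C.
Proof.
rewrite /unitary_conj !det_mulmx mulrAC -det_mulmx VV' det1 mul1r det_diag rmorph_prod.
by apply: eq_bigr => i _; rewrite mxE.
Qed.

Lemma unitary_conj_conj l a b : unitary_conj V l b a = conj (unitary_conj V l a b).
Proof.
rewrite !unitary_conjE conjc_sum; apply: eq_bigr => i _.
by rewrite !conjcM conjcK conjc_real; ring.
Qed.

(** Both sides are the trace of the squared matrix, by Hermitian symmetry. *)
Lemma unitary_conj_frobenius l :
  \sum_a \sum_b normc (unitary_conj V l a b) ^+ 2 = \sum_i l i ^+ 2.
Proof.
apply: (@complexI R).
transitivity (\tr (unitary_conj V l *m unitary_conj V l)).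
  rewrite real_complex_sum; apply: eq_bigr => a _; rewrite mxE real_complex_sum.
  by apply: eq_bigr => b _; rewrite -mulc_conj -unitary_conj_conj.
by rewrite unitary_conjM unitary_conj_trace; congr (_%:C); apply: eq_bigr => i _; rewrite expr2.
Qed.

Lemma unitary_conj_form l (g : 'I_n -> C) :
  \sum_a \sum_b g a * conj (g b) * unitary_conj V l a b =
  (\sum_i l i * normc (\sum_a g a * conj (V i a)) ^+ 2)%:C.
Proof.
rewrite real_complex_sum.
transitivity (\sum_a \sum_b \sum_i (l i)%:C * (g a * conj (V i a)) * (conj (g b) * V i b)).
  apply: eq_bigr => a _; apply: eq_bigr => b _; rewrite unitary_conjE mulr_sumr.
  by apply: eq_bigr => i _; ring.
under eq_bigr do rewrite exchange_big.
rewrite exchange_big; apply: eq_bigr => i _.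
rewrite real_complexM -mulc_conj mulr_suml mulr_sumr; apply: eq_bigr => a _.
rewrite conjc_sum !mulr_sumr; apply: eq_bigr => b _.
by rewrite conjcM conjcK; ring.
Qed.

(** At the unit vector [V i] the form takes the value [l i]. *)
Lemma unitary_conj_ge1 l i :
  (forall g : 'I_n -> C, \sum_a normc (g a) ^+ 2 <=
     complex.Re (\sum_a \sum_b g a * conj (g b) * unitary_conj V l a b)) -> 1 <= l i.
Proof.
move=> /(_ (V i)); rewrite unitary_conj_form /=.
have -> : \sum_a normc (V i a) ^+ 2 = 1.
  apply: (@complexI R); rewrite real_complex_sum.
  transitivity (\sum_a V i a * conj (V i a)); last by rewrite unitary_row eqxx.
  by apply: eq_bigr => a _; rewrite mulc_conj.
rewrite (bigD1 i)//= unitary_row eqxx ComplexField.Normc.normc1 expr1n mulr1 big1 ?addr0//.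
by move=> j ji; rewrite unitary_row eq_sym (negbTE ji) ComplexField.Normc.normc0 expr0n mulr0.
Qed.

Lemma unitary_conj_adj l : (forall i, l i != 0) ->
  \adj (unitary_conj V l) = (\prod_i l i)%:C *: unitary_conj V (fun i => (l i)^-1).
Proof.
move=> l0; set S := unitary_conj V l.
have SI : unitary_conj V (fun i => (l i)^-1) *m S = 1%:M.
  rewrite unitary_conjM -unitary_conj1; congr unitary_conj.
  by apply/funext => i; rewrite mulVf.
have SI' : S *m unitary_conj V (fun i => (l i)^-1) = 1%:M.
  rewrite unitary_conjM -unitary_conj1; congr unitary_conj.
  by apply/funext => i; rewrite mulfV.
rewrite -[LHS]mulmx1 -SI' mulmxA mul_adj_mx unitary_conj_det.
by rewrite mul_scalar_mx.
Qed.

Lemma unitary_conj_adj_form l (y : 'I_n -> C) : (forall i, l i != 0) ->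
  \sum_a \sum_b conj (y a) * \adj (unitary_conj V l) a b * y b =
  ((\prod_i l i) * \sum_i (l i)^-1 * normc (\sum_b V i b * y b) ^+ 2)%:C.
Proof.
move=> l0; rewrite unitary_conj_adj// real_complexM.
have := unitary_conj_form (fun i => (l i)^-1) (fun a => conj (y a)).
rewrite (_ : \sum_i _ * _ = \sum_i (l i)^-1 * normc (\sum_b V i b * y b) ^+ 2); last first.
  apply: eq_bigr => i _; congr (_ * _); rewrite -[normc (\sum_b V i b * y b)]normc_conj.
  congr (normc _ ^+ 2); rewrite conjc_sum; apply: eq_bigr => a _.
  by rewrite conjcM mulrC.
move=> <-; rewrite mulr_sumr; apply: eq_bigr => a _; rewrite mulr_sumr; apply: eq_bigr => b _.
by rewrite [X in _ * X * _]mxE conjcK; ring.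
Qed.

End decomposed.
End hermitian_matrices.

(** The properties of the density are arguments of the set function, so that the structure of a
    probability can be attached to it; the uniqueness theorem for laws then applies to a density. *)
Definition density_prob d (T : measurableType d) (R : realType)
    (P : probability T R) (f : T -> R) of measurable_fun setT f
    & (forall x, 0 <= f x) & (\int[P]_x (f x)%:E = 1)%E : set T -> \bar R :=
  fun A => (\int[P]_(x in A) (f x)%:E)%E.

Section density_prob_measure.
Context d (T : measurableType d) (R : realType) (P : probability T R).
Variables (f : T -> R) (mf : measurable_fun setT f) (f0 : forall x, 0 <= f x)
  (f1 : (\int[P]_x (f x)%:E = 1)%E).
Local Notation fP := (density_prob mf f0 f1).

Let fP0 : fP set0 = 0%E.
Proof. by rewrite /density_prob integral_set0. Qed.

Let fP_ge0 A : (0 <= fP A)%E.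
Proof. by apply: integral_ge0 => x _; rewrite lee_fin. Qed.

Let fP_sigma_additive : semi_sigma_additive fP.
Proof.
move=> /= A mA tA mUA; rewrite /density_prob ge0_integral_bigcup//.
- by apply: is_cvg_ereal_nneg_natsum_cond => n _ _; exact: fP_ge0.
- by apply/measurable_EFinP; exact: measurable_funTS.
- by move=> x _; rewrite lee_fin.
Qed.

HB.instance Definition _ := isMeasure.Build _ _ _ fP fP0 fP_ge0 fP_sigma_additive.

Let fP_setT : fP setT = 1%E. Proof. exact: f1. Qed.

HB.instance Definition _ := @Measure_isProbability.Build _ _ R fP fP_setT.

End density_prob_measure.

(** * Gaussian densities relative to scaled noise *)

Section gaussian_density.
Context (R : realType) (n : nat).
Local Notation C := R[i].
Local Notation conj := (@conjc R).
Local Notation E := (n.-tuple C).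

(* The density of the proper Gaussian law of covariance S with respect to that of
   covariance L^2, which replaces the Lebesgue measure on C^n.  The inverse of S is
   written as the adjugate over the determinant to keep measurability in S
   visible. *)
Definition gaussian_density (L : R) (S : 'M[C]_n) (y : E) : R :=
  (L ^+ 2) ^+ n / complex.Re (\det S) *
  expR (- (complex.Re (\sum_a \sum_b conj (tnth y a) * \adj S a b * tnth y b)
             / complex.Re (\det S))
        + (\sum_a normc (tnth y a) ^+ 2) / L ^+ 2).

Section diagonalized.
Variables (V : 'M[C]_n) (l : 'I_n -> R) (L : R).
Local Notation ctr V := (map_mx conj V^T).
Hypotheses (VV : V *m ctr V = 1%:M) (VV' : ctr V *m V = 1%:M).
Hypotheses (l1 : forall i, 1 <= l i) (lL : forall i, l i <= L ^+ 2) (L0 : 0 < L).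
Let l0 i : 0 < l i. Proof. exact: lt_le_trans (l1 i). Qed.

(** The adjugate form with all eigenvalues equal to 1 is the form of the identity matrix. *)
Lemma unitary_norm (y : 'I_n -> C) :
  \sum_i normc (\sum_b V i b * y b) ^+ 2 = \sum_a normc (y a) ^+ 2.
Proof.
have := unitary_conj_adj_form VV VV' y (fun i => oner_neq0 R).
have e : \prod_(i < n) (1 : R) = 1 by rewrite big1.
have -> : \sum_i (1 : R)^-1 * normc (\sum_b V i b * y b) ^+ 2 =
    \sum_i normc (\sum_b V i b * y b) ^+ 2.
  by apply: eq_bigr => i _; rewrite invr1 mul1r.
rewrite unitary_conj1// adj1 e mul1r => h; apply: (@complexI R); rewrite -h real_complex_sum.
apply: eq_bigr => a _; rewrite (bigD1 a)//= mxE eqxx mulr1 conj_mulc big1 ?addr0//.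
by move=> b; rewrite mxE eq_sym => /negbTE ->; rewrite mulr0 mul0r.
Qed.

Lemma unitary_norm_row (g : 'I_n -> C) :
  \sum_b normc (\sum_i g i * V i b) ^+ 2 = \sum_i normc (g i) ^+ 2.
Proof.
transitivity (\sum_b normc (\sum_i conj (V i b) * conj (g i)) ^+ 2).
  apply: eq_bigr => b _; rewrite -normc_conj conjc_sum; congr (normc _ ^+ 2).
  by apply: eq_bigr => i _; rewrite conjcM mulrC.
apply: (@complexI R); rewrite !real_complex_sum.
transitivity (\sum_b \sum_i \sum_j (conj (g i) * g j) * (conj (V i b) * V j b)).
  apply: eq_bigr => b _; rewrite -mulc_conj mulr_suml; apply: eq_bigr => i _.
  rewrite conjc_sum mulr_sumr; apply: eq_bigr => j _.
  by rewrite conjcM !conjcK; ring.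
rewrite exchange_big; apply: eq_bigr => i _.
rewrite exchange_big/=.
transitivity (\sum_j conj (g i) * g j * (\sum_b V j b * conj (V i b))).
  apply: eq_bigr => j _; rewrite mulr_sumr; apply: eq_bigr => b _.
  by rewrite [V j b * _]mulrC.
rewrite (bigD1 i)//= unitary_row// eqxx mulr1 conj_mulc big1 ?addr0// => j /negbTE ji.
by rewrite unitary_row// ji mulr0.
Qed.

Definition rotate (y : E) : E := [tuple \sum_b V i b * tnth y b | i < n].

Lemma measurable_rotate : measurable_fun setT rotate.
Proof.
apply/measurable_fun_tnthP => i.
under [X in measurable_fun _ X]eq_fun do rewrite /= tnth_mktuple.
apply: measurable_complex_sum => b; apply: measurable_complexM.
  exact: measurable_cst.
exact: measurable_tnth.
Qed.

Lemma rotate_norm (y : E) :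
  \sum_i normc (tnth (rotate y) i) ^+ 2 = \sum_a normc (tnth y a) ^+ 2.
Proof.
rewrite -[RHS](unitary_norm (fun b => tnth y b)).
by apply: eq_bigr => i _; rewrite tnth_mktuple.
Qed.

Lemma real_form_rotate g (y : E) :
  real_form g (rotate y) = real_form (fun b => \sum_i g i * V i b) y.
Proof.
rewrite /real_form; congr complex.Re.
transitivity (\sum_i \sum_b g i * V i b * tnth y b).
  by apply: eq_bigr => i _; rewrite tnth_mktuple mulr_sumr; apply: eq_bigr => b _; rewrite mulrA.
by rewrite exchange_big; apply: eq_bigr => b _; rewrite mulr_suml.
Qed.

Lemma real_form_unrotate g (y : E) :
  real_form g y = real_form (fun i => \sum_a g a * conj (V i a)) (rotate y).
Proof.
rewrite real_form_rotate; congr real_form; apply/funext => b.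
transitivity (\sum_a g a * \sum_i conj (V i a) * V i b).
  rewrite (bigD1 b)//= unitary_col// eqxx mulr1 big1 ?addr0//.
  by move=> a /negbTE ab; rewrite unitary_col// ab mulr0.
under eq_bigr do rewrite mulr_sumr.
rewrite exchange_big; apply: eq_bigr => i _; rewrite mulr_suml.
by apply: eq_bigr => a _; rewrite mulrA.
Qed.

Lemma gaussian_densityE (y : E) : gaussian_density L (unitary_conj V l) y =
  \prod_i (L ^+ 2 / l i) *
  expR (- \sum_i (normc (tnth (rotate y) i) ^+ 2 * ((l i)^-1 - (L ^+ 2)^-1))).
Proof.
rewrite /gaussian_density unitary_conj_det// unitary_conj_adj_form//; last first.
  by move=> i; rewrite gt_eqF.
rewrite /=; set p := \prod_i l i.
have p0 : p != 0 by apply/prodf_neq0 => i _; rewrite gt_eqF.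
congr (_ * expR _).
  rewrite big_split/= prodr_const card_ord; congr (_ * _).
  by rewrite /p prodfV.
rewrite mulrAC divff// mul1r -rotate_norm mulr_suml -sumrN -big_split -sumrN.
by apply: eq_bigr => i _ /=; rewrite tnth_mktuple; ring.
Qed.

Lemma gaussian_density_gt0 (y : E) : 0 < gaussian_density L (unitary_conj V l) y.
Proof.
rewrite gaussian_densityE mulr_gt0 ?expR_gt0//.
by apply: prodr_gt0 => i _; rewrite divr_gt0// exprn_gt0.
Qed.

(** Each eigenvalue lies between 1 and L^2: the upper bound makes the exponent nonpositive, the
    lower bound controls the prefactor. Every integrability argument about the density relies on
    this. *)
Lemma gaussian_density_le (y : E) : gaussian_density L (unitary_conj V l) y <= (L ^+ 2) ^+ n.
Proof.
rewrite gaussian_densityE -[leRHS]mulr1 ler_pM ?expR_ge0//.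
- by apply: prodr_ge0 => i _; rewrite divr_ge0 ?ltW// exprn_gt0.
- rewrite -[X in _ <= _ ^+ X]card_ord -prodr_const; apply: ler_prod => i _.
  apply/andP; split; first by rewrite divr_ge0 ?sqr_ge0// ltW.
  by rewrite ler_pdivrMr// ler_peMr// sqr_ge0.
- rewrite -expR0 ler_expR oppr_le0; apply: sumr_ge0 => i _.
  by rewrite mulr_ge0 ?sqr_ge0// subr_ge0 lef_pV2 ?posrE ?exprn_gt0.
Qed.

Section noise.
Context d (T : measurableType d) (P : probability T R) (w : T -> E).
Hypothesis mw : measurable_fun setT w.
(* The joint transform of the components and their squared moduli, which is what
   a change of Gaussian density uses; it says that w is standard proper normal. *)
Hypothesis weighted_charfun : forall (c : 'I_n -> R) g th, (forall i, 0 <= c i) ->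
  \int[P]_t (\prod_i expR (- (c i * normc (tnth (w t) i) ^+ 2)) *
              cos (real_form g (w t) + th)) =
  \prod_i ((1 + c i)^-1 * expR (- (normc (g i) ^+ 2 / (4 * (1 + c i))))) * cos th.

Lemma noise_charfun g th : \int[P]_t cos (real_form g (w t) + th) =
  expR (- ((\sum_i normc (g i) ^+ 2) / 4)) * cos th.
Proof.
have := @weighted_charfun (fun=> 0) g th (fun=> lexx _).
have -> : \int[P]_t (\prod_i expR (- (0 * normc (tnth (w t) i) ^+ 2)) *
    cos (real_form g (w t) + th)) = \int[P]_t cos (real_form g (w t) + th).
  apply: eq_Rintegral => t _; rewrite big1 ?mul1r// => i _.
  by rewrite mul0r oppr0 expR0.
move=> ->; congr (_ * _); rewrite mulr_suml -sumrN expR_sum.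
by apply: eq_bigr => i _; rewrite addr0 invr1 mul1r mulr1.
Qed.

(** The transform of the noise depends on the frequency only through its norm, which a unitary
    matrix preserves. *)
Lemma rotate_same_law A : measurable A ->
  P ((fun t => rotate (w t)) @^-1` A) = P (w @^-1` A).
Proof.
apply: same_charfun_same_law => // [|g th].
  by apply: measurableT_comp => //; exact: measurable_rotate.
under eq_Rintegral do rewrite real_form_rotate.
by rewrite !noise_charfun unitary_norm_row.
Qed.

Definition scaled_noise (t : T) : E := [tuple L%:C * tnth (w t) i | i < n].

Lemma measurable_scaled_noise : measurable_fun setT scaled_noise.
Proof.
apply/measurable_fun_tnthP => i.
under [X in measurable_fun _ X]eq_fun do rewrite /= tnth_mktuple.
apply: measurable_complexM; first exact: measurable_cst.
exact: (measurableT_comp (measurable_tnth i)).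
Qed.

Lemma measurable_normc2 : measurable_fun setT (fun x : C => normc x ^+ 2).
Proof.
under eq_fun do rewrite sqr_normcE.
by apply: measurable_funD; apply: measurable_funX;
  [exact: measurable_Re|exact: measurable_Im].
Qed.

Let dens t := gaussian_density L (unitary_conj V l) (scaled_noise t).
(** The density at the scaled noise, in terms of the rotated unscaled noise: scaling by [L]
    multiplies 1 / l - 1 / L^2 by L^2. *)
Let weight (u : E) := \prod_i (L ^+ 2 / l i) *
  \prod_i expR (- ((L ^+ 2 / l i - 1) * normc (tnth u i) ^+ 2)).

Let densE t : dens t = weight (rotate (w t)).
Proof.
rewrite /dens gaussian_densityE /weight; congr (_ * _).
rewrite -expR_sum; congr expR; rewrite -sumrN; apply: eq_bigr => i _.
rewrite (_ : tnth (rotate (scaled_noise t)) i = L%:C * tnth (rotate (w t)) i); last first.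
  rewrite !tnth_mktuple mulr_sumr; apply: eq_bigr => b _.
  by rewrite tnth_mktuple mulrCA.
rewrite ComplexField.Normc.normcM exprMn.
have -> : normc L%:C ^+ 2 = L ^+ 2 by rewrite sqr_normcE/= expr0n addr0.
by field; rewrite !gt_eqF.
Qed.

Let mweight : measurable_fun setT weight.
Proof.
apply: measurable_funM => //; apply: measurable_prod => i _.
apply: measurableT_comp => //; apply: measurableT_comp => //.
apply: measurable_funM => //.
exact: (measurableT_comp measurable_normc2 (measurable_tnth i)).
Qed.

(** The weighted transform of the noise is applied with c = L^2 / l - 1. Then 1 + c = L^2 / l
    cancels the prefactor of the density and leaves the eigenvalue [l] in the exponent. *)
Lemma gaussian_density_charfun g th :
  \int[P]_t (dens t * cos (real_form g (scaled_noise t) + th)) =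
  expR (- (complex.Re (\sum_a \sum_b g a * conj (g b) * unitary_conj V l a b) / 4)) * cos th.
Proof.
pose h i := L%:C * \sum_a g a * conj (V i a).
have E1 t : dens t * cos (real_form g (scaled_noise t) + th) =
    weight (rotate (w t)) * cos (real_form h (rotate (w t)) + th).
  rewrite densE; congr (_ * cos (_ + _)).
  transitivity (real_form (fun i => L%:C * g i) (w t)).
    rewrite /real_form; congr complex.Re; apply: eq_bigr => i _.
    by rewrite tnth_mktuple mulrCA mulrA.
  rewrite real_form_unrotate; congr real_form; apply/funext => i.
  by rewrite /h mulr_sumr; apply: eq_bigr => a _; rewrite mulrA.
under eq_Rintegral do rewrite E1.
have mg : measurable_fun setT (fun u : E => weight u * cos (real_form h u + th)).
  by apply: measurable_funM => //; exact: measurable_trig.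
rewrite (@same_law_Rintegral _ _ _ _ _ P P _ _ _ _ _ mw rotate_same_law _ mg); last first.
  by apply: measurableT_comp => //; exact: measurable_rotate.
have c0 i : 0 <= L ^+ 2 / l i - 1.
  by rewrite subr_ge0 ler_pdivlMr// mul1r.
rewrite /weight; under eq_Rintegral do rewrite -mulrA.
rewrite RintegralZl//; last first.
  apply: (@bounded_integrable _ _ _ P _ 1).
    apply: measurable_funM; last exact: (measurableT_comp (@measurable_trig _ _ _ _)).
    apply: measurable_prod => i _; apply: measurableT_comp => //; apply: measurableT_comp => //.
    apply: measurable_funM => //.
    exact: (measurableT_comp measurable_normc2 (measurableT_comp (measurable_tnth i) mw)).
  move=> t; rewrite normrM mulr_ile1// ?cos_max// ger0_norm; last first.
    by apply: prodr_ge0 => i _; exact: expR_ge0.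
  apply: prodr_ile1 => i _; rewrite expR_ge0/= expR_le1 oppr_le0.
  by rewrite mulr_ge0// sqr_ge0.
rewrite weighted_charfun// mulrA -big_split/=; congr (_ * _).
rewrite unitary_conj_form//= mulr_suml -sumrN expR_sum; apply: eq_bigr => i _.
rewrite [1 + _]addrC subrK [LHS]mulrA divff ?mul1r; last by rewrite gt_eqF// divr_gt0// exprn_gt0.
congr expR; rewrite /h ComplexField.Normc.normcM exprMn.
have -> : normc L%:C ^+ 2 = L ^+ 2 by rewrite sqr_normcE/= expr0n addr0.
by field; rewrite !gt_eqF.
Qed.

Let mdens : measurable_fun setT dens.
Proof.
rewrite (_ : dens = weight \o rotate \o w); last by apply/funext => t; rewrite densE.
by apply: measurableT_comp => //; apply: measurableT_comp => //; exact: measurable_rotate.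
Qed.

Let dens0 t : 0 <= dens t.
Proof. by rewrite ltW// gaussian_density_gt0. Qed.

Let idens : P.-integrable setT (fun t => (dens t)%:E).
Proof.
apply: (@bounded_integrable _ _ _ P _ ((L ^+ 2) ^+ n)) => // t.
by rewrite ger0_norm// gaussian_density_le.
Qed.

Lemma gaussian_density_total : (\int[P]_t (dens t)%:E = 1)%E.
Proof.
rewrite Rintegral_EFin//; congr EFin.
have := gaussian_density_charfun (fun=> 0) 0.
under eq_Rintegral do rewrite real_form0 addr0 cos0 mulr1.
move=> ->; rewrite cos0 mulr1 big1 ?mul0r ?oppr0 ?expR0// => a _.
by rewrite big1// => b _; rewrite !mul0r.
Qed.

(** The density defines a probability with the same cosine transform as the law of [X], so the
    uniqueness theorem identifies the two. *)
Theorem gaussian_law d' (T' : measurableType d') (P' : probability T' R) (X : T' -> E) :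
  measurable_fun setT X ->
  (forall g th, \int[P']_t cos (real_form g (X t) + th) =
    expR (- (complex.Re (\sum_a \sum_b g a * conj (g b) * unitary_conj V l a b) / 4)) * cos th) ->
  forall A, measurable A ->
    P' (X @^-1` A) = (\int[P]_(t in scaled_noise @^-1` A) (dens t)%:E)%E.
Proof.
move=> mX cX A mA.
have := @same_charfun_same_law R n _ _ _ _ P' (density_prob mdens dens0 gaussian_density_total)
  X scaled_noise mX measurable_scaled_noise.
apply => // g th; rewrite cX.
have mc : measurable_fun setT (fun t => cos (real_form g (scaled_noise t) + th)).
  exact: (measurableT_comp (@measurable_trig _ _ g th) measurable_scaled_noise).
rewrite (@Rintegral_density _ _ _ P (density_prob mdens dens0 gaussian_density_total) dens)//.
- by rewrite -gaussian_density_charfun; apply: eq_Rintegral => t _; rewrite mulrC.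
- under eq_fun do rewrite mulrC.
  by apply: (integrableM_bounded (M := 1)) => // t; exact: cos_max.
Qed.

End noise.
End diagonalized.
End gaussian_density.

(** * Relative entropy *)

(** The inverse is a composition of measurable functions, with a formula that is right at 0 as well:
    there both sides are 0. *)
Lemma measurable_invr (R : realType) : measurable_fun setT (@GRing.inv R).
Proof.
rewrite (_ : @GRing.inv R = fun x => x * expR (- ln (x ^+ 2))).
  apply: measurable_funM => //; apply: measurableT_comp => //.
  apply: measurableT_comp => //; apply: measurableT_comp => //.
apply/funext => x; have [->|x0] := eqVneq x 0; first by rewrite invr0 mul0r.
have x2 : 0 < x ^+ 2 by rewrite exprn_even_gt0.
by rewrite expRN lnK ?posrE// expr2 invfM mulrA divff// mul1r.
Qed.

Lemma measurable_lne (R : realType) : measurable_fun setT (@lne R).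
Proof.
rewrite (_ : @lne R = fun x => if x == +oo%E then +oo%E else
    if (x <= 0)%E then -oo%E else (ln (fine x))%:E); last first.
  apply: funext; case => [r||]; first by rewrite /lne /= lee_fin.
    by [].
  by rewrite /= leNye.
apply: measurable_fun_ifT => //.
  apply: (measurable_fun_bool true).
  rewrite setTI (_ : _ @^-1` _ = [set +oo%E]); first exact: emeasurable_set1.
  by apply/seteqP; split=> x /= /eqP.
apply: measurable_fun_ifT => //.
  apply: (measurable_fun_bool true).
  rewrite setTI (_ : _ @^-1` _ = [set x | (x <= 0)%E]); last by apply/seteqP; split=> x.
  exact: emeasurable_itv (`]-oo, 0%E]).
by apply/measurable_EFinP; apply: measurableT_comp.
Qed.

Section kl_divergence_bounds.
Context d (T : measurableType d) (R : realType) (P Q : probability T R).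

Lemma ln_le_subr1 (x : R) : 0 < x -> ln x <= x - 1.
Proof.
move=> x0; have := @le_ln1Dx R (x - 1); rewrite addrCA subrr addr0; apply.
by rewrite ltrBDl subrr.
Qed.

(** Positive and negative parts are compared separately, so that [g] may be the logarithm of a
    Radon-Nikodym derivative with infinite integral. *)
Lemma le_integral_ae (f : T -> R) (g : T -> \bar R) :
  P.-integrable setT (fun x => (f x)%:E) -> measurable_fun setT g ->
  {ae P, forall x, ((f x)%:E <= g x)%E} ->
  ((\int[P]_x f x)%:E <= \int[P]_x g x)%E.
Proof.
move=> fi mg fg; rewrite -Rintegral_EFin// integralE [leRHS]integralE.
have mf := measurable_int P fi.
apply: leeB.
- apply: ae_ge0_le_integral => //; [exact: measurable_funepos|exact: measurable_funepos|].
  apply: filterS fg => x fgx _; rewrite !funeposE.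
  by rewrite ge_max !le_max fgx lexx orbT.
- apply: ae_ge0_le_integral => //; [exact: measurable_funeneg|exact: measurable_funeneg|].
  apply: filterS fg => x fgx _; rewrite !funenegE.
  by rewrite ge_max !le_max leeN2 fgx lexx orbT.
Qed.

(** The variational lower bound. With [f] the density of [P] with respect to [Q], ln g - ln f <= g /
    f - 1, and the mean of g / f under [P] is at most the integral of [g] under [Q]. *)
Lemma kl_ge_integral_ln (g : T -> R) : measurable_fun setT g -> (forall x, 0 < g x) ->
  (\int[Q]_x (g x)%:E <= 1)%E -> P.-integrable setT (fun x => (ln (g x))%:E) ->
  ((\int[P]_x ln (g x))%:E <= kl_divergence P Q)%E.
Proof.
move=> mg g0 g1 ig; rewrite /kl_divergence; case: ifPn => [/asboolP PQ|_]; last by rewrite leey.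
pose f0 := Radon_Nikodym_SigmaFinite.f P Q.
have f0_fin x : f0 x \is a fin_num by exact: Radon_Nikodym_SigmaFinite.f_fin_num.
have f0_ge0 x : (0 <= f0 x)%E by exact: Radon_Nikodym_SigmaFinite.f_ge0.
have mf0 : measurable_fun setT f0.
  exact: (measurable_int Q (Radon_Nikodym_SigmaFinite.f_integrable PQ)).
pose f x := fine (f0 x).
have fE x : (f x)%:E = f0 x by rewrite fineK.
have mf : measurable_fun setT f by exact: measurableT_comp.
have fge0 x : 0 <= f x by rewrite fine_ge0.
have PE A : measurable A -> P A = (\int[Q]_(x in A) (f x)%:E)%E.
  move=> mA; under eq_integral do rewrite fE.
  exact: Radon_Nikodym_SigmaFinite.f_integral.
(* The set where the density vanishes has [P]-measure equal to the integral of 0. *)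
have fpos : {ae P, forall x, 0 < f x}.
  exists (f @^-1` [set 0]); split.
  - by rewrite -[X in measurable X]setTI; apply: mf.
  - rewrite PE; last by rewrite -[X in measurable X]setTI; apply: mf.
    by rewrite integral0_eq// => x ->.
  - by move=> x /= /negP; rewrite -leNgt => fx; apply/eqP; rewrite eq_le fx fge0.
have rE : {ae P, forall x, Radon_Nikodym (charge_of_finite_measure P) Q x = (f x)%:E}.
  have := ae_eq_Radon_Nikodym_SigmaFinite PQ measurableT.
  move=> [A [mA A0 AE]]; exists A; split => //.
    by move/null_content_dominatesP : PQ; apply.
  move=> x /= xA; apply: AE => /= h; apply: xA; rewrite -h// fE.
(* Division by 0 returns 0, so the left side is 0 where [f] vanishes and equality holds
   elsewhere. *)
have gfE x : g x / f x * f x <= g x.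
  have [->|fx] := eqVneq (f x) 0; first by rewrite mulr0 ltW.
  by rewrite divfK.
have mgf : measurable_fun setT (fun x => g x / f x).
  by apply: measurable_funM => //; exact: (measurableT_comp (@measurable_invr R)).
have gf0 x : 0 <= g x / f x by rewrite divr_ge0// ltW.
have Igf : (\int[P]_x (g x / f x)%:E <= 1)%E.
  rewrite (ge0_integral_density mf PE)//; last by exact/measurable_EFinP.
  apply: le_trans g1; apply: ge0_le_integral => //.
  - by move=> x _; rewrite -EFinM lee_fin mulr_ge0.
  - by under eq_fun do rewrite -EFinM; apply/measurable_EFinP/measurable_funM.
  - exact/measurable_EFinP.
  - by move=> x _; rewrite -EFinM lee_fin.
have igf : P.-integrable setT (fun x => (g x / f x)%:E).
  apply/integrableP; split; first exact/measurable_EFinP.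
  under eq_integral do rewrite /= ger0_norm//.
  by rewrite (le_lt_trans Igf)// ltry.
have i1 : P.-integrable setT (fun x : T => (1 : R)%:E) by exact: finite_measure_integrable_cst.
apply: (@le_trans _ _ (\int[P]_x (ln (g x) + (1 - g x / f x)))%:E).
  rewrite RintegralD//; last exact: integrableBR.
  rewrite RintegralB// Rintegral_cst1 lee_fin lerDl subr_ge0.
  by rewrite -lee_fin -Rintegral_EFin.
apply: le_integral_ae.
- by apply: integrableDR => //; exact: integrableBR.
- apply: measurableT_comp; first exact: measurable_lne.
  have := @Radon_Nikodym_integrable _ _ _ (charge_of_finite_measure P) Q PQ.
  exact: measurable_int.
- apply: filterS2 fpos rE => x fx ->; rewrite lne_EFin// lee_fin.
  have := ln_le_subr1 (divr_gt0 (g0 x) fx).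
  rewrite ln_div ?posrE//; lra.
Qed.

Section with_density.
Variable f : T -> R.
Hypotheses (mf : measurable_fun setT f) (f0 : forall x, 0 < f x).
Hypothesis PE : forall A, measurable A -> P A = (\int[Q]_(x in A) (f x)%:E)%E.
Let f_ge0 x : 0 <= f x. Proof. exact: ltW. Qed.

Lemma kl_density : kl_divergence P Q = (\int[P]_x (ln (f x))%:E)%E.
Proof.
have PQ := density_dominates mf PE.
rewrite /kl_divergence asboolT//.
have h := density_RN mf PE.
have mln : measurable_fun setT (fun x => (ln (f x))%:E).
  by apply/measurable_EFinP; exact: measurableT_comp.
apply: ae_eq_integral => //.
- apply: measurableT_comp; first exact: measurable_lne.
  have := @Radon_Nikodym_integrable _ _ _ (charge_of_finite_measure P) Q PQ.
  exact: measurable_int.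
- move: h => [A [mA A0 AE]]; exists A; split => //.
    by move/null_content_dominatesP : PQ; apply.
  move=> x /= xA; apply: AE => /= h; apply: xA => _.
  by rewrite h// lne_EFin.
Qed.

(** In use, [u] is the logarithm of the conditional density over a comparison density, and [v] is
    the comparison density over the true output density. The term [v - 1] has nonpositive mean, so
    the comparison density can only increase the value. *)
Lemma kl_le_integral (u v : T -> R) :
  P.-integrable setT (fun x => (u x)%:E) -> measurable_fun setT v ->
  (forall x, 0 <= v x) -> (\int[P]_x (v x)%:E <= 1)%E ->
  (forall x, ln (f x) <= u x + v x - 1) ->
  P.-integrable setT (fun x => (ln (f x))%:E) /\ \int[P]_x ln (f x) <= \int[P]_x u x.
Proof.
move=> iu mv v0 v1 fuv.
have mu : measurable_fun setT u by exact/measurable_EFinP/(measurable_int P).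
have iv : P.-integrable setT (fun x => (v x)%:E).
  apply/integrableP; split; first exact/measurable_EFinP.
  under eq_integral do rewrite /= ger0_norm//.
  by rewrite (le_lt_trans v1)// ltry.
have mfi : measurable_fun setT (fun x => (f x)^-1).
  exact: (measurableT_comp (@measurable_invr R)).
(* The mean of 1 / f under [P] is the mass of [Q]. Since - ln f <= 1 / f - 1, this controls the
   logarithm from below, while [u] and [v] control it from above. *)
have ifi : P.-integrable setT (fun x => ((f x)^-1)%:E).
  apply/integrableP; split; first exact/measurable_EFinP.
  under eq_integral do rewrite /= ger0_norm ?invr_ge0//.
  rewrite (ge0_integral_density mf PE)//; last 2 first.
  - exact/measurable_EFinP.
  - by move=> x; rewrite lee_fin invr_ge0.
  under eq_integral do rewrite -EFinM mulVf ?gt_eqF//.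
  rewrite integral_cst// mul1e; apply: (@le_lt_trans _ _ 1%E); last exact: ltry.
  exact: probability_le1.
have i1 : P.-integrable setT (fun x : T => (1 : R)%:E) by exact: finite_measure_integrable_cst.
have iln : P.-integrable setT (fun x => (ln (f x))%:E).
  apply: (@le_integrableR _ _ _ P _ (fun x => `|u x| + v x + 1 + (f x)^-1)).
  - exact: measurableT_comp.
  - move=> x; have h1 := fuv x.
    have fi0 : 0 < (f x)^-1 by rewrite invr_gt0.
    have h2 := ln_le_subr1 fi0; rewrite lnV ?posrE// in h2.
    have h3 := ler_norm (u x); have h4 := v0 x; have h5 := normr_ge0 (u x).
    by rewrite ler_norml; apply/andP; split; lra.
  - apply: integrableDR => //; apply: integrableDR => //; apply: integrableDR => //.
    exact: (integrable_abse iu).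
split => //.
apply: (@le_trans _ _ (\int[P]_x (u x + (v x - 1)))).
  apply: le_Rintegral => //.
  - by apply: integrableDR => //; exact: integrableBR.
  - by move=> x _; rewrite addrA.
rewrite RintegralD//; last exact: integrableBR.
rewrite RintegralB// Rintegral_cst1 gerDl subr_le0.
by rewrite -lee_fin -Rintegral_EFin.
Qed.

End with_density.

Lemma density_ratio (M : probability T R) (F G : T -> R) :
  measurable_fun setT F -> measurable_fun setT G ->
  (forall x, 0 <= F x) -> (forall x, 0 < G x) ->
  (forall A, measurable A -> P A = (\int[M]_(x in A) (F x)%:E)%E) ->
  (forall A, measurable A -> Q A = (\int[M]_(x in A) (G x)%:E)%E) ->
  forall A, measurable A -> P A = (\int[Q]_(x in A) (F x / G x)%:E)%E.
Proof.
move=> mF mG F0 G0 PF QG A mA.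
rewrite PF// integral_mkcond [RHS]integral_mkcond.
have mFG : measurable_fun setT (fun x => F x / G x).
  by apply: measurable_funM => //; exact: (measurableT_comp (@measurable_invr R)).
rewrite (ge0_integral_density mG QG); last 2 first.
- by apply/(measurable_restrictT _ _).1 => //; apply/measurable_EFinP; exact: measurable_funTS.
- move=> x; rewrite patchE; case: ifP => // _.
  by rewrite lee_fin divr_ge0// ltW.
apply: eq_integral => x _; rewrite !patchE; case: ifP => _; last by rewrite mul0e.
by rewrite -EFinM divfK// gt_eqF.
Qed.

End kl_divergence_bounds.

(** * Normal laws with a Gaussian weight *)

Section normal_weight.
Context (R : realType) (s c : R).
Hypotheses (s0 : 0 < s) (c0 : 0 <= c).
Let q := Num.sqrt (1 + 2 * c * s ^+ 2).
Let s' := s / q.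

Let w0 : 0 <= 2 * c * s ^+ 2.
Proof. by apply: mulr_ge0; [apply: mulr_ge0|exact: sqr_ge0]. Qed.

Let q2 : q ^+ 2 = 1 + 2 * c * s ^+ 2.
Proof. by rewrite /q sqr_sqrtr// addr_ge0. Qed.

Let q0 : 0 < q.
Proof. by rewrite /q sqrtr_gt0 ltr_wpDr. Qed.

Let s'0 : 0 < s'. Proof. exact: divr_gt0. Qed.

(** The weight adds 2 c to the reciprocal of the variance; [q] is the ratio of the two standard
    deviations. *)
Lemma normal_pdf_weight (x : R) :
  expR (- (c * x ^+ 2)) * normal_pdf 0 s x = q^-1 * normal_pdf 0 s' x.
Proof.
rewrite !normal_pdfE ?gt_eqF// /normal_fun /normal_peak.
have -> : s ^+ 2 * pi *+ 2 = q ^+ 2 * (s' ^+ 2 * pi *+ 2).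
  rewrite /s' -![(_ * _) *+ 2]mulr_natr; field; exact: (lt0r_neq0 q0).
rewrite (sqrtrM _ (sqr_ge0 q)) sqrtr_sqr gtr0_norm// invfM mulrCA -!mulrA; congr (_ * _).
congr (_ * _); rewrite -expRD; congr expR; rewrite !subr0 /s' expr_div_n q2.
rewrite -![_ ^+ 2 *+ 2]mulr_natr -![(_ / _) *+ 2]mulr_natr; field.
have h : 0 < 1 + 2 * c * s ^+ 2 by rewrite -q2 exprn_gt0.
by rewrite !gt_eqF.
Qed.

Lemma ge0_normal_weight (g : R -> R) : measurable_fun setT g -> (forall x, 0 <= g x) ->
  (\int[normal_prob 0 s]_x (expR (- (c * x ^+ 2)) * g x)%:E =
   q^-1%:E * \int[normal_prob 0 s']_x (g x)%:E)%E.
Proof.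
move=> mg g0.
have me : measurable_fun setT (fun x : R => expR (- (c * x ^+ 2))).
  apply: measurableT_comp => //; apply: measurableT_comp => //.
  by apply: measurable_funM.
rewrite !ge0_normal_integral//; last 2 first.
- exact: measurable_funM.
- by move=> x; rewrite mulr_ge0// expR_ge0.
rewrite -ge0_integralZl//; last 3 first.
- apply/measurable_EFinP/measurable_funM => //; exact: measurable_normal_pdf.
- by move=> x _; rewrite lee_fin mulr_ge0// normal_pdf_ge0.
- by rewrite lee_fin invr_ge0 (ltW q0).
by apply: eq_integral => x _; rewrite -EFinM; congr EFin; rewrite mulrAC normal_pdf_weight; ring.
Qed.

Lemma normal_weight_cos (t th : R) :
  \int[normal_prob 0 s]_x (expR (- (c * x ^+ 2)) * cos (t * x + th)) =
  q^-1 * expR (- (t ^+ 2 * s' ^+ 2 / 2)) * cos th.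
Proof.
have mc : measurable_fun setT (fun x : R => cos (t * x + th)).
  by apply: measurableT_comp; [exact: measurable_cos|apply: measurable_funD => //; exact: measurable_funM].
have me : measurable_fun setT (fun x : R => expR (- (c * x ^+ 2))).
  apply: measurableT_comp => //; apply: measurableT_comp => //.
  by apply: measurable_funM.
have e1 (x : R) : `|expR (- (c * x ^+ 2))| <= 1.
  by rewrite ger0_norm ?expR_ge0// -expR0 ler_expR oppr_le0 mulr_ge0// sqr_ge0.
have ie : (normal_prob 0 s).-integrable setT (fun x : R => (expR (- (c * x ^+ 2)))%:E).
  exact: (@bounded_integrable _ _ _ (normal_prob 0 s) _ 1).
have iec : (normal_prob 0 s).-integrable setT
    (fun x : R => (expR (- (c * x ^+ 2)) * cos (t * x + th))%:E).
  apply: (@bounded_integrable _ _ _ (normal_prob 0 s) _ 1); first exact: measurable_funM.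
  by move=> x; rewrite normrM mulr_ile1 ?cos_max.
have ic : (normal_prob 0 s').-integrable setT (fun x : R => (cos (t * x + th))%:E).
  by apply: (@bounded_integrable _ _ _ (normal_prob 0 s') _ 1) => // x; exact: cos_max.
have i1 : (normal_prob 0 s').-integrable setT (fun x : R => (1 : R)%:E).
  by apply: (@bounded_integrable _ _ _ (normal_prob 0 s') _ 1) => // x; rewrite normr1.
have h1 : \int[normal_prob 0 s]_x (expR (- (c * x ^+ 2))) = q^-1.
  rewrite /Rintegral.
  transitivity (fine (\int[normal_prob 0 s]_x (expR (- (c * x ^+ 2)) * 1)%:E)%E).
    by under eq_integral do rewrite -[expR _]mulr1.
  rewrite (@ge0_normal_weight (fun=> 1))//.
  by rewrite (Rintegral_EFin i1) Rintegral_cst1 -EFinM mulr1.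
have h2 : \int[normal_prob 0 s]_x (expR (- (c * x ^+ 2)) * (1 + cos (t * x + th))) =
    q^-1 * \int[normal_prob 0 s']_x (1 + cos (t * x + th)).
  have m1c : measurable_fun setT (fun x : R => 1 + cos (t * x + th)) by exact: measurable_funD.
  rewrite /Rintegral ge0_normal_weight//.
    by rewrite Rintegral_EFin//; exact: integrableDR.
have h3 : \int[normal_prob 0 s]_x (expR (- (c * x ^+ 2)) * (1 + cos (t * x + th))) =
    q^-1 + \int[normal_prob 0 s]_x (expR (- (c * x ^+ 2)) * cos (t * x + th)).
  by rewrite -h1 -RintegralD//; apply: eq_Rintegral => x _; rewrite mulrDr mulr1.
move: h2; rewrite h3 RintegralD// Rintegral_cst1 normal_cos//.
by rewrite mulrDr mulr1 => /addrI ->; rewrite mulrA.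
Qed.

End normal_weight.

Section fubini.
Context d1 d2 (T1 : measurableType d1) (T2 : measurableType d2) (R : realType).
Variables (P1 : probability T1 R) (P2 : probability T2 R).

Lemma Rintegral_prod (f : T1 * T2 -> R) :
  (P1 \x P2)%E.-integrable setT (fun z => (f z)%:E) ->
  \int[(P1 \x P2)%E]_z f z = \int[P1]_x \int[P2]_y f (x, y).
Proof.
move=> fi; rewrite /Rintegral -integral12_prod_meas1//; congr fine.
apply: ae_eq_integral => //.
- exact: (measurable_int P1 (integrable_fubini_F fi)).
- apply/measurable_EFinP; apply: measurableT_comp => //.
  exact: (measurable_int P1 (integrable_fubini_F fi)).
- have := ae_integrable1 fi; apply: filterS => x ix _.
  by rewrite fineK// integrable_fin_num.
Qed.

Lemma bounded_integrable_prod (f : T1 * T2 -> R) (M : R) :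
  measurable_fun setT f -> (forall z, `|f z| <= M) ->
  (P1 \x P2)%E.-integrable setT (fun z => (f z)%:E).
Proof. by move=> mf fM; exact: (@bounded_integrable _ _ _ ((P1 \x P2)%E : probability _ R) f M mf fM). Qed.

End fubini.

Section standard_complex_normal.
Context (R : realType).
(** The real and the imaginary part each carry half of the unit variance. *)
Let s : R := Num.sqrt 2^-1.
Let s0 : 0 < s. Proof. by rewrite sqrtr_gt0 invr_gt0. Qed.
Let s2 : s ^+ 2 = 2^-1. Proof. by rewrite sqr_sqrtr// invr_ge0. Qed.
Let N : probability _ R := normal_prob (0 : R) s.
Let NN : probability _ R := (N \x N)%E.
Let X (z : R * R) : 1.-tuple R[i] := [tuple z.1 +i* z.2].

Let mX : measurable_fun setT X.
Proof.
apply/measurable_fun_tnthP => i.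
rewrite (_ : _ \o _ = fun z : R * R => z.1 +i* z.2); last by apply/funext => z /=; rewrite ord1.
apply/measurable_fun_complexP; split; [exact: measurable_fst|exact: measurable_snd].
Qed.

Let weighted (c a b th : R) : 0 <= c ->
  \int[NN]_z (expR (- (c * (z.1 ^+ 2 + z.2 ^+ 2))) * cos (a * z.1 - b * z.2 + th)) =
  (1 + c)^-1 * expR (- ((a ^+ 2 + b ^+ 2) / (4 * (1 + c)))) * cos th.
Proof.
move=> c0; rewrite Rintegral_prod; last first.
  apply: (@bounded_integrable_prod _ _ _ _ R N N _ 1).
    apply: measurable_funM.
      apply: measurableT_comp => //; apply: measurableT_comp => //; apply: measurable_funM => //.
      apply: measurable_funD.
        by apply: measurable_funX; exact: measurable_fst.
      by apply: measurable_funX; exact: measurable_snd.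
    apply: measurableT_comp; first exact: measurable_cos.
    apply: measurable_funD => //; apply: measurable_funB.
      by apply: measurable_funM => //; exact: measurable_fst.
    by apply: measurable_funM => //; exact: measurable_snd.
  move=> z; rewrite normrM mulr_ile1 ?cos_max// ger0_norm ?expR_ge0//.
  by rewrite -expR0 ler_expR oppr_le0 mulr_ge0// addr_ge0// sqr_ge0.
have e x y : expR (- (c * (x ^+ 2 + y ^+ 2))) * cos (a * x - b * y + th) =
    expR (- (c * x ^+ 2)) * (expR (- (c * y ^+ 2)) * cos (- b * y + (a * x + th))).
  by rewrite mulrDr opprD expRD -mulrA; congr (_ * (_ * cos _)); ring.
pose q := Num.sqrt (1 + 2 * c * s ^+ 2).
have q2 : q ^+ 2 = 1 + c.
  by rewrite sqr_sqrtr s2; [field|rewrite addr_ge0// mulr_ge0 ?mulr_ge0].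
have c1 : 1 + c != 0 by rewrite gt_eqF// ltr_wpDr.
transitivity (\int[N]_x (q^-1 * expR (- ((- b) ^+ 2 * (s / q) ^+ 2 / 2)) *
    (expR (- (c * x ^+ 2)) * cos (a * x + th)))).
  apply: eq_Rintegral => x _; transitivity (\int[N]_y (expR (- (c * x ^+ 2)) *
      (expR (- (c * y ^+ 2)) * cos (- b * y + (a * x + th))))).
    by apply: eq_Rintegral => y _; exact: e.
  rewrite RintegralZl//; last first.
    apply: (@bounded_integrable _ _ _ N _ 1).
      apply: measurable_funM.
        apply: measurableT_comp => //; apply: measurableT_comp => //; exact: measurable_funM.
      apply: measurableT_comp; first exact: measurable_cos.
      by apply: measurable_funD => //; exact: measurable_funM.
    move=> y; rewrite normrM mulr_ile1 ?cos_max// ger0_norm ?expR_ge0//.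
    by rewrite -expR0 ler_expR oppr_le0 mulr_ge0// sqr_ge0.
  by rewrite normal_weight_cos// -/q; ring.
rewrite RintegralZl//; last first.
  apply: (@bounded_integrable _ _ _ N _ 1).
    apply: measurable_funM.
      apply: measurableT_comp => //; apply: measurableT_comp => //; exact: measurable_funM.
    apply: measurableT_comp; first exact: measurable_cos.
    by apply: measurable_funD => //; exact: measurable_funM.
  move=> y; rewrite normrM mulr_ile1 ?cos_max// ger0_norm ?expR_ge0//.
  by rewrite -expR0 ler_expR oppr_le0 mulr_ge0// sqr_ge0.
rewrite normal_weight_cos// -/q !mulrA; congr (_ * _).
set u := - (_ / 2); set v := - (_ / 2).
have -> : q^-1 * expR u / q * expR v = (q ^+ 2)^-1 * (expR u * expR v).
  by rewrite expr2 invfM; ring.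
rewrite q2 -expRD; congr (_ * expR _); have q0 : q != 0 by apply: contra_eq_neq q2 => ->; rewrite expr0n/= eq_sym.
have -> : u + v = - ((a ^+ 2 + b ^+ 2) * (s ^+ 2 / q ^+ 2) / 2) by rewrite /u /v; field.
by rewrite q2 s2; field.
Qed.

(** Only the cosine transform of [W] is known. By uniqueness it determines the law, so the weighted
    transform can be computed on an explicit model, a pair of independent normal variables, by
    Fubini. *)
Lemma complex_normal_weight d (T : measurableType d) (P : probability T R) (W : T -> R[i]) :
  measurable_fun setT W ->
  (forall g th, \int[P]_w cos (complex.Re (g * W w) + th) =
     expR (- (normc g ^+ 2 / 4)) * cos th) ->
  forall (c : R) g th, 0 <= c ->
  \int[P]_w (expR (- (c * normc (W w) ^+ 2)) * cos (complex.Re (g * W w) + th)) =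
  (1 + c)^-1 * expR (- (normc g ^+ 2 / (4 * (1 + c)))) * cos th.
Proof.
move=> mW WE c g th c0.
pose Y w : 1.-tuple R[i] := [tuple W w].
have mY : measurable_fun setT Y.
  apply/measurable_fun_tnthP => i.
  by rewrite (_ : _ \o _ = W)//; apply/funext => z /=; rewrite ord1.
have form (g' : 'I_1 -> R[i]) (x : R[i]) : real_form g' [tuple x] = complex.Re (g' ord0 * x).
  by rewrite /real_form big_ord_recl big_ord0 addr0.
have law := @same_charfun_same_law R 1 _ _ _ _ P NN Y X mY mX.
have {}law : forall A, measurable A -> P (Y @^-1` A) = NN (X @^-1` A).
  apply: law => g' th'.
  transitivity (expR (- (normc (g' ord0) ^+ 2 / 4)) * cos th').
    by rewrite -WE; apply: eq_Rintegral => w _; rewrite form.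
  have := @weighted 0 (complex.Re (g' ord0)) (complex.Im (g' ord0)) th' (lexx 0).
  rewrite addr0 invr1 mul1r mulr1 -sqr_normcE => <-.
  by apply: eq_Rintegral => z _; rewrite form complex_ReM/= mul0r oppr0 expR0 mul1r.
pose F (y : 1.-tuple R[i]) := expR (- (c * normc (tnth y ord0) ^+ 2)) *
  cos (complex.Re (g * tnth y ord0) + th).
have mF : measurable_fun setT F.
  apply: measurable_funM.
    apply: measurableT_comp => //; apply: measurableT_comp => //.
    apply: measurable_funM => //.
    exact: (measurableT_comp (@measurable_normc2 R) (measurable_tnth ord0)).
  apply: measurableT_comp; first exact: measurable_cos.
  apply: measurable_funD => //; apply: measurableT_comp; first exact: measurable_Re.
  by apply: measurable_complexM => //; exact: measurable_tnth.
have := @same_law_Rintegral _ _ _ _ _ P NN _ _ Y X mY mX law F mF; rewrite /F/= => ->.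
rewrite -/NN [in RHS]sqr_normcE -weighted//; apply: eq_Rintegral => z _.
have zE : tnth (X z) ord0 = z.1 +i* z.2 by [].
by rewrite zE [normc (z.1 +i* z.2) ^+ 2]sqr_normcE complex_ReM.
Qed.

End standard_complex_normal.

(** * Moments *)

Section moments.
Context d (T : measurableType d) (R : realType) (P : probability T R).
Implicit Types f g : T -> R.

(** This class contains the normal variables and is closed under sums and products, so integrability
    of polynomials in them follows from their shape alone. *)
Definition all_moments f : Prop :=
  measurable_fun setT f /\ forall p : nat, P.-integrable setT (fun x => (`|f x| ^+ p)%:E).

Lemma all_moments_le f g : measurable_fun setT f -> (forall x, `|f x| <= `|g x|) ->
  all_moments g -> all_moments f.
Proof.
move=> mf fg [mg ig]; split=> // p.
apply: (le_integrableR (g := fun x => `|g x| ^+ p)) => //.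
  by apply: measurable_funX; exact: measurableT_comp.
by move=> x; rewrite ger0_norm ?exprn_ge0// lerXn2r ?nnegrE.
Qed.

Lemma all_moments_integrable f : all_moments f -> P.-integrable setT (fun x => (f x)%:E).
Proof.
move=> [mf /(_ 1%N) fi]; by apply: (le_integrableR (g := fun x => `|f x| ^+ 1)) => // x; rewrite expr1.
Qed.

Lemma all_moments_cst (c : R) : all_moments (fun=> c).
Proof. by split=> // p; exact: finite_measure_integrable_cst. Qed.

Lemma all_momentsX f p : all_moments f -> all_moments (fun x => f x ^+ p).
Proof.
move=> [mf fi]; split; first exact: measurable_funX.
move=> r; have := fi (p * r)%N; congr (P.-integrable _ _).
by apply/funext => x; rewrite normrX exprM.
Qed.

Lemma all_momentsD f g : all_moments f -> all_moments g -> all_moments (fun x => f x + g x).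
Proof.
move=> [mf fi] [mg gi]; split; first exact: measurable_funD.
move=> p; apply: (le_integrableR (g := fun x => 2 ^+ p * (`|f x| ^+ p + `|g x| ^+ p))).
- by apply: measurable_funX; apply: measurableT_comp => //; exact: measurable_funD.
- move=> x; rewrite ger0_norm ?exprn_ge0//.
  wlog h : f g {mf mg fi gi} / `|f x| <= `|g x|.
    move=> h; have [/h//|/ltW/h] := leP `|f x| `|g x|.
    by rewrite addrC [X in _ * X]addrC.
  apply: (@le_trans _ _ ((2 * `|g x|) ^+ p)).
    rewrite lerXn2r ?nnegrE ?mulr_ge0//.
    by rewrite mulr_natl mulr2n (le_trans (ler_normD _ _))// lerD2r.
  by rewrite exprMn ler_pM2l ?exprn_gt0// lerDr exprn_ge0.
- by apply: integrableZR; exact: integrableDR.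
Qed.

Lemma all_momentsN f : all_moments f -> all_moments (fun x => - f x).
Proof.
move=> fm; apply: (all_moments_le _ _ fm); first by apply: measurableT_comp => //; exact: fm.1.
by move=> x; rewrite normrN.
Qed.

Lemma all_momentsB f g : all_moments f -> all_moments g -> all_moments (fun x => f x - g x).
Proof. by move=> fm gm; apply: all_momentsD => //; exact: all_momentsN. Qed.

Lemma all_momentsM f g : all_moments f -> all_moments g -> all_moments (fun x => f x * g x).
Proof.
move=> fm gm; apply: (all_moments_le _ _ (all_momentsD (all_momentsX 2 fm) (all_momentsX 2 gm))).
  by apply: measurable_funM; [exact: fm.1|exact: gm.1].
move=> x; rewrite [leRHS]ger0_norm ?addr_ge0 ?sqr_ge0// normrM.
rewrite -[f x ^+ 2]real_normK ?num_real// -[g x ^+ 2]real_normK ?num_real//.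
have := sqr_ge0 (`|f x| - `|g x|); have := sqr_ge0 (`|f x| + `|g x|); nra.
Qed.

Lemma all_moments_sum (I : Type) (r : seq I) (p : pred I) (f : I -> T -> R) :
  (forall i, p i -> all_moments (f i)) -> all_moments (fun x => \sum_(i <- r | p i) f i x).
Proof.
move=> fm; elim: r => [|i r ih].
  by under eq_fun do rewrite big_nil; exact: all_moments_cst.
have [pi|/negbTE pi] := boolP (p i); last first.
  by under eq_fun do rewrite big_cons pi.
under eq_fun do rewrite big_cons pi.
by apply: all_momentsD => //; exact: fm.
Qed.

Lemma has_normal_law_all_moments f : measurable_fun setT f -> has_normal_law P f ->
  all_moments f.
Proof.
move=> mf nf; split=> // p.
apply: (le_integrableR (g := fun x => expR (p%:R * `|f x|))).
- by apply: measurable_funX; exact: measurableT_comp.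
- move=> x; rewrite ger0_norm ?exprn_ge0// expRM_natl lerXn2r ?nnegrE ?expR_ge0//.
  exact: ler_abs_expR.
- exact: has_normal_law_integrable_expR.
Qed.

End moments.

Lemma complex_Re_conj (R : realType) (x : R[i]) : complex.Re x^* = complex.Re x.
Proof. by case: x. Qed.

Lemma complex_Im_conj (R : realType) (x : R[i]) : complex.Im x^* = - complex.Im x.
Proof. by case: x. Qed.

Section complex_moments.
Context d (T : measurableType d) (R : realType) (P : probability T R).
Implicit Types X Y : T -> R[i].

Definition complex_moments X : Prop :=
  all_moments P (fun w => complex.Re (X w)) /\ all_moments P (fun w => complex.Im (X w)).

Lemma complex_moments_measurable X : complex_moments X -> measurable_fun setT X.
Proof. by move=> [[h _] [h' _]]; apply/measurable_fun_complexP. Qed.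

Lemma complex_moments_cst (c : R[i]) : complex_moments (fun=> c).
Proof. by split; exact: all_moments_cst. Qed.

Lemma complex_momentsD X Y : complex_moments X -> complex_moments Y ->
  complex_moments (fun w => X w + Y w).
Proof.
move=> [Xr Xi] [Yr Yi]; split.
- by under eq_fun do rewrite ReD; exact: all_momentsD.
- by under eq_fun do rewrite ImD; exact: all_momentsD.
Qed.

Lemma complex_momentsM X Y : complex_moments X -> complex_moments Y ->
  complex_moments (fun w => X w * Y w).
Proof.
move=> [Xr Xi] [Yr Yi]; split.
- by under eq_fun do rewrite complex_ReM; apply: all_momentsB; exact: all_momentsM.
- by under eq_fun do rewrite complex_ImM; apply: all_momentsD; exact: all_momentsM.
Qed.

Lemma complex_moments_conj X : complex_moments X -> complex_moments (fun w => (X w)^*).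
Proof.
move=> [Xr Xi]; split; first by under eq_fun do rewrite complex_Re_conj.
by under eq_fun do rewrite complex_Im_conj; exact: all_momentsN.
Qed.

Lemma complex_moments_sum (I : Type) (r : seq I) (X : I -> T -> R[i]) :
  (forall i, complex_moments (X i)) -> complex_moments (fun w => \sum_(i <- r) X i w).
Proof.
move=> Xm; elim: r => [|i r ih].
  by under eq_fun do rewrite big_nil; exact: complex_moments_cst.
by under eq_fun do rewrite big_cons; exact: complex_momentsD.
Qed.

Lemma complex_moments_normc2 X : complex_moments X -> all_moments P (fun w => normc (X w) ^+ 2).
Proof.
move=> [Xr Xi]; under eq_fun do rewrite sqr_normcE.
by apply: all_momentsD; exact: all_momentsX.
Qed.

Lemma normc_le1Dsqr (x : R[i]) : normc x <= 1 + normc x ^+ 2.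
Proof. have := sqr_ge0 (normc x - 1); have := normc_ge0 x; nra. Qed.

Lemma complex_moments_normc X : complex_moments X -> all_moments P (fun w => normc (X w)).
Proof.
move=> Xm; apply: (all_moments_le (g := fun w => 1 + normc (X w) ^+ 2)).
- have mX := complex_moments_measurable Xm.
  have -> : (fun w => normc (X w)) = fun w => Num.sqrt (normc (X w) ^+ 2).
    by apply/funext => w; rewrite sqrtr_sqr ger0_norm// normc_ge0.
  exact: (measurableT_comp (continuous_measurable_fun (@sqrt_continuous R)) (complex_moments_normc2 Xm).1).
- move=> w; rewrite !ger0_norm ?normc_le1Dsqr ?normc_ge0//.
  by rewrite addr_ge0// sqr_ge0.
- by apply: all_momentsD; [exact: all_moments_cst|exact: complex_moments_normc2].
Qed.

Lemma complex_expectationE X :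
  complex_expectation P X = (\int[P]_w complex.Re (X w)) +i* (\int[P]_w complex.Im (X w)).
Proof. by rewrite /complex_expectation unlock. Qed.

Lemma complex_expectationD X Y : complex_moments X -> complex_moments Y ->
  complex_expectation P (fun w => X w + Y w) =
  complex_expectation P X + complex_expectation P Y.
Proof.
move=> [Xr Xi] [Yr Yi]; rewrite !complex_expectationE; apply: complex_ext => /=;
  rewrite -RintegralD//; do ?exact: all_moments_integrable.
- by apply: eq_Rintegral => w _; rewrite ReD.
- by apply: eq_Rintegral => w _; rewrite ImD.
Qed.

Lemma complex_expectationZ (c : R[i]) X : complex_moments X ->
  complex_expectation P (fun w => c * X w) = c * complex_expectation P X.
Proof.
move=> [/all_moments_integrable Xr /all_moments_integrable Xi].
rewrite !complex_expectationE; apply: complex_ext; rewrite ?complex_ReM ?complex_ImM /=.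
- rewrite -!RintegralZl//; rewrite -RintegralB//; do ?exact: integrableZR.
  by apply: eq_Rintegral => w _; rewrite complex_ReM.
- rewrite -!RintegralZl//; rewrite -RintegralD//; do ?exact: integrableZR.
  by apply: eq_Rintegral => w _; rewrite complex_ImM.
Qed.

Lemma complex_expectation_cst (c : R[i]) : complex_expectation P (fun=> c) = c.
Proof. by rewrite complex_expectationE !Rintegral_cst1; case: c. Qed.

Lemma complex_expectation_sum (I : Type) (r : seq I) (X : I -> T -> R[i]) :
  (forall i, complex_moments (X i)) ->
  complex_expectation P (fun w => \sum_(i <- r) X i w) =
  \sum_(i <- r) complex_expectation P (X i).
Proof.
move=> Xm; elim: r => [|i r ih].
  rewrite big_nil -[RHS](complex_expectation_cst 0); congr complex_expectation.
  by apply/funext => w; rewrite big_nil.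
rewrite big_cons -ih -complex_expectationD//; last exact: complex_moments_sum.
by congr complex_expectation; apply/funext => w; rewrite big_cons.
Qed.

Lemma complex_expectation_conj X : complex_moments X ->
  complex_expectation P (fun w => (X w)^*) = (complex_expectation P X)^*.
Proof.
move=> [Xr Xi]; rewrite !complex_expectationE; apply: complex_ext => /=.
- by apply: eq_Rintegral => w _; rewrite complex_Re_conj.
- rewrite -mulN1r -RintegralZl//; last exact: all_moments_integrable.
  by apply: eq_Rintegral => w _; rewrite complex_Im_conj mulN1r.
Qed.

Lemma sqr_Re_half (x : R[i]) :
  complex.Re x ^+ 2 = 2^-1 * (complex.Re (x * x^*) + complex.Re (x * x)).
Proof. by case: x => a b; rewrite /= ; field. Qed.

Lemma Rintegral_sqr_Re X : complex_moments X ->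
  \int[P]_w (complex.Re (X w) ^+ 2) =
  2^-1 * (complex.Re (complex_expectation P (fun w => X w * (X w)^*)) +
          complex.Re (complex_expectation P (fun w => X w * X w))).
Proof.
move=> Xm; rewrite !complex_expectationE /=.
have m1 := complex_momentsM Xm (complex_moments_conj Xm).
have m2 := complex_momentsM Xm Xm.
rewrite -RintegralD//; last 2 first.
- exact: all_moments_integrable m1.1.
- exact: all_moments_integrable m2.1.
rewrite -RintegralZl//; last by apply: integrableDR; apply: all_moments_integrable; [exact: m1.1|exact: m2.1].
by apply: eq_Rintegral => w _; exact: sqr_Re_half.
Qed.

Lemma complex_expectation_indep X Y : complex_moments X -> complex_moments Y ->
  (forall A B, measurable A -> measurable B ->
    P (X @^-1` A `&` Y @^-1` B) = (P (X @^-1` A) * P (Y @^-1` B))%E) ->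
  complex_expectation P (fun w => X w * Y w) =
  complex_expectation P X * complex_expectation P Y.
Proof.
move=> Xm Ym XY; rewrite !complex_expectationE.
have mX := complex_moments_measurable Xm; have mY := complex_moments_measurable Ym.
have E (f g : R[i] -> R) : measurable_fun setT f -> measurable_fun setT g ->
    all_moments P (fun w => f (X w)) -> all_moments P (fun w => g (Y w)) ->
    \int[P]_w (f (X w) * g (Y w)) = (\int[P]_w f (X w)) * (\int[P]_w g (Y w)).
  move=> mf mg fm gm; apply: (indep_pair mX mY XY mf mg); apply: all_moments_integrable => //.
  exact: all_momentsM.
have mre := @measurable_Re R; have mim := @measurable_Im R.
have [Xr Xi] := Xm; have [Yr Yi] := Ym.
apply: complex_ext; rewrite ?complex_ReM ?complex_ImM /= -!E//.
- rewrite -RintegralB//; do ?by apply: all_moments_integrable; exact: all_momentsM.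
  by apply: eq_Rintegral => w _; rewrite complex_ReM.
- rewrite -RintegralD//; do ?by apply: all_moments_integrable; exact: all_momentsM.
  by apply: eq_Rintegral => w _; rewrite complex_ImM.
Qed.

End complex_moments.

(** * Noise, fading and output *)

Section sigma_of_measurable.
Context (R : realType).

Lemma sigma_of_preimage (S : pointedType) (J : Type) (X : J -> S -> R[i]) d'
    (E : measurableType d') (f : S -> E) :
  measurable_fun [set: g_sigma_algebraType
    (\bigcup_j preimage_set_system setT (X j) measurable)] f ->
  forall B, measurable B -> sigma_of X (f @^-1` B).
Proof. by move=> mf B mB; have := mf measurableT B mB; rewrite setTI. Qed.

Lemma sigma_of_coord (S : pointedType) (J : Type) (X : J -> S -> R[i]) (j : J) :
  measurable_fun [set: g_sigma_algebraType
    (\bigcup_j preimage_set_system setT (X j) measurable)] (X j).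
Proof. by move=> _ A mA; apply: sub_sigma_algebra; exists j => //; exists A. Qed.

End sigma_of_measurable.

Lemma conjcE (R : realType) (x : R[i]) : (x^*)%R = x^*%C.
Proof. by []. Qed.

Section proper_normal.
Context d (T : measurableType d) (R : realType) (P : probability T R).

Lemma mutually_independent_inj (I : finType) (J : eqType) (e : I -> J) (F : J -> set (set T)) :
  injective e -> mutually_independent P F -> mutually_independent P (fun i => F (e i)).
Proof.
move=> einj FI [|i0 s] A us As; first by rewrite !big_nil probability_setT.
set s' := i0 :: s.
(* A partial inverse of [e]. The default [i0] concerns only indices outside the image of [e], and
   none of these occur in [map e s']. *)
pose A' j := A (odflt i0 [pick i | e i == j]).
have A'E i : A' (e i) = A i.
  rewrite /A'; case: pickP => [i' /eqP/einj -> //|/(_ i)]; by rewrite eqxx.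
have := FI (map e s') A'; rewrite !big_map (map_inj_uniq einj).
under eq_bigr do rewrite A'E.
move=> h; rewrite h//; first by apply: eq_bigr => i _; rewrite A'E.
by move=> j /mapP[i si ->]; rewrite A'E; exact: As.
Qed.

Lemma proper_normal_inj (I : finType) (J : eqType) (e : I -> J) (X : J -> T -> R[i]) :
  injective e -> jointly_proper_normal P X -> jointly_proper_normal P (fun i => X (e i)).
Proof.
move=> einj [XN XP]; split=> [s c|i j]; last exact: XP.
pose c' j := if [pick i | e i == j] is Some i then c i else 0.
have c'E i : c' (e i) = c i.
  rewrite /c'; case: pickP => [i' /eqP/einj -> //|/(_ i)]; by rewrite eqxx.
have := XN (map e s) c'; congr has_normal_law; apply/funext => w.
by rewrite big_map; under eq_bigr do rewrite c'E.
Qed.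

Context (J : Type) (X : J -> T -> R[i]).
Hypothesis mX : forall j, measurable_fun setT (X j).
Hypothesis nX : jointly_proper_normal P X.
Hypothesis X0 : forall j, complex_expectation P (X j) = 0.

Lemma proper_normal_moments j : complex_moments P (X j).
Proof.
have [mr mi] := (measurable_fun_complexP (X j)).1 (mX j).
split; apply: has_normal_law_all_moments => //.
- have := nX.1 [:: j] (fun=> 1); congr has_normal_law; apply/funext => w.
  by rewrite big_seq1 mul1r.
- have := nX.1 [:: j] (fun=> 0 -i* 1); congr has_normal_law; apply/funext => w.
  by rewrite big_seq1 complex_ReM /= mul0r sub0r mulN1r opprK.
Qed.

Lemma proper_normal_pseudo i j : complex_expectation P (fun w => X i w * X j w) = 0.
Proof.
have <- := nX.2 i j; rewrite !X0.
by congr complex_expectation; apply/funext => w; rewrite !subr0.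
Qed.

(** The 4 is 2 times 2: the real part of a proper variable has half of its power as variance, and
    the normal transform halves the variance again. *)
Lemma proper_normal_cos (s : seq J) (c : J -> R[i]) (th : R) :
  \int[P]_w cos (complex.Re (\sum_(j <- s) c j * X j w) + th) =
  expR (- (complex.Re (\sum_(i <- s) \sum_(j <- s) c i * (c j)^* *
     complex_expectation P (fun w => X i w * (X j w)^*)) / 4)) * cos th.
Proof.
have Xm := proper_normal_moments.
have cXm j : complex_moments P (fun w => c j * X j w).
  by apply: complex_momentsM => //; exact: complex_moments_cst.
have Sm : complex_moments P (fun w => \sum_(j <- s) c j * X j w).
  exact: complex_moments_sum.
rewrite has_normal_law_cos; [|exact: Sm.1.1|exact: nX.1|]; last first.
  have := complex_expectation_sum s cXm.
  rewrite complex_expectationE => /(congr1 (@complex.Re R)) /= ->.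
  rewrite big1// => j _; rewrite complex_expectationZ// X0 mulr0//.
congr (expR (- _) * _); rewrite Rintegral_sqr_Re//.
have -> : complex_expectation P (fun w => (\sum_(j <- s) c j * X j w) *
    (\sum_(j <- s) c j * X j w)) = 0.
  transitivity (complex_expectation P (fun w =>
      \sum_(i <- s) \sum_(j <- s) (c i * c j) * (X i w * X j w))).
    congr complex_expectation; apply/funext => w; rewrite mulr_suml; apply: eq_bigr => i _.
    by rewrite mulr_sumr; apply: eq_bigr => j _; ring.
  rewrite complex_expectation_sum; last first.
    move=> i; apply: complex_moments_sum => j; apply: complex_momentsM.
      exact: complex_moments_cst.
    exact: complex_momentsM.
  rewrite big1// => i _; rewrite complex_expectation_sum; last first.
    move=> j; apply: complex_momentsM; first exact: complex_moments_cst.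
    exact: complex_momentsM.
  rewrite big1// => j _; rewrite complex_expectationZ ?proper_normal_pseudo ?mulr0//.
  exact: complex_momentsM.
have -> : complex_expectation P (fun w => (\sum_(j <- s) c j * X j w) *
    (\sum_(j <- s) c j * X j w)^*) = \sum_(i <- s) \sum_(j <- s) c i * (c j)^* *
     complex_expectation P (fun w => X i w * (X j w)^*).
  transitivity (complex_expectation P (fun w =>
      \sum_(i <- s) \sum_(j <- s) (c i * (c j)^*) * (X i w * (X j w)^*))).
    congr complex_expectation; apply/funext => w; rewrite mulr_suml; apply: eq_bigr => i _.
    rewrite conjcE conjc_sum mulr_sumr; apply: eq_bigr => j _.
    by rewrite conjcM !conjcE; ring.
  have Xm2 i j : complex_moments P (fun w => X i w * (X j w)^*).
    by apply: complex_momentsM => //; exact: complex_moments_conj.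
  rewrite complex_expectation_sum; last first.
    move=> i; apply: complex_moments_sum => j; apply: complex_momentsM => //.
    exact: complex_moments_cst.
  apply: eq_bigr => i _; rewrite complex_expectation_sum; last first.
    by move=> j; apply: complex_momentsM => //; exact: complex_moments_cst.
  by apply: eq_bigr => j _; rewrite complex_expectationZ.
by rewrite /= addr0; field.
Qed.

End proper_normal.

Section noise.
Context d (T : measurableType d) (R : realType) (P : probability T R) (NR : nat).
Variable W : 'I_NR -> nat -> {RV P >-> R[i]}.
Hypothesis nm : noise_model W.

Let mW l n : measurable_fun setT (W l n). Proof. exact: measurable_funP. Qed.

Lemma noise_moments l n : complex_moments P (W l n).
Proof. exact: (@proper_normal_moments _ _ _ _ _ _ (fun _ : unit => mW l n) (noise_normal nm l n) tt). Qed.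

Lemma noise_second l n : \int[P]_t (normc (W l n t) ^+ 2) = 1.
Proof. by have := noise_variance1 nm l n; rewrite unlock /Rintegral => ->. Qed.

Lemma noise_variance l n : complex_expectation P (fun t => W l n t * (W l n t)^*) = 1.
Proof.
rewrite complex_expectationE; apply: complex_ext => /=.
- by rewrite -(noise_second l n); apply: eq_Rintegral => t _; rewrite mulc_conj.
- by rewrite -[RHS](Rintegral_cst1 P 0); apply: eq_Rintegral => t _; rewrite mulc_conj.
Qed.

Lemma noise_cos l n (g : R[i]) (th : R) :
  \int[P]_t cos (complex.Re (g * W l n t) + th) = expR (- (normc g ^+ 2 / 4)) * cos th.
Proof.
have := @proper_normal_cos _ _ _ _ _ _ (fun _ : unit => mW l n) (noise_normal nm l n)
  (fun=> noise_mean0 nm l n) [:: tt] (fun=> g) th.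
rewrite !big_seq1 noise_variance mulr1 mulc_conj /= => <-.
by apply: eq_Rintegral => t _; rewrite big_seq1.
Qed.

Section block.
Variables (D : nat) (e : 'I_D -> 'I_NR * nat).
Hypothesis einj : injective e.

Definition noise_block t : D.-tuple R[i] := [tuple W (e a).1 (e a).2 t | a < D].

Lemma measurable_noise_block : measurable_fun setT noise_block.
Proof.
apply/measurable_fun_tnthP => a.
by rewrite (_ : _ \o _ = W (e a).1 (e a).2)//; apply/funext => t /=; rewrite tnth_mktuple.
Qed.

Lemma noise_weighted_charfun (c : 'I_D -> R) (g : 'I_D -> R[i]) (th : R) :
  (forall a, 0 <= c a) ->
  \int[P]_t (\prod_a expR (- (c a * normc (tnth (noise_block t) a) ^+ 2)) *
     cos (real_form g (noise_block t) + th)) =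
  \prod_a ((1 + c a)^-1 * expR (- (normc (g a) ^+ 2 / (4 * (1 + c a))))) * cos th.
Proof.
move=> c0.
have := @indep_family _ _ _ P _ (fun a t => W (e a).1 (e a).2 t)
  (fun a x => expR (- (c a * normc x ^+ 2))) (fun a x => complex.Re (g a * x))
  (fun a => (1 + c a)^-1 * expR (- (normc (g a) ^+ 2 / (4 * (1 + c a)))))
  (index_enum 'I_D) th.
move=> <- //.
- apply: eq_Rintegral => t _; congr (_ * cos (_ + _)).
    by apply: eq_bigr => a _; rewrite tnth_mktuple.
  by rewrite /real_form Re_sum; apply: eq_bigr => a _; rewrite tnth_mktuple.
- exact: (mutually_independent_inj einj (noise_indep nm)).
- move=> a; apply: measurableT_comp => //; apply: measurableT_comp => //.
  by apply: measurable_funM => //; exact: measurable_normc2.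
- move=> a x; rewrite ger0_norm ?expR_ge0// -expR0 ler_expR oppr_le0.
  by rewrite mulr_ge0 ?sqr_ge0.
- move=> a; apply: measurableT_comp; first exact: measurable_Re.
  by apply: measurable_complexM.
- by move=> a th0; apply: complex_normal_weight => // *; exact: noise_cos.
- exact: index_enum_uniq.
Qed.

End block.

Lemma noise_cross l l' n n' : (l, n) != (l', n') ->
  complex_expectation P (fun t => W l n t * (W l' n' t)^*) = 0.
Proof.
move=> ne; rewrite complex_expectation_indep ?(noise_mean0 nm) ?mul0r//.
- exact: noise_moments.
- exact/complex_moments_conj/noise_moments.
move=> A B mA mB.
have := noise_indep nm (s := [:: (l, n); (l', n')])
  (A := fun i => if i == (l, n) then W l n @^-1` A else (fun t => (W l' n' t)^*) @^-1` B).
rewrite /= !big_cons !big_nil eqxx eq_sym (negbTE ne) setIT mule1; apply=> //.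
  by rewrite inE ne.
move=> i; rewrite !inE => /orP[] /eqP ->.
  rewrite eqxx; apply: sigma_of_preimage mA.
  exact: (sigma_of_coord (X := fun _ : unit => W l n) tt).
rewrite eq_sym (negbTE ne); apply: sigma_of_preimage mB.
have h := sigma_of_coord (X := fun _ : unit => W l' n' : T -> R[i]) tt.
apply/measurable_fun_complexP; have [h1 h2] := (measurable_fun_complexP _).1 h; split.
- by rewrite (_ : _ \o _ = complex.Re (R:=R) \o W l' n')//; apply/funext => t /=; rewrite complex_Re_conj.
- rewrite (_ : _ \o _ = -%R \o (complex.Im (R:=R) \o W l' n')); last first.
    by apply/funext => t /=; rewrite complex_Im_conj.
  exact: measurableT_comp.
Qed.

End noise.

Section fading.
Context d (T : measurableType d) (R : realType) (P : probability T R) (NT NR : nat).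
Variable H : 'I_NT -> 'I_NR -> int -> {RV P >-> R[i]}.
Hypothesis fm : fading_model H.

Lemma fading_moments k l n : complex_moments P (H k l n).
Proof.
by apply: (@proper_normal_moments _ _ _ _ _ _ _ (fading_normal fm) (k, l, n)) => j.
Qed.

(** Stationarity, with the shift [m], is applied to events in the two coordinates [n - m] and 0
    only. *)
Lemma fading_cov_shift k l n m :
  complex_expectation P (fun t => H k l n t * (H k l m t)^*) =
  autocorrelation P (H k l) (n - m).
Proof.
pose X1 t := (H k l n t, H k l m t); pose X2 t := (H k l (n - m) t, H k l 0 t).
have mX1 : measurable_fun setT X1 by exact: measurable_fun_pair.
have mX2 : measurable_fun setT X2 by exact: measurable_fun_pair.
have law A : measurable A -> P (X1 @^-1` A) = P (X2 @^-1` A).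
  move=> mA.
  have := fading_stationary fm k l m (A := [set x | A (x (n - m), x 0)]).
  rewrite /= subrK add0r; apply.
  rewrite /sequence_event.
  apply: (@sigma_of_preimage R (int -> R[i]) int _ _ _ (fun x => (x (n - m), x 0))) mA.
  by apply: measurable_fun_pair; exact: sigma_of_coord.
rewrite /autocorrelation !complex_expectationE.
have mp : measurable_fun setT (fun z : R[i] * R[i] => z.1 * z.2^*).
  apply: measurable_complexM; first exact: measurable_fst.
  have [h1 h2] := (measurable_fun_complexP _).1 (@measurable_snd _ _ R[i] R[i]).
  apply/measurable_fun_complexP; split.
  - by rewrite (_ : _ \o _ = complex.Re (R:=R) \o snd)//; apply/funext => t /=; rewrite complex_Re_conj.
  - rewrite (_ : _ \o _ = -%R \o (complex.Im (R:=R) \o snd)); last first.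
      by apply/funext => t /=; rewrite complex_Im_conj.
    exact: measurableT_comp.
have [mr mi] := (measurable_fun_complexP _).1 mp.
apply: complex_ext => /=.
- exact: (@same_law_Rintegral _ _ _ _ _ P P _ _ X1 X2 mX1 mX2 law _ mr).
- exact: (@same_law_Rintegral _ _ _ _ _ P P _ _ X1 X2 mX1 mX2 law _ mi).
Qed.

Lemma fading_cov k l k' l' n m :
  complex_expectation P (fun t => H k l n t * (H k' l' m t)^*) =
  if (k, l) == (k', l') then autocorrelation P (H k l) (n - m) else 0.
Proof.
case: eqP => [[<- <-]|/eqP ne]; first exact: fading_cov_shift.
rewrite complex_expectation_indep ?(fading_mean0 fm) ?mul0r//.
- exact: fading_moments.
- exact/complex_moments_conj/fading_moments.
move=> A B mA mB.
have := fading_indep fm (s := [:: (k, l); (k', l')])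
  (A := fun i => if i == (k, l) then H k l n @^-1` A else (fun t => (H k' l' m t)^*) @^-1` B).
rewrite /= !big_cons !big_nil eqxx eq_sym (negbTE ne) setIT mule1; apply=> //.
  by rewrite inE ne.
move=> i; rewrite !inE => /orP[] /eqP ->.
  rewrite eqxx; apply: sigma_of_preimage mA.
  exact: (sigma_of_coord (X := fun n => H k l n : T -> R[i])).
rewrite eq_sym (negbTE ne); apply: sigma_of_preimage mB.
have h := sigma_of_coord (X := fun m => H k' l' m : T -> R[i]) m.
apply/measurable_fun_complexP; have [h1 h2] := (measurable_fun_complexP _).1 h; split.
- by rewrite (_ : _ \o _ = complex.Re (R:=R) \o H k' l' m)//; apply/funext => t /=; rewrite complex_Re_conj.
- rewrite (_ : _ \o _ = -%R \o (complex.Im (R:=R) \o H k' l' m)); last first.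
    by apply/funext => t /=; rewrite complex_Im_conj.
  exact: measurableT_comp.
Qed.

Lemma autocorrelationN k l n :
  autocorrelation P (H k l) (- n) = (autocorrelation P (H k l) n)^*.
Proof.
have mm : complex_moments P (fun t => H k l n t * (H k l 0 t)^*).
  by apply: complex_momentsM; [exact: fading_moments|exact/complex_moments_conj/fading_moments].
rewrite -[in RHS](subr0 n) -fading_cov_shift -complex_expectation_conj// -sub0r -fading_cov_shift.
by congr complex_expectation; apply/funext => t; rewrite conjcM conjcK mulrC.
Qed.

End fading.

(** * Flattened blocks and the conditional law of the output *)

Section flat_blocks.
Context (R : realType) (N n : nat).
Local Notation block := (N.-tuple (n.-tuple R[i])).
Local Notation D := #|{: 'I_N * 'I_n}|.

(** Gaussian densities live on plain tuples, so a block is flattened; an index of the flat tuple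
    encodes a time and an antenna. *)
Definition time_of (a : 'I_D) : 'I_N := (enum_val a).1.
Definition antenna_of (a : 'I_D) : 'I_n := (enum_val a).2.

Definition flat (y : block) : D.-tuple R[i] :=
  [tuple tnth (tnth y (time_of a)) (antenna_of a) | a < D].

Definition unflat (v : D.-tuple R[i]) : block :=
  [tuple [tuple tnth v (enum_rank (i, l)) | l < n] | i < N].

Lemma flatK : cancel flat unflat.
Proof.
move=> y; apply/eq_from_tnth => i; apply/eq_from_tnth => l.
by rewrite !tnth_mktuple /time_of /antenna_of enum_rankK.
Qed.

Lemma unflatK : cancel unflat flat.
Proof.
move=> v; apply/eq_from_tnth => a; rewrite !tnth_mktuple /time_of /antenna_of.
by rewrite -surjective_pairing enum_valK.
Qed.

Lemma measurable_entry (i : 'I_N) (l : 'I_n) :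
  measurable_fun setT (fun y : block => tnth (tnth y i) l).
Proof. exact: (measurableT_comp (measurable_tnth l) (measurable_tnth i)). Qed.

Lemma measurable_flat : measurable_fun setT flat.
Proof.
apply/measurable_fun_tnthP => a.
rewrite (_ : _ \o _ = fun y : block => tnth (tnth y (time_of a)) (antenna_of a)).
  exact: measurable_entry.
by apply/funext => y /=; rewrite tnth_mktuple.
Qed.

Lemma measurable_unflat : measurable_fun setT unflat.
Proof.
apply/measurable_fun_tnthP => i; apply/measurable_fun_tnthP => l.
rewrite (_ : _ \o _ = fun v : D.-tuple R[i] => tnth v (enum_rank (i, l))).
  exact: measurable_tnth.
by apply/funext => y /=; rewrite !tnth_mktuple.
Qed.

Lemma sum_flat (V : nmodType) (F : 'I_N -> 'I_n -> V) :
  \sum_a F (time_of a) (antenna_of a) = \sum_i \sum_l F i l.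
Proof.
rewrite pair_big /= (reindex (fun a : 'I_D => enum_val a)) /=; first by apply: eq_bigr.
by exists enum_rank => x _; rewrite ?enum_valK ?enum_rankK.
Qed.

Lemma flat_index_inj (a b : 'I_D) : time_of a = time_of b -> antenna_of a = antenna_of b -> a = b.
Proof.
rewrite /time_of /antenna_of => e1 e2; apply: enum_val_inj.
by rewrite [LHS]surjective_pairing [RHS]surjective_pairing e1 e2.
Qed.

End flat_blocks.

Section output.
Context d (T : measurableType d) (R : realType) (P : probability T R) (NT NR : nat).
Variables (H : 'I_NT -> 'I_NR -> int -> {RV P >-> R[i]}).
Variables (W : 'I_NR -> nat -> {RV P >-> R[i]}).
Hypotheses (fm : fading_model H) (nm : noise_model W) (fn : fading_noise_independent H W).
Variables (rho : R) (N : nat).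
Hypothesis rho0 : 0 <= rho.
Local Notation block n := (N.-tuple (n.-tuple R[i])).
Local Notation D := #|{: 'I_N * 'I_NR}|.
Local Notation conj := (@conjc R).
Local Notation entry z i k := (tnth (tnth z i) k).
Implicit Types (z : block NT) (a b : 'I_D) (s : nat).

(** The offset [s] is the time elapsed before the block. It lets the second of two concatenated
    blocks be the output of the same channel at offset [N]. *)
Definition output s z t : block NR :=
  [tuple [tuple (Num.sqrt rho)%:C *
      (\sum_(k < NT) H k l (s + i).+1%:Z t * tnth (tnth z i) k)
      + W l (s + i).+1 t | l < NR] | i < N].

Definition signal s z a t : R[i] :=
  \sum_(k < NT) H k (antenna_of a) (s + time_of a).+1%:Z t * entry z (time_of a) k.

(** The offset [s] of the block is absent: by stationarity only time differences matter. Different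
    receive antennas see independent centred fading, whence the 0. *)
Definition signal_cov z a b : R[i] :=
  if antenna_of a == antenna_of b then
    \sum_(k < NT) autocorrelation P (H k (antenna_of a)) ((time_of a)%:Z - (time_of b)%:Z) *
      (entry z (time_of a) k * conj (entry z (time_of b) k))
  else 0.

Definition output_cov z : 'M[R[i]]_D :=
  \matrix_(a, b) ((a == b)%:R + rho%:C * signal_cov z a b).

Definition noise_index s a : 'I_NR * nat := (antenna_of a, (s + time_of a).+1).

Lemma noise_index_inj s : injective (noise_index s).
Proof.
by move=> a b [e1 /eqP]; rewrite eqn_add2l => /eqP/ord_inj e2; exact: flat_index_inj.
Qed.

Lemma flat_output s z t a : tnth (flat (output s z t)) a =
  (Num.sqrt rho)%:C * signal s z a t + tnth (noise_block W (noise_index s) t) a.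
Proof. by rewrite !tnth_mktuple. Qed.

Lemma signal_moments s z a : complex_moments P (signal s z a).
Proof.
apply: complex_moments_sum => k; apply: complex_momentsM; last exact: complex_moments_cst.
exact: fading_moments.
Qed.

Let fading_form z a b (c c' : R[i]) : \sum_k \sum_k' (c * entry z (time_of a) k) *
     conj (c' * entry z (time_of b) k') *
     (if (k, antenna_of a) == (k', antenna_of b) then
       autocorrelation P (H k (antenna_of a)) ((time_of a)%:Z - (time_of b)%:Z) else 0) =
  c * conj c' * signal_cov z a b.
Proof.
rewrite /signal_cov; case: (eqVneq (antenna_of a) (antenna_of b)) => [eab|nab]; last first.
  rewrite mulr0 big1// => k _; rewrite big1// => k' _.
  by rewrite xpair_eqE (negbTE nab) andbF mulr0.
rewrite mulr_sumr; apply: eq_bigr => k _; rewrite (bigD1 k)//= eab eqxx big1 ?addr0.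
  by rewrite conjcM; ring.
by move=> k' kk'; rewrite xpair_eqE eq_sym (negbTE kk') mulr0.
Qed.

Let fading_cov_block s k k' a b :
  complex_expectation P (fun t => H k (antenna_of a) (s + time_of a).+1%:Z t *
     conj (H k' (antenna_of b) (s + time_of b).+1%:Z t)) =
  if (k, antenna_of a) == (k', antenna_of b) then
    autocorrelation P (H k (antenna_of a)) ((time_of a)%:Z - (time_of b)%:Z) else 0.
Proof.
rewrite (fading_cov fm); case: ifP => // _; congr autocorrelation.
by rewrite -!addnS !PoszD -![(time_of _).+1]addn1 !PoszD; ring.
Qed.

Lemma signal_cos s z (g : 'I_D -> R[i]) (th : R) :
  \int[P]_t cos (complex.Re (\sum_a g a * signal s z a t) + th) =
  expR (- (complex.Re (\sum_a \sum_b g a * conj (g b) * signal_cov z a b) / 4)) * cos th.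
Proof.
pose e (p : 'I_D * 'I_NT) := (p.2, antenna_of p.1, (s + time_of p.1).+1%:Z).
have einj : injective e.
  move=> [a k] [a' k'] [] /= -> e1 /eqP; rewrite eqn_add2l => /eqP/ord_inj e2.
  by rewrite (flat_index_inj e2 e1).
have := @proper_normal_cos _ _ _ _ _ _ (fun p => _ : measurable_fun setT (H (e p).1.1 (e p).1.2 (e p).2))
  (proper_normal_inj einj (fading_normal fm)) (fun p => fading_mean0 fm (e p).1.1 (e p).1.2 (e p).2)
  (index_enum ('I_D * 'I_NT)%type) (fun p => g p.1 * entry z (time_of p.1) p.2) th.
have -> : \sum_p \sum_q g p.1 * entry z (time_of p.1) p.2 *
     ((g q.1 * entry z (time_of q.1) q.2)^*)%R *
     complex_expectation P (fun w => H (e p).1.1 (e p).1.2 (e p).2 w *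
       ((H (e q).1.1 (e q).1.2 (e q).2 w)^*)%R) =
   \sum_a \sum_b g a * conj (g b) * signal_cov z a b.
  rewrite -(pair_bigA _ (fun a k => \sum_q g a * entry z (time_of a) k *
     conj (g q.1 * entry z (time_of q.1) q.2) *
     complex_expectation P (fun w => H k (antenna_of a) (s + time_of a).+1%:Z w *
       conj (H (e q).1.1 (e q).1.2 (e q).2 w)))) /=.
  apply: eq_bigr => a _.
  transitivity (\sum_k \sum_b \sum_k' (g a * entry z (time_of a) k) *
     conj (g b * entry z (time_of b) k') *
     (if (k, antenna_of a) == (k', antenna_of b) then
       autocorrelation P (H k (antenna_of a)) ((time_of a)%:Z - (time_of b)%:Z) else 0)).
    apply: eq_bigr => k _; rewrite -(pair_bigA _ (fun b k' => g a * entry z (time_of a) k *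
     conj (g b * entry z (time_of b) k') *
     complex_expectation P (fun w => H k (antenna_of a) (s + time_of a).+1%:Z w *
       conj (H k' (antenna_of b) (s + time_of b).+1%:Z w)))) /=.
    by apply: eq_bigr => b _; apply: eq_bigr => k' _; rewrite fading_cov_block.
  by rewrite exchange_big; apply: eq_bigr => b _; rewrite fading_form.
move=> <- //; apply: eq_Rintegral => t _; congr (cos (complex.Re _ + _)).
rewrite -(pair_bigA _ (fun a k => g a * entry z (time_of a) k *
   H k (antenna_of a) (s + time_of a).+1%:Z t)) /=.
apply: eq_bigr => a _; rewrite mulr_sumr; apply: eq_bigr => k _; ring.
Qed.

Lemma signal_second s z a b :
  complex_expectation P (fun t => signal s z a t * conj (signal s z b t)) = signal_cov z a b.
Proof.
have := fading_form z a b 1 1; rewrite !mul1r conjc1 mul1r => <-.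
have hm k k' : complex_moments P (fun t => H k (antenna_of a) (s + time_of a).+1%:Z t *
     conj (H k' (antenna_of b) (s + time_of b).+1%:Z t)).
  by apply: complex_momentsM; [exact: fading_moments|exact/complex_moments_conj/fading_moments].
transitivity (complex_expectation P (fun t => \sum_k \sum_k' (entry z (time_of a) k *
    conj (entry z (time_of b) k')) * (H k (antenna_of a) (s + time_of a).+1%:Z t *
     conj (H k' (antenna_of b) (s + time_of b).+1%:Z t)))).
  congr complex_expectation; apply/funext => t; rewrite mulr_suml; apply: eq_bigr => k _.
  rewrite conjc_sum mulr_sumr; apply: eq_bigr => k' _; rewrite conjcM; ring.
rewrite complex_expectation_sum; last first.
  move=> k; apply: complex_moments_sum => k'; apply: complex_momentsM => //.
  exact: complex_moments_cst.
apply: eq_bigr => k _; rewrite complex_expectation_sum; last first.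
  by move=> k'; apply: complex_momentsM => //; exact: complex_moments_cst.
by apply: eq_bigr => k' _; rewrite complex_expectationZ// fading_cov_block !mul1r.
Qed.

Let G := g_sigma_algebraType (\bigcup_j preimage_set_system setT
  (fun t => H j.1.1 j.1.2 j.2 t) measurable) : measurableType _.
Let G' := g_sigma_algebraType (\bigcup_j preimage_set_system setT
  (fun t => W j.1 j.2 t) measurable) : measurableType _.

Let signal_sigma s z a : measurable_fun [set: G] (signal s z a : G -> R[i]).
Proof.
apply: measurable_complex_sum => k; apply: measurable_complexM => //.
exact: (@sigma_of_coord R T _ (fun j t => H j.1.1 j.1.2 j.2 t) (k, antenna_of a, (s + time_of a).+1%:Z)).
Qed.

Let noise_sigma s : measurable_fun [set: G'] (noise_block W (noise_index s) : G' -> D.-tuple R[i]).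
Proof.
apply/measurable_fun_tnthP => a.
rewrite (_ : _ \o _ = W (noise_index s a).1 (noise_index s a).2)//; last first.
  by apply/funext => t /=; rewrite tnth_mktuple.
exact: (@sigma_of_coord R T _ (fun j t => W j.1 j.2 t) (noise_index s a)).
Qed.

Let indep d1 d2 (E1 : measurableType d1) (E2 : measurableType d2) (f : T -> E1) (g : T -> E2) :
  measurable_fun [set: G] f -> measurable_fun [set: G'] g ->
  forall A B, measurable A -> measurable B ->
    P (f @^-1` A `&` g @^-1` B) = (P (f @^-1` A) * P (g @^-1` B))%E.
Proof.
move=> mf mg A B mA mB; apply: fn.
- exact: (@sigma_of_preimage _ _ _ _ _ _ _ mf _ mA).
- exact: (@sigma_of_preimage _ _ _ _ _ _ _ mg _ mB).
Qed.

Lemma measurable_output s z : measurable_fun setT (output s z).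
Proof.
apply/measurable_fun_tnthP => i; apply/measurable_fun_tnthP => l.
rewrite (_ : _ \o _ = fun t => (Num.sqrt rho)%:C *
      (\sum_(k < NT) H k l (s + i).+1%:Z t * tnth (tnth z i) k)
      + W l (s + i).+1 t); last by apply/funext => t /=; rewrite !tnth_mktuple.
apply: measurable_complexD => //; apply: measurable_complexM => //.
by apply: measurable_complex_sum => k; exact: measurable_complexM.
Qed.

Let quad_cov z (g : 'I_D -> R[i]) :
  complex.Re (\sum_a \sum_b g a * conj (g b) * output_cov z a b) =
  \sum_a normc (g a) ^+ 2 +
  rho * complex.Re (\sum_a \sum_b g a * conj (g b) * signal_cov z a b).
Proof.
rewrite -ReZ.
have -> : \sum_a normc (g a) ^+ 2 = complex.Re (\sum_a \sum_b g a * conj (g b) * (a == b)%:R).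
  rewrite Re_sum; apply: eq_bigr => a _; rewrite (bigD1 a)//= eqxx mulr1 mulc_conj big1 ?addr0//.
  by move=> b; rewrite eq_sym => /negbTE ->; rewrite mulr0.
rewrite -ReD; congr complex.Re; rewrite mulr_sumr -big_split; apply: eq_bigr => a _ /=.
rewrite mulr_sumr -big_split; apply: eq_bigr => b _ /=; rewrite mxE; ring.
Qed.

(** Signal and noise are independent, so the addition formula splits the transform. The product of
    sines drops out since the sine of the signal part has mean 0, which is [signal_cos] at phase pi
    / 2. *)
Lemma output_cos s z (g : 'I_D -> R[i]) (th : R) :
  \int[P]_t cos (real_form g (flat (output s z t)) + th) =
  expR (- (complex.Re (\sum_a \sum_b g a * conj (g b) * output_cov z a b) / 4)) * cos th.
Proof.
pose A t := complex.Re (\sum_a ((Num.sqrt rho)%:C * g a) * signal s z a t).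
pose B t := real_form g (noise_block W (noise_index s) t).
have mA : measurable_fun [set: G] (A : G -> R).
  apply: measurableT_comp; first exact: measurable_Re.
  by apply: measurable_complex_sum => a; exact: measurable_complexM.
have mB : measurable_fun [set: G'] (B : G' -> R).
  by apply: measurableT_comp; [exact: measurable_real_form|exact: noise_sigma].
have mA' : measurable_fun setT A.
  apply: measurableT_comp; first exact: measurable_Re.
  apply: measurable_complex_sum => a; apply: measurable_complexM => //.
  exact: complex_moments_measurable (signal_moments s z a).
have mB' : measurable_fun setT B.
  by apply: measurableT_comp; [exact: measurable_real_form|exact: measurable_noise_block].
have E t : cos (real_form g (flat (output s z t)) + th) =
    cos (A t) * cos (B t + th) - sin (A t) * sin (B t + th).
  rewrite -cosD addrA; congr (cos (_ + _)).
  rewrite /real_form /A /B /real_form -ReD -big_split; congr complex.Re.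
  apply: eq_bigr => a _ /=; rewrite flat_output; ring.
have mcos := @measurable_cos R; have msin := @measurable_sin R.
have mct : measurable_fun setT (fun x : R => cos (x + th)).
  by apply: measurableT_comp => //; exact: measurable_funD.
have mst : measurable_fun setT (fun x : R => sin (x + th)).
  by apply: measurableT_comp => //; exact: measurable_funD.
have bi (f : T -> R) : measurable_fun setT f -> (forall t, `|f t| <= 1) ->
  P.-integrable setT (fun t => (f t)%:E) by exact: bounded_integrable.
have mcA := measurableT_comp mcos mA'; have msA := measurableT_comp msin mA'.
have mcB := measurableT_comp mct mB'; have msB := measurableT_comp mst mB'.
have i1 : P.-integrable setT (fun t => (cos (A t) * cos (B t + th))%:E).
  apply: bi; first exact: measurable_funM.
  by move=> t; rewrite normrM mulr_ile1 ?cos_max.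
have i2 : P.-integrable setT (fun t => (sin (A t) * sin (B t + th))%:E).
  apply: bi; first exact: measurable_funM.
  by move=> t; rewrite normrM mulr_ile1 ?sin_max.
transitivity (\int[P]_t (cos (A t) * cos (B t + th) - sin (A t) * sin (B t + th))).
  by apply: eq_Rintegral => t _; exact: E.
rewrite RintegralB//.
rewrite (indep_pair mA' mB' (indep mA mB) mcos mct)//; last 2 first.
- by apply: bi; [by []|move=> t; exact: cos_max].
- by apply: bi; [by []|move=> t; exact: cos_max].
rewrite (indep_pair mA' mB' (indep mA mB) msin mst)//; last 2 first.
- by apply: bi; [by []|move=> t; exact: sin_max].
- by apply: bi; [by []|move=> t; exact: sin_max].
have cA := signal_cos s z (fun a => (Num.sqrt rho)%:C * g a).
have -> : \int[P]_t sin (A t) = 0.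
  have := cA (pi / 2); rewrite cos_pihalf mulr0.
  under eq_Rintegral do rewrite cosDpihalf.
  have -> : \int[P]_t (- sin (A t)) = - 1 * \int[P]_t sin (A t).
    rewrite -RintegralZl//; last by apply: bi => // t; exact: sin_max.
    by apply: eq_Rintegral => t _; rewrite mulN1r.
  by rewrite mulN1r => /eqP; rewrite oppr_eq0 => /eqP.
rewrite mul0r subr0.
have -> : \int[P]_t cos (A t) = expR (- (rho *
    complex.Re (\sum_a \sum_b g a * conj (g b) * signal_cov z a b) / 4)).
  have qe : complex.Re (\sum_a \sum_b (Num.sqrt rho)%:C * g a *
      conj ((Num.sqrt rho)%:C * g b) * signal_cov z a b) =
      rho * complex.Re (\sum_a \sum_b g a * conj (g b) * signal_cov z a b).
    rewrite -ReZ; congr complex.Re.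
    rewrite mulr_sumr; apply: eq_bigr => a _; rewrite mulr_sumr; apply: eq_bigr => b _.
    rewrite conjcM conjc_real.
    have -> : rho%:C = (Num.sqrt rho)%:C * (Num.sqrt rho)%:C :> R[i].
      by rewrite -real_complexM -expr2 sqr_sqrtr.
    ring.
  by have := cA 0; rewrite cos0 mulr1 qe => <-; apply: eq_Rintegral => t _; rewrite addr0.
have := noise_charfun (fun c g th => noise_weighted_charfun nm (@noise_index_inj s) (c:=c) g th) g th.
move=> ->; rewrite mulrA -expRD quad_cov; congr (expR _ * _); ring.
Qed.

Lemma output_moments s z a : complex_moments P (fun t => tnth (flat (output s z t)) a).
Proof.
under eq_fun do rewrite flat_output tnth_mktuple.
apply: complex_momentsD; last exact: noise_moments.
by apply: complex_momentsM; [exact: complex_moments_cst|exact: signal_moments].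
Qed.

Let noise_entry s a t := tnth (noise_block W (noise_index s) t) a.

Let noise_entry_moments s a : complex_moments P (noise_entry s a).
Proof.
rewrite (_ : noise_entry s a = W (noise_index s a).1 (noise_index s a).2); first exact: noise_moments.
by apply/funext => t; rewrite /noise_entry tnth_mktuple.
Qed.

Let noise_entry_second s a b : complex_expectation P (fun t => noise_entry s a t * conj (noise_entry s b t)) =
  (a == b)%:R.
Proof.
have E c : noise_entry s c = W (noise_index s c).1 (noise_index s c).2.
  by apply/funext => t; rewrite /noise_entry tnth_mktuple.
rewrite !E; have [->|ab] := eqVneq a b; first exact: (noise_variance nm).
by apply: (noise_cross nm); apply: contra ab => /eqP/noise_index_inj ->.
Qed.

Let measurable_conj d' (S : measurableType d') (f : S -> R[i]) : measurable_fun setT f ->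
  measurable_fun setT (fun x => conj (f x)).
Proof.
move=> /measurable_fun_complexP [h1 h2]; apply/measurable_fun_complexP; split.
- by rewrite (_ : _ \o _ = complex.Re (R:=R) \o f)//; apply/funext => t /=; rewrite complex_Re_conj.
- rewrite (_ : _ \o _ = -%R \o (complex.Im (R:=R) \o f)); last first.
    by apply/funext => t /=; rewrite complex_Im_conj.
  exact: measurableT_comp.
Qed.

Let noise_entry0 s a : complex_expectation P (noise_entry s a) = 0.
Proof.
rewrite -(noise_mean0 nm (noise_index s a).1 (noise_index s a).2).
by congr complex_expectation; apply/funext => t; rewrite /noise_entry tnth_mktuple.
Qed.

Let cross_second s z a b :
  complex_expectation P (fun t => signal s z a t * conj (noise_entry s b t)) = 0.
Proof.
rewrite complex_expectation_indep//.
- by rewrite (@complex_expectation_conj _ _ _ P (noise_entry s b))// noise_entry0 conjc0 mulr0.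
- exact: signal_moments.
- exact: complex_moments_conj.
apply: indep; first exact: signal_sigma.
by apply: measurable_conj; exact: (measurableT_comp (measurable_tnth b) (noise_sigma s)).
Qed.

Lemma output_second s z a b :
  complex_expectation P (fun t => tnth (flat (output s z t)) a * conj (tnth (flat (output s z t)) b)) =
  output_cov z a b.
Proof.
set q := (Num.sqrt rho)%:C.
have qq : conj q = q by exact: conjc_real.
have q2 : q * q = rho%:C by rewrite -real_complexM -expr2 sqr_sqrtr.
have conjD (x y : R[i]) : conj (x + y) = conj x + conj y by exact: rmorphD.
have pt (S S' w w' : R[i]) : (q * S + w) * conj (q * S' + w') =
    (rho%:C * (S * conj S') + q * (S * conj w')) + (q * conj (S' * conj w) + w * conj w').
  by rewrite conjD !conjcM conjcK qq -q2; ring.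
have Sm c := signal_moments s z c; have wm := noise_entry_moments s.
have cst := @complex_moments_cst _ _ _ P.
have SSm : complex_moments P (fun t => signal s z a t * conj (signal s z b t)).
  by apply: complex_momentsM => //; exact: complex_moments_conj.
have Swm c c' : complex_moments P (fun t => signal s z c t * conj (noise_entry s c' t)).
  by apply: complex_momentsM => //; exact: complex_moments_conj.
have wwm : complex_moments P (fun t => noise_entry s a t * conj (noise_entry s b t)).
  by apply: complex_momentsM => //; exact: complex_moments_conj.
transitivity (complex_expectation P (fun t =>
    (rho%:C * (signal s z a t * conj (signal s z b t)) +
     q * (signal s z a t * conj (noise_entry s b t))) +
    (q * conj (signal s z b t * conj (noise_entry s a t)) +
     noise_entry s a t * conj (noise_entry s b t)))).
  congr complex_expectation; apply/funext => t; rewrite !flat_output; exact: pt.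
rewrite !complex_expectationD//; last 5 first.
- by apply: complex_momentsM => //; exact: complex_moments_conj.
- by apply: complex_momentsM.
- by apply: complex_momentsM.
- by apply: complex_momentsD; apply: complex_momentsM.
- by apply: complex_momentsD => //; apply: complex_momentsM => //; exact: complex_moments_conj.
rewrite !complex_expectationZ//; last exact: complex_moments_conj.
rewrite complex_expectation_conj// !cross_second conjc0 !mulr0 addr0 add0r.
by rewrite signal_second noise_entry_second mxE addrC.
Qed.

Lemma output_cov_conj z a b : output_cov z b a = conj (output_cov z a b).
Proof.
rewrite -!(output_second 0) -complex_expectation_conj; last first.
  by apply: complex_momentsM; [exact: output_moments|exact/complex_moments_conj/output_moments].
by congr complex_expectation; apply/funext => t; rewrite conjcM conjcK mulrC.
Qed.

Lemma output_cov_ge z (g : 'I_D -> R[i]) : \sum_a normc (g a) ^+ 2 <=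
  complex.Re (\sum_a \sum_b g a * conj (g b) * output_cov z a b).
Proof.
rewrite quad_cov lerDl mulr_ge0//.
have Sm c := signal_moments 0 z c.
have cst := @complex_moments_cst _ _ _ P.
have -> : \sum_a \sum_b g a * conj (g b) * signal_cov z a b =
  complex_expectation P (fun t => (\sum_a g a * signal 0 z a t) * conj (\sum_a g a * signal 0 z a t)).
  transitivity (complex_expectation P (fun t => \sum_a \sum_b (g a * conj (g b)) *
      (signal 0 z a t * conj (signal 0 z b t)))).
    have mm a b : complex_moments P (fun t => (g a * conj (g b)) *
        (signal 0 z a t * conj (signal 0 z b t))).
      by apply: complex_momentsM => //; apply: complex_momentsM => //; exact: complex_moments_conj.
    rewrite complex_expectation_sum; last by move=> a; exact: complex_moments_sum.
    apply: eq_bigr => a _; rewrite complex_expectation_sum//.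
    apply: eq_bigr => b _; rewrite complex_expectationZ ?signal_second//.
    by apply: complex_momentsM => //; exact: complex_moments_conj.
  congr complex_expectation; apply/funext => t; rewrite mulr_suml; apply: eq_bigr => a _.
  rewrite conjc_sum mulr_sumr; apply: eq_bigr => b _; rewrite conjcM; ring.
rewrite complex_expectationE /=; apply: Rintegral_ge0 => t _.
by rewrite mulc_conj /= sqr_ge0.
Qed.

Lemma autocorrelation0 k l : autocorrelation P (H k l) 0 =
  (\int[P]_t (normc (H k l 0 t) ^+ 2))%:C.
Proof.
rewrite /autocorrelation complex_expectationE; apply: complex_ext => /=.
- by apply: eq_Rintegral => t _; rewrite mulc_conj.
- by rewrite -[RHS](Rintegral_cst1 P 0); apply: eq_Rintegral => t _; rewrite mulc_conj.
Qed.

Definition fading_power k l : R := complex.Re (autocorrelation P (H k l) 0).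

Lemma fading_power_ge0 k l : 0 <= fading_power k l.
Proof. by rewrite /fading_power autocorrelation0; apply: Rintegral_ge0 => t _; exact: sqr_ge0. Qed.

Lemma output_cov_diag z a : output_cov z a a =
  (1 + rho * \sum_k fading_power k (antenna_of a) * normc (entry z (time_of a) k) ^+ 2)%:C.
Proof.
rewrite mxE /signal_cov !eqxx subrr.
have -> : \sum_k autocorrelation P (H k (antenna_of a)) 0 *
      (entry z (time_of a) k * conj (entry z (time_of a) k)) =
   (\sum_k fading_power k (antenna_of a) * normc (entry z (time_of a) k) ^+ 2)%:C.
  rewrite real_complex_sum; apply: eq_bigr => k _.
  by rewrite mulc_conj real_complexM /fading_power autocorrelation0.
by rewrite -real_complexM -[1%:R]/(1%:C) -raddfD.
Qed.

Definition peak_constraint z : Prop := forall i k, normc (entry z i k) ^+ 2 <= 1.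

(* The trace bound makes noise_scale^2 dominate every eigenvalue of the output
   covariance, so that the density relative to noise of this scale is bounded. *)
Definition noise_scale : R :=
  1 + D%:R + rho * \sum_(a : 'I_D) \sum_k fading_power k (antenna_of a).

Lemma noise_scale_ge1 : 1 <= noise_scale.
Proof.
rewrite /noise_scale -addrA lerDl addr_ge0// mulr_ge0// sumr_ge0// => a _.
by apply: sumr_ge0 => k _; exact: fading_power_ge0.
Qed.

Lemma noise_scale_gt0 : 0 < noise_scale.
Proof. exact: lt_le_trans noise_scale_ge1. Qed.

Lemma output_cov_decomposition z : peak_constraint z -> exists V, exists l,
  [/\ V *m map_mx conj V^T = 1%:M, map_mx conj V^T *m V = 1%:M,
      output_cov z = unitary_conj V l, (forall i, 1 <= l i) &
      (forall i, l i <= noise_scale ^+ 2)].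
Proof.
move=> zok; have [V [l [VV VV' SE]]] := hermitian_decomposition (output_cov_conj z).
have l1 i : 1 <= l i.
  by apply: (unitary_conj_ge1 VV) => g; rewrite -SE; exact: output_cov_ge.
exists V, l; split=> // i.
have tr : \sum_j l j <= noise_scale.
  have := unitary_conj_trace VV l; rewrite -SE /mxtrace.
  under eq_bigr do rewrite output_cov_diag.
  rewrite -real_complex_sum => /complexI <-.
  rewrite big_split/= sumr_const card_ord -mulr_sumr /noise_scale -addrA.
  rewrite -[1 *+ _]/(_%:R) -[leLHS]add0r lerD// lerD2l ler_wpM2l//.
  apply: ler_sum => a _; apply: ler_sum => k _.
  by rewrite ler_piMr// fading_power_ge0.
apply: (@le_trans _ _ noise_scale); last by rewrite expr2 ler_peMl ?(ltW noise_scale_gt0)// noise_scale_ge1.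
apply: le_trans tr; rewrite (bigD1 i)//= lerDl sumr_ge0// => j _.
by apply: le_trans (l1 j).
Qed.

Definition reference_noise t : D.-tuple R[i] :=
  scaled_noise noise_scale (noise_block W (noise_index 0)) t.

Lemma measurable_reference_noise : measurable_fun setT reference_noise.
Proof. exact/measurable_scaled_noise/measurable_noise_block. Qed.

Definition output_density z (v : D.-tuple R[i]) : R :=
  gaussian_density noise_scale (output_cov z) v.

(** The right side does not involve [s]: reference noise and density are the same for all offsets,
    and this is how stationarity enters superadditivity. *)
Lemma output_law s z A : peak_constraint z -> measurable A ->
  P (output s z @^-1` A) =
  (\int[P]_(t in (@unflat R N NR \o reference_noise) @^-1` A) (output_density z (reference_noise t))%:E)%E.
Proof.
move=> zok mA; have [V [l [VV VV' SE l1 lL]]] := output_cov_decomposition zok.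
rewrite /output_density SE.
have mfo : measurable_fun setT (fun t => flat (output s z t)).
  exact: (measurableT_comp (@measurable_flat _ _ _) (measurable_output s z)).
have mB : measurable (@unflat R N NR @^-1` A).
  by rewrite -[X in measurable X]setTI; exact: measurable_unflat.
have := gaussian_law (P' := P) VV VV' l1 lL noise_scale_gt0
  (measurable_noise_block W (noise_index 0))
  (fun c g th => noise_weighted_charfun nm (@noise_index_inj 0) (c:=c) g th) mfo _ mB.
rewrite /= => <-; last by move=> g th; rewrite -SE; exact: output_cos.
by congr (P _); apply/seteqP; split=> t /=; rewrite flatK.
Qed.

End output.

(** * Mutual information through a channel density *)

Section channel_density.
Context d1 d2 d3 (Z : measurableType d1) (Y : measurableType d2) (T : measurableType d3)
  (R : realType).
Variables (mu : probability Z R) (P : probability T R).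
Variables (X : {RV (mu \x P)%E >-> Z}) (V : {RV (mu \x P)%E >-> Y}).
Hypothesis X_fst : forall w, X w = w.1.

Let JP : probability _ R := distribution (mu \x P)%E (joint_rv X V).
Let QX : probability _ R := distribution (mu \x P)%E X.
Let QY : probability _ R := distribution (mu \x P)%E V.
Let QP : probability _ R := (QX \x QY)%E.

Lemma ge0_integral_joint (F : Z * Y -> \bar R) : measurable_fun setT F ->
  (forall p, 0 <= F p)%E ->
  (\int[JP]_p F p = \int[(mu \x P)%E]_w F (w.1, V w))%E.
Proof.
move=> mF F0; rewrite (@ge0_integral_distribution _ _ _ _ _ (mu \x P)%E (joint_rv X V))//.
by apply: eq_integral => w _; rewrite /= /joint_rv X_fst.
Qed.

Lemma Rintegral_joint (f : Z * Y -> R) : measurable_fun setT f ->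
  \int[JP]_p f p = \int[(mu \x P)%E]_w f (w.1, V w).
Proof.
move=> mf; rewrite /Rintegral integralE [in RHS]integralE; congr (fine (_ - _)%E).
- rewrite ge0_integral_joint//; first by apply: eq_integral => w _; rewrite !funeposE.
  by apply: measurable_funepos; exact/measurable_EFinP.
- rewrite ge0_integral_joint//; first by apply: eq_integral => w _; rewrite !funenegE.
  by apply: measurable_funeneg; exact/measurable_EFinP.
Qed.

Lemma integrable_joint (f : Z * Y -> R) : measurable_fun setT f ->
  JP.-integrable setT (fun p => (f p)%:E) <->
  (mu \x P)%E.-integrable setT (fun w => (f (w.1, V w))%:E).
Proof.
move=> mf; have mfV : measurable_fun setT (fun w => f (w.1, V w)).
  by apply: measurableT_comp => //; apply: measurable_fun_pair => //; exact: measurable_fst.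
have e : (\int[JP]_p `|(f p)%:E| = \int[(mu \x P)%E]_w `|(f (w.1, V w))%:E|)%E.
  rewrite (ge0_integral_joint (F := fun p => `|(f p)%:E|%E))//.
  by apply: measurableT_comp => //; exact/measurable_EFinP.
split=> /integrableP[_ h]; apply/integrableP; split; try exact/measurable_EFinP.
- by rewrite -e.
- by rewrite e.
Qed.

Lemma ge0_integral_fst (F : Z -> \bar R) : measurable_fun setT F -> (forall z, 0 <= F z)%E ->
  (\int[(mu \x P)%E]_w F w.1 = \int[mu]_z F z)%E.
Proof.
move=> mF F0; rewrite fubini_tonelli1//; last exact: (measurableT_comp mF measurable_fst).
apply: eq_integral => z _; rewrite /fubini_F /= integral_cst//.
by rewrite -[RHS]mule1; congr (_ * _)%E; exact: probability_setT.
Qed.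

Lemma ge0_integral_independent (G : Z * Y -> \bar R) : measurable_fun setT G ->
  (forall p, 0 <= G p)%E ->
  (\int[QP]_p G p = \int[mu]_z \int[(mu \x P)%E]_w G (z, V w))%E.
Proof.
move=> mG G0; rewrite /QP fubini_tonelli1//.
rewrite (@ge0_integral_distribution _ _ _ _ _ (mu \x P)%E X)//; last 2 first.
- exact: measurable_fun_fubini_tonelli_F.
- by move=> z; apply: integral_ge0 => y _; exact: G0.
have mH : measurable_fun setT (fun z => \int[(mu \x P)%E]_w G (z, V w))%E.
  pose MP : probability _ R := (mu \x P)%E.
  apply: (@measurable_fun_fubini_tonelli_F _ _ Z _ R MP (fun p => G (p.1, V p.2))) => //.
  apply: measurableT_comp => //; apply: measurable_fun_pair; first exact: measurable_fst.
  exact: (measurableT_comp _ measurable_snd).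
transitivity (\int[(mu \x P)%E]_w (fun z => \int[(mu \x P)%E]_w' G (z, V w')) w.1)%E.
  apply: eq_integral => w _ /=; rewrite /fubini_F X_fst ge0_integral_distribution//.
  exact: (measurableT_comp mG (measurable_pair1 w.1)).
by rewrite (@ge0_integral_fst (fun z => \int[(mu \x P)%E]_w' G (z, V w'))%E)// => z; apply: integral_ge0.
Qed.

(** In the double integral the input [z] is drawn independently of the output [V w], whose own input
    is [w.1]; this is the integral under the product of the marginals. *)
Lemma information_lower (g : Z * Y -> R) : measurable_fun setT g -> (forall p, 0 < g p) ->
  (\int[mu]_z \int[(mu \x P)%E]_w (g (z, V w))%:E <= 1)%E ->
  (mu \x P)%E.-integrable setT (fun w => (ln (g (w.1, V w)))%:E) ->
  ((\int[(mu \x P)%E]_w ln (g (w.1, V w)))%:E <= mutual_information X V)%E.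
Proof.
move=> mg g0 g1 ig.
have mln : measurable_fun setT (fun p => ln (g p)) by exact: measurableT_comp.
rewrite -(Rintegral_joint mln); apply: kl_ge_integral_ln => //.
- rewrite -/QX -/QY -/QP ge0_integral_independent//; first exact/measurable_EFinP.
  by move=> p; rewrite lee_fin ltW.
- exact/integrable_joint.
Qed.

Variables (ref : probability Y R) (dens : Z * Y -> R) (C : R).
Hypotheses (mdens : measurable_fun setT dens) (dens0 : forall p, 0 < dens p)
  (densC : forall p, dens p <= C).
Hypothesis densE : {ae mu, forall z, forall A, measurable A ->
  P [set t | A (V (z, t))] = (\int[ref]_(y in A) (dens (z, y))%:E)%E}.

Lemma ge0_integral_joint_density (F : Z * Y -> \bar R) : measurable_fun setT F ->
  (forall p, 0 <= F p)%E ->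
  (\int[JP]_p F p = \int[(mu \x ref)%E]_p (F p * (dens p)%:E))%E.
Proof.
move=> mF F0; rewrite ge0_integral_joint//.
have mFV : measurable_fun setT (fun w => F (w.1, V w)).
  by apply: measurableT_comp => //; apply: measurable_fun_pair => //; exact: measurable_fst.
have mFd : measurable_fun setT (fun p => F p * (dens p)%:E)%E.
  by apply: emeasurable_funM => //; exact/measurable_EFinP.
have Fd0 p : (0 <= F p * (dens p)%:E)%E by rewrite mule_ge0// lee_fin ltW.
rewrite !fubini_tonelli1//.
apply: ge0_ae_eq_integral => //.
- exact: measurable_fun_fubini_tonelli_F.
- exact: measurable_fun_fubini_tonelli_F.
- by move=> z _; apply: integral_ge0.
- by move=> z _; apply: integral_ge0.
apply: filterS densE => z zE _; rewrite /fubini_F /=.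
have mVz : measurable_fun setT (fun t => V (z, t)).
  exact: (measurableT_comp _ (measurable_pair1 z)).
(* For almost every input, the conditional law of the output is made a probability in order to apply
   the change of density to it. *)
pose Vz : {mfun T >-> Y} := HB.pack (fun t => V (z, t)) (isMeasurableFun.Build _ _ _ _ _ mVz).
pose nu : probability Y R := distribution P Vz.
have nuE A : measurable A -> nu A = (\int[ref]_(y in A) (dens (z, y))%:E)%E.
  by move=> mA; rewrite -zE.
have mFz : measurable_fun setT (fun y => F (z, y)) by exact: (measurableT_comp mF (measurable_pair1 z)).
have mdz : measurable_fun setT (fun y => dens (z, y)).
  exact: (measurableT_comp mdens (measurable_pair1 z)).
have := ge0_integral_density mdz nuE mFz (fun y => F0 (z, y)).
by rewrite /= => <-; rewrite ge0_integral_distribution.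
Qed.

Definition mean_density (y : Y) : R := \int[mu]_z dens (z, y).

Let mdens_l y : measurable_fun setT (fun z => dens (z, y)).
Proof. exact: (measurableT_comp mdens (measurable_pair2 y)). Qed.

Let idens y : mu.-integrable setT (fun z => (dens (z, y))%:E).
Proof.
apply: (@bounded_integrable _ _ _ mu _ C); first exact: mdens_l.
by move=> z; rewrite ger0_norm// ltW.
Qed.

Lemma mean_densityE y : (\int[mu]_z (dens (z, y))%:E)%E = (mean_density y)%:E.
Proof. exact: Rintegral_EFin (idens y). Qed.

Lemma mean_density_ge0 y : 0 <= mean_density y.
Proof. by apply: Rintegral_ge0 => z _; exact: ltW. Qed.

Lemma mean_density_gt0 y : 0 < mean_density y.
Proof.
rewrite lt_neqAle mean_density_ge0 andbT eq_sym; apply/eqP => h.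
have : (\int[mu]_z `|(dens (z, y))%:E| = 0)%E.
  by under eq_integral do rewrite /= ger0_norm ?(ltW (dens0 _))//; rewrite mean_densityE h.
move/(ae_eq_integral_abs mu measurableT (measurable_int mu (idens y))) => [A [mA A0 AE]].
have : (mu setT <= mu A)%E.
  by rewrite le_measure ?inE// => z _; apply: AE => /=; move=> /(_ I) [] /eqP; rewrite gt_eqF.
by rewrite A0 probability_setT lee_fin ler10.
Qed.

Lemma measurable_mean_density : measurable_fun setT mean_density.
Proof.
have h := @measurable_fun_fubini_tonelli_G _ _ _ _ _ mu (fun p => (dens p)%:E).
have : measurable_fun setT (fun y => (mean_density y)%:E).
  rewrite (_ : (fun y => _) = fubini_G mu (fun p => (dens p)%:E)); last first.
    by apply/funext => y; rewrite /fubini_G mean_densityE.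
  by apply: h; [exact/measurable_EFinP|move=> p; rewrite lee_fin ltW].
by move/measurable_EFinP.
Qed.

Lemma ge0_integral_output (F : Y -> \bar R) : measurable_fun setT F -> (forall y, 0 <= F y)%E ->
  (\int[(mu \x P)%E]_w F (V w) = \int[ref]_y (F y * (mean_density y)%:E))%E.
Proof.
move=> mF F0; have mF2 : measurable_fun setT (fun p : Z * Y => F p.2).
  exact: (measurableT_comp mF measurable_snd).
have := ge0_integral_joint mF2 (fun p => F0 p.2); rewrite /= => <-.
rewrite ge0_integral_joint_density// fubini_tonelli2//; last 2 first.
- by apply: emeasurable_funM => //; exact/measurable_EFinP.
- by move=> p; rewrite mule_ge0// lee_fin ltW.
apply: eq_integral => y _; rewrite /fubini_G /= ge0_integralZl//.
- by rewrite mean_densityE.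
- exact/measurable_EFinP.
- by move=> z _; rewrite lee_fin ltW.
Qed.

Definition density_ratio_fun (p : Z * Y) : R := dens p / mean_density p.2.

Lemma density_ratio_gt0 p : 0 < density_ratio_fun p.
Proof. by rewrite divr_gt0// mean_density_gt0. Qed.

Lemma measurable_density_ratio : measurable_fun setT density_ratio_fun.
Proof.
apply: measurable_funM => //; apply: (measurableT_comp (@measurable_invr R)).
exact: (measurableT_comp measurable_mean_density measurable_snd).
Qed.

Lemma density_ratio_integral y : (\int[mu]_z (density_ratio_fun (z, y))%:E = 1)%E.
Proof.
rewrite /density_ratio_fun /=.
under eq_integral do rewrite mulrC EFinM.
rewrite ge0_integralZl//; last 3 first.
- exact/measurable_EFinP.
- by move=> z _; rewrite lee_fin ltW.
- by rewrite lee_fin invr_ge0 mean_density_ge0.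
by rewrite mean_densityE -EFinM mulVf// gt_eqF// mean_density_gt0.
Qed.

Let JPE A : measurable A -> JP A = (\int[(mu \x ref)%E]_(p in A) (dens p)%:E)%E.
Proof.
move=> mA; rewrite -[in LHS](setIT A) -integral_indic//.
have m1 : measurable_fun setT (fun p => (\1_A p)%:E : \bar R) by exact/measurable_EFinP.
rewrite (@ge0_integral_joint_density (fun p => (\1_A p)%:E))//.
rewrite [RHS]integral_mkcond; apply: eq_integral => p _; rewrite patchE indicE.
by case: ifP => _; rewrite ?mul1e ?mul0e.
Qed.

Let QPE A : measurable A -> QP A = (\int[(mu \x ref)%E]_(p in A) (mean_density p.2)%:E)%E.
Proof.
move=> mA; rewrite -[in LHS](setIT A) -integral_indic//.
have m1 : measurable_fun setT (fun p => (\1_A p)%:E : \bar R) by exact/measurable_EFinP.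
rewrite (@ge0_integral_independent (fun p => (\1_A p)%:E))//.
have mm : measurable_fun setT (fun p : Z * Y => (\1_A p)%:E * (mean_density p.2)%:E)%E.
  apply: emeasurable_funM => //; apply/measurable_EFinP.
  exact: (measurableT_comp measurable_mean_density measurable_snd).
transitivity (\int[(mu \x ref)%E]_p ((\1_A p)%:E * (mean_density p.2)%:E))%E; last first.
  rewrite [RHS]integral_mkcond; apply: eq_integral => p _; rewrite patchE indicE.
  by case: ifP => _; rewrite ?mul1e ?mul0e.
rewrite fubini_tonelli1//; last by move=> p; rewrite mule_ge0// lee_fin mean_density_ge0.
apply: eq_integral => z _; rewrite /fubini_F /=.
rewrite (@ge0_integral_output (fun y => (\1_A (z, y))%:E))//.
exact: (measurableT_comp m1 (measurable_pair1 z)).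
Qed.

(** Replacing the output density by [q] adds the relative entropy of the output law from [q], which
    is nonnegative. Formally [q p.2 / mean_density p.2] plays the role of [v] in [kl_le_integral];
    its joint mean is the integral of [q]. *)
Lemma information_upper (q : Y -> R) : measurable_fun setT q -> (forall y, 0 < q y) ->
  (\int[ref]_y (q y)%:E <= 1)%E ->
  (mu \x P)%E.-integrable setT (fun w => (ln (dens (w.1, V w)) - ln (q (V w)))%:E) ->
  [/\ (mu \x P)%E.-integrable setT (fun w => (ln (density_ratio_fun (w.1, V w)))%:E),
      mutual_information X V = (\int[(mu \x P)%E]_w ln (density_ratio_fun (w.1, V w)))%:E &
      \int[(mu \x P)%E]_w ln (density_ratio_fun (w.1, V w)) <=
      \int[(mu \x P)%E]_w (ln (dens (w.1, V w)) - ln (q (V w)))].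
Proof.
move=> mq q0 q1 iu.
have mm : measurable_fun setT (fun p : Z * Y => mean_density p.2).
  exact: (measurableT_comp measurable_mean_density measurable_snd).
have mqs : measurable_fun setT (fun p : Z * Y => q p.2).
  exact: (measurableT_comp mq measurable_snd).
have mr := measurable_density_ratio.
have mu' : measurable_fun setT (fun p : Z * Y => ln (dens p) - ln (q p.2)).
  by apply: measurable_funB; apply: measurableT_comp.
have PQ : forall A, measurable A -> JP A = (\int[QP]_(x in A) (density_ratio_fun x)%:E)%E.
  apply: (density_ratio (M := (mu \x ref)%E)) JPE QPE => //.
  - by move=> p; exact: ltW.
  - by move=> p; exact: mean_density_gt0.
have [] := @kl_le_integral _ _ R JP QP density_ratio_fun mr density_ratio_gt0 PQ
  (fun p => ln (dens p) - ln (q p.2)) (fun p => q p.2 / mean_density p.2).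
- exact/integrable_joint.
- by apply: measurable_funM => //; exact: (measurableT_comp (@measurable_invr R)).
- by move=> p; rewrite divr_ge0 ?mean_density_ge0// ltW.
- have mqm : measurable_fun setT (fun y => q y / mean_density y).
    apply: measurable_funM => //; apply: (measurableT_comp (@measurable_invr R)).
    exact: measurable_mean_density.
  have mqmE : measurable_fun setT (fun y => (q y / mean_density y)%:E) by exact/measurable_EFinP.
  rewrite (@ge0_integral_joint (fun p => (q p.2 / mean_density p.2)%:E))//; last 2 first.
  + exact: (measurableT_comp mqmE measurable_snd).
  + by move=> p; rewrite lee_fin divr_ge0 ?mean_density_ge0// ltW.
  rewrite (ge0_integral_output mqmE) /=; last first.
    by move=> p; rewrite lee_fin divr_ge0 ?mean_density_ge0// ltW.
  apply: le_trans q1; rewrite le_eqVlt; apply/orP; left; apply/eqP.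
  by apply: eq_integral => y _; rewrite -EFinM divfK// gt_eqF// mean_density_gt0.
- move=> p; rewrite /density_ratio_fun ln_div ?posrE ?mean_density_gt0//.
  have qm : 0 < q p.2 / mean_density p.2 by rewrite divr_gt0// mean_density_gt0.
  have := ln_le_subr1 qm; rewrite ln_div ?posrE ?mean_density_gt0//; lra.
move=> il ile; have mlr : measurable_fun setT (fun p => ln (density_ratio_fun p)).
  exact: measurableT_comp.
rewrite -(Rintegral_joint mlr); split.
- exact/(integrable_joint mlr).
- rewrite -(Rintegral_EFin il); exact: (kl_density mr density_ratio_gt0 PQ).
- by rewrite -(Rintegral_joint mu').
Qed.

End channel_density.

(** * Measurability and logarithms of Gaussian densities *)

Section measurable_det.
Context d (S : measurableType d) (R : realType).

Lemma measurable_complex_prod (I : Type) (r : seq I) (f : I -> S -> R[i]) :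
  (forall i, measurable_fun setT (f i)) ->
  measurable_fun setT (fun x => \prod_(i <- r) f i x).
Proof.
move=> mf; elim: r => [|i r ih].
  by under eq_fun do rewrite big_nil; exact: measurable_cst.
by under eq_fun do rewrite big_cons; exact: measurable_complexM.
Qed.

Lemma measurable_det n (M : S -> 'M[R[i]]_n) :
  (forall a b, measurable_fun setT (fun x => M x a b)) ->
  measurable_fun setT (fun x => \det (M x)).
Proof.
move=> mM; rewrite /determinant; apply: measurable_complex_sum => s.
by apply: measurable_complexM => //; exact: measurable_complex_prod.
Qed.

Lemma measurable_adj n (M : S -> 'M[R[i]]_n) a b :
  (forall a b, measurable_fun setT (fun x => M x a b)) ->
  measurable_fun setT (fun x => \adj (M x) a b).
Proof.
move=> mM; under eq_fun do rewrite mxE.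
apply: measurable_complexM => //; apply: measurable_det => i j.
rewrite (_ : (fun x => _) = fun x => M x (lift b i) (lift a j))//.
by apply/funext => x; rewrite !mxE.
Qed.

Lemma measurable_conjc (f : S -> R[i]) : measurable_fun setT f ->
  measurable_fun setT (fun x => (f x)^*).
Proof.
move=> /measurable_fun_complexP [h1 h2]; apply/measurable_fun_complexP; split.
- by rewrite (_ : _ \o _ = complex.Re (R:=R) \o f)//; apply/funext => t /=; rewrite complex_Re_conj.
- rewrite (_ : _ \o _ = -%R \o (complex.Im (R:=R) \o f)); last first.
    by apply/funext => t /=; rewrite complex_Im_conj.
  exact: measurableT_comp.
Qed.

Lemma measurable_normc2_comp (f : S -> R[i]) : measurable_fun setT f ->
  measurable_fun setT (fun x => normc (f x) ^+ 2).
Proof. exact: (measurableT_comp (@measurable_normc2 R)). Qed.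

Lemma measurable_gaussian_density n (L : R) (M : S -> 'M[R[i]]_n) (f : S -> n.-tuple R[i]) :
  (forall a b, measurable_fun setT (fun x => M x a b)) -> measurable_fun setT f ->
  measurable_fun setT (fun x => gaussian_density L (M x) (f x)).
Proof.
move=> mM mf.
have mre (g : S -> R[i]) : measurable_fun setT g -> measurable_fun setT (fun x => complex.Re (g x)).
  by move=> mg; exact: (measurableT_comp (@measurable_Re R)).
have mdi : measurable_fun setT (fun x => (complex.Re (\det (M x)))^-1).
  by apply: (measurableT_comp (@measurable_invr R)); apply/mre/measurable_det.
have mfa a : measurable_fun setT (fun x => tnth (f x) a).
  exact: (measurableT_comp (measurable_tnth a) mf).
rewrite /gaussian_density; apply: measurable_funM; first exact: measurable_funM.
apply: measurableT_comp => //; apply: measurable_funD.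
  apply: measurableT_comp => //; apply: measurable_funM => //; apply: mre.
  apply: measurable_complex_sum => a; apply: measurable_complex_sum => b.
  apply: measurable_complexM => //; apply: measurable_complexM.
    exact: measurable_conjc.
  exact: measurable_adj.
apply: measurable_funM => //; apply: measurable_sum => a.
exact: measurable_normc2_comp.
Qed.

End measurable_det.

Section gaussian_density_log.
Context (R : realType) (n : nat) (V : 'M[R[i]]_n) (l : 'I_n -> R) (L : R).
Local Notation conj := (@conjc R).
Hypotheses (VV : V *m map_mx conj V^T = 1%:M) (VV' : map_mx conj V^T *m V = 1%:M).
Hypotheses (l1 : forall i, 1 <= l i) (lL : forall i, l i <= L ^+ 2) (L1 : 1 <= L).
Let l0 i : 0 < l i. Proof. exact: lt_le_trans (l1 i). Qed.
Let L0 : 0 < L. Proof. exact: lt_le_trans L1. Qed.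

(** The quadratic form of the inverse matrix; for Hermitian [S] both the numerator and the
    determinant are real. *)
Definition inverse_form (S : 'M[R[i]]_n) (y : n.-tuple R[i]) : R :=
  complex.Re (\sum_a \sum_b conj (tnth y a) * \adj S a b * tnth y b) / complex.Re (\det S).

Lemma det_prod : complex.Re (\det (unitary_conj V l)) = \prod_i l i.
Proof. by rewrite unitary_conj_det. Qed.

Lemma det_ge1 : 1 <= complex.Re (\det (unitary_conj V l)).
Proof.
rewrite det_prod; elim/big_ind: _ => // x y x1 y1.
by rewrite -[leLHS]mulr1 ler_pM.
Qed.

Lemma det_gt0 : 0 < complex.Re (\det (unitary_conj V l)).
Proof. exact: lt_le_trans det_ge1. Qed.

Lemma ln_det : ln (complex.Re (\det (unitary_conj V l))) = \sum_i ln (l i).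
Proof.
rewrite det_prod.
suff: 0 < \prod_i l i /\ ln (\prod_i l i) = \sum_i ln (l i) by case.
apply: (big_ind2 (fun x y => 0 < x /\ ln x = y)) => [|x1 x2 y1 y2 [x0 xE] [y0 yE]|i _].
- by rewrite ln1.
- by rewrite mulr_gt0// lnM ?posrE// xE yE.
- by [].
Qed.

Lemma inverse_form_bounds y :
  0 <= inverse_form (unitary_conj V l) y <= \sum_a normc (tnth y a) ^+ 2.
Proof.
rewrite /inverse_form unitary_conj_adj_form//; last by move=> i; rewrite gt_eqF.
have p0 : \prod_i l i != 0 by apply/prodf_neq0 => i _; rewrite gt_eqF.
rewrite det_prod /= mulrAC divff// mul1r; apply/andP; split.
  by apply: sumr_ge0 => i _; rewrite mulr_ge0 ?sqr_ge0// invr_ge0 ltW.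
rewrite -(unitary_norm VV VV' (fun b => tnth y b)); apply: ler_sum => i _.
by rewrite ler_piMl ?sqr_ge0// invf_le1.
Qed.

Lemma ln_gaussian_density y : ln (gaussian_density L (unitary_conj V l) y) =
  ln ((L ^+ 2) ^+ n) - ln (complex.Re (\det (unitary_conj V l))) -
  inverse_form (unitary_conj V l) y + (\sum_a normc (tnth y a) ^+ 2) / L ^+ 2.
Proof.
have Ln : 0 < (L ^+ 2) ^+ n by rewrite !exprn_gt0.
rewrite /gaussian_density lnM ?posrE ?expR_gt0//; last by rewrite divr_gt0// det_gt0.
by rewrite expRK ln_div ?posrE// ?det_gt0// -/(inverse_form _ _); ring.
Qed.

Lemma ln_gaussian_density_bound y : `|ln (gaussian_density L (unitary_conj V l) y)| <=
  ln ((L ^+ 2) ^+ n) + \sum_a normc (tnth y a) ^+ 2.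
Proof.
rewrite ln_gaussian_density.
have L2 : 1 <= L ^+ 2 by rewrite exprn_ege1.
have h1 : 0 <= ln (complex.Re (\det (unitary_conj V l))) by rewrite ln_ge0// det_ge1.
have h2 : ln (complex.Re (\det (unitary_conj V l))) <= ln ((L ^+ 2) ^+ n).
  rewrite ler_ln ?posrE ?det_gt0 ?exprn_gt0// det_prod.
  by rewrite -[leRHS]mulr1 -[n in leRHS]card_ord -prodr_const mulr1; apply: ler_prod => i _; rewrite lL ltW.
have s0 : 0 <= \sum_a normc (tnth y a) ^+ 2 by apply: sumr_ge0 => a _; exact: sqr_ge0.
have h3 : 0 <= (\sum_a normc (tnth y a) ^+ 2) / L ^+ 2 by rewrite divr_ge0// sqr_ge0.
have h4 : (\sum_a normc (tnth y a) ^+ 2) / L ^+ 2 <= \sum_a normc (tnth y a) ^+ 2.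
  by rewrite ler_piMr// invf_le1 ?exprn_gt0.
have /andP[h5 h6] := inverse_form_bounds y.
by rewrite ler_norml; apply/andP; split; lra.
Qed.

End gaussian_density_log.

(** * Upper bound for a block *)

Section ln_bounds.
Context (R : realType).
Implicit Types x : R.

Lemma nonneg_of_derive (f df : R -> R) x : 0 <= x ->
  (forall t : R, 0 <= t <= x -> is_derive t 1 f (df t)) ->
  (forall t : R, 0 <= t <= x -> 0 <= df t) -> f 0 <= f x.
Proof.
move=> x0 fd df0.
have [||c] := @MVT_segment R f df 0 x x0.
- by move=> t; rewrite in_itv/= => /andP[/ltW t0 /ltW tx]; apply: fd; rewrite t0.
- apply: derivable_within_continuous => t; rewrite in_itv/= => tx.
  by have [] := fd t tx.
rewrite in_itv/= => cx h; rewrite -subr_ge0 h subr0 mulr_ge0//.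
exact: df0.
Qed.

Lemma is_derive_ln1D x : 0 <= x -> is_derive x 1 (fun t => ln (1 + t)) (1 + x)^-1.
Proof.
move=> x0; have x1 : 0 < 1 + x by rewrite ltr_wpDr.
have h : is_derive x 1 (fun t => 1 + t) (1 : R).
  rewrite (_ : (fun t => 1 + t) = (cst 1 : R -> R) + id)//.
  by apply: is_derive_eq; rewrite add0r.
have := @is_derive1_comp R (@ln R) (fun t => 1 + t) x _ _ (is_derive1_ln x1) h.
by rewrite mulr1.
Qed.

Lemma ln1D_ge x : 0 <= x -> x - x ^+ 2 / 2 <= ln (1 + x).
Proof.
move=> x0; pose f (t : R) := ln (1 + t) - (t - t ^+ 2 / 2).
pose df (t : R) := (1 + t)^-1 - (1 - t).
have f0 : f 0 = 0 by rewrite /f addr0 ln1 expr0n/= mul0r subr0 subr0.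
have fd (t : R) : 0 <= t <= x -> is_derive t 1 f (df t).
  move=> /andP[t0 _]; have h := is_derive_ln1D t0; apply: is_derive_eq.
  by rewrite /df /GRing.scale /=; field; rewrite gt_eqF// ltr_wpDr.
have df0 (t : R) : 0 <= t <= x -> 0 <= df t.
  move=> /andP[t0 _]; have t1 : 0 < 1 + t by rewrite ltr_wpDr.
  rewrite subr_ge0 -[(_)^-1]mul1r ler_pdivlMr//; nra.
by have := nonneg_of_derive x0 fd df0; rewrite f0 /f subr_ge0.
Qed.

Lemma ln1D_le x : 0 <= x -> ln (1 + x) <= x - x ^+ 2 / 2 + x ^+ 3 / 3.
Proof.
move=> x0; pose f (t : R) := t - t ^+ 2 / 2 + t ^+ 3 / 3 - ln (1 + t).
pose df (t : R) := 1 - t + t ^+ 2 - (1 + t)^-1.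
have f0 : f 0 = 0 by rewrite /f addr0 ln1 !expr0n/= !mul0r !subr0 addr0.
have fd (t : R) : 0 <= t <= x -> is_derive t 1 f (df t).
  move=> /andP[t0 _]; have h := is_derive_ln1D t0; apply: is_derive_eq.
  by rewrite /df /GRing.scale /=; field; rewrite gt_eqF// ltr_wpDr.
have df0 (t : R) : 0 <= t <= x -> 0 <= df t.
  move=> /andP[t0 _]; have t1 : 0 < 1 + t by rewrite ltr_wpDr.
  rewrite subr_ge0 -[(_)^-1]mul1r ler_pdivrMr//.
  have := mulr_ge0 t0 (sqr_ge0 t); nra.
by have := nonneg_of_derive x0 fd df0; rewrite f0 /f subr_ge0.
Qed.

Lemma sqr_sum_le n (x : 'I_n -> R) : (\sum_i x i) ^+ 2 <= n%:R * \sum_i x i ^+ 2.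
Proof.
rewrite expr2 mulr_suml.
apply: (@le_trans _ _ (\sum_i \sum_j ((x i ^+ 2 + x j ^+ 2) / 2))).
  apply: ler_sum => i _; rewrite mulr_sumr; apply: ler_sum => j _.
  have := sqr_ge0 (x i - x j); nra.
under eq_bigr do under eq_bigr do rewrite mulrDl.
under eq_bigr do rewrite big_split/= sumr_const card_ord.
rewrite big_split/= sumr_const card_ord sumrMnl -mulr_suml !mulr_natl.
set s := \sum_i _; rewrite -mulrnDl; lra.
Qed.

Lemma sqr_normc_sum_le n (x : 'I_n -> R[i]) :
  normc (\sum_i x i) ^+ 2 <= n%:R * \sum_i normc (x i) ^+ 2.
Proof.
rewrite [leLHS]sqr_normcE Re_sum Im_sum [X in _ <= _ * X](eq_bigr (fun i => complex.Re (x i) ^+ 2 + complex.Im (x i) ^+ 2)); last first.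
  by move=> i _; rewrite sqr_normcE.
rewrite big_split/= mulrDr; apply: lerD; exact: sqr_sum_le.
Qed.

Lemma normcM_sqr (x y : R[i]) : normc (x * y) ^+ 2 = normc x ^+ 2 * normc y ^+ 2.
Proof. by rewrite !sqr_normcE complex_ReM complex_ImM; ring. Qed.

End ln_bounds.

Lemma ae_bounded_integrable d (T : measurableType d) (R : realType) (P : probability T R)
  (f : T -> R) (M : R) : measurable_fun setT f -> {ae P, forall x, `|f x| <= M} ->
  P.-integrable setT (fun x => (f x)%:E).
Proof.
move=> mf fM; apply/integrableP; split; first exact/measurable_EFinP.
apply: (@le_lt_trans _ _ (\int[P]_x (`|M|)%:E)%E).
  apply: ae_ge0_le_integral => //.
  - by apply: measurableT_comp => //; exact/measurable_EFinP.
  - by apply: filterS fM => x fxM _; rewrite /= lee_fin (le_trans fxM)// ler_norm.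
rewrite integral_cst//=; apply: (@le_lt_trans _ _ (`|M|)%:E); last exact: ltry.
by rewrite -[leRHS]mule1; apply: lee_wpmul2l => //; exact: probability_le1.
Qed.

Section block_information.
Context d (T : measurableType d) (R : realType) (P : probability T R) (NT NR : nat).
Variables (H : 'I_NT -> 'I_NR -> int -> {RV P >-> R[i]}).
Variables (W : 'I_NR -> nat -> {RV P >-> R[i]}).
Hypotheses (fm : fading_model H) (nm : noise_model W) (fn : fading_noise_independent H W).
Variables (rho : R) (N : nat).
Hypothesis rho0 : 0 <= rho.
Local Notation block n := (N.-tuple (n.-tuple R[i])).
Local Notation D := #|{: 'I_N * 'I_NR}|.
Local Notation conj := (@conjc R).
Local Notation entry z i k := (tnth (tnth z i) k).
Local Notation L := (noise_scale H rho N).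
Local Notation cov := (output_cov H rho).

(* A measurable form of the peak constraint. *)
Definition peak_excess (z : block NT) : R :=
  \sum_i \sum_k Num.max 0 (normc (entry z i k) ^+ 2 - 1).

Lemma peak_excessP z : reflect (peak_constraint z) (peak_excess z <= 0).
Proof.
have e0 i k : 0 <= Num.max 0 (normc (entry z i k) ^+ 2 - 1) by rewrite le_max lexx.
apply: (iffP idP) => [h i k|h].
  rewrite -subr_le0; apply: le_trans h.
  apply: (@le_trans _ _ (Num.max 0 (normc (entry z i k) ^+ 2 - 1))); first by rewrite le_max lexx orbT.
  rewrite /peak_excess (bigD1 i)//= (bigD1 k)//= -addrA lerDl addr_ge0//.
    by apply: sumr_ge0 => j _.
  by apply: sumr_ge0 => j _; apply: sumr_ge0.
rewrite /peak_excess big1// => i _; rewrite big1// => k _.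
by apply/max_idPl; rewrite subr_le0.
Qed.

Lemma measurable_signal_cov a b : measurable_fun setT (fun z : block NT => signal_cov H z a b).
Proof.
rewrite /signal_cov; case: (antenna_of a == antenna_of b) => //; apply: measurable_complex_sum => k.
apply: measurable_complexM => //; apply: measurable_complexM; first exact: measurable_entry.
by apply: measurable_conjc; exact: measurable_entry.
Qed.

Lemma measurable_output_cov a b : measurable_fun setT (fun z : block NT => cov z a b).
Proof.
under eq_fun do rewrite mxE; apply: measurable_complexD => //.
by apply: measurable_complexM => //; exact: measurable_signal_cov.
Qed.

(** The value 1 off the peak constraint keeps the density positive and bounded everywhere; it
    concerns a null set of inputs. *)
Definition transition_density (p : block NT * block NR) : R :=
  if peak_excess p.1 <= 0 then output_density H rho p.1 (flat p.2) else 1.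

Lemma measurable_transition_density : measurable_fun setT transition_density.
Proof.
apply: measurable_fun_ifT => //.
- apply: (measurable_fun_ler (f := fun p => peak_excess p.1)) => //.
  apply: measurable_sum => i; apply: measurable_sum => k.
  apply: measurable_maxr => //; apply: measurable_funB => //.
  apply: measurable_normc2_comp; exact: (measurableT_comp (@measurable_entry _ _ _ i k) measurable_fst).
- apply: measurable_gaussian_density.
    by move=> a b; exact: (measurableT_comp (measurable_output_cov a b) measurable_fst).
  exact: (measurableT_comp (@measurable_flat _ _ _) measurable_snd).
Qed.

Let L1 : 1 <= L. Proof. exact: noise_scale_ge1. Qed.
Let L0 : 0 < L. Proof. exact: noise_scale_gt0. Qed.

Lemma transition_density_gt0 p : 0 < transition_density p.
Proof.
rewrite /transition_density; case: ifP => // /peak_excessP zok.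
have [V [l [VV VV' SE l1 lL]]] := output_cov_decomposition fm nm fn rho0 zok.
by rewrite /output_density SE; exact: gaussian_density_gt0.
Qed.

Lemma transition_density_le p : transition_density p <= (L ^+ 2) ^+ D.
Proof.
rewrite /transition_density; case: ifP => [/peak_excessP zok|_]; last first.
  by rewrite -exprM exprn_ege1.
have [V [l [VV VV' SE l1 lL]]] := output_cov_decomposition fm nm fn rho0 zok.
by rewrite /output_density SE; exact: gaussian_density_le.
Qed.

Lemma ln_transition_density_bound p : `|ln (transition_density p)| <=
  ln ((L ^+ 2) ^+ D) + \sum_a normc (tnth (flat p.2) a) ^+ 2.
Proof.
rewrite /transition_density; case: ifP => [/peak_excessP zok|_]; last first.
  rewrite ln1 normr0 addr_ge0 ?ln_ge0//; first by rewrite -exprM exprn_ege1.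
  by apply: sumr_ge0 => a _; exact: sqr_ge0.
have [V [l [VV VV' SE l1 lL]]] := output_cov_decomposition fm nm fn rho0 zok.
by rewrite /output_density SE; exact: ln_gaussian_density_bound.
Qed.

Let refX t : block NR := unflat (reference_noise H W rho N t).
Let mrefX : measurable_fun setT refX.
Proof. exact: (measurableT_comp (@measurable_unflat _ _ _) (measurable_reference_noise H W rho (N:=N))). Qed.

HB.instance Definition _ := isMeasurableFun.Build _ _ _ _ refX mrefX.

Definition reference_law : probability (block NR) R := distribution P refX.

Lemma transition_density_law s z A : peak_constraint z -> measurable A ->
  P (output H W rho s z @^-1` A) =
  (\int[reference_law]_(y in A) (transition_density (z, y))%:E)%E.
Proof.
move=> zok mA; rewrite (output_law fm nm fn rho0)//.
have mdz : measurable_fun setT (fun y => transition_density (z, y)).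
  exact: (measurableT_comp measurable_transition_density (measurable_pair1 z)).
rewrite integral_mkcond [RHS]integral_mkcond ge0_integral_distribution//; last 2 first.
- by apply/(measurable_restrictT _ _).1 => //; apply/measurable_EFinP; exact: measurable_funTS.
- by move=> y; rewrite patchE; case: ifP => // _; rewrite lee_fin ltW// transition_density_gt0.
apply: eq_integral => t _; rewrite /= !patchE.
rewrite /transition_density /= (introT (peak_excessP z) zok) /refX unflatK.
by rewrite (_ : (t \in _) = (unflat (reference_noise H W rho N t) \in A))//.
Qed.

Variable mu : probability (block NT) R.
Hypothesis peak : {ae mu, forall z, peak_constraint z}.

Definition symbol_power (k : 'I_NT) (i : 'I_N) : R := \int[mu]_z (normc (entry z i k) ^+ 2).

Lemma measurable_symbol i k : measurable_fun setT (fun z : block NT => normc (entry z i k) ^+ 2).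
Proof. by apply: measurable_normc2_comp; exact: measurable_entry. Qed.

Lemma symbol_integrable i k : mu.-integrable setT (fun z : block NT => (normc (entry z i k) ^+ 2)%:E).
Proof.
apply: (ae_bounded_integrable (M := 1)); first exact: measurable_symbol.
by apply: filterS peak => z zok; rewrite ger0_norm ?sqr_ge0.
Qed.

Lemma symbol_power_bounds k i : 0 <= symbol_power k i <= 1.
Proof.
apply/andP; split; first by apply: Rintegral_ge0 => z _; exact: sqr_ge0.
rewrite -lee_fin -Rintegral_EFin; last exact: symbol_integrable.
apply: (@le_trans _ _ (\int[mu]_z 1)%E).
  apply: ae_ge0_le_integral => //.
  - by move=> z _; rewrite lee_fin sqr_ge0.
  - by apply/measurable_EFinP; exact: measurable_symbol.
  - by apply: filterS peak => z zok _; rewrite lee_fin.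
by rewrite integral_cst// mul1e probability_le1.
Qed.

Definition signal_power (z : block NT) (a : 'I_D) : R :=
  \sum_k fading_power H k (antenna_of a) * normc (entry z (time_of a) k) ^+ 2.

Definition mean_signal_power (a : 'I_D) : R :=
  \sum_k fading_power H k (antenna_of a) * symbol_power k (time_of a).

Lemma signal_power_integrable a : mu.-integrable setT (fun z => (signal_power z a)%:E).
Proof. by apply: integrable_sumR => k _; apply: integrableZR; exact: symbol_integrable. Qed.

Lemma integral_signal_power a : \int[mu]_z signal_power z a = mean_signal_power a.
Proof.
rewrite Rintegral_sum; last by move=> k _; apply: integrableZR; exact: symbol_integrable.
by apply: eq_bigr => k _; rewrite RintegralZl//; exact: symbol_integrable.
Qed.

Lemma mean_signal_power_ge0 a : 0 <= mean_signal_power a.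
Proof.
apply: sumr_ge0 => k _; rewrite mulr_ge0 ?fading_power_ge0//.
by have /andP[] := symbol_power_bounds k (time_of a).
Qed.

(** Cauchy-Schwarz over the transmit antennas produces the factor [NT]. The peak constraint is spent
    on the symbol at the time of [b] only; the power at the time of [a] is kept, to be averaged
    later. *)
Lemma signal_cov_le z (a b : 'I_D) : peak_constraint z -> normc (signal_cov H z a b) ^+ 2 <=
  if antenna_of a == antenna_of b then
    NT%:R * \sum_k normc (autocorrelation P (H k (antenna_of a)) ((time_of a)%:Z - (time_of b)%:Z)) ^+ 2
      * normc (entry z (time_of a) k) ^+ 2
  else 0.
Proof.
move=> zok; rewrite /signal_cov; case: ifP => _; last by rewrite sqr_normcE /= expr0n addr0.
apply: le_trans (sqr_normc_sum_le _) _; rewrite ler_wpM2l//; apply: ler_sum => k _.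
rewrite !normcM_sqr normc_conj ler_wpM2l ?sqr_ge0//.
by rewrite ler_piMr ?sqr_ge0.
Qed.

Definition cov_energy (z : block NT) : R := \sum_a \sum_b normc (signal_cov H z a b) ^+ 2.

Lemma signal_cov_integrable (a b : 'I_D) :
  mu.-integrable setT (fun z => (normc (signal_cov H z a b) ^+ 2)%:E).
Proof.
apply: (ae_bounded_integrable (M := NT%:R * \sum_k normc (autocorrelation P (H k (antenna_of a)) ((time_of a)%:Z - (time_of b)%:Z)) ^+ 2)).
  by apply: measurable_normc2_comp; exact: measurable_signal_cov.
apply: filterS peak => z zok; rewrite ger0_norm ?sqr_ge0//.
apply: le_trans (signal_cov_le _ _ zok) _; case: ifP => _; last first.
  by rewrite mulr_ge0// sumr_ge0// => k _; exact: sqr_ge0.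
by rewrite ler_wpM2l//; apply: ler_sum => k _; rewrite ler_piMr ?sqr_ge0.
Qed.

Lemma cov_energy_integrable : mu.-integrable setT (fun z => (cov_energy z)%:E).
Proof. by apply: integrable_sumR => a _; apply: integrable_sumR => b _; exact: signal_cov_integrable. Qed.

End block_information.

Lemma Re_mulrn (R : realType) (x : R[i]) n : complex.Re (x *+ n) = complex.Re x *+ n.
Proof. by elim: n => // n ih; rewrite !mulrS ReD ih. Qed.

Lemma unitary1 (R : realType) n :
  (1%:M : 'M[R[i]]_n) *m map_mx (@conjc R) (1%:M : 'M[R[i]]_n)^T = 1%:M.
Proof. by rewrite trmx1 map_mx1 mulmx1. Qed.

Lemma unitary1' (R : realType) n :
  map_mx (@conjc R) (1%:M : 'M[R[i]]_n)^T *m (1%:M : 'M[R[i]]_n) = 1%:M.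
Proof. by rewrite trmx1 map_mx1 mulmx1. Qed.

Section block_information_upper.
Context d (T : measurableType d) (R : realType) (P : probability T R) (NT NR : nat).
Variables (H : 'I_NT -> 'I_NR -> int -> {RV P >-> R[i]}).
Variables (W : 'I_NR -> nat -> {RV P >-> R[i]}).
Hypotheses (fm : fading_model H) (nm : noise_model W) (fn : fading_noise_independent H W).
Variables (rho : R) (N : nat).
Hypothesis rho0 : 0 <= rho.
Local Notation block n := (N.-tuple (n.-tuple R[i])).
Local Notation D := #|{: 'I_N * 'I_NR}|.
Local Notation conj := (@conjc R).
Local Notation L := (noise_scale H rho N).
Local Notation cov := (output_cov H rho).
Local Notation out := (output H W rho 0).
Variable mu : probability (block NT) R.
Hypothesis peak : {ae mu, forall z, peak_constraint z}.
Local Notation MP := (mu \x P)%E.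

Let L1 : 1 <= L. Proof. exact: noise_scale_ge1. Qed.
Let L0 : 0 < L. Proof. exact: noise_scale_gt0. Qed.

Lemma output_normc2 s (z : block NT) (a : 'I_D) :
  \int[P]_t (normc (tnth (flat (output H W rho s z t)) a) ^+ 2) = 1 + rho * signal_power H z a.
Proof.
have := output_second fm nm fn rho0 s z a a.
rewrite complex_expectationE output_cov_diag => /(congr1 (@complex.Re R)) /= <-.
by apply: eq_Rintegral => t _; rewrite mulc_conj.
Qed.

(** The mean of y^* S^-1 y is the trace of S^-1 S, as S is the covariance of y. *)
Lemma output_inverse_form (z : block NT) : peak_constraint z ->
  P.-integrable setT (fun t => (inverse_form (cov z) (flat (out z t)))%:E) /\
  \int[P]_t inverse_form (cov z) (flat (out z t)) = D%:R.
Proof.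
move=> zok; have [V [l [VV VV' SE l1 lL]]] := output_cov_decomposition fm nm fn rho0 zok.
have ym a : complex_moments P (fun t => tnth (flat (out z t)) a) by exact: output_moments.
have cst := @complex_moments_cst _ _ _ P.
have yym a b : complex_moments P (fun t => tnth (flat (out z t)) b * conj (tnth (flat (out z t)) a)).
  by apply: complex_momentsM => //; exact: complex_moments_conj.
pose q t := \sum_a \sum_b \adj (cov z) a b * (tnth (flat (out z t)) b * conj (tnth (flat (out z t)) a)).
have qm : complex_moments P q.
  by apply: complex_moments_sum => a; apply: complex_moments_sum => b; exact: complex_momentsM.
have E t : inverse_form (cov z) (flat (out z t)) = (complex.Re (\det (cov z)))^-1 * complex.Re (q t).
  rewrite /inverse_form mulrC; congr (_ * complex.Re _); apply: eq_bigr => a _.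
  by apply: eq_bigr => b _; ring.
have qi := all_moments_integrable qm.1.
split.
  by under eq_fun do rewrite E; exact: integrableZR.
under eq_Rintegral do rewrite E.
rewrite RintegralZl//.
have -> : \int[P]_t complex.Re (q t) = complex.Re (complex_expectation P q).
  by rewrite complex_expectationE.
have -> : complex_expectation P q = D%:R * \det (cov z).
  rewrite /q complex_expectation_sum; last first.
    by move=> a; apply: complex_moments_sum => b; exact: complex_momentsM.
  transitivity (\sum_(a < D) \det (cov z)); last by rewrite sumr_const card_ord mulr_natl.
  apply: eq_bigr => a _; rewrite complex_expectation_sum; last first.
    by move=> b; exact: complex_momentsM.
  have := mul_adj_mx (cov z) => /matrixP/(_ a a); rewrite !mxE eqxx mulr1n => <-.
  apply: eq_bigr => b _; rewrite complex_expectationZ//.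
  by rewrite (output_second fm nm fn rho0).
have dg : 0 < complex.Re (\det (cov z)) by rewrite SE; exact: det_gt0.
have -> : complex.Re (D%:R * \det (cov z)) = D%:R * complex.Re (\det (cov z)).
  by rewrite !mulr_natl Re_mulrn.
by rewrite mulrCA mulVf ?mulr1// gt_eqF.
Qed.

(** Apply ln (1 + x) >= x - x^2 / 2 to the eigenvalues of the covariance minus the identity: their
    sum is a trace and the sum of their squares a Frobenius norm. *)
Lemma ln_det_ge (z : block NT) : peak_constraint z ->
  rho * \sum_a signal_power H z a - rho ^+ 2 / 2 * cov_energy H z <=
  ln (complex.Re (\det (cov z))).
Proof.
move=> zok; have [V [l [VV VV' SE l1 lL]]] := output_cov_decomposition fm nm fn rho0 zok.
rewrite SE ln_det//.
have B1 := unitary_conjB1 VV' l; rewrite -SE in B1.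
have tr : \sum_i (l i - 1) = rho * \sum_a signal_power H z a.
  apply: (@complexI R); rewrite -(unitary_conj_trace VV) -B1 /mxtrace mulr_sumr real_complex_sum.
  apply: eq_bigr => a _; rewrite mxE output_cov_diag !mxE eqxx -/(signal_power H z a).
  by apply: complex_ext; rewrite ?ReD ?ImD /=; ring.
have fr : \sum_i (l i - 1) ^+ 2 = rho ^+ 2 * cov_energy H z.
  rewrite -(unitary_conj_frobenius VV) -B1 mulr_sumr; apply: eq_bigr => a _.
  rewrite mulr_sumr; apply: eq_bigr => b _; rewrite !mxE [(_ == _)%:R + _]addrC addrK.
  by rewrite normcM_sqr sqr_normcE /= expr0n addr0.
rewrite -tr; have -> : rho ^+ 2 / 2 * cov_energy H z = \sum_i (l i - 1) ^+ 2 / 2.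
  by rewrite -mulr_suml fr; ring.
rewrite -sumrB; apply: ler_sum => i _.
by have := @ln1D_ge R (l i - 1); rewrite [1 + _]addrC subrK; apply; rewrite subr_ge0.
Qed.

Definition mean_variance (a : 'I_D) : R := 1 + rho * mean_signal_power H mu a.

Let mean_variance_ge1 a : 1 <= mean_variance a.
Proof. by rewrite lerDl mulr_ge0// mean_signal_power_ge0. Qed.

Let mean_variance_gt0 a : 0 < mean_variance a. Proof. exact: lt_le_trans (mean_variance_ge1 a). Qed.

Let mean_variance_le a : mean_variance a <= L ^+ 2.
Proof.
apply: (@le_trans _ _ L); last by rewrite expr2 ler_peMl// ltW.
rewrite /mean_variance /noise_scale -addrA lerD2l -[leLHS]add0r lerD// ler_wpM2l//.
apply: (@le_trans _ _ (\sum_k fading_power H k (antenna_of a))).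
  apply: ler_sum => k _; rewrite ler_piMr ?fading_power_ge0//.
  by have /andP[] := symbol_power_bounds peak k (time_of a).
rewrite [leRHS](bigD1 a)//= lerDl sumr_ge0// => b _.
by apply: sumr_ge0 => k _; exact: fading_power_ge0.
Qed.

Let I1 := @unitary1 R D.
Let I2 := @unitary1' R D.

(** The diagonal covariance is presented with the identity as unitary matrix, so that all facts
    about diagonalized Gaussian densities apply to it. *)
Definition product_density (y : block NR) : R :=
  gaussian_density L (unitary_conj 1%:M mean_variance) (flat y).

Let diag_inverse_form y : inverse_form (unitary_conj 1%:M mean_variance) y =
  \sum_a normc (tnth y a) ^+ 2 / mean_variance a.
Proof.
rewrite /inverse_form (unitary_conj_adj_form I1 I2); last by move=> i; rewrite gt_eqF.
have p0 : \prod_i mean_variance i != 0 by apply/prodf_neq0 => i _; rewrite gt_eqF.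
rewrite (det_prod _ I2) /= mulrAC divff// mul1r; apply: eq_bigr => a _; rewrite mulrC.
rewrite (bigD1 a)//= mxE eqxx mul1r big1 ?addr0// => b; rewrite mxE eq_sym => /negbTE ->.
by rewrite mul0r.
Qed.

Lemma measurable_channel_out : measurable_fun setT (fun w : block NT * T => out w.1 w.2).
Proof. exact: (@measurable_channel_output _ T R P NT NR H W rho N). Qed.

Let mYa a : measurable_fun setT (fun w : block NT * T => normc (tnth (flat (out w.1 w.2)) a) ^+ 2).
Proof.
apply: measurable_normc2_comp; apply: (measurableT_comp (measurable_tnth a)).
exact: (measurableT_comp (@measurable_flat _ _ _) measurable_channel_out).
Qed.

Lemma output_normc2_integrable a :
  MP.-integrable setT (fun w => (normc (tnth (flat (out w.1 w.2)) a) ^+ 2)%:E).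
Proof.
apply/integrableP; split; first exact/measurable_EFinP.
under eq_integral do rewrite /= ger0_norm ?sqr_ge0//.
rewrite fubini_tonelli1//; last 2 first.
- exact/measurable_EFinP.
- by move=> w; rewrite lee_fin sqr_ge0.
have := signal_power_integrable H peak a => si.
have vi : mu.-integrable setT (fun z => (1 + rho * signal_power H z a)%:E).
  by apply: integrableDR; [exact: finite_measure_integrable_cst|exact: integrableZR].
rewrite (_ : fubini_F _ _ = fun z => (1 + rho * signal_power H z a)%:E); last first.
  apply/funext => z; rewrite /fubini_F /= -(output_normc2 0) Rintegral_EFin//.
  apply: all_moments_integrable; apply: complex_moments_normc2.
  exact: (output_moments fm nm rho 0 z a).
by rewrite Rintegral_EFin// ltry.
Qed.

Let energy (w : block NT * T) := \sum_a normc (tnth (flat (out w.1 w.2)) a) ^+ 2.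

Let energy_integrable : MP.-integrable setT (fun w => (energy w)%:E).
Proof. by apply: integrable_sumR => a _; exact: output_normc2_integrable. Qed.

Let u (w : block NT * T) := ln (transition_density H rho (w.1, out w.1 w.2)) -
  ln (product_density (out w.1 w.2)).

Let mproduct : measurable_fun setT product_density.
Proof.
apply: measurable_gaussian_density => [a b|]; [exact: measurable_cst|exact: measurable_flat].
Qed.

Let mu_ : measurable_fun setT u.
Proof.
apply: measurable_funB; apply: measurableT_comp => //.
  apply: (measurableT_comp (@measurable_transition_density _ _ _ _ _ _ H rho N)).
  by apply: measurable_fun_pair; [exact: measurable_fst|exact: measurable_channel_out].
exact: (measurableT_comp mproduct measurable_channel_out).
Qed.

Let u_integrable : MP.-integrable setT (fun w => (u w)%:E).
Proof.
apply: (le_integrableR (g := fun w => 2 * (ln ((L ^+ 2) ^+ D) + energy w))) => //.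
- move=> w; rewrite mulr_natl mulr2n; apply: le_trans (ler_normB _ _) _; apply: lerD.
    exact: (ln_transition_density_bound fm nm fn rho0).
  exact: (ln_gaussian_density_bound I1 I2 mean_variance_ge1 mean_variance_le L1).
- apply: integrableZR; apply: integrableDR => //.
  by apply: (bounded_integrable_prod _ _ (M := `|ln ((L ^+ 2) ^+ D)|)).
Qed.

(** The conditional mean of [u] given the input, where the inverse form has contributed [D] and the
    log-determinant is replaced by its lower bound. *)
Let bound (z : block NT) := (\sum_a ln (mean_variance a) - D%:R +
  \sum_a (1 + rho * signal_power H z a) / mean_variance a) -
  (rho * \sum_a signal_power H z a - rho ^+ 2 / 2 * cov_energy H z).

Let inner_bound z : peak_constraint z -> \int[P]_t u (z, t) <= bound z.
Proof.
move=> zok; have [V [l [VV VV' SE l1 lL]]] := output_cov_decomposition fm nm fn rho0 zok.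
have [fi fE] := output_inverse_form zok.
have E t : u (z, t) = (\sum_a ln (mean_variance a) - ln (complex.Re (\det (cov z)))) -
    inverse_form (cov z) (flat (out z t)) +
    \sum_a (mean_variance a)^-1 * normc (tnth (flat (out z t)) a) ^+ 2.
  rewrite /u /transition_density /= (introT (peak_excessP z) zok) /output_density SE.
  have e1 := ln_gaussian_density VV' l1 L1 (flat (out z t)).
  have e2 := ln_gaussian_density I2 mean_variance_ge1 L1 (flat (out z t)).
  etransitivity; first exact: (congr2 (fun x y => x - y) e1 e2).
  rewrite diag_inverse_form.
  rewrite (ln_det I2 mean_variance_ge1).
  have -> : \sum_a (mean_variance a)^-1 * normc (tnth (flat (out z t)) a) ^+ 2 =
     \sum_a normc (tnth (flat (out z t)) a) ^+ 2 / mean_variance a.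
    by apply: eq_bigr => a _; rewrite mulrC.
  ring.
have ni a : P.-integrable setT (fun t => (normc (tnth (flat (out z t)) a) ^+ 2)%:E).
  apply: all_moments_integrable; apply: complex_moments_normc2.
  exact: (output_moments fm nm rho 0 z a).
have si : P.-integrable setT (fun t => (\sum_a (mean_variance a)^-1 *
    normc (tnth (flat (out z t)) a) ^+ 2)%:E).
  by apply: integrable_sumR => a _; exact: integrableZR.
set c := \sum_a ln (mean_variance a) - ln (complex.Re (\det (cov z))).
have ci : P.-integrable setT (fun t => c%:E) by exact: finite_measure_integrable_cst.
have -> : \int[P]_t u (z, t) = c - D%:R +
    \sum_a (1 + rho * signal_power H z a) / mean_variance a.
  transitivity (\int[P]_t (c - inverse_form (cov z) (flat (out z t)) +
    \sum_a (mean_variance a)^-1 * normc (tnth (flat (out z t)) a) ^+ 2)).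
    by apply: eq_Rintegral => t _; exact: E.
  rewrite RintegralD//; last exact: integrableBR.
  rewrite RintegralB// Rintegral_cst1 fE Rintegral_sum; last by move=> a _; exact: integrableZR.
  congr (_ + _); apply: eq_bigr => a _; rewrite RintegralZl//; [rewrite mulrC; congr (_ / _)|exact: ni].
  exact: output_normc2.
have := ln_det_ge zok; rewrite /bound /c; lra.
Qed.

Let bound_integrable : mu.-integrable setT (fun z => (bound z)%:E).
Proof.
have ci (c : R) : mu.-integrable setT (fun z => c%:E) by exact: finite_measure_integrable_cst.
have si := signal_power_integrable H peak.
have spE a : \int[mu]_z signal_power H z a = mean_signal_power H mu a by exact: integral_signal_power.
apply: integrableBR.
  apply: integrableDR => //; apply: integrable_sumR => a _.
  under eq_fun do rewrite mulrC; apply: integrableZR; apply: integrableDR => //.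
  exact: integrableZR.
apply: integrableBR.
  by apply: integrableZR; apply: integrable_sumR => a _; exact: si.
by apply: integrableZR; exact: cov_energy_integrable.
Qed.

Let integral_bound : \int[mu]_z bound z =
  \sum_a (ln (mean_variance a) - rho * mean_signal_power H mu a) +
  rho ^+ 2 / 2 * \int[mu]_z cov_energy H z.
Proof.
have ci (c : R) : mu.-integrable setT (fun z => c%:E) by exact: finite_measure_integrable_cst.
have si := signal_power_integrable H peak.
have spE a : \int[mu]_z signal_power H z a = mean_signal_power H mu a by exact: integral_signal_power.
have vi a : mu.-integrable setT (fun z => ((1 + rho * signal_power H z a) / mean_variance a)%:E).
  by under eq_fun do rewrite mulrC; apply: integrableZR; apply: integrableDR => //; exact: integrableZR.
have fi : mu.-integrable setT (fun z => (cov_energy H z)%:E) by exact: cov_energy_integrable.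
rewrite /bound RintegralB//; last 2 first.
- by apply: integrableDR => //; apply: integrable_sumR => a _; exact: vi.
- apply: integrableBR; last exact: integrableZR.
  by apply: integrableZR; apply: integrable_sumR => a _; exact: si.
rewrite RintegralD//; [|exact: ci|by apply: integrable_sumR => a _; exact: vi].
rewrite Rintegral_cst1 Rintegral_sum; last by move=> a _; exact: vi.
(* By the choice of [mean_variance] each quotient averages to 1, and the sum cancels the trace [D]
   of the inverse form. *)
have -> : \sum_a \int[mu]_z ((1 + rho * signal_power H z a) / mean_variance a) = D%:R.
  transitivity (\sum_(a < D) (1 : R)); last by rewrite sumr_const card_ord.
  apply: eq_bigr => a _.
  transitivity (\int[mu]_z ((mean_variance a)^-1 * (1 + rho * signal_power H z a))).
    by apply: eq_Rintegral => z _; rewrite mulrC.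
  rewrite RintegralZl//; last by apply: integrableDR => //; exact: integrableZR.
  rewrite RintegralD//; [|exact: ci|exact: integrableZR].
  have -> : \int[mu]_z (rho * signal_power H z a) = rho * mean_signal_power H mu a.
    by rewrite -spE RintegralZl//; exact: si.
  by rewrite Rintegral_cst1 mulVf// gt_eqF.
rewrite subrK RintegralB//; last 2 first.
- by apply: integrableZR; apply: integrable_sumR => a _; exact: si.
- exact: integrableZR.
rewrite !RintegralZl//; last by apply: integrable_sumR => a _; exact: si.
rewrite Rintegral_sum; last by move=> a _; exact: si.
rewrite sumrB.
rewrite -[in RHS]mulr_sumr; have -> : \sum_a mean_signal_power H mu a = \sum_a \int[mu]_z signal_power H z a.
  by apply: eq_bigr => a _; rewrite spE.
ring.
Qed.

Local Notation dens := (@transition_density _ _ _ _ _ _ H rho N).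

(** The integrability and the exact formula serve superadditivity; the inequality serves the
    capacity bound. *)
Lemma block_information_upper :
  [/\ MP.-integrable setT (fun w : block NT * T =>
       (ln (density_ratio_fun mu dens (w.1, out w.1 w.2)))%:E),
      block_information H W rho mu =
        (\int[MP]_w ln (density_ratio_fun mu dens (w.1, out w.1 w.2)))%:E &
      \int[MP]_w ln (density_ratio_fun mu dens (w.1, out w.1 w.2)) <=
      \sum_a (ln (1 + rho * mean_signal_power H mu a) - rho * mean_signal_power H mu a) +
        rho ^+ 2 / 2 * \int[mu]_z cov_energy H z].
Proof.
have densE : {ae mu, forall z, forall A, measurable A ->
    P [set t | A (@channel_output _ T R P NT NR H W rho N (z, t))] =
    (\int[reference_law H W rho N]_(y in A) (transition_density H rho (z, y))%:E)%E}.
  by apply: filterS peak => z zok A mA; rewrite -(transition_density_law fm nm fn rho0 0 zok mA).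
have q1 : (\int[reference_law H W rho N]_y (product_density y)%:E <= 1)%E.
  rewrite ge0_integral_distribution//; last 2 first.
  - exact/measurable_EFinP.
  - by move=> y; rewrite lee_fin ltW//; exact: (gaussian_density_gt0 I1 I2 mean_variance_ge1 L0).
  have := gaussian_density_total I1 I2 mean_variance_ge1 mean_variance_le L0
    (measurable_noise_block W (noise_index 0))
    (fun c g th => noise_weighted_charfun nm (@noise_index_inj NR N 0) (c:=c) g th).
  move=> <-; rewrite le_eqVlt; apply/orP; left; apply/eqP.
  by apply: eq_integral => t _; rewrite /= /product_density unflatK.
have q0 y : 0 < product_density y by exact: (gaussian_density_gt0 I1 I2 mean_variance_ge1 L0 (flat y)).
have [i1 e1 b1] := @information_upper _ _ _ _ _ _ R mu P (@channel_input _ T R NT N)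
  (@channel_output _ T R P NT NR H W rho N) (fun w => erefl) (reference_law H W rho N)
  dens ((L ^+ 2) ^+ D)
  (@measurable_transition_density _ _ _ _ _ _ H rho N) (transition_density_gt0 fm nm fn rho0)
  (transition_density_le fm nm fn rho0) densE product_density mproduct q0 q1 u_integrable.
split; [exact: i1|exact: e1|].
apply: le_trans b1 _; rewrite -integral_bound (Rintegral_prod u_integrable).
(* Fubini yields integrability of the extended-real inner integral, which agrees almost everywhere
   with its finite part. *)
have ii : mu.-integrable setT (fun z => (\int[P]_t u (z, t))%:E).
  have := integrable_fubini_F u_integrable.
  move=> /integrableP[mF iF]; apply/integrableP.
  have aeE : {ae mu, forall z, fubini_F P (fun w => (u w)%:E) z = (\int[P]_t u (z, t))%:E}.
    have := ae_integrable1 u_integrable; apply: filterS => z iz.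
    by rewrite /fubini_F Rintegral_EFin.
  have mR : measurable_fun setT (fun z => (\int[P]_t u (z, t))%:E).
    by apply/measurable_EFinP; apply: measurableT_comp mF.
  split=> //; apply: le_lt_trans iF; rewrite le_eqVlt; apply/orP; left; apply/eqP.
  apply: ae_eq_integral => //.
  - exact: measurableT_comp.
  - exact: measurableT_comp.
  - by apply: filterS aeE => z -> _.
rewrite -lee_fin -(Rintegral_EFin bound_integrable); apply: le_integral_ae => //.
  exact: (measurable_int mu bound_integrable).
by apply: filterS peak => z zok; rewrite lee_fin; exact: inner_bound.
Qed.

End block_information_upper.

(** * Mean energy of the signal covariance *)

Section information_bound.
Context d (T : measurableType d) (R : realType) (P : probability T R) (NT NR : nat).
Variables (H : 'I_NT -> 'I_NR -> int -> {RV P >-> R[i]}).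
Variables (W : 'I_NR -> nat -> {RV P >-> R[i]}).
Hypotheses (fm : fading_model H) (nm : noise_model W) (fn : fading_noise_independent H W).
Hypothesis phi_fin : forall k l, (phi P (H k l) < +oo)%E.
Hypothesis nonephemeral : forall k l, ~ ephemeral P (H k l).

Definition phi_real k l : R := fine (phi P (H k l)).

Let c k l (n : int) : R := normc (autocorrelation P (H k l) n) ^+ 2.
Let c0 k l n : 0 <= c k l n. Proof. exact: sqr_ge0. Qed.

Lemma phi_ge0 k l : (0 <= phi P (H k l))%E.
Proof. by apply: nneseries_ge0 => n _ _; rewrite lee_fin sqr_ge0. Qed.

Lemma phi_realE k l : (phi_real k l)%:E = phi P (H k l).
Proof. by rewrite fineK// ge0_fin_numE ?phi_ge0. Qed.

Lemma phi_partial k l n : \sum_(1 <= j < n) c k l j%:Z <= phi_real k l.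
Proof.
rewrite -lee_fin phi_realE /phi -sumEFin.
by apply: nneseries_lim_ge => j _ _; rewrite lee_fin sqr_ge0.
Qed.

Lemma fading_power_phi k l : fading_power H k l ^+ 2 <= 2 * phi_real k l.
Proof.
have /negP := @nonephemeral k l; rewrite -ltNge -phi_realE -EFinM lte_fin => /ltW.
by [].
Qed.

(** The times before [n] and those after it each show a lag at most once, and opposite lags have
    conjugate autocorrelations. Each side is a partial sum of the series [phi]. *)
Lemma autocorrelation_offdiag N (n : 'I_N) k l :
  \sum_(m < N | m != n) c k l (n%:Z - m%:Z) <= 2 * phi_real k l.
Proof.
rewrite (bigID (fun m : 'I_N => (m < n)%N)) /= mulr_natl mulr2n; apply: lerD.
- apply: le_trans (phi_partial k l n.+1).
  have -> : \sum_(1 <= j < n.+1) c k l j%:Z = \sum_(0 <= m < n) c k l (n%:Z - m%:Z).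
    rewrite big_add1/= big_nat_rev/= add0n; apply: eq_big_nat => m /andP[_ mn].
    by rewrite subnSK// -subzn// ltnW.
  rewrite big_mkord (big_ord_widen_cond N predT (fun m => c k l (n%:Z - m%:Z)) (ltnW (ltn_ord n))).
  rewrite le_eqVlt; apply/orP; left; apply/eqP; apply: eq_bigl => m /=.
  by apply: andb_idl => mn; apply/eqP => e; rewrite e ltnn in mn.
- apply: le_trans (phi_partial k l (N - n)).
  have -> : \sum_(1 <= j < N - n) c k l j%:Z = \sum_(n.+1 <= m < N) c k l (n%:Z - m%:Z).
    rewrite -[n.+1]add1n big_addn; apply: eq_big_nat => j _.
    rewrite /c -normc_conj -(autocorrelationN fm); congr (normc (autocorrelation _ _ _) ^+ 2).
    by rewrite PoszD; ring.
  rewrite (big_geq_mkord n.+1 N predT (fun m => c k l (n%:Z - m%:Z))) /=.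
  rewrite le_eqVlt; apply/orP; left; apply/eqP; apply: eq_bigl => m /=.
  by rewrite -leqNgt [RHS]ltn_neqAle eq_sym -val_eqE.
Qed.

Section block.
Variables (rho : R) (N : nat).
Hypothesis rho0 : 0 <= rho.
Local Notation block n := (N.-tuple (n.-tuple R[i])).
Local Notation D := #|{: 'I_N * 'I_NR}|.
Variable mu : probability (block NT) R.
Hypothesis peak : {ae mu, forall z, peak_constraint z}.

Let x (z : block NT) (a : 'I_D) k : R := normc (tnth (tnth z (time_of a)) k) ^+ 2.
Let p (a : 'I_D) k : R := symbol_power mu k (time_of a).
Let r k (a : 'I_D) : R := fading_power H k (antenna_of a).
Let m (a : 'I_D) : R := mean_signal_power H mu a.

Let xi a k : mu.-integrable setT (fun z => (x z a k)%:E).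
Proof. exact: symbol_integrable. Qed.

Let p01 a k : 0 <= p a k <= 1.
Proof. exact: symbol_power_bounds. Qed.

Let neighbours k (a : 'I_D) : R := \sum_(b | (b != a) && (antenna_of a == antenna_of b))
  c k (antenna_of a) ((time_of a)%:Z - (time_of b)%:Z).

Let neighbours_le k a : neighbours k a <= 2 * phi_real k (antenna_of a).
Proof.
rewrite /neighbours; apply: le_trans (autocorrelation_offdiag (time_of a) k (antenna_of a)).
pose F (i : 'I_N) := c k (antenna_of a) ((time_of a)%:Z - i%:Z).
rewrite big_mkcond /=.
apply: (@le_trans _ _ (\sum_(b : 'I_D) (fun (i : 'I_N) (l : 'I_NR) => if (i != time_of a) && (l == antenna_of a) then F i else 0)
    (time_of b) (antenna_of b))).
  rewrite le_eqVlt; apply/orP; left; apply/eqP; apply: eq_bigr => b _.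
  rewrite [antenna_of b == _]eq_sym; case: (eqVneq (antenna_of a) (antenna_of b)) => [e|_]; last by rewrite !andbF.
  rewrite !andbT; congr (if _ then _ else _); congr negb.
  by apply/eqP/eqP => [->//|e']; exact: flat_index_inj.
rewrite (sum_flat (fun (i : 'I_N) (l : 'I_NR) => if (i != time_of a) && (l == antenna_of a) then F i else 0)).
rewrite [leRHS]big_mkcond /= le_eqVlt; apply/orP; left; apply/eqP.
apply: eq_bigr => i _; rewrite (bigD1 (antenna_of a))//= eqxx andbT big1 ?addr0// => l /negbTE ->.
by rewrite andbF.
Qed.

(** Affine in the powers [x], so that its mean involves only their means. The squared signal power
    is expanded around [m a]; Cauchy-Schwarz bounds the fluctuation, and the peak constraint
    replaces x^2 by x. The term [m a ^+ 2] is kept exact because it has to cancel. *)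
Let energy_bound (z : block NT) : R := \sum_a (m a ^+ 2 + 2 * m a * (signal_power H z a - m a) +
  NT%:R * \sum_k (r k a ^+ 2 * (x z a k - 2 * p a k * x z a k + p a k ^+ 2)) +
  NT%:R * \sum_k (neighbours k a * x z a k)).

Let cov_energy_le z : peak_constraint z -> cov_energy H z <= energy_bound z.
Proof.
move=> zok; apply: ler_sum => a _; rewrite (bigD1 a)//=; apply: lerD.
  have -> : signal_cov H z a a = (signal_power H z a)%:C.
    rewrite /signal_cov eqxx subrr /signal_power real_complex_sum; apply: eq_bigr => k _.
    by rewrite mulc_conj real_complexM /fading_power autocorrelation0.
  rewrite sqr_normcE /= expr0n addr0.
  have -> : signal_power H z a ^+ 2 = m a ^+ 2 + 2 * m a * (signal_power H z a - m a) +
     (signal_power H z a - m a) ^+ 2 by ring.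
  rewrite lerD2l.
  have -> : signal_power H z a - m a = \sum_k r k a * (x z a k - p a k).
    by rewrite /signal_power /m /mean_signal_power -sumrB; apply: eq_bigr => k _; rewrite mulrBr.
  apply: le_trans (sqr_sum_le _) _; rewrite ler_wpM2l//; apply: ler_sum => k _.
  rewrite exprMn ler_wpM2l ?sqr_ge0//.
  have x1 : x z a k <= 1 by exact: zok.
  have x0 : 0 <= x z a k by exact: sqr_ge0.
  nra.
apply: (@le_trans _ _ (\sum_(b | (b != a) && (antenna_of a == antenna_of b)) NT%:R * \sum_k
    c k (antenna_of a) ((time_of a)%:Z - (time_of b)%:Z) * x z a k)).
  rewrite [leRHS]big_mkcondr; apply: ler_sum => b _.
  exact: signal_cov_le.
rewrite -mulr_sumr ler_wpM2l// exchange_big /= le_eqVlt; apply/orP; left; apply/eqP.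
by apply: eq_bigr => k _; rewrite mulr_suml.
Qed.

Let ci (y : R) : mu.-integrable setT (fun z => y%:E).
Proof. exact: finite_measure_integrable_cst. Qed.

Let spi a : mu.-integrable setT (fun z => (signal_power H z a)%:E).
Proof. exact: signal_power_integrable. Qed.

Let i1 a : mu.-integrable setT (fun z => (m a ^+ 2 + 2 * m a * (signal_power H z a - m a))%:E).
Proof. by apply: integrableDR => //; apply: integrableZR; exact: integrableBR. Qed.

Let i2k a k : mu.-integrable setT (fun z => (x z a k - 2 * p a k * x z a k + p a k ^+ 2)%:E).
Proof. by apply: integrableDR => //; apply: integrableBR => //; exact: integrableZR. Qed.

Let i2 a : mu.-integrable setT (fun z =>
  (NT%:R * \sum_k (r k a ^+ 2 * (x z a k - 2 * p a k * x z a k + p a k ^+ 2)))%:E).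
Proof. by apply: integrableZR; apply: integrable_sumR => k _; apply: integrableZR; exact: i2k. Qed.

Let i3 a : mu.-integrable setT (fun z => (NT%:R * \sum_k (neighbours k a * x z a k))%:E).
Proof. by apply: integrableZR; apply: integrable_sumR => k _; exact: integrableZR. Qed.

Let energy_bound_integrable : mu.-integrable setT (fun z => (energy_bound z)%:E).
Proof.
apply: integrable_sumR => a _; apply: integrableDR; last exact: i3.
by apply: integrableDR; [exact: i1|exact: i2].
Qed.

Let integral_energy_bound : \int[mu]_z energy_bound z = \sum_a (m a ^+ 2 +
  NT%:R * \sum_k (r k a ^+ 2 * (p a k - p a k ^+ 2)) + NT%:R * \sum_k (neighbours k a * p a k)).
Proof.
rewrite Rintegral_sum; last first.
  by move=> a _; apply: integrableDR; [apply: integrableDR; [exact: i1|exact: i2]|exact: i3].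
apply: eq_bigr => a _; rewrite RintegralD//; [|by apply: integrableDR; [exact: i1|exact: i2]|exact: i3].
rewrite RintegralD//; [|exact: i1|exact: i2].
congr (_ + _ + _).
- rewrite RintegralD//; [|exact: ci|by apply: integrableZR; exact: integrableBR].
  rewrite Rintegral_cst1 RintegralZl//; last exact: integrableBR.
  rewrite RintegralB//; [|exact: spi|exact: ci].
  by rewrite Rintegral_cst1 (integral_signal_power H peak) subrr mulr0 addr0.
- rewrite RintegralZl//; last by apply: integrable_sumR => k _; apply: integrableZR; exact: i2k.
  rewrite Rintegral_sum; last by move=> k _; apply: integrableZR; exact: i2k.
  congr (_ * _); apply: eq_bigr => k _; rewrite RintegralZl//; last exact: i2k.
  congr (_ * _); rewrite RintegralD//; [|by apply: integrableBR; [exact: xi|exact: integrableZR]|exact: ci].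
  rewrite RintegralB//; [|exact: xi|exact: integrableZR].
  rewrite Rintegral_cst1 RintegralZl//; last exact: xi.
  have -> : \int[mu]_z x z a k = p a k by [].
  ring.
- rewrite RintegralZl//; last by apply: integrable_sumR => k _; exact: integrableZR.
  rewrite Rintegral_sum; last by move=> k _; exact: integrableZR.
  by congr (_ * _); apply: eq_bigr => k _; rewrite RintegralZl//; exact: xi.
Qed.

Lemma mean_cov_energy_le : \int[mu]_z cov_energy H z <=
  \sum_a (m a ^+ 2 + NT%:R * \sum_k 2 * phi_real k (antenna_of a)).
Proof.
apply: (@le_trans _ _ (\int[mu]_z energy_bound z)).
  rewrite -lee_fin -(Rintegral_EFin energy_bound_integrable); apply: le_integral_ae.
  - exact: cov_energy_integrable.
  - exact: (measurable_int mu energy_bound_integrable).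
  - by apply: filterS peak => z zok; rewrite lee_fin; exact: cov_energy_le.
rewrite integral_energy_bound; apply: ler_sum => a _; rewrite -addrA lerD2l -mulrDr ler_wpM2l//.
rewrite -big_split /=; apply: ler_sum => k _.
have /andP[p0 p1] := p01 a k; have n1 := neighbours_le k a.
have f1 := fading_power_phi k (antenna_of a); rewrite -/(r k a) in f1.
set q := 2 * phi_real k (antenna_of a) in n1 f1 *.
apply: (@le_trans _ _ (q * (p a k - p a k ^+ 2) + q * p a k)).
  by apply: lerD; rewrite ler_wpM2r// subr_ge0 expr2 ler_piMr.
have q0 : 0 <= q by apply: le_trans f1; exact: sqr_ge0.
rewrite -mulrDr ler_piMr//; have := sqr_ge0 (1 - p a k); nra.
Qed.

Definition cubic_rate : R := \sum_l (\sum_k fading_power H k l) ^+ 3 / 3.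

Let m_bounds a : 0 <= m a <= \sum_k fading_power H k (antenna_of a).
Proof.
rewrite mean_signal_power_ge0//=; apply: ler_sum => k _; rewrite ler_piMr ?fading_power_ge0//.
by have /andP[] := p01 a k.
Qed.

Lemma block_information_le : exists I : R, block_information H W rho mu = I%:E /\
  I <= N%:R * (rho ^+ 2 * (NT%:R * \sum_k \sum_l phi_real k l) + rho ^+ 3 * cubic_rate).
Proof.
have [_ -> h] := block_information_upper fm nm fn rho0 peak.
eexists; split; [reflexivity|]; apply: le_trans h _.
have e := mean_cov_energy_le.
have l1 a : ln (1 + rho * m a) - rho * m a <=
    - (rho ^+ 2 / 2) * m a ^+ 2 + rho ^+ 3 * ((\sum_k fading_power H k (antenna_of a)) ^+ 3 / 3).
  have /andP[m0 m1] := m_bounds a.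
  have := @ln1D_le R (rho * m a) (mulr_ge0 rho0 m0).
  have m3 : m a ^+ 3 <= (\sum_k fading_power H k (antenna_of a)) ^+ 3.
    by rewrite lerXn2r ?nnegrE// (le_trans m0).
  have r3 : 0 <= rho ^+ 3 by rewrite exprn_ge0.
  have := ler_wpM2l r3 m3; rewrite !exprMn; lra.
have s1 : \sum_a (ln (1 + rho * m a) - rho * m a) <=
    - (rho ^+ 2 / 2) * \sum_a m a ^+ 2 +
    rho ^+ 3 * \sum_(a : 'I_D) ((\sum_k fading_power H k (antenna_of a)) ^+ 3 / 3).
  by rewrite !mulr_sumr -big_split; apply: ler_sum => a _; exact: l1.
apply: (@le_trans _ _ (rho ^+ 2 * \sum_(a : 'I_D) (NT%:R * \sum_k phi_real k (antenna_of a)) +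
    rho ^+ 3 * \sum_(a : 'I_D) ((\sum_k fading_power H k (antenna_of a)) ^+ 3 / 3))).
  (* Scaled by rho^2 / 2, the energy bound contains [m a ^+ 2] with the opposite of its coefficient
     in [s1]: the concavity of the logarithm pays exactly for the mean diagonal. *)
  have r2 : 0 <= rho ^+ 2 / 2 by rewrite divr_ge0// sqr_ge0.
  have := ler_wpM2l r2 e; rewrite big_split /= => e'.
  have E2 : \sum_(a : 'I_D) (NT%:R * \sum_k 2 * phi_real k (antenna_of a)) =
     2 * \sum_(a : 'I_D) (NT%:R * \sum_k phi_real k (antenna_of a)).
    by rewrite mulr_sumr; apply: eq_bigr => a _; rewrite -mulr_sumr; ring.
  rewrite E2 in e'; lra.
rewrite (sum_flat (fun _ l => NT%:R * \sum_k phi_real k l)).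
rewrite (sum_flat (fun _ l => (\sum_k fading_power H k l) ^+ 3 / 3)).
rewrite !sumr_const card_ord -/cubic_rate -mulr_sumr exchange_big /=.
rewrite -(mulr_natl (NT%:R * _)) -(mulr_natl cubic_rate) le_eqVlt; apply/orP; left; apply/eqP; ring.
Qed.

End block.

Lemma power_constraint_peak N (mu : probability (N.-tuple (NT.-tuple R[i])) R) (beta : R) :
  individual_power_constraint beta mu -> {ae mu, forall z, peak_constraint z}.
Proof.
move=> h; apply: filter_forall => i; apply: filter_forall => k.
by have [] := h i k.
Qed.

End information_bound.

(** * Superadditivity *)

(** The limit is the supremum of the quotients. This is stated as well, because the supremum is what
    turns bounds for single blocks into bounds for the limit. *)
Lemma fekete (R : realType) (a : nat -> R) (c : R) :
  (forall m n, a m + a n <= a (m + n)%N) -> (forall n, 0 <= a n) ->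
  (forall n, a n <= n%:R * c) ->
  exists S : R, [/\ (n%:R^-1 * a n) @[n --> \oo] --> S,
    (forall n, n%:R^-1 * a n <= S) & forall B : R, (forall n, n%:R^-1 * a n <= B) -> S <= B].
Proof.
move=> sa a0 ac; pose b n := n%:R^-1 * a n.
have bc n : b n <= c.
  rewrite /b; case: n => [|n]; first by rewrite invr0 mul0r (le_trans (a0 1))// (le_trans (ac _))// mul1r.
  by rewrite mulrC ler_pdivrMr// mulrC.
have b0 n : 0 <= b n by rewrite mulr_ge0// invr_ge0.
have hs : has_sup (range b).
  by split; [exists (b 0), 0|exists c => _ [n _ <-]].
exists (sup (range b)); set S := sup _.
have bS n : b n <= S by apply: sup_upper_bound => //; exists n.
split; [|exact: bS|]; last first.
  move=> B h; apply: ge_sup; first exact: hs.1.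
  by move=> _ [n _ <-]; exact: h.
have S0 : 0 <= S by exact: le_trans (bS 0).
have qa q m : q%:R * a m <= a (q * m)%N.
  elim: q => [|q ih]; first by rewrite mul0r mul0n.
  by rewrite mulSn -[q.+1]add1n natrD mulrDl mul1r (le_trans _ (sa _ _))// lerD2l.
have amono m n : (m <= n)%N -> a m <= a n.
  by move=> mn; rewrite -(subnKC mn) (le_trans _ (sa _ _))// lerDl.
apply/cvgrPdist_le => e e0.
have e2 : 0 < e / 2 by rewrite divr_gt0.
have [_ [m _ <-] mS] := sup_adherent e2 hs; rewrite -/S in mS.
near=> n.
rewrite -/(b n) ger0_norm ?subr_ge0// lerBlDr -lerBlDl.
have n0 : (0 < n)%N by near: n; exists 1%N.
(* The nearly optimal index may be 0, where the quotient is 0 because [0^-1] is 0; then [S] itself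
   is below e / 2. *)
have [m0|m0] := posnP m.
  have bm : b m = 0 by rewrite /b m0 invr0 mul0r.
  rewrite bm in mS; have := b0 n; lra.
have nR : 0 < n%:R :> R by rewrite ltr0n.
have mR : 0 < m%:R :> R by rewrite ltr0n.
(* The range is cut into n / m pieces of length [m]; the remainder, shorter than [m], is
   discarded. *)
have h1 : (n%:R - m%:R) * b m <= a n.
  apply: (@le_trans _ _ ((n %/ m)%:R * a m)); last first.
    by apply: le_trans (qa _ _) _; apply: amono; exact: leq_trunc_div.
  have -> : a m = m%:R * b m by rewrite /b mulVKf// gt_eqF.
  rewrite [leRHS]mulrA ler_wpM2r// -natrM lerBlDr -natrD ler_nat.
  by rewrite {1}(divn_eq n m) leq_add2l ltnW// ltn_mod.
have h2 : m%:R * S <= (e / 2) * n%:R.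
  rewrite -ler_pdivrMl//; near: n; exact: nbhs_infty_ger.
have h3 : m%:R * b m <= m%:R * S by rewrite ler_wpM2l.
have nb : n%:R * b n = a n by rewrite /b mulVKf// gt_eqF.
have h4 : n%:R * (S - e / 2) <= n%:R * b m by rewrite ler_wpM2l// ltW.
rewrite -(ler_pM2l nR) nb; nra.
Unshelve. all: by end_near.
Qed.

Section shifted_law.
Context d (T : measurableType d) (R : realType) (P : probability T R) (NT NR : nat).
Variables (H : 'I_NT -> 'I_NR -> int -> {RV P >-> R[i]}).
Variables (W : 'I_NR -> nat -> {RV P >-> R[i]}).
Hypotheses (fm : fading_model H) (nm : noise_model W) (fn : fading_noise_independent H W).
Variable rho : R.
Hypothesis rho0 : 0 <= rho.
Local Notation block K n := (K.-tuple (n.-tuple R[i])).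
Local Notation out := (output H W rho).

Lemma measurable_output_joint K s :
  measurable_fun setT (fun w : block K NT * T => out s w.1 w.2).
Proof.
apply/measurable_fun_tnthP => i; apply/measurable_fun_tnthP => l.
rewrite (_ : _ \o _ = fun w : block K NT * T => (Num.sqrt rho)%:C *
      (\sum_(k < NT) H k l (s + i).+1%:Z w.2 * tnth (tnth w.1 i) k)
      + W l (s + i).+1 w.2); last by apply/funext => t /=; rewrite !tnth_mktuple.
apply: measurable_complexD; last exact: (measurableT_comp _ measurable_snd).
apply: measurable_complexM => //.
apply: measurable_complex_sum => k; apply: measurable_complexM.
  exact: (measurableT_comp _ measurable_snd).
exact: (measurableT_comp (@measurable_entry _ _ _ i k) measurable_fst).
Qed.

(** [pi] extracts a part of a longer input. Given each input the output has the same law at every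
    offset, so a comparison section by section leaves only the law of the input. *)
Lemma shifted_law K (mu' : probability (block K NT) R) d' (S : measurableType d')
    (mu : probability S R) (pi : S -> block K NT) s :
  {ae mu', forall z, peak_constraint z} ->
  measurable_fun setT pi -> (forall A, measurable A -> mu (pi @^-1` A) = mu' A) ->
  forall A, measurable A ->
  (mu \x P)%E ((fun w => (pi w.1, out s (pi w.1) w.2)) @^-1` A) =
  (mu' \x P)%E ((fun w => (w.1, out 0 w.1 w.2)) @^-1` A).
Proof.
move=> peak mpi law A mA.
pose B s := (fun w : block K NT * T => (w.1, out s w.1 w.2)) @^-1` A.
have mB s' : measurable (B s').
  rewrite -[X in measurable X]setTI; apply: measurable_fun_pair => //.
  exact: measurable_output_joint.
pose h s' z := P (xsection (B s') z).
have mh s' : measurable_fun setT (h s') by exact: measurable_fun_xsection.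
pose piM : {mfun S >-> block K NT} := HB.pack pi (isMeasurableFun.Build _ _ _ _ _ mpi).
transitivity (\int[mu]_z (h s \o pi) z)%E.
  by apply: eq_integral => z _; congr (P _); rewrite !xsectionE.
transitivity (\int[distribution mu piM]_z h s z)%E; first by rewrite ge0_integral_distribution.
transitivity (\int[mu']_z h s z)%E.
  by apply: eq_measure_integral => C mC _; exact: law.
transitivity (\int[mu']_z h 0%N z)%E; last by apply: eq_integral.
apply: ae_eq_integral => //; apply: filterS peak => z zok _.
pose C := xsection A z; have mC : measurable C by exact: measurable_xsection.
have e s' : xsection (B s') z = out s' z @^-1` C by rewrite /C !xsectionE.
by rewrite /h !e !(transition_density_law fm nm fn rho0 _ zok mC).
Qed.

End shifted_law.

Section concatenation.
Context (R : realType) (n N M : nat).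
Local Notation block K := (K.-tuple (n.-tuple R[i])).

Definition left_block (z : block (N + M)) : block N := [tuple tnth z (lshift M i) | i < N].
Definition right_block (z : block (N + M)) : block M := [tuple tnth z (rshift N i) | i < M].
Definition cat_block (p : block N * block M) : block (N + M) := cat_tuple p.1 p.2.

Lemma left_cat p : left_block (cat_block p) = p.1.
Proof. by apply/eq_from_tnth => i; rewrite tnth_mktuple tnth_lshift. Qed.

Lemma right_cat p : right_block (cat_block p) = p.2.
Proof. by apply/eq_from_tnth => i; rewrite tnth_mktuple tnth_rshift. Qed.

Lemma measurable_left : measurable_fun setT left_block.
Proof.
apply/measurable_fun_tnthP => i.
rewrite (_ : _ \o _ = fun z : block (N + M) => tnth z (lshift M i)); first exact: measurable_tnth.
by apply/funext => z /=; rewrite tnth_mktuple.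
Qed.

Lemma measurable_right : measurable_fun setT right_block.
Proof.
apply/measurable_fun_tnthP => i.
rewrite (_ : _ \o _ = fun z : block (N + M) => tnth z (rshift N i)); first exact: measurable_tnth.
by apply/funext => z /=; rewrite tnth_mktuple.
Qed.

Lemma measurable_cat : measurable_fun setT cat_block.
Proof.
apply/measurable_fun_tnthP => i; rewrite -(fintype.splitK i); case: (fintype.split i) => j /=.
- rewrite (_ : _ \o _ = fun p : block N * block M => tnth p.1 j).
    exact: (measurableT_comp (measurable_tnth j) measurable_fst).
  by apply/funext => p /=; rewrite tnth_lshift.
- rewrite (_ : _ \o _ = fun p : block N * block M => tnth p.2 j).
    exact: (measurableT_comp (measurable_tnth j) measurable_snd).
  by apply/funext => p /=; rewrite tnth_rshift.
Qed.

HB.instance Definition _ := isMeasurableFun.Build _ _ _ _ cat_block measurable_cat.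

Variables (mu1 : probability (block N) R) (mu2 : probability (block M) R).

Definition cat_law : probability (block (N + M)) R := distribution (mu1 \x mu2)%E cat_block.

Lemma cat_law_left A : measurable A -> cat_law (left_block @^-1` A) = mu1 A.
Proof.
move=> mA; rewrite /cat_law /distribution /pushforward /=.
have -> : cat_block @^-1` (left_block @^-1` A) = A `*` setT.
  by apply/seteqP; split=> p /=; rewrite left_cat; [|case].
rewrite product_measure1E//; transitivity (mu1 A * 1)%E; last exact: mule1.
by congr (_ * _)%E; exact: probability_setT.
Qed.

Lemma cat_law_right A : measurable A -> cat_law (right_block @^-1` A) = mu2 A.
Proof.
move=> mA; rewrite /cat_law /distribution /pushforward /=.
have -> : cat_block @^-1` (right_block @^-1` A) = setT `*` A.
  by apply/seteqP; split=> p /=; rewrite right_cat; [|case].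
rewrite product_measure1E//; transitivity (1 * mu2 A)%E; last exact: mul1e.
by congr (_ * _)%E; exact: probability_setT.
Qed.

Lemma cat_law_peak : {ae mu1, forall z, peak_constraint z} ->
  {ae mu2, forall z, peak_constraint z} -> {ae cat_law, forall z, peak_constraint z}.
Proof.
move=> [A [mA A0 AP]] [B [mB B0 BP]].
exists (left_block @^-1` A `|` right_block @^-1` B); split.
- by apply: measurableU; rewrite -[X in measurable X]setTI; [exact: measurable_left|exact: measurable_right].
- have mlA : measurable (left_block @^-1` A).
    by rewrite -[X in measurable X]setTI; exact: measurable_left.
  have mrB : measurable (right_block @^-1` B).
    by rewrite -[X in measurable X]setTI; exact: measurable_right.
  apply/eqP; rewrite -measure_le0; apply: le_trans (measureU2 _ mlA mrB) _.
  by rewrite [X in (X + _)%E]cat_law_left// [X in (_ + X)%E]cat_law_right// A0 B0 adde0.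
- move=> z /= zn; apply: contrapT => /not_orP[zA zB]; apply: zn => i k.
  have zl : peak_constraint (left_block z) by apply: contrapT => h; apply: zA; apply: AP.
  have zr : peak_constraint (right_block z) by apply: contrapT => h; apply: zB; apply: BP.
  rewrite -(fintype.splitK i); case: (fintype.split i) => j /=.
  + by have := zl j k; rewrite tnth_mktuple.
  + by have := zr j k; rewrite tnth_mktuple.
Qed.

End concatenation.

Section superadditivity.
Context d (T : measurableType d) (R : realType) (P : probability T R) (NT NR : nat).
Variables (H : 'I_NT -> 'I_NR -> int -> {RV P >-> R[i]}).
Variables (W : 'I_NR -> nat -> {RV P >-> R[i]}).
Hypotheses (fm : fading_model H) (nm : noise_model W) (fn : fading_noise_independent H W).
Variable rho : R.
Hypothesis rho0 : 0 <= rho.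
Local Notation block K n := (K.-tuple (n.-tuple R[i])).
Local Notation out := (output H W rho).

Lemma peak_power_constraint K (mu : probability (block K NT) R) :
  {ae mu, forall z, peak_constraint z} -> individual_power_constraint 1 mu.
Proof.
move=> peak i k; split; first by apply: filterS peak => z; exact.
rewrite unlock invr1; apply: (@le_trans _ _ (\int[mu]_z 1)%E).
  apply: ae_ge0_le_integral => //.
  - by move=> z _; rewrite lee_fin sqr_ge0.
  - by apply/measurable_EFinP; exact: measurable_symbol.
  - by apply: filterS peak => z zok _; rewrite lee_fin; exact: zok.
by rewrite integral_cst// mul1e probability_le1.
Qed.

(** The variational bound with the constant test function 1. *)
Lemma information_ge0 K (mu : probability (block K NT) R) : (0 <= block_information H W rho mu)%E.
Proof.
have := @information_lower _ _ _ _ _ _ R mu P (@channel_input _ T R NT K)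
  (@channel_output _ T R P NT NR H W rho K) (fun w => erefl) (fun=> 1)
  (measurable_cst _) (fun=> ltr01).
rewrite ln1 Rintegral_cst1; apply; last exact: integrable0.
have e1 : (\int[(mu \x P)%E]_w (1%:E))%E = 1%E.
  by rewrite integral_cst//= mul1e; exact: probability_setT.
under eq_integral do rewrite e1.
by rewrite integral_cst// mul1e probability_le1.
Qed.

Section two_blocks.
Variables (N M : nat) (mu1 : probability (block N NT) R) (mu2 : probability (block M NT) R).
Hypotheses (peak1 : {ae mu1, forall z, peak_constraint z})
  (peak2 : {ae mu2, forall z, peak_constraint z}).
Let mu := cat_law mu1 mu2.
Let r1 := density_ratio_fun mu1 (@transition_density _ _ _ _ _ _ H rho N).
Let r2 := density_ratio_fun mu2 (@transition_density _ _ _ _ _ _ H rho M).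
Let mr1 : measurable_fun setT r1.
Proof.
exact: (measurable_density_ratio mu1 (@measurable_transition_density _ _ _ _ _ _ H rho N)
  (transition_density_gt0 fm nm fn rho0) (transition_density_le fm nm fn rho0)).
Qed.
Let mr2 : measurable_fun setT r2.
Proof.
exact: (measurable_density_ratio mu2 (@measurable_transition_density _ _ _ _ _ _ H rho M)
  (transition_density_gt0 fm nm fn rho0) (transition_density_le fm nm fn rho0)).
Qed.
Let r10 p : 0 < r1 p.
Proof.
exact: (density_ratio_gt0 mu1 (@measurable_transition_density _ _ _ _ _ _ H rho N)
  (transition_density_gt0 fm nm fn rho0) (transition_density_le fm nm fn rho0)).
Qed.
Let r20 p : 0 < r2 p.
Proof.
exact: (density_ratio_gt0 mu2 (@measurable_transition_density _ _ _ _ _ _ H rho M)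
  (transition_density_gt0 fm nm fn rho0) (transition_density_le fm nm fn rho0)).
Qed.

(** Fading is correlated across the two blocks, so this need not be the true density ratio of the
    long block; as a test function it only has to satisfy the normalization [g_total]. *)
Let g (p : block (N + M) NT * block (N + M) NR) : R :=
  r1 (left_block p.1, left_block p.2) * r2 (right_block p.1, right_block p.2).

Let ml n := @measurable_left R n N M.
Let mr n := @measurable_right R n N M.

Let mg1 : measurable_fun setT (fun p : block (N + M) NT * block (N + M) NR =>
  r1 (left_block p.1, left_block p.2)).
Proof.
apply: measurableT_comp => //; apply: measurable_fun_pair.
  exact: (measurableT_comp (@ml _) measurable_fst).
exact: (measurableT_comp (@ml _) measurable_snd).
Qed.

Let mg2 : measurable_fun setT (fun p : block (N + M) NT * block (N + M) NR =>
  r2 (right_block p.1, right_block p.2)).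
Proof.
apply: measurableT_comp => //; apply: measurable_fun_pair.
  exact: (measurableT_comp (@mr _) measurable_fst).
exact: (measurableT_comp (@mr _) measurable_snd).
Qed.

Let mg : measurable_fun setT g. Proof. exact: measurable_funM. Qed.
Let g0 p : 0 < g p. Proof. exact: mulr_gt0. Qed.

(** For a fixed output the two halves of the input are independent under [mu], and each density
    ratio integrates to 1 over its own input. The dependence between the two halves of the output
    does not matter. *)
Let g_total y : (\int[mu]_z (g (z, y))%:E = 1)%E.
Proof.
rewrite /mu /cat_law ge0_integral_distribution//; last 2 first.
- by apply/measurable_EFinP; exact: (measurableT_comp mg (measurable_pair2 y)).
- by move=> z; rewrite lee_fin ltW.
have m1 y' : measurable_fun setT (fun z => r1 (z, y')) by exact: (measurableT_comp mr1 (measurable_pair2 y')).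
have m2 y' : measurable_fun setT (fun z => r2 (z, y')) by exact: (measurableT_comp mr2 (measurable_pair2 y')).
transitivity (\int[(mu1 \x mu2)%E]_p (r1 (p.1, left_block y) * r2 (p.2, right_block y))%:E)%E.
  by apply: eq_integral => p _; rewrite /g /= left_cat right_cat.
rewrite fubini_tonelli1//; last 2 first.
- apply/measurable_EFinP; apply: measurable_funM.
    exact: (measurableT_comp (m1 _) measurable_fst).
  exact: (measurableT_comp (m2 _) measurable_snd).
- by move=> p; rewrite lee_fin mulr_ge0// ltW.
rewrite -(density_ratio_integral mu1 (@measurable_transition_density _ _ _ _ _ _ H rho N)
  (transition_density_gt0 fm nm fn rho0) (transition_density_le fm nm fn rho0) (left_block y)).
apply: eq_integral => z1 _; rewrite /fubini_F /=.
under eq_integral do rewrite EFinM.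
rewrite ge0_integralZl//; last 3 first.
- by apply/measurable_EFinP; exact: m2.
- by move=> z _; rewrite lee_fin (ltW (r20 _)).
- by rewrite lee_fin (ltW (r10 _)).
rewrite (density_ratio_integral mu2 (@measurable_transition_density _ _ _ _ _ _ H rho M)
  (transition_density_gt0 fm nm fn rho0) (transition_density_le fm nm fn rho0) (right_block y)).
by rewrite mule1.
Qed.

Let left_out s (z : block (N + M) NT) t : left_block (out s z t) = out s (left_block z) t.
Proof.
apply/eq_from_tnth => i; apply/eq_from_tnth => l; rewrite !tnth_mktuple /=.
by congr (_ * _ + _); apply: eq_bigr => k _; rewrite tnth_mktuple.
Qed.

Let right_out (z : block (N + M) NT) t : right_block (out 0 z t) = out N (right_block z) t.
Proof.
apply/eq_from_tnth => i; apply/eq_from_tnth => l; rewrite !tnth_mktuple /=.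
by congr (_ * _ + _); apply: eq_bigr => k _; rewrite tnth_mktuple.
Qed.

Let transfer K (mu' : probability (block K NT) R) (pi : block (N + M) NT -> block K NT) s
    (f : block K NT * block K NR -> R) :
  {ae mu', forall z, peak_constraint z} ->
  measurable_fun setT pi -> (forall A, measurable A -> mu (pi @^-1` A) = mu' A) ->
  measurable_fun setT f ->
  (mu' \x P)%E.-integrable setT (fun w => (f (w.1, out 0 w.1 w.2))%:E) ->
  (mu \x P)%E.-integrable setT (fun w => (f (pi w.1, out s (pi w.1) w.2))%:E) /\
  \int[(mu \x P)%E]_w f (pi w.1, out s (pi w.1) w.2) =
  \int[(mu' \x P)%E]_w f (w.1, out 0 w.1 w.2).
Proof.
move=> peak mpi law mf fi.
pose MP : probability _ R := (mu \x P)%E; pose MP' : probability _ R := (mu' \x P)%E.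
have mo s' := @measurable_output_joint _ T R P NT NR H W rho K s'.
have m1 : measurable_fun setT (fun w : block (N + M) NT * T => (pi w.1, out s (pi w.1) w.2)).
  have mp : measurable_fun setT (fun w : block (N + M) NT * T => (pi w.1, w.2)).
    by apply: measurable_fun_pair => //; exact: (measurableT_comp mpi measurable_fst).
  apply: measurable_fun_pair; first exact: (measurableT_comp mpi measurable_fst).
  exact: (measurableT_comp (mo s) mp).
have m2 : measurable_fun setT (fun w : block K NT * T => (w.1, out 0 w.1 w.2)).
  by apply: measurable_fun_pair => //; exact: mo.
have lw := shifted_law fm nm fn rho0 s peak mpi law.
split.
- exact: (@same_law_integrable _ _ _ _ _ MP' MP _ _ _ _ m2 m1 (fun A mA => esym (lw A mA)) f mf fi).
- exact: (@same_law_Rintegral _ _ _ _ _ MP MP' _ _ _ _ m1 m2 lw f mf).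
Qed.

Lemma information_cat : (block_information H W rho mu1 + block_information H W rho mu2 <=
  block_information H W rho mu)%E.
Proof.
have [i1 -> _] := block_information_upper fm nm fn rho0 peak1.
have [i2 -> _] := block_information_upper fm nm fn rho0 peak2.
have ml1 : measurable_fun setT (fun p => ln (r1 p)) by exact: (measurableT_comp (@measurable_ln R) mr1).
have ml2 : measurable_fun setT (fun p => ln (r2 p)) by exact: (measurableT_comp (@measurable_ln R) mr2).
have [j1 e1] := transfer 0 peak1 (@ml NT) (@cat_law_left _ _ _ _ mu1 mu2) ml1 i1.
have [j2 e2] := transfer N peak2 (@mr NT) (@cat_law_right _ _ _ _ mu1 mu2) ml2 i2.
have E w : ln (g (w.1, out 0 w.1 w.2)) =
    ln (r1 (left_block w.1, out 0 (left_block w.1) w.2)) +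
    ln (r2 (right_block w.1, out N (right_block w.1) w.2)).
  by rewrite /g /= left_out right_out lnM ?posrE.
rewrite -EFinD -e1 -e2 -RintegralD//.
have := @information_lower _ _ _ _ _ _ R mu P (@channel_input _ T R NT (N + M))
  (@channel_output _ T R P NT NR H W rho (N + M)) (fun w => erefl) g mg g0.
have h1 : (\int[mu]_z \int[(mu \x P)%E]_w (g (z, out 0 w.1 w.2))%:E <= 1)%E.
  pose MP : probability _ R := (mu \x P)%E.
  have mo := @measurable_output_joint _ T R P NT NR H W rho (N + M) 0.
  (* The order is exchanged to integrate over the independent input first, with the output fixed. *)
  rewrite (@fubini_tonelli _ _ _ _ R mu MP (fun q => (g (q.1, out 0 q.2.1 q.2.2))%:E))//=; last 2 first.
  - apply/measurable_EFinP; apply: measurableT_comp => //; apply: measurable_fun_pair => //.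
    exact: (measurableT_comp mo measurable_snd).
  - by move=> q; rewrite lee_fin ltW.
  under eq_integral do rewrite g_total.
  by rewrite integral_cst// mul1e probability_le1.
have h2 : (mu \x P)%E.-integrable setT (fun w => (ln (g (w.1, out 0 w.1 w.2)))%:E).
  by under eq_fun do rewrite E; exact: integrableDR.
move=> /(_ h1 h2); apply: le_trans; rewrite lee_fin le_eqVlt; apply/orP; left; apply/eqP.
by apply: eq_Rintegral => w _; rewrite -E.
Qed.

End two_blocks.
End superadditivity.

(** * Lower bound for a block *)

Lemma is_derive_expR_opp (R : realType) (t : R) :
  is_derive t 1 (fun t => expR (- t)) (- expR (- t)).
Proof.
have h : is_derive t 1 (fun t : R => - t) (- 1 : R) by apply: is_derive_eq.
have := @is_derive1_comp R (@expR R) (fun t => - t) t _ _ (is_derive_expR _) h.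
by rewrite mulrN1.
Qed.

Section clipping.
Context (R : realType).
Implicit Types a x : R.

(* The test statistic is quadratic in the output, so its exponential need not be
   integrable; truncation costs only a cubic error. *)
Definition clip a : R := Num.max (-1) (Num.min a 1).

Lemma clip_bounds a : -1 <= clip a <= 1.
Proof.
rewrite /clip le_max lexx /= ge_max ge_min lexx orbT andbT.
by rewrite (le_trans (lerN10 R))// ler01.
Qed.

Lemma clip_ge a : a - `|a| ^+ 3 <= clip a.
Proof.
have n3 : 0 <= `|a| ^+ 3 by rewrite exprn_ge0.
rewrite /clip; have [a1|a1] := leP a 1.
  by rewrite le_max; apply/orP; right; lra.
rewrite le_max; apply/orP; right.
have : a <= a ^+ 3 by rewrite ler_eXnr// ltW.
by rewrite gtr0_norm ?(lt_trans ltr01)//; lra.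
Qed.

(** Multiplied by exp(- t), the polynomial has derivative exp(- t) t^2 (5 / 2 - t), nonnegative on
    [0, 1], and it starts from 1. *)
Lemma expR_cubic_ge0 x : 0 <= x <= 1 -> expR x <= 1 + x + x ^+ 2 / 2 + x ^+ 3.
Proof.
move=> /andP[x0 x1]; pose f (t : R) := expR (- t) * (1 + t + t ^+ 2 / 2 + t ^+ 3).
pose df (t : R) := expR (- t) * (t ^+ 2 * (5 / 2 - t)).
have f0 : f 0 = 1 by rewrite /f oppr0 expR0 !expr0n/= mul0r !addr0 mulr1.
have fd (t : R) : 0 <= t <= x -> is_derive t 1 f (df t).
  move=> _; have h := is_derive_expR_opp t; apply: is_derive_eq.
  by rewrite /df /GRing.scale /=; field.
have df0 (t : R) : 0 <= t <= x -> 0 <= df t.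
  move=> /andP[t0 tx]; rewrite mulr_ge0 ?expR_ge0// mulr_ge0 ?sqr_ge0//.
  by have := le_trans tx x1; lra.
have := nonneg_of_derive x0 fd df0; rewrite f0 /f expRN => h.
by move: h; rewrite ler_pdivlMl ?expR_gt0// mulr1.
Qed.

Lemma expR_cubic_opp x : 0 <= x -> expR (- x) <= 1 - x + x ^+ 2 / 2 + x ^+ 3.
Proof.
move=> x0; pose f (t : R) := expR t * (1 - t + t ^+ 2 / 2 + t ^+ 3).
pose df (t : R) := expR t * (t ^+ 2 * (7 / 2 + t)).
have f0 : f 0 = 1 by rewrite /f expR0 subr0 !expr0n/= mul0r !addr0 mulr1.
have fd (t : R) : 0 <= t <= x -> is_derive t 1 f (df t).
  move=> _; apply: is_derive_eq.
  by rewrite /df /GRing.scale /=; field.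
have df0 (t : R) : 0 <= t <= x -> 0 <= df t.
  move=> /andP[t0 tx]; rewrite mulr_ge0 ?expR_ge0// mulr_ge0 ?sqr_ge0//; lra.
have := nonneg_of_derive x0 fd df0; rewrite f0 /f expRN => h.
by rewrite -[leLHS]mulr1 ler_pdivrMl ?expR_gt0.
Qed.

(** On [-1, 1] this is the cubic Taylor bound. Outside, the left side is constant, and powers of |a|
    are at least 1, so the cubic term dominates the linear one. *)
Lemma expR_clip a : expR (clip a) <= 1 + a + a ^+ 2 / 2 + 2 * `|a| ^+ 3.
Proof.
rewrite /clip; have [a1|a1] := leP a 1; last first.
  rewrite max_r ?(le_trans (lerN10 R))// gtr0_norm ?(lt_trans ltr01)//.
  have := @expR_cubic_ge0 1; rewrite ler01 lexx !expr1n => /(_ isT).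
  have : 1 <= a ^+ 3 by rewrite exprn_ege1// ltW.
  have : 1 <= a ^+ 2 by rewrite exprn_ege1// ltW.
  lra.
have [a2|a2] := leP (-1) a; last first.
  have b1 : 1 < - a by rewrite ltrNr.
  rewrite ltr0_norm; last by rewrite -oppr_gt0 (lt_trans ltr01).
  have := @expR_cubic_opp 1 ler01; rewrite !expr1n -[a ^+ 2]sqrrN.
  set b := - a in b1 *; have -> : a = - b by rewrite opprK.
  have : b <= b ^+ 3 by rewrite ler_eXnr// ltW.
  have : 1 <= b ^+ 2 by rewrite exprn_ege1// ltW.
  lra.
have [a0|a0] := leP 0 a.
  rewrite ger0_norm//; have := @expR_cubic_ge0 a; rewrite a0 a1 => /(_ isT).
  have : 0 <= a ^+ 3 by rewrite exprn_ge0.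
  lra.
rewrite ltr0_norm//; have := @expR_cubic_opp (- a); rewrite opprK oppr_ge0 (ltW a0) => /(_ isT).
have : 0 <= (- a) ^+ 3 by rewrite exprn_ge0// oppr_ge0 ltW.
rewrite sqrrN; lra.
Qed.

End clipping.

(** * Random signs and quadratic test statistics *)

Section average_of_points.
Context d (T : measurableType d) (R : realType) (m : nat) (x : nat -> T).

Definition average_weight : {nonneg R} := NngNum (divr_ge0 ler01 (ler0n R m.+1)).

(** The uniform law on x 0, ..., x m, counted with multiplicity; the successor excludes an empty
    average. *)
Definition average : set T -> \bar R :=
  mscale average_weight (msum (fun i => dirac (x i)) m.+1).

HB.instance Definition _ := Measure.on average.

Lemma ge0_integral_average (f : T -> \bar R) : measurable_fun setT f -> (forall y, 0 <= f y)%E ->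
  (\int[average]_y f y = (m.+1%:R^-1)%:E * \sum_(i < m.+1) f (x i))%E.
Proof.
move=> mf f0; rewrite /average ge0_integral_mscale// /average_weight /= div1r; congr (_ * _)%E.
rewrite ge0_integral_measure_sum//; apply: eq_bigr => i _.
by rewrite integral_dirac// diracT mul1e.
Qed.

Let average_setT : average setT = 1%E.
Proof.
transitivity (\int[average]_y 1)%E; first by rewrite integral_cst// mul1e.
rewrite ge0_integral_average//= sumEFin sumr_const card_ord -EFinM mulVf//.
Qed.

HB.instance Definition _ := @Measure_isProbability.Build _ _ R average average_setT.

Lemma Rintegral_average (f : T -> R) : measurable_fun setT f ->
  \int[average]_y f y = m.+1%:R^-1 * \sum_(i < m.+1) f (x i).
Proof.
move=> mf; have mE : measurable_fun setT (fun y => (f y)%:E) by exact/measurable_EFinP.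
rewrite /Rintegral integralE !ge0_integral_average//; last 2 first.
- exact: measurable_funeneg.
- exact: measurable_funepos.
under eq_bigr do rewrite funeposE -[0%E]/(0%:E) -EFin_max.
under [in X in (_ - X)%E]eq_bigr do rewrite funenegE -[0%E]/(0%:E) -EFinN -EFin_max.
rewrite !sumEFin -!EFinM -EFinB /= -mulrBr -sumrB; congr (_ * _).
apply: eq_bigr => i _; have [h|h] := leP 0 (f (x i)).
  by rewrite max_r ?subr0// oppr_le0.
by rewrite max_l ?sub0r ?opprK// oppr_ge0 ltW.
Qed.

Lemma ae_average (Q : T -> Prop) (A : set T) : measurable A -> (forall i, ~ A (x i)) ->
  (forall y, ~ A y -> Q y) -> {ae average, forall y, Q y}.
Proof.
move=> mA xA AQ; exists A; split => //; last by move=> y /= h; apply: contrapT => /AQ.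
have mA1 : measurable_fun setT (fun y => (\1_A y : R)%:E) by exact/measurable_EFinP/measurable_indic.
have -> : average A = (\int[average]_y (\1_A y : R)%:E)%E.
  by rewrite integral_indic// setIT.
rewrite ge0_integral_average//.
have -> : (\sum_(i < m.+1) (\1_A (x i) : R)%:E = 0)%E.
  by apply: big1 => i _; rewrite indicE memNset.
by rewrite mule0.
Qed.

End average_of_points.

Section signs.
Context (R : realType) (N : nat).
Local Notation U := {ffun 'I_N -> bool}.

Definition sign (u : U) (n : 'I_N) : R := (-1) ^+ u n.

Lemma sign_sqr u n : sign u n * sign u n = 1.
Proof. by rewrite /sign -signr_addb addbb. Qed.

Lemma sign_norm u n : `|sign u n| = 1.
Proof. by rewrite /sign normrX normrN1 expr1n. Qed.

(** Flipping the sign at [n] is a bijection of the sign vectors that negates the summand. *)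
Lemma sum_sign_product (n m : 'I_N) : n != m -> \sum_u sign u n * sign u m = 0.
Proof.
move=> nm; pose f (u : U) : U := [ffun i => u i (+) (i == n)].
have ff : involutive f by move=> u; apply/ffunP => i; rewrite !ffunE -addbA addbb addbF.
set s := \sum_u _; suff e : s = - s by apply/eqP; move/eqP: e; rewrite -addr_eq0 -mulr2n mulrn_eq0.
rewrite {1}/s (reindex_inj (inv_inj ff)) /= -sumrN; apply: eq_bigr => u _.
rewrite /sign !ffunE eqxx eq_sym (negbTE nm) addbF -mulNr; congr (_ * _).
by rewrite signr_addb mulrN1.
Qed.

Lemma sum_nth_signs (V : nmodType) (F : U -> V) :
  \sum_(i < #|{: U}|.-1.+1) F (nth [ffun=> false] (enum {: U}) i) = \sum_u F u.
Proof.
have c0 : (0 < #|{: U}|)%N by apply/card_gt0P; exists [ffun=> false].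
rewrite prednK// -[in RHS]big_enum /= (big_nth [ffun=> false]) -cardE big_mkord.
by [].
Qed.

End signs.

Lemma ler_norm_Re (R : realType) (x : R[i]) : `|complex.Re x| <= normc x.
Proof.
rewrite -(@ler_pXn2r _ 2)// ?nnegrE ?normc_ge0// sqr_normcE real_normK ?num_real//.
by rewrite lerDl sqr_ge0.
Qed.

Section phase_rotation.
Context d (T : measurableType d) (R : realType) (P : probability T R) (NR : nat).
Variable W : 'I_NR -> nat -> {RV P >-> R[i]}.
Hypothesis nm : noise_model W.
Variables (D : nat) (e : 'I_D -> 'I_NR * nat).
Hypothesis einj : injective e.

Definition phase (om : 'I_D -> R[i]) (v : D.-tuple R[i]) : D.-tuple R[i] :=
  [tuple om a * tnth v a | a < D].

Lemma measurable_phase om : measurable_fun setT (phase om).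
Proof.
apply/measurable_fun_tnthP => a.
rewrite (_ : _ \o _ = fun v : D.-tuple R[i] => om a * tnth v a); last first.
  by apply/funext => v /=; rewrite tnth_mktuple.
by apply: measurable_complexM => //; exact: measurable_tnth.
Qed.

(** Unimodular factors do not change the norm of a frequency, hence neither the transform nor the
    law. The second moments below are found from this symmetry with the factors -1 and ['i]. *)
Lemma noise_phase (om : 'I_D -> R[i]) (f : D.-tuple R[i] -> R) :
  (forall a, normc (om a) = 1) -> measurable_fun setT f ->
  \int[P]_t f (phase om (noise_block W e t)) = \int[P]_t f (noise_block W e t).
Proof.
move=> om1 mf; have mW := measurable_noise_block W e.
have mpW := measurableT_comp (measurable_phase om) mW.
apply: (@same_law_Rintegral _ _ _ _ _ P P _ _ _ _ mpW mW) => //.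
have char := noise_charfun (fun c g th => noise_weighted_charfun nm einj (c := c) g th).
apply: (same_charfun_same_law mpW mW) => g th; rewrite char.
transitivity (\int[P]_t cos (real_form (fun a => g a * om a) (noise_block W e t) + th)).
  apply: eq_Rintegral => t _; congr (cos (complex.Re _ + _)).
  by apply: eq_bigr => a _; rewrite tnth_mktuple mulrA.
have -> : \sum_i normc (g i) ^+ 2 = \sum_i normc (g i * om i) ^+ 2.
  by apply: eq_bigr => a _; rewrite normcM_sqr om1 expr1n mulr1.
exact: char.
Qed.

End phase_rotation.

Section quadratic_form.
Context (R : realType) (D : nat) (tau : 'I_D -> nat) (pr : pred ('I_D * 'I_D)).
Hypothesis pr_lt : forall p, pr p -> (tau p.2 < tau p.1)%N.
Implicit Types (c : 'I_D * 'I_D -> R[i]) (v w : D.-tuple R[i]).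

Definition quad_term c (p : 'I_D * 'I_D) v : R :=
  complex.Re (c p * (tnth v p.1 * (tnth v p.2)^*%C)).

(** By [pr_lt] no squared modulus occurs and a pair never occurs together with its transpose; this
    makes the terms orthogonal under noise. *)
Definition quad_form c v : R := \sum_(p | pr p) quad_term c p v.

Definition quad_size c : R := \sum_(p | pr p) normc (c p).

Lemma measurable_quad_term c p : measurable_fun setT (quad_term c p).
Proof.
apply: measurableT_comp; first exact: measurable_Re.
apply: measurable_complexM => //; apply: measurable_complexM; first exact: measurable_tnth.
by apply: measurable_conjc; exact: measurable_tnth.
Qed.

Lemma quad_form_le c v (G : R) : (forall a, normc (tnth v a) <= G) ->
  `|quad_form c v| <= quad_size c * G ^+ 2.
Proof.
move=> vG; apply: (le_trans (ler_norm_sum _ _ _)); rewrite /quad_size mulr_suml.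
apply: ler_sum => p _; apply: (le_trans (ler_norm_Re _)).
rewrite !ComplexField.Normc.normcM normc_conj ler_wpM2l ?normc_ge0//.
by rewrite expr2 ler_pM ?normc_ge0.
Qed.

Lemma quad_formB_le c v w (G eps : R) : (forall a, normc (tnth v a) <= G) ->
  (forall a, normc (tnth w a) <= G) ->
  (forall a, normc (tnth v a - tnth w a) <= eps * G) ->
  `|quad_form c v - quad_form c w| <= 2 * eps * (quad_size c * G ^+ 2).
Proof.
move=> vG wG vwG; rewrite /quad_form -sumrB /quad_size mulr_suml mulr_sumr.
apply: (le_trans (ler_norm_sum _ _ _)); apply: ler_sum => p _.
have ReB (x y : R[i]) : complex.Re x - complex.Re y = complex.Re (x - y).
  by case: x y => [? ?] [].
rewrite /quad_term ReB -mulrBr.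
set x1 := tnth v p.1; set x2 := tnth v p.2; set y1 := tnth w p.1; set y2 := tnth w p.2.
have -> : x1 * x2^*%C - y1 * y2^*%C = (x1 - y1) * x2^*%C + y1 * (x2 - y2)^*%C.
  by rewrite -!conjcE rmorphB; ring.
apply: (le_trans (ler_norm_Re _)); rewrite ComplexField.Normc.normcM.
rewrite mulrCA ler_wpM2l ?normc_ge0//.
apply: (le_trans (@le_normcD R _ _)); rewrite !ComplexField.Normc.normcM !normc_conj.
have -> : 2 * eps * G ^+ 2 = eps * G * G + G * (eps * G) by ring.
apply: lerD.
  exact: ler_pM (normc_ge0 _) (normc_ge0 _) (vwG _) (vG _).
exact: ler_pM (normc_ge0 _) (normc_ge0 _) (wG _) (vwG _).
Qed.

Lemma quad_form_sqrB_le c v w (G eps : R) : (forall a, normc (tnth v a) <= G) ->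
  (forall a, normc (tnth w a) <= G) ->
  (forall a, normc (tnth v a - tnth w a) <= eps * G) ->
  `|quad_form c v ^+ 2 - quad_form c w ^+ 2| <= 4 * eps * (quad_size c ^+ 2 * G ^+ 4).
Proof.
move=> vG wG vwG; rewrite subr_sqr normrM.
have h1 := quad_formB_le c vG wG vwG.
have h2 : `|quad_form c v + quad_form c w| <= 2 * (quad_size c * G ^+ 2).
  apply: (le_trans (ler_normD _ _)); rewrite mulr2n mulrDl mul1r.
  by apply: lerD; exact: quad_form_le.
have := ler_pM (normr_ge0 _) (normr_ge0 _) h1 h2; move=> /le_trans; apply.
by rewrite le_eqVlt; apply/orP; left; apply/eqP; ring.
Qed.

Section moments.
Context d (T : measurableType d) (P : probability T R).

Lemma quad_term_moments c p (Y : T -> D.-tuple R[i]) :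
  (forall a, complex_moments P (fun t => tnth (Y t) a)) ->
  all_moments P (fun t => quad_term c p (Y t)).
Proof.
move=> Ym; have h : complex_moments P (fun t => c p * (tnth (Y t) p.1 * (tnth (Y t) p.2)^*%C)).
  apply: complex_momentsM; first exact: complex_moments_cst.
  by apply: complex_momentsM => //; exact: complex_moments_conj.
exact: h.1.
Qed.

Lemma quad_form_moments c (Y : T -> D.-tuple R[i]) :
  (forall a, complex_moments P (fun t => tnth (Y t) a)) ->
  all_moments P (fun t => quad_form c (Y t)).
Proof. by move=> Ym; apply: all_moments_sum => p _; exact: quad_term_moments. Qed.

Lemma quad_form_mean c (Y : T -> D.-tuple R[i]) :
  (forall a, complex_moments P (fun t => tnth (Y t) a)) ->
  \int[P]_t quad_form c (Y t) = \sum_(p | pr p) complex.Re (c p *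
    complex_expectation P (fun t => tnth (Y t) p.1 * (tnth (Y t) p.2)^*%C)).
Proof.
move=> Ym; rewrite Rintegral_sum; last first.
  by move=> p _; apply/all_moments_integrable; exact: quad_term_moments.
apply: eq_bigr => p _; rewrite -complex_expectationZ ?complex_expectationE//.
by apply: complex_momentsM => //; exact: complex_moments_conj.
Qed.

Variables (NR : nat) (W : 'I_NR -> nat -> {RV P >-> R[i]}) (e : 'I_D -> 'I_NR * nat).
Hypotheses (nm : noise_model W) (einj : injective e).
Local Notation w := (noise_block W e).

Let wm a : complex_moments P (fun t => tnth (w t) a).
Proof.
rewrite (_ : (fun t => _) = W (e a).1 (e a).2); first exact: noise_moments.
by apply/funext => t; rewrite tnth_mktuple.
Qed.

Let qm c p : all_moments P (fun t => quad_term c p (w t)).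
Proof. exact: quad_term_moments. Qed.

Let flip b : 'I_D -> R[i] := fun a => if a == b then -1 else 1.

Let flip1 b a : normc (flip b a) = 1.
Proof.
rewrite /flip; case: ifP => _; last exact: ComplexField.Normc.normc1.
by rewrite (@normcN R) ComplexField.Normc.normc1.
Qed.

Let quad_flip c b p v : quad_term c p (phase (flip b) v) =
  (-1) ^+ ((p.1 == b) + (p.2 == b)) * quad_term c p v.
Proof.
rewrite /quad_term !tnth_mktuple /flip.
by do 2 case: ifP => _; rewrite /= ?(expr0, expr1, sqrr_sign, addn0, add0n, mul1r, mulN1r, rmorphN)//=
  ?conjcN ?mulNr ?mulrN ?opprK ?mul1r ?sqrrN ?expr1n ?mulN1r ?mul1r//=; case: (c p * _).
Qed.

(* If p <> p', some coordinate occurs exactly once among p.1, p.2, p'.1, p'.2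
   and changing its sign changes the sign of the product. *)
Lemma noise_quad_orthogonal c p p' : pr p -> pr p' -> p != p' ->
  \int[P]_t (quad_term c p (w t) * quad_term c p' (w t)) = 0.
Proof.
move=> hp hp' ne.
have [b bodd] : exists b, odd ((p.1 == b) + (p.2 == b) + ((p'.1 == b) + (p'.2 == b))).
  have lt1 := pr_lt hp; have lt2 := pr_lt hp'.
  case: p p' ne lt1 lt2 {hp hp'} => [a b] [a' b'] /=; rewrite xpair_eqE => ne l1 l2.
  have nab : (a == b) = false by apply/negP => /eqP h; rewrite h ltnn in l1.
  have nab' : (a' == b') = false by apply/negP => /eqP h; rewrite h ltnn in l2.
  have [eaa|naa] := eqVneq a a'.
    exists b; rewrite eaa eqxx /= in ne nab nab' l1 *.
    by rewrite nab eqxx eq_sym (negbTE ne).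
  have [eab|nab2] := eqVneq a b'.
    exists a'; rewrite (negbTE naa) eqxx (eq_sym b') nab'.
    (* Otherwise the second pair would be the first one reversed, against the two strict
       inequalities. *)
    suff /negbTE -> : b != a' by [].
    by apply/eqP => h; rewrite -h -eab in l2; have := ltn_trans l1 l2; rewrite ltnn.
  by exists a; rewrite eqxx (eq_sym b) nab (eq_sym a') (negbTE naa) (eq_sym b') (negbTE nab2).
have mf : measurable_fun setT (fun v => quad_term c p v * quad_term c p' v).
  by apply: measurable_funM; exact: measurable_quad_term.
have h := noise_phase nm einj (flip1 b) mf.
have e1 : \int[P]_t (quad_term c p (phase (flip b) (w t)) * quad_term c p' (phase (flip b) (w t))) =
    - \int[P]_t (quad_term c p (w t) * quad_term c p' (w t)).
  rewrite -mulN1r -RintegralZl//; last exact/all_moments_integrable/all_momentsM.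
  apply: eq_Rintegral => t _; rewrite !quad_flip mulrACA -exprD.
  by rewrite -signr_odd bodd expr1.
by move: h; rewrite e1 => /eqP; rewrite eq_sym -addr_eq0 -mulr2n mulrn_eq0 => /eqP.
Qed.

Let noise_fourth a b : a != b ->
  \int[P]_t (normc (tnth (w t) a) ^+ 2 * normc (tnth (w t) b) ^+ 2) = 1.
Proof.
move=> ab.
have ma i : measurable_fun setT (fun t => normc (tnth (w t) i)).
  by have := complex_moments_normc (wm i) => -[].
have W2 i : all_moments P (fun t => normc (tnth (w t) i) ^+ 2) by exact: complex_moments_normc2.
have e1 i : \int[P]_t (normc (tnth (w t) i) ^+ 2) = 1.
  rewrite -[RHS](noise_second nm (e i).1 (e i).2).
  by apply: eq_Rintegral => t _; rewrite tnth_mktuple.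
have -> := @indep_pair _ _ _ P _ _ _ _ (fun t => tnth (w t) a) (fun t => tnth (w t) b)
  (fun x => normc x ^+ 2) (fun x => normc x ^+ 2)
  (complex_moments_measurable (wm a)) (complex_moments_measurable (wm b))
  _ (@measurable_normc2 R) (@measurable_normc2 R)
  (all_moments_integrable (W2 a)) (all_moments_integrable (W2 b)); last 1 first.
- exact/all_moments_integrable/all_momentsM.
- by rewrite !e1 mulr1.
move=> A B mA mB.
have neab : (e a) != (e b) by apply: contra ab => /eqP/einj ->.
have := noise_indep nm (s := [:: e a; e b])
  (A := fun i => if i == e a then W (e a).1 (e a).2 @^-1` A else W (e b).1 (e b).2 @^-1` B).
rewrite /= !big_cons !big_nil eqxx eq_sym (negbTE neab) setIT mule1.
have wE i : (fun t => tnth (w t) i) = W (e i).1 (e i).2.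
  by apply/funext => t; rewrite tnth_mktuple.
rewrite !wE; apply=> //; first by rewrite inE neab.
move=> i; rewrite !inE => /orP[] /eqP ->.
  rewrite eqxx; apply: sigma_of_preimage mA.
  exact: (sigma_of_coord (X := fun _ : unit => W (e a).1 (e a).2) tt).
rewrite eq_sym (negbTE neab); apply: sigma_of_preimage mB.
exact: (sigma_of_coord (X := fun _ : unit => W (e b).1 (e b).2) tt).
Qed.

(* Multiplying the coordinate p.1 by 'i exchanges the squares of the real and
   imaginary parts, so each has half of the mean of the squared modulus. *)
Lemma noise_quad_sqr c p : pr p ->
  \int[P]_t (quad_term c p (w t) ^+ 2) = normc (c p) ^+ 2 / 2.
Proof.
move=> hp; have ne : p.1 != p.2 by apply/eqP => h; have := pr_lt hp; rewrite h ltnn.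
pose om a : R[i] := if a == p.1 then 'i else 1.
have om1 a : normc (om a) = 1.
  rewrite /om; case: ifP => _; last exact: ComplexField.Normc.normc1.
  by rewrite /= expr0n/= add0r expr1n sqrtr1.
pose f v := complex.Im (c p * (tnth v p.1 * (tnth v p.2)^*%C)).
have fm : all_moments P (fun t => f (w t)).
  have h : complex_moments P (fun t => c p * (tnth (w t) p.1 * (tnth (w t) p.2)^*%C)).
    apply: complex_momentsM; first exact: complex_moments_cst.
    by apply: complex_momentsM => //; exact: complex_moments_conj.
  exact: h.2.
have mf : measurable_fun setT (fun v => quad_term c p v ^+ 2).
  by apply: measurable_funX; exact: measurable_quad_term.
have e1 : \int[P]_t (f (w t) ^+ 2) = \int[P]_t (quad_term c p (w t) ^+ 2).
  rewrite -(noise_phase nm einj om1 mf); apply: eq_Rintegral => t _.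
  rewrite /quad_term /f !tnth_mktuple /om eqxx eq_sym (negbTE ne) mul1r.
  set y := W _ _ t; set z := (W _ _ t)^*%C; set x := c p * (y * z).
  have -> : c p * ('i * y * z) = 'i * x by rewrite /x; ring.
  by case: x => x1 x2 /=; rewrite mul0r mul1r sub0r sqrrN.
have e2 : \int[P]_t (quad_term c p (w t) ^+ 2) + \int[P]_t (f (w t) ^+ 2) = normc (c p) ^+ 2.
  rewrite -RintegralD//; last 2 first.
  - exact/all_moments_integrable/all_momentsX.
  - exact/all_moments_integrable/all_momentsX.
  rewrite -[RHS]mulr1 -(noise_fourth ne) -RintegralZl//; last first.
    by apply/all_moments_integrable/all_momentsM; exact: complex_moments_normc2.
  apply: eq_Rintegral => t _; rewrite /quad_term /f -sqr_normcE !normcM_sqr normc_conj.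
  by [].
by rewrite -e2 e1; field.
Qed.

Lemma noise_quad_form_sqr c :
  \int[P]_t (quad_form c (w t) ^+ 2) = (\sum_(p | pr p) normc (c p) ^+ 2) / 2.
Proof.
transitivity (\int[P]_t \sum_(p | pr p) \sum_(p' | pr p')
    (quad_term c p (w t) * quad_term c p' (w t))).
  apply: eq_Rintegral => t _; rewrite expr2 /quad_form mulr_suml.
  by apply: eq_bigr => p _; rewrite mulr_sumr.
have qq p p' : P.-integrable setT (fun t => (quad_term c p (w t) * quad_term c p' (w t))%:E).
  exact/all_moments_integrable/all_momentsM.
rewrite Rintegral_sum; last by move=> p _; apply: integrable_sumR => p' _.
rewrite mulr_suml; apply: eq_bigr => p hp; rewrite Rintegral_sum//.
rewrite (bigD1 p)//= big1 ?addr0 => [|p' /andP[hp' ne]].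
  by rewrite -noise_quad_sqr//; apply: eq_Rintegral => t _; rewrite expr2.
by apply: noise_quad_orthogonal; rewrite // eq_sym.
Qed.

End moments.
End quadratic_form.

Section antipodal_signalling.
Context d (T : measurableType d) (R : realType) (P : probability T R) (NT NR : nat).
Variables (H : 'I_NT -> 'I_NR -> int -> {RV P >-> R[i]}).
Variables (W : 'I_NR -> nat -> {RV P >-> R[i]}).
Hypotheses (fm : fading_model H) (nm : noise_model W) (fn : fading_noise_independent H W).
Variables (k0 : 'I_NT) (N : nat).
Local Notation block n := (N.-tuple (n.-tuple R[i])).
Local Notation D := #|{: 'I_N * 'I_NR}|.
Local Notation U := {ffun 'I_N -> bool}.
Implicit Types (u : U) (s : 'I_N -> R) (v : D.-tuple R[i]) (p : 'I_D * 'I_D).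

Definition sign_block u : block NT := [tuple [tuple (sign R u n)%:C | k < NT] | n < N].

Lemma tnth_sign_block u n k : tnth (tnth (sign_block u) n) k = (sign R u n)%:C.
Proof. by rewrite !tnth_mktuple. Qed.

Lemma sign_block_peak u : peak_constraint (sign_block u).
Proof.
move=> n k; rewrite tnth_sign_block sqr_normcE /= expr0n addr0 -(@real_normK _ (sign R u n)) ?num_real//.
by rewrite sign_norm expr1n.
Qed.

Definition antenna_cov (l : 'I_NR) (j : int) : R[i] :=
  \sum_(k < NT) autocorrelation P (H k l) j.

Definition earlier p : bool :=
  (antenna_of p.1 == antenna_of p.2) && (time_of p.2 < time_of p.1)%N.

Lemma earlier_lt p : earlier p -> (time_of p.2 < time_of p.1)%N.
Proof. by case/andP. Qed.

Definition pair_cov p : R[i] :=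
  antenna_cov (antenna_of p.1) ((time_of p.1)%:Z - (time_of p.2)%:Z).

(** With c in place of 2, a pair of covariance R contributes rho c |R|^2 to the mean and c^2 |R|^2 /
    2 to the second moment under noise, hence rho^2 (c - c^2 / 4) |R|^2 to the leading term of the
    bound. This is largest at c = 2. *)
Definition test_coef s p : R[i] :=
  (2 * (s (time_of p.1) * s (time_of p.2)))%:C * (pair_cov p)^*%C.

Definition test_form s v : R := quad_form earlier (test_coef s) v.

Lemma test_formE s v : test_form s v = \sum_(p | earlier p)
  s (time_of p.1) * s (time_of p.2) * quad_term (test_coef (fun=> 1)) p v.
Proof.
apply: eq_bigr => p _; rewrite /quad_term /test_coef !mulr1.
rewrite -[X in complex.Re X]mulrA -[X in _ = _ * complex.Re X]mulrA.
by case: ((pair_cov p)^*%C * _) => y1 y2 /=; ring.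
Qed.

Definition test_energy : R := \sum_(p | earlier p) 2 * normc (pair_cov p) ^+ 2.

Definition test_size : R := \sum_(p | earlier p) 2 * normc (pair_cov p).

Let normc_coef u p : normc (test_coef (sign R u) p) = 2 * normc (pair_cov p).
Proof.
rewrite /test_coef ComplexField.Normc.normcM normc_conj; congr (_ * _).
rewrite /= expr0n addr0 sqrtr_sqr !normrM !sign_norm !mulr1 ger0_norm//.
Qed.

Lemma quad_size_test u : quad_size earlier (test_coef (sign R u)) = test_size.
Proof. by apply: eq_bigr => p _; rewrite normc_coef. Qed.

Let size0 : 0 <= test_size.
Proof. by apply: sumr_ge0 => p _; rewrite mulr_ge0 ?normc_ge0. Qed.

(** Holds for every received vector: the tested signs are independent of the output under the
    product of the marginals, and products of two different signs average to 0. This is why the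
    linear term disappears there. *)
Lemma sum_test_form v : \sum_u test_form (sign R u) v = 0.
Proof.
under eq_bigr do rewrite test_formE.
rewrite exchange_big big1//= => p hp; rewrite -mulr_suml sum_sign_product ?mul0r//.
by apply/eqP => h; have := earlier_lt hp; rewrite h ltnn.
Qed.

(* Dominates every coordinate of the output and of the noise for rho <= 1; their
   difference is at most sqrt rho times the envelope. *)
Definition envelope (t : T) : R := 1 + \sum_(a < D)
  (\sum_(k < NT) normc (H k (antenna_of a) (0 + time_of a).+1%:Z t) +
   normc (tnth (noise_block W (noise_index 0) t) a)).

Let wm (a : 'I_D) : complex_moments P (fun t => tnth (noise_block W (noise_index 0) t) a).
Proof.
rewrite (_ : (fun t => _) = W (noise_index 0 a).1 (noise_index 0 a).2); first exact: noise_moments.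
by apply/funext => t; rewrite tnth_mktuple.
Qed.

Lemma envelope_moments : all_moments P envelope.
Proof.
apply: all_momentsD; first exact: all_moments_cst.
apply: all_moments_sum => a _; apply: all_momentsD; last exact: complex_moments_normc.
by apply: all_moments_sum => k _; apply: complex_moments_normc; exact: fading_moments.
Qed.

Let envelope_ge0 t : 0 <= envelope t.
Proof.
by rewrite addr_ge0// sumr_ge0// => a _; rewrite addr_ge0 ?normc_ge0// sumr_ge0// => k _; rewrite normc_ge0.
Qed.

Let envelope_entry t (a : 'I_D) :
  \sum_(k < NT) normc (H k (antenna_of a) (0 + time_of a).+1%:Z t) +
   normc (tnth (noise_block W (noise_index 0) t) a) <= envelope t.
Proof.
rewrite /envelope (bigD1 a)//= addrCA lerDl addr_ge0// sumr_ge0// => b _.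
by rewrite addr_ge0 ?normc_ge0// sumr_ge0// => k _; rewrite normc_ge0.
Qed.

(** Free of [rho], as is [third_moment_bound]; the errors are therefore of order rho^2 sqrt rho and
    rho^3. *)
Definition deviation_rate : R := 4 * (test_size ^+ 2 * \int[P]_t (envelope t ^+ 4)).

Definition third_moment_bound : R := test_size ^+ 3 * \int[P]_t (envelope t ^+ 6).

Section received.
Variable rho : R.
Hypothesis rho01 : 0 <= rho <= 1.
Let rho0 : 0 <= rho. Proof. by case/andP: rho01. Qed.
Let sqrt_rho1 : Num.sqrt rho <= 1.
Proof. by rewrite -sqrtr1 ler_wsqrtr//; case/andP: rho01. Qed.

Local Notation received u t := (flat (output H W rho 0 (sign_block u) t)).
Local Notation noise t := (noise_block W (noise_index 0) t : D.-tuple R[i]).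

Let received_moments u a : complex_moments P (fun t => tnth (received u t) a).
Proof. exact: output_moments. Qed.

Let signal_le u a t : normc (signal H 0 (sign_block u) a t) <=
  \sum_(k < NT) normc (H k (antenna_of a) (0 + time_of a).+1%:Z t).
Proof.
rewrite /signal; elim/big_ind2 : _ => [|x x' y y' h1 h2|k _].
- by rewrite ComplexField.Normc.normc0.
- by apply: (le_trans (@le_normcD R _ _)); exact: lerD.
- rewrite ComplexField.Normc.normcM tnth_sign_block /= expr0n addr0 sqrtr_sqr sign_norm.
  by rewrite mulr1.
Qed.

Let norm_sqrt (x : R[i]) : normc ((Num.sqrt rho)%:C * x) = Num.sqrt rho * normc x.
Proof.
by rewrite ComplexField.Normc.normcM /= expr0n addr0 sqrtr_sqr ger0_norm// sqrtr_ge0.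
Qed.

Let signal_envelope u a t : normc (signal H 0 (sign_block u) a t) <= envelope t.
Proof.
apply: (le_trans (signal_le u a t)); apply: (le_trans _ (envelope_entry t a)).
by rewrite lerDl normc_ge0.
Qed.

Let noise_envelope (a : 'I_D) t : normc (tnth (noise t) a) <= envelope t.
Proof.
apply: (le_trans _ (envelope_entry t a)); rewrite lerDr.
by rewrite sumr_ge0// => k _; rewrite normc_ge0.
Qed.

Let received_envelope u a t : normc (tnth (received u t) a) <= envelope t.
Proof.
rewrite flat_output; apply: (le_trans (@le_normcD R _ _)).
apply: (le_trans _ (envelope_entry t a)); rewrite lerD2r norm_sqrt.
apply: (le_trans _ (signal_le u a t)).
by rewrite ler_piMl ?normc_ge0.
Qed.

Let received_noise u a t : normc (tnth (received u t) a - tnth (noise t) a) <=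
  Num.sqrt rho * envelope t.
Proof.
rewrite flat_output addrK norm_sqrt ler_wpM2l ?sqrtr_ge0//.
Qed.

Lemma test_form_moments u u' : all_moments P (fun t => test_form (sign R u) (received u' t)).
Proof. exact: quad_form_moments. Qed.

Lemma test_form_mean u : \int[P]_t test_form (sign R u) (received u t) = rho * test_energy.
Proof.
rewrite quad_form_mean// /test_energy mulr_sumr; apply: eq_bigr => p hp.
rewrite (output_second fm nm fn rho0) mxE.
have /negbTE -> : p.1 != p.2.
  by apply/eqP => h; have := earlier_lt hp; rewrite h ltnn.
rewrite add0r /signal_cov; case/andP: hp => -> _.
have -> : \sum_k autocorrelation P (H k (antenna_of p.1)) ((time_of p.1)%:Z - (time_of p.2)%:Z) *
    (tnth (tnth (sign_block u) (time_of p.1)) k *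
     (tnth (tnth (sign_block u) (time_of p.2)) k)^*%C) =
    pair_cov p * (sign R u (time_of p.1) * sign R u (time_of p.2))%:C.
  rewrite /pair_cov /antenna_cov mulr_suml; apply: eq_bigr => k _.
  by rewrite !tnth_sign_block conjc_real rmorphM.
rewrite /test_coef; set a := sign R u _; set b := sign R u _.
have -> : (2 * (a * b))%:C * (pair_cov p)^*%C * (rho%:C * (pair_cov p * (a * b)%:C)) =
    (2 * rho * ((a * a) * (b * b)))%:C * ((pair_cov p)^*%C * pair_cov p).
  by rewrite !rmorphM; ring.
rewrite /a /b !sign_sqr !mulr1 conj_mulc -rmorphM /=; ring.
Qed.

Let noise_test_sqr u : \int[P]_t (test_form (sign R u) (noise t) ^+ 2) = test_energy.
Proof.
rewrite (@noise_quad_form_sqr _ _ (fun a => time_of a) _ earlier_lt _ _ _ _ _ _ nm (@noise_index_inj NR N 0)).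
by rewrite mulr_suml; apply: eq_bigr => p _; rewrite normc_coef; field.
Qed.

(** [u'] is the block sent and [u] the one tested; they differ because the product of the marginals
    decouples them. Replacing the output by pure noise, where the second moment is known, costs a
    multiple of sqrt rho. *)
Lemma test_form_second u u' : \int[P]_t (test_form (sign R u) (received u' t) ^+ 2) <=
  test_energy + deviation_rate * Num.sqrt rho.
Proof.
have nm2 : all_moments P (fun t => test_form (sign R u) (noise t) ^+ 2).
  by apply: all_momentsX; exact: quad_form_moments.
have G4 := all_momentsX 4 envelope_moments.
have rm2 := all_momentsX 2 (test_form_moments u u').
rewrite -(noise_test_sqr u).
have -> : deviation_rate * Num.sqrt rho =
    \int[P]_t ((4 * Num.sqrt rho * test_size ^+ 2) * envelope t ^+ 4).
  by rewrite RintegralZl//; [rewrite /deviation_rate; ring|exact: all_moments_integrable].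
have cG4 : all_moments P (fun t => (4 * Num.sqrt rho * test_size ^+ 2) * envelope t ^+ 4).
  by apply: all_momentsM => //; exact: all_moments_cst.
rewrite -RintegralD//; last 2 first.
- exact: all_moments_integrable.
- exact: all_moments_integrable.
apply: le_Rintegral => //.
- exact: all_moments_integrable.
- by apply: all_moments_integrable; exact: all_momentsD.
move=> t _; rewrite -lerBlDl; apply: (le_trans (ler_norm _)).
have := @quad_form_sqrB_le R D earlier (test_coef (sign R u)) (received u' t) (noise t) (envelope t)
  (Num.sqrt rho) (fun a => received_envelope u' a t) (fun a => noise_envelope a t)
  (fun a => received_noise u' a t).
by rewrite quad_size_test mulrA.
Qed.

Lemma test_form_third u u' : \int[P]_t (`|test_form (sign R u) (received u' t)| ^+ 3) <=
  third_moment_bound.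
Proof.
have G6 := all_momentsX 6 envelope_moments.
have rm := test_form_moments u u'.
rewrite /third_moment_bound -RintegralZl//; last exact: all_moments_integrable.
apply: le_Rintegral => //.
- exact: rm.2.
- by apply: all_moments_integrable; apply: all_momentsM => //; exact: all_moments_cst.
move=> t _; rewrite (_ : test_size ^+ 3 * envelope t ^+ 6 = (test_size * envelope t ^+ 2) ^+ 3); last by ring.
rewrite lerXn2r ?nnegrE ?normr_ge0 ?mulr_ge0 ?exprn_ge0//.
have := @quad_form_le R D earlier (test_coef (sign R u)) (received u' t) (envelope t)
  (fun a => received_envelope u' a t).
by rewrite quad_size_test.
Qed.

Let scaled u u' t := rho * test_form (sign R u) (received u' t).

Let scaled_moments u u' : all_moments P (scaled u u').
Proof. by apply: all_momentsM; [exact: all_moments_cst|exact: test_form_moments]. Qed.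

Let scaled_abs3 u u' : all_moments P (fun t => `|scaled u u' t| ^+ 3).
Proof.
apply: all_momentsX; have [h1 h2] := scaled_moments u u'.
apply: (all_moments_le _ _ (scaled_moments u u')); first exact: measurableT_comp.
by move=> t; rewrite normr_id.
Qed.

Let scaled_third u u' : \int[P]_t (`|scaled u u' t| ^+ 3) <= rho ^+ 3 * third_moment_bound.
Proof.
have -> : \int[P]_t (`|scaled u u' t| ^+ 3) =
    rho ^+ 3 * \int[P]_t (`|test_form (sign R u) (received u' t)| ^+ 3).
  rewrite -RintegralZl//; last exact: (test_form_moments u u').2.
  by apply: eq_Rintegral => t _; rewrite /scaled normrM exprMn (ger0_norm rho0).
by rewrite ler_wpM2l ?exprn_ge0// test_form_third.
Qed.

Lemma measurable_clip : measurable_fun setT (@clip R).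
Proof.
by apply: measurable_maxr => //; exact: measurable_minr.
Qed.

Let measurable_scaled u u' : measurable_fun setT (scaled u u').
Proof. by have [] := scaled_moments u u'. Qed.

Lemma mean_clip_ge u :
  rho ^+ 2 * test_energy - rho ^+ 3 * third_moment_bound <=
  \int[P]_t clip (rho * test_form (sign R u) (received u t)).
Proof.
have e1 : \int[P]_t scaled u u t = rho ^+ 2 * test_energy.
  rewrite RintegralZl//; last exact/all_moments_integrable/test_form_moments.
  by rewrite test_form_mean; ring.
apply: (@le_trans _ _ (\int[P]_t (scaled u u t - `|scaled u u t| ^+ 3))).
  rewrite RintegralB//; last 2 first.
  - exact: all_moments_integrable.
  - exact: all_moments_integrable.
  by rewrite e1 lerB.
apply: le_Rintegral => //.
- by apply: all_moments_integrable; exact: all_momentsB.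
- apply: (@bounded_integrable _ _ _ P _ 1).
    exact: (measurableT_comp measurable_clip (measurable_scaled u u)).
  by move=> t; rewrite ler_norml; exact: clip_bounds.
- by move=> t _; exact: clip_ge.
Qed.

(** Bounds the mean of the exponentiated statistic under the product of the marginals, the linear
    term having averaged out over the tested signs. Division by it makes [g] an admissible test
    function. *)
Definition test_norm : R := 1 + rho ^+ 2 / 2 * (test_energy + deviation_rate * Num.sqrt rho) +
  2 * (rho ^+ 3 * third_moment_bound).

Let expR_clip_integrable u u' : P.-integrable setT (fun t => (expR (clip (scaled u u' t)))%:E).
Proof.
apply: (@bounded_integrable _ _ _ P _ (expR 1)).
  apply: measurableT_comp => //.
  exact: (measurableT_comp measurable_clip (measurable_scaled u u')).
by move=> t; rewrite ger0_norm ?expR_ge0// ler_expR; case/andP: (clip_bounds (scaled u u' t)).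
Qed.

Lemma mean_expR_clip_le u u' :
  \int[P]_t expR (clip (rho * test_form (sign R u) (received u' t))) <=
  test_norm + rho * \int[P]_t test_form (sign R u) (received u' t).
Proof.
have m2 := all_momentsX 2 (scaled_moments u u').
pose f t := scaled u u' t + (2^-1 * scaled u u' t ^+ 2 + 2 * `|scaled u u' t| ^+ 3).
have i2 : all_moments P (fun t => 2^-1 * scaled u u' t ^+ 2).
  by apply: all_momentsM => //; exact: all_moments_cst.
have i3 : all_moments P (fun t => 2 * `|scaled u u' t| ^+ 3).
  by apply: all_momentsM => //; exact: all_moments_cst.
have fm' : all_moments P f by apply: all_momentsD => //; exact: all_momentsD.
apply: (@le_trans _ _ (\int[P]_t (1 + f t))).
  apply: le_Rintegral => //; first exact: expR_clip_integrable.
  - by apply: all_moments_integrable; apply: all_momentsD => //; exact: all_moments_cst.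
  - move=> t _; apply: (le_trans (expR_clip _)); rewrite le_eqVlt; apply/orP; left; apply/eqP.
    rewrite /f /scaled; ring.
rewrite RintegralD//; last 2 first.
- exact/all_moments_integrable/all_moments_cst.
- exact: all_moments_integrable.
rewrite Rintegral_cst1 /f RintegralD//; last 2 first.
- exact: all_moments_integrable.
- by apply: all_moments_integrable; exact: all_momentsD.
rewrite RintegralD//; last 2 first.
- exact: all_moments_integrable.
- exact: all_moments_integrable.
rewrite !RintegralZl//; last 3 first.
- exact: all_moments_integrable.
- exact: all_moments_integrable.
- exact/all_moments_integrable/test_form_moments.
have -> : \int[P]_t (scaled u u' t ^+ 2) =
    rho ^+ 2 * \int[P]_t (test_form (sign R u) (received u' t) ^+ 2).
  rewrite -RintegralZl//; last exact/all_moments_integrable/all_momentsX/test_form_moments.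
  by apply: eq_Rintegral => t _; rewrite /scaled exprMn.
have h2 := ler_wpM2l (exprn_ge0 2 rho0) (test_form_second u u').
have h3 := scaled_third u u'.
rewrite /test_norm; lra.
Qed.

Lemma sum_mean_test_form u' :
  \sum_u \int[P]_t test_form (sign R u) (received u' t) = 0.
Proof.
rewrite -Rintegral_sum; last by move=> u _; exact/all_moments_integrable/test_form_moments.
by under eq_Rintegral do rewrite sum_test_form; rewrite Rintegral_cst1.
Qed.

Lemma test_norm_ge1 : 1 <= test_norm.
Proof.
have e0 : 0 <= test_energy by apply: sumr_ge0 => p _; rewrite mulr_ge0 ?exprn_ge0 ?normc_ge0.
have d0 : 0 <= deviation_rate.
  rewrite mulr_ge0// mulr_ge0 ?sqr_ge0// Rintegral_ge0// => t _.
  by rewrite exprn_ge0.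
have t0 : 0 <= third_moment_bound.
  by rewrite mulr_ge0 ?exprn_ge0// Rintegral_ge0// => t _; rewrite exprn_ge0.
rewrite /test_norm -addrA lerDl; apply: addr_ge0; apply: mulr_ge0 => //.
- by rewrite divr_ge0// exprn_ge0.
- by apply: addr_ge0 => //; apply: mulr_ge0 => //; exact: sqrtr_ge0.
- by apply: mulr_ge0 => //; exact: exprn_ge0.
Qed.

Let norm_gt0 : 0 < test_norm. Proof. exact: lt_le_trans ltr01 test_norm_ge1. Qed.

Let points (i : nat) : block NT := sign_block (nth [ffun=> false] (enum {: U}) i).
Let m := #|{: U}|.-1.

Definition antipodal_law : probability (block NT) R := average R m points.

Lemma antipodal_peak : {ae antipodal_law, forall z, peak_constraint z}.
Proof.
pose A := ~` \bigcap_(n in [set: 'I_N]) \bigcap_(k in [set: 'I_NT])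
  [set z : block NT | normc (tnth (tnth z n) k) ^+ 2 <= 1].
have mA : measurable A.
  apply: measurableC; apply: fin_bigcap_measurable => [|n _]; first exact: finite_finset.
  apply: fin_bigcap_measurable => [|k _]; first exact: finite_finset.
  have mf : measurable_fun setT (fun z : block NT => normc (tnth (tnth z n) k) ^+ 2).
    exact: (measurableT_comp (@measurable_normc2 R) (measurable_entry n k)).
  have := mf measurableT _ (measurable_itv `]-oo, 1 : R]); rewrite setTI.
  by congr measurable; apply/seteqP; split => z /=; rewrite in_itv.
apply: (ae_average R m mA) => [i|z zA]; first by move=> h; apply: h => n _ k _ /=; exact: sign_block_peak.
by move=> n k; move/contrapT : zA => /(_ n I k I).
Qed.

(** The test function must be defined on all inputs; as all antennas send the same sign, it is read
    off at the single antenna [k0]. *)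
Let symbols (z : block NT) (n : 'I_N) : R := complex.Re (tnth (tnth z n) k0).

Let symbols_sign u : symbols (sign_block u) = sign R u.
Proof. by apply/funext => n; rewrite /symbols tnth_sign_block. Qed.

Let statistic (q : block NT * block NR) : R := clip (rho * test_form (symbols q.1) (flat q.2)).

Let measurable_statistic : measurable_fun setT statistic.
Proof.
apply: (measurableT_comp measurable_clip); apply: measurable_funM => //.
under eq_fun do rewrite test_formE big_mkcond /=.
apply: measurable_sum => p; case: (earlier p); last exact: measurable_cst.
have ms n : measurable_fun setT (fun q : block NT * block NR => symbols q.1 n).
  apply: (measurableT_comp (@measurable_Re R)).
  exact: (measurableT_comp (measurable_entry n k0) measurable_fst).
apply: measurable_funM; first exact: measurable_funM.
apply: (measurableT_comp (@measurable_quad_term R D _ p)).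
exact: (measurableT_comp (@measurable_flat R N NR) measurable_snd).
Qed.

Let g (q : block NT * block NR) : R := expR (statistic q) / test_norm.

Let mg : measurable_fun setT g.
Proof. by apply: measurable_funM => //; exact: measurableT_comp. Qed.

Let g0 q : 0 < g q. Proof. by rewrite divr_gt0 ?expR_gt0. Qed.

Let g_le q : `|g q| <= expR 1 / test_norm.
Proof.
rewrite gtr0_norm// ler_wpM2r ?invr_ge0 ?(ltW norm_gt0)// ler_expR.
by have /andP[] := clip_bounds (rho * test_form (symbols q.1) (flat q.2)).
Qed.

Let g_points u u' : \int[P]_t g (sign_block u, output H W rho 0 (sign_block u') t) =
  \int[P]_t expR (clip (rho * test_form (sign R u) (received u' t))) / test_norm.
Proof.
rewrite [RHS]mulrC -RintegralZl//; last exact: expR_clip_integrable.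
by apply: eq_Rintegral => t _; rewrite /g /statistic /= symbols_sign mulrC.
Qed.

Let sum_points (F : U -> R) : \sum_(i < m.+1) F (nth [ffun=> false] (enum {: U}) i) = \sum_u F u.
Proof. exact: sum_nth_signs. Qed.

Let card_points : \sum_(u : U) (1 : R) = m.+1%:R.
Proof. by rewrite -(sum_points (fun=> 1)) sumr_const card_ord. Qed.

Let double_mean : m.+1%:R^-1 * \sum_u (m.+1%:R^-1 *
  \sum_u' \int[P]_t g (sign_block u, output H W rho 0 (sign_block u') t)) <= 1.
Proof.
have M0 : 0 < m.+1%:R :> R by rewrite ltr0n.
(* After the exchange the inner sum runs over the tested signs at a fixed transmitted block, where
   the linear terms cancel. *)
rewrite -mulr_sumr ler_pdivrMl// mulr1 ler_pdivrMl// exchange_big /=.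
have const (c : R) : \sum_(u : U) c = m.+1%:R * c.
  by rewrite -card_points mulr_suml; apply: eq_bigr => u _; rewrite mul1r.
rewrite -(const m.+1%:R).
apply: ler_sum => u' _; under eq_bigr do rewrite g_points.
rewrite -mulr_suml ler_pdivrMr//.
apply: (@le_trans _ _ (\sum_u (test_norm + rho * \int[P]_t test_form (sign R u) (received u' t)))).
  by apply: ler_sum => u _; exact: mean_expR_clip_le.
rewrite big_split /= -mulr_sumr sum_mean_test_form mulr0 addr0.
by rewrite const.
Qed.

Let MP : probability _ R := (antipodal_law \x P)%E.

Let g_total : (\int[antipodal_law]_z \int[MP]_w (g (z, output H W rho 0 w.1 w.2))%:E <= 1)%E.
Proof.
have mo := @measurable_output_joint _ T R P NT NR H W rho N 0.
pose F (q : block NT * (block NT * T)) := (g (q.1, output H W rho 0 q.2.1 q.2.2))%:E.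
have mF : measurable_fun setT F.
  apply/measurable_EFinP; apply: measurableT_comp => //; apply: measurable_fun_pair => //.
  exact: (measurableT_comp mo measurable_snd).
have F0 q : (0 <= F q)%E by rewrite lee_fin ltW.
have mFu z : measurable_fun setT (fun w => F (z, w)) by exact: (measurableT_comp mF (measurable_pair1 z)).
have inner u : (\int[MP]_w F (sign_block u, w))%E = (m.+1%:R^-1 *
    \sum_u' \int[P]_t g (sign_block u, output H W rho 0 (sign_block u') t))%:E.
  rewrite (fubini_tonelli1 (fun w => F (sign_block u, w)))//.
  rewrite ge0_integral_average//; last 2 first.
  - exact: (measurable_fun_fubini_tonelli_F (m2 := P) (fun w => F (sign_block u, w))).
  - by move=> z; apply: integral_ge0.
  rewrite EFinM; congr (_ * _)%E; rewrite -sum_points -sumEFin; apply: eq_bigr => i _.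
  rewrite /fubini_F /F /= Rintegral_EFin//.
  apply: (@bounded_integrable _ _ _ P _ (expR 1 / test_norm)) => //.
  have h := measurable_output H W rho 0 (points i).
  apply: (measurableT_comp mg); apply: measurable_fun_pair => //.
rewrite ge0_integral_average//; last 2 first.
- exact: (measurable_fun_fubini_tonelli_F (m2 := MP) F).
- by move=> z; apply: integral_ge0 => w _; rewrite lee_fin ltW.
under eq_bigr do rewrite inner.
rewrite sumEFin -EFinM lee_fin.
by rewrite (sum_points (fun u => m.+1%:R^-1 *
    \sum_u' \int[P]_t g (sign_block u, output H W rho 0 (sign_block u') t))).
Qed.

(** The mean of the clipped statistic supplies rho^2 times the energy, and ln x <= x - 1 at
    [test_norm] takes half of it back. The 3 adds the cubic error of the clipped mean and twice that
    of the exponential. *)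
Lemma antipodal_information :
  ((rho ^+ 2 * test_energy / 2 - rho ^+ 2 * Num.sqrt rho * (deviation_rate / 2) -
    3 * (rho ^+ 3 * third_moment_bound))%:E <=
  block_information H W rho antipodal_law)%E.
Proof.
have mo := @measurable_output_joint _ T R P NT NR H W rho N 0.
have lngE q : ln (g q) = statistic q - ln test_norm.
  by rewrite /g ln_div ?posrE ?expR_gt0// expRK.
have mV : measurable_fun setT (fun w : block NT * T => (w.1, output H W rho 0 w.1 w.2)).
  exact: measurable_fun_pair.
have mlg : measurable_fun setT (fun w : block NT * T => ln (g (w.1, output H W rho 0 w.1 w.2))).
  exact: (measurableT_comp (measurableT_comp (@measurable_ln R) mg) mV).
have lng_le w : `|ln (g (w.1, output H W rho 0 w.1 w.2))| <= 1 + ln test_norm.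
  rewrite lngE; apply: (le_trans (ler_normB _ _)); apply: lerD.
    by rewrite ler_norml; exact: clip_bounds.
  by rewrite ger0_norm// ln_ge0// test_norm_ge1.
have h2 := bounded_integrable_prod antipodal_law P mlg lng_le.
have := @information_lower _ _ _ _ _ _ R antipodal_law P (@channel_input _ T R NT N)
  (@channel_output _ T R P NT NR H W rho N) (fun w => erefl) g mg g0 g_total h2.
apply: le_trans; rewrite lee_fin Rintegral_prod//.
rewrite Rintegral_average; last first.
  have := measurable_fubini_F h2 => mf; apply: (measurableT_comp (@fine_measurable R _ measurableT)).
  exact: mf.
have M0 : 0 < m.+1%:R :> R by rewrite ltr0n.
rewrite -ler_pdivrMl ?invr_gt0// invrK.
rewrite (sum_points (fun u => \int[P]_t ln (g (sign_block u, output H W rho 0 (sign_block u) t)))).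
rewrite -card_points mulr_suml; apply: ler_sum => u _; rewrite mul1r.
have ic : P.-integrable setT (fun t => (clip (rho * test_form (sign R u) (received u t)))%:E).
  apply: (@bounded_integrable _ _ _ P _ 1).
    exact: (measurableT_comp measurable_clip (measurable_scaled u u)).
  by move=> t; rewrite ler_norml; exact: clip_bounds.
have -> : \int[P]_t ln (g (sign_block u, output H W rho 0 (sign_block u) t)) =
    \int[P]_t (clip (rho * test_form (sign R u) (received u t)) - ln test_norm).
  by apply: eq_Rintegral => t _; rewrite lngE /statistic /= symbols_sign.
rewrite RintegralB//; last exact/all_moments_integrable/all_moments_cst.
rewrite Rintegral_cst1.
have h3 := mean_clip_ge u; have h4 := ln_le_subr1 norm_gt0.
by move: h4; rewrite /test_norm; lra.
Qed.

End received.
End antipodal_signalling.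

(** * Capacity *)

Section right_limits.
Context (R : realType).
Implicit Types (f : R -> \bar R) (h : R -> R).

Lemma limf_esup_le_cvg f h (A : R) : (forall x, 0 < x <= 1 -> (f x <= (h x)%:E)%E) ->
  h x @[x --> 0^'+] --> A -> (limf_esup f 0^'+ <= A%:E)%E.
Proof.
move=> fh hA; apply/lee_addgt0Pr => e e0.
have V : \forall x \near 0^'+, (f x <= A%:E + e%:E)%E.
  have hle : \forall x \near 0^'+, h x <= A + e.
    move/cvgrPdist_le : hA => /(_ e e0); apply: filterS => x.
    by have := ler_norm (h x - A); rewrite distrC; lra.
  near=> x; apply: (@le_trans _ _ (h x)%:E); last by rewrite -EFinD lee_fin; near: x.
  apply: fh; apply/andP; split; near: x; [exact: nbhs_right_gt|exact: nbhs_right_le].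
rewrite limf_esupE; apply: (@le_trans _ _ (ereal_sup [set f x | x in [set x | (f x <= A%:E + e%:E)%E]])).
  by apply: ereal_inf_lbound; exists [set x | (f x <= A%:E + e%:E)%E].
by apply: ge_ereal_sup => _ [x fx <-].
Unshelve. all: by end_near.
Qed.

Lemma limf_einf_ge_cvg f h (A : R) : (forall x, 0 < x <= 1 -> ((h x)%:E <= f x)%E) ->
  h x @[x --> 0^'+] --> A -> (A%:E <= limf_einf f 0^'+)%E.
Proof.
move=> fh hA; rewrite /limf_einf leeNr -EFinN.
apply: (@limf_esup_le_cvg _ (fun x => - h x)); last exact: cvgN.
by move=> x /fh; rewrite EFinN leeN2.
Qed.

End right_limits.

Section capacity.
Context d (T : measurableType d) (R : realType) (P : probability T R) (NT NR : nat).
Variables (H : 'I_NT -> 'I_NR -> int -> {RV P >-> R[i]}).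
Variables (W : 'I_NR -> nat -> {RV P >-> R[i]}).
Hypotheses (fm : fading_model H) (nm : noise_model W) (fn : fading_noise_independent H W).
Hypothesis phi_fin : forall k l, (phi P (H k l) < +oo)%E.
Hypothesis nonephemeral : forall k l, ~ ephemeral P (H k l).
Local Notation block N n := (N.-tuple (n.-tuple R[i])).

Definition block_capacity (rho : R) N : \bar R := ereal_sup
  [set block_information H W rho mu | mu in @individual_power_constraint R NT N 1].

Definition block_rate_bound (rho : R) : R :=
  rho ^+ 2 * (NT%:R * \sum_k \sum_l phi_real H k l) + rho ^+ 3 * cubic_rate H.

Lemma antipodal_feasible N : individual_power_constraint 1 (antipodal_law R NT N).
Proof. exact/peak_power_constraint/antipodal_peak. Qed.

Lemma block_capacity_ge rho N (mu : probability (block N NT) R) :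
  individual_power_constraint 1 mu -> (block_information H W rho mu <= block_capacity rho N)%E.
Proof. by move=> mu1; apply: ereal_sup_ubound; exists mu. Qed.

Lemma block_capacity_ge0 rho N : (0 <= block_capacity rho N)%E.
Proof.
apply: le_trans (block_capacity_ge rho (@antipodal_feasible N)).
exact: information_ge0.
Qed.

Section fixed_power.
Variable rho : R.
Hypothesis rho0 : 0 <= rho.

Lemma block_capacity_le N : (block_capacity rho N <= (N%:R * block_rate_bound rho)%:E)%E.
Proof.
apply: ge_ereal_sup => _ [mu mu1 <-].
have [I [-> h]] := block_information_le fm nm fn phi_fin nonephemeral rho0
  (power_constraint_peak mu1).
by rewrite lee_fin.
Qed.

Lemma block_capacityE N : (fine (block_capacity rho N))%:E = block_capacity rho N.
Proof.
rewrite fineK// ge0_fin_numE ?block_capacity_ge0//.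
by apply: le_lt_trans (block_capacity_le N) _; rewrite ltry.
Qed.

Lemma block_capacity_superadditive N M :
  (block_capacity rho N + block_capacity rho M <= block_capacity rho (N + M))%E.
Proof.
rewrite -leeBrDr; last by rewrite -block_capacityE.
apply: ge_ereal_sup => _ [mu1 f1 <-].
have [I1 [e1 _]] := block_information_le fm nm fn phi_fin nonephemeral rho0
  (power_constraint_peak f1).
rewrite leeBrDr; last by rewrite -block_capacityE.
rewrite e1 addeC -leeBrDr//.
apply: ge_ereal_sup => _ [mu2 f2 <-]; rewrite leeBrDr// addeC -e1.
apply: le_trans (information_cat fm nm fn rho0 (power_constraint_peak f1)
  (power_constraint_peak f2)) _.
apply: block_capacity_ge; apply: peak_power_constraint.
by apply: cat_law_peak; apply: power_constraint_peak; eassumption.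
Qed.

(** The last clause accepts any real lower bound [I] of the information, so that explicit estimates
    of a single block pass to the capacity directly. *)
Lemma capacityP : exists S : R, [/\ capacity_mimo_i H W rho 1 = S%:E,
  S <= block_rate_bound rho &
  forall N (mu : probability (block N NT) R) (I : R), individual_power_constraint 1 mu ->
    (I%:E <= block_information H W rho mu)%E -> N%:R^-1 * I <= S].
Proof.
pose a N := fine (block_capacity rho N).
have aE N : (a N)%:E = block_capacity rho N by exact: block_capacityE.
have [] := @fekete R a (block_rate_bound rho).
- by move=> m n; rewrite -lee_fin EFinD !aE; exact: block_capacity_superadditive.
- by move=> n; rewrite -lee_fin aE block_capacity_ge0.
- by move=> n; rewrite -lee_fin aE block_capacity_le.
move=> S [Scvg Sge Sle]; exists S; split.
- rewrite /capacity_mimo_i; apply: cvg_lim; first exact: ereal_hausdorff.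
  apply: (@cvg_trans _ ((n%:R^-1 * a n)%:E @[n --> \oo])).
    apply: near_eq_cvg; near=> n; rewrite EFinM; congr (_ * _)%E.
    exact: block_capacityE.
  by apply: cvg_EFin => //; near=> n.
(* At n = 0 the quotient is 0, and the rate bound is nonnegative because it dominates the capacity
   of a block of length 1. *)
- apply: Sle => -[|n].
    rewrite invr0 mul0r -(@ler_pM2l _ 1)// mulr0.
    by rewrite -lee_fin; apply: le_trans (block_capacity_ge0 rho 1) (block_capacity_le 1).
  by rewrite ler_pdivrMl// -lee_fin aE block_capacity_le.
- move=> N mu I mu1 hI; apply: le_trans (Sge N); rewrite ler_wpM2l ?invr_ge0//.
  by rewrite -lee_fin aE; apply: le_trans hI (block_capacity_ge rho mu1).
Unshelve. all: by end_near.
Qed.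

End fixed_power.

Local Notation rate := (fun rho : R => (capacity_mimo_i H W rho 1 * (rho ^- 2)%:E)%E).

Lemma limf_esup_capacity :
  (limf_esup rate 0^'+ <= (NT%:R * \sum_k \sum_l phi_real H k l)%:E)%E.
Proof.
set A := NT%:R * _; apply: (@limf_esup_le_cvg _ _ (fun rho => A + rho * cubic_rate H)).
  move=> rho /andP[rho0 _]; have [S [-> SK _]] := capacityP (ltW rho0).
  rewrite -EFinM lee_fin ler_pdivrMr ?exprn_gt0//.
  apply: le_trans SK _; rewrite /block_rate_bound -/A le_eqVlt; apply/orP; left; apply/eqP; ring.
rewrite -[X in _ --> X]addr0 -[X in _ --> _ + X](mul0r (cubic_rate H)).
by apply: cvg_at_right_filter; apply: cvgD; [exact: cvg_cst|apply: cvgMl; exact: cvg_id].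
Qed.

(** Serves the channel without transmit antennas, where no [k0] exists; the block of length 0
    suffices. *)
Lemma limf_einf_capacity_ge0 : (0 <= limf_einf rate 0^'+)%E.
Proof.
apply: (@limf_einf_ge_cvg _ _ (fun=> 0)); last exact: cvg_cst.
move=> rho /andP[rho0 _]; have [S [-> _ h]] := capacityP (ltW rho0).
rewrite -EFinM lee_fin divr_ge0 ?exprn_ge0 ?(ltW rho0)//.
by have := h 0%N _ 0 (@antipodal_feasible 0) (information_ge0 _ _ _ _); rewrite mulr0.
Qed.

Lemma limf_einf_capacity_energy (k0 : 'I_NT) N :
  ((N%:R^-1 * (test_energy H N / 2))%:E <= limf_einf rate 0^'+)%E.
Proof.
set E := test_energy H N; set C := deviation_rate H W N; set C3 := third_moment_bound H W N.
apply: (@limf_einf_ge_cvg _ _ (fun rho => N%:R^-1 * (E / 2 - Num.sqrt rho * (C / 2) - rho * (3 * C3)))).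
  move=> rho /andP[rho0 rho1]; have [S [-> _ h]] := capacityP (ltW rho0).
  rewrite -EFinM lee_fin ler_pdivlMr ?exprn_gt0//.
  have r01 : 0 <= rho <= 1 by rewrite ltW.
  have := h N _ _ (@antipodal_feasible N) (antipodal_information fm nm fn k0 N r01).
  apply: le_trans; rewrite -/E -/C -/C3 le_eqVlt; apply/orP; left; apply/eqP; ring.
have e : N%:R^-1 * (E / 2) = N%:R^-1 * (E / 2 - Num.sqrt 0 * (C / 2) - 0 * (3 * C3)).
  by rewrite sqrtr0 !mul0r !subr0.
rewrite [X in _ --> X]e; apply: cvg_at_right_filter; apply: cvgMr.
apply: cvgB; last by apply: cvgMl; exact: cvg_id.
by apply: cvgB; [exact: cvg_cst|apply: cvgMl; exact: sqrt_continuous].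
Qed.

Local Notation c l n := (normc (antenna_cov H l n) ^+ 2).

(** Sorted by the later time n, counted from 0, the earlier times produce each lag from 1 to n once;
    the 2 in [test_energy] cancels the division. *)
Lemma test_energyE N : test_energy H N / 2 =
  \sum_(n < N) \sum_l \sum_(1 <= j < n.+1) c l j%:Z.
Proof.
have inner (n : 'I_N) l : \sum_(1 <= j < n.+1) c l j%:Z =
    \sum_(m < N) (if (m < n)%N then c l (n%:Z - m%:Z) else 0).
  rewrite -big_mkcond /=.
  have -> : \sum_(1 <= j < n.+1) c l j%:Z = \sum_(0 <= m < n) c l (n%:Z - m%:Z).
    rewrite big_add1/= big_nat_rev/= add0n; apply: eq_big_nat => m /andP[_ mn].
    by rewrite subnSK// -subzn// ltnW.
  by rewrite big_mkord (big_ord_widen_cond N predT (fun m => c l (n%:Z - m%:Z)) (ltnW (ltn_ord n))).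
transitivity (\sum_(p | earlier p) normc (pair_cov H (N := N) p) ^+ 2).
  by rewrite /test_energy mulr_suml; apply: eq_bigr => p _; field.
rewrite big_mkcond /= -(pair_bigA _ (fun a b => if earlier (a, b) then
  normc (pair_cov H (N := N) (a, b)) ^+ 2 else 0)) /=.
transitivity (\sum_(a < #|{: 'I_N * 'I_NR}|) \sum_(1 <= j < (time_of a).+1) c (antenna_of a) j%:Z).
  apply: eq_bigr => a _; rewrite inner.
  rewrite (eq_bigr (fun b => (fun m l => if l == antenna_of a then
     (if (m < time_of a)%N then c (antenna_of a) ((time_of a)%:Z - m%:Z) else 0) else 0)
     (time_of b) (antenna_of b))) => [|b _].
    rewrite (sum_flat (fun m l => if l == antenna_of a then
     (if (m < time_of a)%N then c (antenna_of a) ((time_of a)%:Z - m%:Z) else 0) else 0)).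
    by apply: eq_bigr => m _; rewrite -big_mkcond big_pred1_eq.
  by rewrite /earlier /pair_cov /= [antenna_of b == _]eq_sym; case: eqP => //= ->.
by rewrite (sum_flat (fun n l => \sum_(1 <= j < n.+1) c l j%:Z)).
Qed.

(** Each of the N - M times from [M] on has all lags below [M] behind it inside the block; the other
    times contribute nonnegative terms. *)
Lemma test_energy_ge M N : (M <= N)%N ->
  (N%:R - M%:R) * (\sum_(1 <= j < M) \sum_l c l j%:Z) <= test_energy H N / 2.
Proof.
move=> MN; rewrite test_energyE exchange_big /=.
set p := \sum_l _; rewrite (bigID (fun n : 'I_N => (n < M)%N)) /=.
have c0 l (s : seq nat) : 0 <= \sum_(j <- s) c l j%:Z by apply: sumr_ge0 => j _; exact: sqr_ge0.
rewrite ler_wpDl//; first by apply: sumr_ge0 => n _; apply: sumr_ge0 => l _.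
apply: (@le_trans _ _ (\sum_(n < N | ~~ (n < M)%N) p)); last first.
  apply: ler_sum => n; rewrite -leqNgt => Mn; apply: ler_sum => l _.
  case: (posnP M) => [->|M1]; first by rewrite big_geq.
  by rewrite (big_cat_nat M1 (leqW Mn))/= lerDl.
have -> : \sum_(n < N | ~~ (n < M)%N) p = \sum_(M <= n < N) p.
  rewrite (big_nat_widenl M 0)// big_mkord; apply: eq_bigl => n.
  by rewrite -leqNgt.
by rewrite sumr_const_nat -[leRHS]mulr_natl natrB.
Qed.

Lemma limf_einf_capacity_partial (k0 : 'I_NT) M :
  ((\sum_(1 <= j < M) \sum_l c l j%:Z)%:E <= limf_einf rate 0^'+)%E.
Proof.
set p := \sum_(1 <= j < M) _; apply/lee_addgt0Pr => e e0.
(* Giving up the first [M] times loses the fraction M / N of the partial sum; this [N] makes the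
   loss at most [e]. *)
have [N [N0 MN Np]] : exists N, [/\ (0 < N)%N, (M <= N)%N & M%:R * p / e <= N%:R].
  have : \forall N \near \oo, [/\ (0 < N)%N, (M <= N)%N & M%:R * p / e <= N%:R].
    near=> N; split; near: N; [exact: nbhs_infty_gt|exact: nbhs_infty_ge|exact: nbhs_infty_ger].
  by move/filter_ex.
have NR0 : 0 < N%:R :> R by rewrite ltr0n.
apply: (@le_trans _ _ ((N%:R^-1 * (test_energy H N / 2))%:E + e%:E)%E).
  rewrite -EFinD lee_fin -(ler_pM2l NR0) mulrDr mulVKf ?gt_eqF//.
  have := test_energy_ge MN; rewrite -/p mulrBl.
  by move: Np; rewrite ler_pdivrMr// ; lra.
by rewrite leeD2r// limf_einf_capacity_energy.
Unshelve. all: by end_near.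
Qed.

Lemma limf_einf_capacity :
  (\sum_(l < NR) \sum_(1 <= n <oo) (c l n%:Z)%:E <= limf_einf rate 0^'+)%E.
Proof.
(* Without transmit antennas the inner sums are empty and the series is 0. *)
have [[k0 _]|none] := pselect (exists k : 'I_NT, True); last first.
  rewrite big1 ?limf_einf_capacity_ge0// => l _; apply: eseries0 => n _ _.
  rewrite /antenna_cov big1 ?ComplexField.Normc.normc0 ?expr0n// => k _.
  by case: none; exists k.
(* Nonnegative terms allow the finite sum over antennas to move inside the series, which is then the
   limit of the partial sums already bounded. *)
rewrite -nneseries_sum => [|l n _]; last by rewrite lee_fin sqr_ge0.
apply: lime_le.
  by apply: is_cvg_nneseries => n _ _; apply: sume_ge0 => l _; rewrite lee_fin sqr_ge0.
apply: nearW => M; apply: le_trans (limf_einf_capacity_partial k0 M).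
rewrite -sumEFin le_eqVlt; apply/orP; left; apply/eqP; apply: eq_bigr => n _.
by rewrite sumEFin.
Unshelve. all: by end_near.
Qed.

End capacity.

Theorem mainTheorem4 (R : realType) (d : measure_display)
  (T : measurableType d) (P : probability T R) (NT NR : nat)
  (H : 'I_NT -> 'I_NR -> int -> {RV P >-> R[i]})
  (W : 'I_NR -> nat -> {RV P >-> R[i]}) :
  fading_model H -> noise_model W -> fading_noise_independent H W ->
  (forall k l, (phi P (H k l) < +oo)%E) ->
  (forall k l, ~ ephemeral P (H k l)) ->
  (limf_esup (fun rho : R => capacity_mimo_i H W rho 1 * (rho ^- 2)%:E) 0^'+
     <= NT%:R%:E * \sum_(k < NT) \sum_(l < NR) phi P (H k l))%E /\
  (\sum_(l < NR) \sum_(1 <= n <oo)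
       (normc (\sum_(k < NT) autocorrelation P (H k l) n%:Z)%R ^+ 2)%:E
     <= limf_einf (fun rho : R => capacity_mimo_i H W rho 1 * (rho ^- 2)%:E) 0^'+)%E.
Proof.
move=> fm nm fn phi_fin nonephemeral; split; last exact: limf_einf_capacity.
have -> : (NT%:R%:E * \sum_(k < NT) \sum_(l < NR) phi P (H k l))%E =
    (NT%:R * \sum_k \sum_l phi_real H k l)%:E.
  rewrite EFinM -sumEFin; congr (_ * _)%E; apply: eq_bigr => k _; rewrite -sumEFin.
  by apply: eq_bigr => l _; rewrite phi_realE.
exact: limf_esup_capacity.
Qed.
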